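(* Let $(R,\mathfrak m)$ be an excellent local domain of prime characteristic $p$ and of dimension $d\ge 2$, and let $I$ be an $\mathfrak m$-primary ideal of $R$ that admits a reduction generated by $d$ elements. Then the following are equivalent: (a) the extended Rees algebra $\mathscr R'_R(I)$ is $F$-rational; (b) $R$ and the Rees algebra $\mathscr R_R(I)$ are both $F$-rational.
   Context: For a noetherian ring $R$ and an ideal $I$, the Rees algebra is $\mathscr R_R(I)=\bigoplus_{n\ge 0} I^n t^n\subseteq R[t]$ and the extended Rees algebra is $\mathscr R'_R(I)=\bigoplus_{n\in\mathbb Z} I^n t^n\subseteq R[t,t^{-1}]$, where $I^n:=R$ for $n\le 0$. All rings are excellent, of prime characteristic $p$, and are equidimensional homomorphic images of excellent Cohen-Macaulay rings. For a ring $S$, $S^0$ is the complement of the union of the minimal primes of $S$. The tight closure $\mathfrak a^*$ of an ideal $\mathfrak a$ of $S$ is the set of $z\in S$ for which there is $c\in S^0$ with $cz^q\in \mathfrak a^{[q]}$ for all $q=p^e$, $e\gg 0$; $\mathfrak a$ is tightly closed if $\mathfrak a^*=\mathfrak a$. A local ring is $F$-rational if the ideal generated by some system of parameters is tightly closed. A ring $S$ is $F$-rational if $S_{\mathfrak n}$ is $F$-rational for every maximal ideal $\mathfrak n$ of $S$. *)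

(* Defs.v *)
From HB Require Import structures.
From mathcomp Require Import all_boot all_order all_algebra ring zify.
From mathcomp Require Import generic_quotient fieldext.
From mathcomp Require Import mathcomp_extra boolp classical_sets.

Set Implicit Arguments.
Unset Strict Implicit.
Unset Printing Implicit Defensive.

Import GRing.Theory.
Local Open Scope classical_set_scope.
Local Open Scope ring_scope.
Local Open Scope quotient_scope.

(* Rings are MathComp comNzRingType's; ideals are Prop-valued sets, the unit
   ideal setT being allowed (unlike in MathComp's idealr_closed). *)

Section Ideals.
Variable A : comNzRingType.
Implicit Types (I J P M : set A).

Definition is_ideal I :=
  [/\ I 0, forall x y, I x -> I y -> I (x + y) & forall a x, I x -> I (a * x)].

Definition ideal_gen (X : set A) : set A := smallest is_ideal X.

Definition ideal_mul I J : set A :=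
  ideal_gen [set z | exists x y, [/\ I x, J y & z = x * y]].

Fixpoint ideal_pow I (n : nat) : set A :=
  if n is n'.+1 then ideal_mul I (ideal_pow I n') else setT.

Definition radical I : set A := [set x | exists n : nat, I (x ^+ n)].

Definition is_prime P :=
  [/\ is_ideal P, ~ P 1 & forall x y, P (x * y) -> P x \/ P y].

Definition is_maximal M :=
  [/\ is_ideal M, ~ M 1
    & forall J, is_ideal J -> M `<=` J -> J = M \/ J = setT].

Definition minimal_prime P :=
  is_prime P /\ forall Q, is_prime Q -> Q `<=` P -> Q = P.

Definition is_primary I :=
  [/\ is_ideal I, ~ I 1
    & forall x y, I (x * y) -> I x \/ exists n : nat, I (y ^+ n)].

Definition primary_to P I := is_primary I /\ radical I = P.

Definition noetherian :=
  forall I, is_ideal I -> exists s : seq A, I = ideal_gen [set` s].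

Definition is_local M := is_maximal M /\ forall N, is_maximal N -> N = M.

Definition is_reduction J I :=
  [/\ is_ideal J, J `<=` I
    & exists n : nat, ideal_mul J (ideal_pow I n) = ideal_pow I n.+1].

(* c 0 < c 1 < ... < c n; the values c i with i > n are irrelevant *)
Definition prime_chain (n : nat) (c : nat -> set A) :=
  (forall i, (i <= n)%N -> is_prime (c i)) /\
  (forall i, (i < n)%N -> c i `<` c i.+1).

Definition krull_dim_ge (n : nat) := exists c, prime_chain n c.

Definition krull_dim (d : nat) := krull_dim_ge d /\ ~ krull_dim_ge d.+1.

(* dim (A / P) >= n *)
Definition quot_dim_ge P (n : nat) := exists c, prime_chain n c /\ P `<=` c 0%N.

(* dim (A / P) = dim A for all minimal primes P *)
Definition equidimensional :=
  forall P, minimal_prime P -> forall n, quot_dim_ge P n <-> krull_dim_ge n.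

Definition saturated_chain P Q (n : nat) (c : nat -> set A) :=
  [/\ prime_chain n c, c 0%N = P, c n = Q
    & forall i, (i < n)%N -> forall Q', is_prime Q' ->
        c i `<=` Q' -> Q' `<=` c i.+1 -> Q' = c i \/ Q' = c i.+1].

(* For noetherian A, where chains of primes between P and Q have bounded
   length, this is catenarity. *)
Definition catenary := forall P Q n n' c c',
  saturated_chain P Q n c -> saturated_chain P Q n' c' -> n = n'.

Definition regular_sequence M (xs : seq A) :=
  [set` xs] `<=` M /\
  forall i, (i < size xs)%N -> forall y,
    ideal_gen [set` take i xs] (xs`_i * y) -> ideal_gen [set` take i xs] y.

Definition depth_ge M (n : nat) := exists xs : n.-tuple A, regular_sequence M xs.

Definition depth M (n : nat) := depth_ge M n /\ ~ depth_ge M n.+1.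

Definition CM_local :=
  noetherian /\ exists M d, [/\ is_local M, krull_dim d & depth M d].

Definition regular_local :=
  noetherian /\ exists M d, [/\ is_local M, krull_dim d
    & exists xs : d.-tuple A, M = ideal_gen [set` xs]].

Definition is_sop M (xs : seq A) :=
  [/\ krull_dim (size xs), [set` xs] `<=` M
    & primary_to M (ideal_gen [set` xs])].

End Ideals.

Arguments noetherian A : clear implicits.
Arguments krull_dim A d : clear implicits.
Arguments krull_dim_ge A n : clear implicits.
Arguments equidimensional A : clear implicits.
Arguments catenary A : clear implicits.
Arguments CM_local A : clear implicits.
Arguments regular_local A : clear implicits.

(* Requiring that 0 is not in the set makes the localization a nonzero ring. *)
Record mulset (A : comNzRingType) := MulSet {
  mulset_car :> set A;
  mulset1 : mulset_car 1;
  mulsetM : forall x y, mulset_car x -> mulset_car y -> mulset_car (x * y);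
  mulset0 : ~ mulset_car 0 }.

Module Localization.
Section Localization.
Variables (A : comNzRingType) (S : mulset A).

Definition den := {s : A | s \in (S : set A)}.

Lemma denP (s : den) : mulset_car S (val s). Proof. exact/set_mem/(valP s). Qed.

Definition mkden (s : A) (Ss : mulset_car S s) : den := exist _ s (mem_set Ss).
Definition den1 : den := mkden (mulset1 S).
Definition denM (s t : den) : den := mkden (mulsetM (denP s) (denP t)).

Local Notation pre := (A * den)%type.
Implicit Types x y z : pre.

Definition eqv x y : bool :=
  `[< exists2 u, mulset_car S u & u * (x.1 * val y.2) = u * (y.1 * val x.2) >].

Lemma eqv_refl : reflexive eqv.
Proof. by move=> x; apply/asboolP; exists 1 => //; exact: mulset1. Qed.

Lemma eqv_sym : symmetric eqv.
Proof.
by move=> x y; apply/asboolP/asboolP=> -[u Su e]; exists u.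
Qed.

Lemma eqv_trans : transitive eqv.
Proof.
move=> y x z /asboolP[u Su e1] /asboolP[v Sv e2]; apply/asboolP.
exists (u * v * val y.2).
  by apply: mulsetM (denP _); apply: mulsetM.
transitivity (v * val z.2 * (u * (x.1 * val y.2))); first by rewrite /=; ring.
rewrite e1; transitivity (u * val x.2 * (v * (y.1 * val z.2))); first by rewrite /=; ring.
by rewrite e2 /=; ring.
Qed.

Canonical eqv_equiv := EquivRel eqv eqv_refl eqv_sym eqv_trans.

Definition type := {eq_quot eqv}.
HB.instance Definition _ : EqQuotient _ eqv type := EqQuotient.on type.
HB.instance Definition _ := Choice.on type.

Definition frac (a : A) (s : den) : type := \pi_type (a, s).

Lemma fracP a s b t :
  frac a s = frac b t <-> exists2 u, mulset_car S u & u * (a * val t) = u * (b * val s).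
Proof.
rewrite /frac; split=> [/eqmodP/asboolP //|h].
by apply/eqmodP/asboolP.
Qed.

Lemma frac_surj (x : type) : exists a s, x = frac a s.
Proof.
by exists (repr x).1, (repr x).2; rewrite /frac -surjective_pairing reprK.
Qed.

Definition add (x y : type) : type :=
  frac ((repr x).1 * val (repr y).2 + (repr y).1 * val (repr x).2)
       (denM (repr x).2 (repr y).2).
Definition opp (x : type) : type := frac (- (repr x).1) (repr x).2.
Definition mul (x y : type) : type :=
  frac ((repr x).1 * (repr y).1) (denM (repr x).2 (repr y).2).

Lemma repr_frac a s : exists2 u, mulset_car S u &
  u * ((repr (frac a s)).1 * val s) = u * (a * val (repr (frac a s)).2).
Proof. by apply/fracP; rewrite /frac -surjective_pairing reprK. Qed.

Lemma add_frac a s b t :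
  add (frac a s) (frac b t) = frac (a * val t + b * val s) (denM s t).
Proof.
rewrite /add; have [u Su eu] := repr_frac a s; have [v Sv ev] := repr_frac b t.
move: (repr (frac a s)) (repr (frac b t)) eu ev => [a' s'] [b' t'] /= eu ev.
apply/fracP; exists (u * v); first exact: mulsetM.
rewrite /=; transitivity (v * val t * val t' * (u * (a' * val s)) +
  u * val s * val s' * (v * (b' * val t))); first by rewrite /=; ring.
by rewrite eu ev /=; ring.
Qed.

Lemma opp_frac a s : opp (frac a s) = frac (- a) s.
Proof.
rewrite /opp; have [u Su eu] := repr_frac a s.
move: (repr (frac a s)) eu => [a' s'] /= eu.
by apply/fracP; exists u => //; rewrite !mulNr !mulrN eu.
Qed.

Lemma mul_frac a s b t : mul (frac a s) (frac b t) = frac (a * b) (denM s t).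
Proof.
rewrite /mul; have [u Su eu] := repr_frac a s; have [v Sv ev] := repr_frac b t.
move: (repr (frac a s)) (repr (frac b t)) eu ev => [a' s'] [b' t'] /= eu ev.
apply/fracP; exists (u * v); first exact: mulsetM.
rewrite /=; transitivity ((u * (a' * val s)) * (v * (b' * val t))); first by rewrite /=; ring.
by rewrite eu ev /=; ring.
Qed.

Lemma frac_eq a s b t : a * val t = b * val s -> frac a s = frac b t.
Proof. by move=> e; apply/fracP; exists 1; [exact: mulset1 | rewrite e]. Qed.

Lemma addA : associative add.
Proof.
move=> x y z; have [a [s ->]] := frac_surj x; have [b [t ->]] := frac_surj y.
by have [c [r ->]] := frac_surj z; rewrite !add_frac; apply: frac_eq => /=; ring.
Qed.

Lemma addC : commutative add.
Proof.
move=> x y; have [a [s ->]] := frac_surj x; have [b [t ->]] := frac_surj y.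
by rewrite !add_frac; apply: frac_eq => /=; ring.
Qed.

Lemma add0 : left_id (frac 0 den1) add.
Proof.
move=> x; have [a [s ->]] := frac_surj x.
by rewrite !add_frac; apply: frac_eq => /=; ring.
Qed.

Lemma addN : left_inverse (frac 0 den1) opp add.
Proof.
move=> x; have [a [s ->]] := frac_surj x.
by rewrite opp_frac add_frac; apply: frac_eq => /=; ring.
Qed.

HB.instance Definition _ := GRing.isZmodule.Build type addA addC add0 addN.

Lemma mulA : associative mul.
Proof.
move=> x y z; have [a [s ->]] := frac_surj x; have [b [t ->]] := frac_surj y.
by have [c [r ->]] := frac_surj z; rewrite !mul_frac; apply: frac_eq => /=; ring.
Qed.

Lemma mulC : commutative mul.
Proof.
move=> x y; have [a [s ->]] := frac_surj x; have [b [t ->]] := frac_surj y.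
by rewrite !mul_frac; apply: frac_eq => /=; ring.
Qed.

Lemma mul1 : left_id (frac 1 den1) mul.
Proof.
move=> x; have [a [s ->]] := frac_surj x.
by rewrite !mul_frac; apply: frac_eq => /=; ring.
Qed.

Lemma mulDl : left_distributive mul add.
Proof.
move=> x y z; have [a [s ->]] := frac_surj x; have [b [t ->]] := frac_surj y.
have [c [r ->]] := frac_surj z.
by rewrite !(add_frac, mul_frac); apply: frac_eq => /=; ring.
Qed.

Lemma nz1 : frac 1 den1 != 0.
Proof.
apply/eqP => /fracP[u Su] /=; rewrite !mulr1 mulr0 => u0.
by apply: (@mulset0 _ S); rewrite -u0.
Qed.

HB.instance Definition _ :=
  GRing.Zmodule_isComNzRing.Build type mulA mulC mul1 mulDl nz1.

End Localization.
End Localization.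
HB.export Localization.

Notation localization S := (@Localization.type _ S).

(* the fraction a / s *)
Definition locfrac (A : comNzRingType) (S : mulset A) (a s : A) (Ss : mulset_car S s) :
  localization S := Localization.frac a (Localization.mkden Ss).

Section PrimeLocalization.
Variables (A : comNzRingType) (P : set A) (hP : is_prime P).

Lemma prime_compl1 : (~` P) 1. Proof. by case: hP. Qed.
Lemma prime_complM x y : (~` P) x -> (~` P) y -> (~` P) (x * y).
Proof. by case: hP => _ _ h nx ny /h[]. Qed.
Lemma prime_compl0 : ~ (~` P) 0. Proof. by case: hP => -[P0 _ _] _ _; apply. Qed.

Definition prime_compl : mulset A :=
  MulSet prime_compl1 prime_complM prime_compl0.

Definition loc_at : comNzRingType := localization prime_compl.

End PrimeLocalization.

Section Excellence.

Definition CM_ring (A : comNzRingType) :=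
  noetherian A /\
  forall (P : set A) (hP : is_prime P), is_maximal P -> CM_local (loc_at hP).

Definition regular_ring (A : comNzRingType) :=
  noetherian A /\ forall (P : set A) (hP : is_prime P), regular_local (loc_at hP).

Definition finite_type (A B : comNzRingType) (f : {rmorphism A -> B}) :=
  exists s : seq B, forall T : {pred B}, GRing.subring_closed T ->
    (forall a, f a \in T) -> {subset s <= T} -> forall b, b \in T.

Definition universally_catenary (A : comNzRingType) :=
  forall (B : comNzRingType) (f : {rmorphism A -> B}), finite_type f -> catenary B.

(* D = B (x)_A C, by its universal property among commutative rings.  When the
   tensor product is the zero ring there is no such comNzRingType D; this is
   harmless below because the zero ring is regular. *)
Definition is_tensor (A B C D : comNzRingType) (f : {rmorphism A -> B})
    (g : {rmorphism A -> C}) (u : {rmorphism B -> D}) (v : {rmorphism C -> D}) :=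
  u \o f =1 v \o g /\
  forall (Z : comNzRingType) (u' : {rmorphism B -> Z}) (v' : {rmorphism C -> Z}),
    u' \o f =1 v' \o g ->
    exists h : {rmorphism D -> Z}, [/\ h \o u =1 u', h \o v =1 v'
      & forall h' : {rmorphism D -> Z}, h' \o u =1 u' -> h' \o v =1 v' -> h' =1 h].

(* g exhibits k as the residue field Frac (A / Q) of A at the prime Q *)
Definition is_residue_field (A : comNzRingType) (Q : set A) (k : fieldType)
    (g : {rmorphism A -> k}) :=
  (forall a, g a = 0 <-> Q a) /\
  forall y : k, exists a b, g b != 0 /\ y = g a / g b.

Definition geometrically_regular (k : fieldType) (B : comNzRingType)
    (f : {rmorphism k -> B}) :=
  forall (K : fieldExtType k) (D : comNzRingType) (u : {rmorphism B -> D})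
    (v : {rmorphism K -> D}),
    is_tensor f (GRing.in_alg K) u v -> regular_ring D.

Definition geometrically_regular_fibres (A B : comNzRingType)
    (f : {rmorphism A -> B}) :=
  forall (Q : set A) (k : fieldType) (g : {rmorphism A -> k}),
    is_prime Q -> is_residue_field Q g ->
    forall (F : comNzRingType) (u : {rmorphism B -> F}) (v : {rmorphism k -> F}),
      is_tensor f g u v -> geometrically_regular v.

(* f exhibits B as the M-adic completion of A: A / M^n -> B / M^n B is
   bijective for all n, and B is separated and complete for the M B-adic
   topology. *)
Definition is_completion (A B : comNzRingType) (M : set A)
    (f : {rmorphism A -> B}) :=
  let MB n := ideal_gen (f @` ideal_pow M n) in
  [/\ forall n a, MB n (f a) -> ideal_pow M n a,
      forall n b, exists a, MB n (b - f a),
      forall b, (forall n, MB n b) -> b = 0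
    & forall w : nat -> B, (forall n, MB n (w n.+1 - w n)) ->
        exists b, forall n, MB n (b - w n)].

Definition G_ring (A : comNzRingType) :=
  forall (P : set A) (hP : is_prime P) (M : set (loc_at hP)) (B : comNzRingType)
    (f : {rmorphism loc_at hP -> B}),
    is_local M -> is_completion M f -> geometrically_regular_fibres f.

Definition regular_locus_open (A : comNzRingType) :=
  exists2 J : set A, is_ideal J &
    forall (P : set A) (hP : is_prime P), regular_local (loc_at hP) <-> ~ J `<=` P.

Definition J2_ring (A : comNzRingType) :=
  forall (B : comNzRingType) (f : {rmorphism A -> B}),
    finite_type f -> regular_locus_open B.

Definition excellent (A : comNzRingType) :=
  [/\ noetherian A, universally_catenary A, G_ring A & J2_ring A].

Definition image_of_excellent_CM (A : comNzRingType) :=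
  exists (B : comNzRingType) (f : {rmorphism B -> A}),
    [/\ excellent B, CM_ring B & forall a, exists b, f b = a].

End Excellence.

(* p is the characteristic of the rings to which these notions are applied. *)
Section TightClosure.
Variables (p : nat) (A : comNzRingType).
Implicit Types (I : set A).

(* the set A^0 *)
Definition off_minimal_primes : set A :=
  [set c | forall P, minimal_prime P -> ~ P c].

(* I^[q] *)
Definition frobenius_power I (q : nat) : set A :=
  ideal_gen [set x ^+ q | x in I].

Definition tight_closure I : set A :=
  [set z | exists2 c, off_minimal_primes c &
    exists e0 : nat, forall e, (e0 <= e)%N ->
      frobenius_power I (p ^ e) (c * z ^+ (p ^ e))].

Definition tightly_closed I := tight_closure I = I.

Definition F_rational_local := exists2 M : set A, is_local M &
  exists2 xs : seq A, is_sop M xs & tightly_closed (ideal_gen [set` xs]).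

End TightClosure.

Arguments F_rational_local p A : clear implicits.

Definition F_rational (p : nat) (A : comNzRingType) :=
  forall (P : set A) (hP : is_prime P), is_maximal P ->
    F_rational_local p (loc_at hP).

Section IdealPowers.
Variables (A : comNzRingType) (I : set A).

Lemma ideal_gen_ideal (X : set A) : is_ideal (ideal_gen X).
Proof.
split=> [J [[]]//|x y hx hy J hJ|a x hx J hJ].
  by case: (hJ) => -[_ hD _] _; apply: hD; [exact: hx | exact: hy].
by case: (hJ) => -[_ _ hM] _; apply: hM; exact: hx.
Qed.

Lemma ideal_pow_ideal n : is_ideal (ideal_pow I n).
Proof. by case: n => [|n]; [split | exact: ideal_gen_ideal]. Qed.

Lemma ideal_powM m n x y :
  ideal_pow I m x -> ideal_pow I n y -> ideal_pow I (m + n) (x * y).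
Proof.
elim: m x => [|m IHm] x hx hy.
  by case: (ideal_pow_ideal n) => _ _; apply.
have [h0 hD hM] := ideal_pow_ideal (m.+1 + n).
apply: (hx [set x | ideal_pow I (m.+1 + n) (x * y)]); split.
  split=> /= [|a b ha hb|a b hb]; first by rewrite mul0r.
    by rewrite mulrDl; apply: hD.
  by rewrite -mulrA; apply: hM.
move=> _ [a [b [Ia hb ->]]] /= J [_]; apply; exists a, (b * y).
by split=> //; [exact: IHm | rewrite mulrA].
Qed.

Lemma ideal_powS m n : (m <= n)%N -> ideal_pow I n `<=` ideal_pow I m.
Proof.
move=> /subnKC <-; elim: (n - m)%N => [|k IHk]; first by rewrite addn0.
rewrite addnS => x hx; apply: IHk; apply: hx.
split; first exact: ideal_pow_ideal.
by move=> _ [a [b [_ hb ->]]]; case: (ideal_pow_ideal (m + k)) => _ _; apply.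
Qed.

Lemma ideal_pow_sum n (J : Type) (r : seq J) (Q : pred J) (F : J -> A) :
  (forall j, Q j -> ideal_pow I n (F j)) -> ideal_pow I n (\sum_(j <- r | Q j) F j).
Proof. by case: (ideal_pow_ideal n) => h0 hD _ h; elim/big_ind: _. Qed.

Lemma ideal_powN n x : ideal_pow I n x -> ideal_pow I n (- x).
Proof. by rewrite -mulN1r; case: (ideal_pow_ideal n) => _ _; apply. Qed.

End IdealPowers.

Section ReesAlgebra.
Variables (A : comNzRingType) (I : set A).

Definition rees_pred : {pred {poly A}} :=
  fun f => `[< forall n, ideal_pow I n f`_n >].

Lemma rees_subring : subring_closed rees_pred.
Proof.
split=> [|f g /asboolP hf /asboolP hg|f g /asboolP hf /asboolP hg].
- apply/asboolP=> n; rewrite coef1; case: n => [|n] //=.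
  by case: (ideal_pow_ideal I n.+1).
- apply/asboolP=> n; rewrite coefB; case: (ideal_pow_ideal I n) => _ hD _.
  by apply: hD; last exact: ideal_powN.
- apply/asboolP=> n; rewrite coefM; apply: ideal_pow_sum => i _.
  by rewrite -[X in ideal_pow I X](subnKC (leq_ord i)); apply: ideal_powM.
Qed.

HB.instance Definition _ :=
  GRing.isSubringClosed.Build {poly A} rees_pred rees_subring.

Record rees_algebra := ReesElement {
  rees_val :> {poly A}; _ : rees_val \in rees_pred }.

HB.instance Definition _ := [isSub for rees_val].
HB.instance Definition _ := [Choice of rees_algebra by <:].
HB.instance Definition _ := [SubChoice_isSubComNzRing of rees_algebra by <:].

End ReesAlgebra.

Section Laurent.
Variable A : comNzRingType.

Definition powers_of_X : set {poly A} := range (fun n : nat => 'X^n).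

Lemma powers_of_X1 : powers_of_X 1.
Proof. by exists 0%N => //; rewrite expr0. Qed.
Lemma powers_of_XM f g : powers_of_X f -> powers_of_X g -> powers_of_X (f * g).
Proof. by move=> [m _ <-] [n _ <-]; exists (m + n)%N => //; rewrite exprD. Qed.
Lemma powers_of_X0 : ~ powers_of_X 0.
Proof. by move=> [n _ /eqP]; rewrite (negPf (monic_neq0 (monicXn A n))). Qed.

Definition X_mulset : mulset {poly A} :=
  MulSet powers_of_X1 powers_of_XM powers_of_X0.

(* A[t, t^-1], as the localization of A[t] at the powers of t *)
Definition laurent : comNzRingType := localization X_mulset.

Lemma powers_of_Xn n : mulset_car X_mulset 'X^n. Proof. by exists n. Qed.

(* the Laurent polynomial f / t^n *)
Definition laurent_frac (f : {poly A}) (n : nat) : laurent :=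
  locfrac f (powers_of_Xn n).

Lemma laurent_fracB f m g n : laurent_frac f m - laurent_frac g n =
  laurent_frac (f * 'X^n - g * 'X^m) (m + n).
Proof.
rewrite /laurent_frac /locfrac [- _]Localization.opp_frac.
rewrite [LHS]Localization.add_frac.
by apply: Localization.frac_eq; rewrite /= exprD; ring.
Qed.

Lemma laurent_fracM f m g n :
  laurent_frac f m * laurent_frac g n = laurent_frac (f * g) (m + n).
Proof.
rewrite /laurent_frac /locfrac [LHS]Localization.mul_frac.
by apply: Localization.frac_eq; rewrite /= exprD; ring.
Qed.

Lemma laurent_frac1 : 1 = laurent_frac 1 0.
Proof. by apply: Localization.frac_eq; rewrite /= expr0. Qed.

Lemma laurent_frac_inj f m g n :
  laurent_frac f m = laurent_frac g n -> f * 'X^n = g * 'X^m.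
Proof.
move=> /Localization.fracP[_ [k _ <-]] /=.
by apply: monic_lreg; exact: monicXn.
Qed.

End Laurent.

Section ExtendedReesAlgebra.
Variables (A : comNzRingType) (I : set A).

(* The coefficient of t^(i - n) in f / t^n is f`_i; the subtraction is
   truncated, which matches the convention I^k = A for k <= 0. *)
Definition ext_rees_pred : {pred laurent A} := fun x =>
  `[< exists f n, x = laurent_frac f n /\ forall i, ideal_pow I (i - n) f`_i >].

(* ext_rees_pred does not depend on the representation of x as a fraction. *)
Lemma ext_rees_predE f n :
  laurent_frac f n \in ext_rees_pred <-> forall i, ideal_pow I (i - n) f`_i.
Proof.
split=> [/asboolP[g [m [/laurent_frac_inj e hg]]] i|h]; last first.
  by apply/asboolP; exists f, n.
have := congr1 (fun h : {poly A} => h`_(i + m)) e.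
rewrite !coefMXn ltnNge leq_addl /= addnK => ->.
case: ltnP => [_|le_n]; first by case: (ideal_pow_ideal I (i - n)).
by have := hg (i + m - n)%N; rewrite subnAC addnK.
Qed.

Lemma ext_rees_subring : subring_closed ext_rees_pred.
Proof.
have shift (f : {poly A}) m n : (forall i, ideal_pow I (i - m) f`_i) ->
    forall i, ideal_pow I (i - (m + n)) (f * 'X^n)`_i.
  move=> hf i; rewrite coefMXn; case: ltnP => [_|le_ni].
    by case: (ideal_pow_ideal I (i - (m + n))).
  by rewrite addnC subnDA; apply: hf.
split=> [|_ _ /asboolP[f [m [-> hf]]] /asboolP[g [n [-> hg]]]
        |_ _ /asboolP[f [m [-> hf]]] /asboolP[g [n [-> hg]]]].
- rewrite laurent_frac1; apply/ext_rees_predE => i; rewrite subn0 coef1.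
  by case: i => [|i] //=; case: (ideal_pow_ideal I i.+1).
- rewrite laurent_fracB; apply/ext_rees_predE => i; rewrite coefB.
  case: (ideal_pow_ideal I (i - (m + n))) => _ hD _.
  by apply: hD; [exact: shift | apply: ideal_powN; rewrite addnC; exact: shift].
- rewrite laurent_fracM; apply/ext_rees_predE => i; rewrite coefM.
  apply: ideal_pow_sum => j _.
  have le : (i - (m + n) <= (j - m) + (i - j - n))%N.
    by have := leq_ord j; lia.
  by apply: (ideal_powS le); apply: ideal_powM.
Qed.

HB.instance Definition _ :=
  GRing.isSubringClosed.Build (laurent A) ext_rees_pred ext_rees_subring.

Record ext_rees_algebra := ExtReesElement {
  ext_rees_val :> laurent A; _ : ext_rees_val \in ext_rees_pred }.

HB.instance Definition _ := [isSub for ext_rees_val].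
HB.instance Definition _ := [Choice of ext_rees_algebra by <:].
HB.instance Definition _ := [SubChoice_isSubComNzRing of ext_rees_algebra by <:].

End ExtendedReesAlgebra.

(* Main.v *)
(* Let [J = (x_1, ..., x_d)] be the reduction, [S] the Rees algebra, [E] the extended
   one and [u = 1/t].  In a domain that is a quotient of a Cohen-Macaulay local ring,
   F-rationality means that one, equivalently every, system of parameters is tightly
   closed (colon capturing), and it passes to localizations and to the closed points of
   the affine line.  Hence all maximal ideals of [S] and [E] are harmless except the
   homogeneous ones: where [u], some [x_i] or some [x_i t] is invertible, the two algebras
   are localizations of [R[X]] or agree with each other.  At the homogeneous maximal
   ideals the parameters are [u, x_1 t, ..., x_d t] in [E] and
   [w_j = x_(j+1) - x_j t], [0 <= j <= d], [x_0 = x_(d+1) = 0], in [S].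
   From [S] to [E]: if [z t^i] is in the tight closure of [(u, x_1 t, ..., x_d t)], then
   [x_1 z t^(i+1)] is in that of the [w_j], because [x_l t = x_(l+1) - w_l]; comparing
   coefficients gives [z] in [I^(i+1) + J] (for [i + 1 >= d], because [J] is tightly
   closed).  Regularity of the [w_j] gives the Valabrega-Valla equalities: [J] meets
   [I^n] in [J I^(n-1)]; so [z t^i] lies in [(u, x_1 t, ..., x_d t)].
   From [E] to [S]: multiplication by [sum_i (x_1 ... x_d / x_i) t^(i-1)] kills
   [w_1, ..., w_(d-1)] modulo the squares [x_l^2], so an [f] in the tight closure of the
   [w_j] yields elements of [R] in the tight closure of [(u^b, (x_l t)^2)]; this forces
   the coefficients of [f], up to an element of [(w_0, ..., w_d)], successively into
   [I, I^2, ..., I^d], and [I^d = J I^(d-1)] ends the argument.  Setting [t = 1]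
   transfers F-rationality from [E] to [R]. *)

From HB Require Import structures.
Require Import Defs.
From mathcomp Require Import all_boot all_order all_algebra ring zify.
From mathcomp Require Import mathcomp_extra boolp classical_sets.

Set Implicit Arguments.
Unset Strict Implicit.
Unset Printing Implicit Defensive.

Import GRing.Theory.
Local Open Scope classical_set_scope.
Local Open Scope ring_scope.

(** * Ideals, associated primes and prime avoidance *)

(** A relation on c f^q descends from a Rees algebra to R through one remark: once q exceeds the
    degree of c, the coefficient of t^(iq+j) in c f^q is exactly c_j f_i^q, so a fixed nonzero c_j
    serves as multiplier for every q. The reduction number r of I is not controlled: I^n falls into
    (x_1^q, ..., x_d^q) only for n at least dq + r. The gap r does not depend on q and is absorbed
    by the fixed multiplier b^r, with b nonzero in I. The same uniformity in q shapes colon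
    capturing and localization, where each auxiliary multiplier is a power of fixed exponent of an
    element chosen before q, or has the form sigma^q and is moved into the element under test. The
    w_j are parameters because x_i x_k and x_(i-1) x_(k+1) agree modulo them, so all products x_i
    x_k vanish. With H = sum_i (x_1 ... x_d / x_i) t^(i-1), the product H x_k is x_1 ... x_d t^(k-1)
    modulo the squares, which is why H w_j telescopes away for 0 < j < d. *)

Lemma set_eqP (T : Type) (X Y : set T) : X = Y -> forall x, X x <-> Y x.
Proof. by move=> ->. Qed.

Section IdealGen.
Variable A : comNzRingType.
Implicit Types (I J K P Q M : set A) (s t : seq A) (x y z a c : A).

Lemma id0 I : is_ideal I -> I 0. Proof. by case. Qed.
Lemma idD I x y : is_ideal I -> I x -> I y -> I (x + y).
Proof. by case=> _ h _; apply: h. Qed.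
Lemma idMl I a x : is_ideal I -> I x -> I (a * x).
Proof. by case=> _ _; apply. Qed.
Lemma idMr I a x : is_ideal I -> I x -> I (x * a).
Proof. by rewrite mulrC; apply: idMl. Qed.
Lemma idN I x : is_ideal I -> I x -> I (- x).
Proof. by move=> h; rewrite -mulN1r; apply: idMl. Qed.
Lemma idB I x y : is_ideal I -> I x -> I y -> I (x - y).
Proof. by move=> h hx hy; apply: idD => //; apply: idN. Qed.
Lemma id_sum I (T : Type) (r : seq T) (Pr : pred T) (F : T -> A) :
  is_ideal I -> (forall i, Pr i -> I (F i)) -> I (\sum_(i <- r | Pr i) F i).
Proof. by move=> h hF; elim/big_ind: _ => // [|x y]; [exact: id0 | exact: idD]. Qed.
Lemma id_sub I x y : is_ideal I -> I y -> I (x - y) -> I x.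
Proof. by move=> h hy hxy; rewrite -(subrK y x); apply: idD. Qed.
Lemma id_exp I x n k : is_ideal I -> (n <= k)%N -> I (x ^+ n) -> I (x ^+ k).
Proof. by move=> h /subnK <-; rewrite exprD; apply: idMl. Qed.
Lemma id_expS I x n : is_ideal I -> I x -> I (x ^+ n.+1).
Proof. by move=> h; rewrite exprSr; apply: idMl. Qed.

Lemma is_ideal0 : is_ideal [set (0 : A)].
Proof. by split=> [//|x y -> ->|a x ->] /=; rewrite ?addr0 ?mulr0. Qed.
Lemma is_idealT : is_ideal (@setT A). Proof. by split. Qed.

(** The ideal I + (s). Keeping the base ideal [I] as a parameter allows statements about [A/I]
    without forming the quotient ring. *)
Fixpoint gen I s : set A :=
  if s is x :: s' then [set z | exists a, gen I s' (z - a * x)] else I.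

Lemma gen_ideal I s : is_ideal I -> is_ideal (gen I s).
Proof.
move=> hI; elim: s => [//|x s ih] /=; split=> [|y z [a ha] [b hb]|c y [a ha]].
- by exists 0; rewrite mul0r subr0; apply: id0.
- exists (a + b); rewrite (_ : _ - _ = (y - a * x) + (z - b * x)); last by ring.
  exact: idD.
- by exists (c * a); rewrite -mulrA -mulrBr; apply: idMl.
Qed.

Lemma gen_base I s z : is_ideal I -> I z -> gen I s z.
Proof.
by move=> hI hz; elim: s => [//|x s ih] /=; exists 0; rewrite mul0r subr0.
Qed.

Lemma gen_mem I s z : is_ideal I -> z \in s -> gen I s z.
Proof.
move=> hI; elim: s => [//|x s ih] /=; rewrite inE => /orP[/eqP->|/ih h].
  by exists 1; rewrite mul1r subrr; exact: (id0 (gen_ideal s hI)).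
by exists 0; rewrite mul0r subr0.
Qed.

Lemma gen_min I s K : is_ideal K -> I `<=` K -> (forall x, x \in s -> K x) ->
  gen I s `<=` K.
Proof.
move=> hK hI; elim: s => [//|x s ih] hs z /= [a /ih h].
have Kx : K (a * x) by apply: idMl => //; apply: hs; rewrite inE eqxx.
apply: id_sub Kx _ => //; apply: h => y ys; apply: hs.
by rewrite inE ys orbT.
Qed.

Lemma gen_sub I J s t : is_ideal J -> I `<=` gen J t ->
  (forall x, x \in s -> gen J t x) -> gen I s `<=` gen J t.
Proof. by move=> hJ; apply: gen_min; exact: gen_ideal. Qed.

Lemma gen_mono I J s : is_ideal J -> I `<=` J -> gen I s `<=` gen J s.
Proof.
move=> hJ hIJ; apply: gen_sub => // [z /hIJ|x]; first exact: gen_base.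
exact: gen_mem.
Qed.

Lemma gen_subseq I s t : is_ideal I -> {subset s <= t} -> gen I s `<=` gen I t.
Proof.
by move=> hI hst; apply: gen_sub => // [z|x /hst]; [exact: gen_base | exact: gen_mem].
Qed.

Lemma gen_eq_mem I s t : is_ideal I -> s =i t -> gen I s = gen I t.
Proof.
by move=> hI st; apply/seteqP; split; apply: gen_subseq => // x; rewrite st.
Qed.

Lemma gen_cat I s t : is_ideal I -> gen I (s ++ t) = gen (gen I t) s.
Proof. by move=> hI; elim: s => [//|x s ih] /=; rewrite ih. Qed.

Lemma gen_catC I s t : is_ideal I -> gen I (s ++ t) = gen (gen I s) t.
Proof.
move=> hI; rewrite -gen_cat //; apply: gen_eq_mem => // x.
by rewrite !mem_cat orbC.
Qed.

Lemma gen_cons I x s : is_ideal I -> gen I (x :: s) = gen (gen I [:: x]) s.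
Proof. by move=> hI; rewrite -gen_catC. Qed.

Lemma gen_rcons I x s : is_ideal I -> gen I (rcons s x) = gen (gen I s) [:: x].
Proof. by move=> hI; rewrite -cats1 gen_catC. Qed.

Lemma gen1P I x z : gen I [:: x] z <-> exists a, I (z - a * x).
Proof. by []. Qed.

Lemma gen_sumP I s z : gen I s z <->
  exists f : nat -> A, I (z - \sum_(i < size s) f i * s`_i).
Proof.
elim: s z => [|x s ih] z /=.
  by split=> [h|[f]]; [exists (fun=> 0) | ]; rewrite big_ord0 subr0.
split=> [[a /ih[f hf]]|[f]].
  exists (fun i => if i is i'.+1 then f i' else a).
  by rewrite big_ord_recl /= opprD addrA.
rewrite big_ord_recl /= opprD addrA => h; exists (f 0%N); apply/ih.
by exists (fun i => f i.+1).
Qed.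

Lemma ideal_gen_min (X : set A) K : is_ideal K -> X `<=` K -> ideal_gen X `<=` K.
Proof. by move=> hK hX z; apply. Qed.

Lemma ideal_gen_mem (X : set A) z : X z -> ideal_gen X z.
Proof. by move=> hz K [_]; apply. Qed.

Definition lin s := gen [set 0] s.

Lemma ideal_genE s : ideal_gen [set` s] = lin s.
Proof.
apply/seteqP; split; last first.
  apply: gen_min; first exact: ideal_gen_ideal.
    by move=> _ ->; exact: (id0 (ideal_gen_ideal _)).
  by move=> x xs; apply: ideal_gen_mem.
apply: ideal_gen_min; first exact/gen_ideal/is_ideal0.
by move=> x /= xs; apply: gen_mem => //; exact: is_ideal0.
Qed.

Lemma lin_ideal s : is_ideal (lin s). Proof. exact/gen_ideal/is_ideal0. Qed.
Hint Resolve lin_ideal is_ideal0 is_idealT : core.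

Lemma lin_mem s x : x \in s -> lin s x. Proof. exact: gen_mem. Qed.

Lemma lin_min s K : is_ideal K -> (forall x, x \in s -> K x) -> lin s `<=` K.
Proof. by move=> hK; apply: gen_min => // _ ->; apply: id0. Qed.

Lemma linP s z : lin s z <->
  exists f : nat -> A, z = \sum_(i < size s) f i * s`_i.
Proof.
split=> [/gen_sumP[f /subr0_eq]|[f ->]]; first by exists f.
by apply/gen_sumP; exists f; rewrite subrr.
Qed.

Lemma lin_sub_gen I s : is_ideal I -> lin s `<=` gen I s.
Proof. by move=> hI; apply: gen_mono => // _ ->; apply: id0. Qed.

Lemma lin_cat s t : lin (s ++ t) = gen (lin s) t.
Proof. exact: gen_catC. Qed.

Lemma lin_rcons s x : lin (rcons s x) = gen (lin s) [:: x].
Proof. by rewrite /lin gen_rcons. Qed.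

Lemma eq_lin s t : s =i t -> lin s = lin t.
Proof. exact: gen_eq_mem. Qed.

Lemma prime_ideal P : is_prime P -> is_ideal P. Proof. by case. Qed.
Lemma primeX P x n : is_prime P -> P (x ^+ n) -> P x.
Proof.
case=> hP h1 hM; elim: n => [|n ih]; first by rewrite expr0.
by rewrite exprS => /hM[].
Qed.
Lemma prime_nM P x y : is_prime P -> ~ P x -> ~ P y -> ~ P (x * y).
Proof. by case=> _ _ h nx ny /h[]. Qed.
Lemma prime_nX P x n : is_prime P -> ~ P x -> ~ P (x ^+ n).
Proof. by move=> hP nx /(primeX hP). Qed.
Lemma prime_cancel P (s x : A) : is_prime P -> ~ P s -> P (s * x) -> P x.
Proof. by case=> _ _ h ns /h[]. Qed.

Definition colon I x : set A := [set a | I (a * x)].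
Lemma colon_ideal I x : is_ideal I -> is_ideal (colon I x).
Proof.
move=> hI; split=> [|a b ha hb|c a ha] /=; rewrite /colon /=.
- by rewrite mul0r; apply: id0.
- by rewrite mulrDl; apply: idD.
- by rewrite -mulrA; apply: idMl.
Qed.

Lemma ideal1 I x : is_ideal I -> I 1 -> I x.
Proof. by move=> hI h1; rewrite -(mulr1 x); apply: idMl. Qed.

Definition nzd I x := forall y, I (x * y) -> I y.

Lemma nzdM I x y : nzd I x -> nzd I y -> nzd I (x * y).
Proof. by move=> hx hy z; rewrite -mulrA => /hx/hy. Qed.
Lemma nzdX I x n : nzd I x -> nzd I (x ^+ n).
Proof.
move=> hx; elim: n => [|n ih]; first by move=> z; rewrite expr0 mul1r.
by rewrite exprS; apply: nzdM.
Qed.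

End IdealGen.

#[global] Arguments gen {A} I s _ : simpl never.
#[global] Hint Resolve lin_ideal is_ideal0 is_idealT : core.

(** * Noetherian rings and associated primes *)

Section Noetherian.
Variable A : comNzRingType.
Hypothesis noeA : noetherian A.
Implicit Types (I J K P Q M : set A) (x y z a c : A).

Lemma noeth_fg I : is_ideal I -> exists s, I = lin s.
Proof. by move=> /noeA[s ->]; exists s; rewrite ideal_genE. Qed.

Lemma max_ideal (S : set (set A)) I0 : S I0 -> (forall I, S I -> is_ideal I) ->
  exists I, [/\ S I, I0 `<=` I & forall J, S J -> I `<=` J -> J `<=` I].
Proof.
move=> S0 Sid; apply: contrapT => /forallNP H.
have nxt (I : {I | S I /\ I0 `<=` I}) : {J : {J | S J /\ I0 `<=` J} |
    sval I `<=` sval J /\ ~ (sval J `<=` sval I)}.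
  apply: cid; case: I => I [SI hI] /=.
  apply: contrapT => h; apply: (H I).
  split=> // J SJ IJ; apply: contrapT => nJI.
  have hJ : I0 `<=` J by apply: subset_trans IJ.
  by apply: h; exists (exist _ J (conj SJ hJ)).
pose F := fix F n := if n is n'.+1 then sval (nxt (F n')) else
  exist (fun I => S I /\ I0 `<=` I) I0 (conj S0 (@subset_refl _ I0)).
have Fid n : is_ideal (sval (F n)) by apply: Sid; have [] := svalP (F n).
have FS n : sval (F n) `<=` sval (F n.+1) by have [] := svalP (nxt (F n)).
have FNS n : ~ (sval (F n.+1) `<=` sval (F n)) by have [] := svalP (nxt (F n)).
have Fm m n : (m <= n)%N -> sval (F m) `<=` sval (F n).
  move=> /subnK <-; elim: (n - m)%N => [|k ih]; first by rewrite add0n.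
  by apply: subset_trans ih _; exact: FS.
pose U : set A := [set x | exists n, sval (F n) x].
have Uid : is_ideal U.
  split=> [|x y [m hm] [n hn]|a x [n hn]].
  - by exists 0%N; apply: id0.
  - exists (maxn m n); apply: idD => //; [apply: Fm hm|apply: Fm hn].
      exact: leq_maxl.
    exact: leq_maxr.
  - by exists n; apply: idMl.
have [s Us] := noeth_fg Uid.
have [n hn] : exists n, forall x, x \in s -> sval (F n) x.
  have : forall x, x \in s -> U x by move=> x xs; rewrite Us; apply: lin_mem.
  elim: s {Us} => [|x s ih] h; first by exists 0%N.
  have [|n hn] := ih; first by move=> y ys; apply: h; rewrite inE ys orbT.
  have [|k hk] := h x; first by rewrite inE eqxx.
  exists (maxn n k) => y; rewrite inE => /orP[/eqP->|/hn].
    by apply: Fm hk; exact: leq_maxr.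
  by apply: Fm; exact: leq_maxl.
apply: (FNS n) => x hx; apply: (@lin_min _ s) => //.
by rewrite -Us; exists n.+1.
Qed.

Lemma noeth_ind (Pr : set A -> Prop) :
  (forall I, is_ideal I -> (forall J, is_ideal J -> I `<=` J -> ~ (J `<=` I) -> Pr J) ->
     Pr I) -> forall I, is_ideal I -> Pr I.
Proof.
move=> H I hI; apply: contrapT => nP.
have [//|J []//|K [[hK nK] _ mK]] :=
  @max_ideal [set J | is_ideal J /\ ~ Pr J] I.
apply: nK; apply: H => // J hJ KJ nJK; apply: contrapT => nPJ.
by apply: nJK; apply: mK.
Qed.

(** An ideal maximal among those avoiding S is prime: two elements outside it with product inside it
    would provide s and t in S whose product falls into it. *)
Lemma prime_avoid_mult I (S : set A) : is_ideal I -> S 1 ->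
  (forall x y, S x -> S y -> S (x * y)) -> (forall x, S x -> ~ I x) ->
  exists P, [/\ is_prime P, I `<=` P & forall x, S x -> ~ P x].
Proof.
move=> hI S1 SM SI.
have [//|J []//|P [[hP nP] IP mP]] :=
  @max_ideal [set J | is_ideal J /\ forall x, S x -> ~ J x] I.
exists P; split=> //; split=> // [|x y Pxy]; first exact: nP.
apply: contrapT => /not_orP[nx ny].
have big z : ~ P z -> exists s a, S s /\ P (s - a * z).
  move=> nz; apply: contrapT => H; apply: nz.
  apply: (mP (gen P [:: z])); last by apply: gen_mem; rewrite ?inE.
    split; first exact: gen_ideal.
    by move=> s Ss [a ha]; apply: H; exists s, a.
  by move=> t; apply: gen_base.
have [s [a [Ss ha]]] := big _ nx; have [t [b [St hb]]] := big _ ny.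
apply: (nP (s * t)); first exact: SM.
rewrite (_ : s * t = (s - a * x) * t + a * x * (t - b * y) + a * b * (x * y)); last by ring.
apply: idD => //; last exact: idMl.
by apply: idD => //; [apply: idMr|apply: idMl].
Qed.

Definition assoc I P := is_prime P /\ exists g, P = colon I g.

Lemma assoc_sub I P : is_ideal I -> assoc I P -> I `<=` P.
Proof. by move=> hI [_ [g ->]] x Ix; apply: idMr. Qed.

(** A maximal member of the family of all (I : h), with h outside I, is prime. *)
Lemma assoc_over I g : is_ideal I -> ~ I g ->
  exists h, ~ I h /\ is_prime (colon I h) /\ colon I g `<=` colon I h.
Proof.
move=> hI ng.
have [|_ [h nh ->]|K [[h nh ->] gh mh]] :=
  @max_ideal [set K | exists2 h, ~ I h & K = colon I h] (colon I g).
- by exists g.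
- exact: colon_ideal.
exists h; split=> //; split=> //; split; first exact: colon_ideal.
  by rewrite /colon /= mul1r.
move=> a b; rewrite /colon /= => hab; apply: contrapT => /not_orP[na nb].
apply: na; apply: (mh (colon I (b * h))) => [|x|].
- by exists (b * h).
- by rewrite /colon /= mulrCA; apply: idMl.
- by rewrite /colon /= mulrA.
Qed.

Lemma assoc_zd I x y : is_ideal I -> I (x * y) -> ~ I y -> exists2 P, assoc I P & P x.
Proof.
move=> hI hxy ny; have [h [nh [ph hh]]] := assoc_over hI ny.
by exists (colon I h); [split=> //; exists h | apply: hh].
Qed.

Lemma assoc_notin I P g : is_ideal I -> is_prime P -> P = colon I g -> ~ I g.
Proof.
by move=> hI [_ n1 _] e Ig; apply: n1; rewrite e /colon /= mul1r.
Qed.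

(** Noetherian induction after choosing g with (I : g) prime. The copy of A/P that an associated
    prime P provides inside A/I either meets the one generated by g, and then P = (I : g), or
    injects into A/(I + g). *)
Lemma assoc_finite_aux I : is_ideal I ->
  exists n (F : nat -> set A), (forall i, (i < n)%N -> is_prime (F i)) /\
    forall P, assoc I P -> exists2 i, (i < n)%N & P = F i.
Proof.
move: I; apply: noeth_ind => I hI ih.
have [I1|n1] := pselect (I 1).
  exists 0%N, (fun=> set0); split=> // P aP; case: (aP) => -[_ nP _] _.
  by case: nP; apply: (assoc_sub hI aP).
have [g [ng [pg _]]] := assoc_over hI n1.
have [|||n [F [pF hF]]] := ih (gen I [:: g]).
- exact: gen_ideal.
- by move=> x; apply: gen_base.
- by move=> h; apply: ng; apply: h; apply: gen_mem; rewrite ?inE.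
exists n.+1, (fun i => if i is i'.+1 then F i' else colon I g).
split=> [[|i] //=|P [pP [g1 eP]]]; first exact: pF.
have [[r [nr hr]]|H] := pselect (exists r, ~ I (r * g1) /\ gen I [:: g] (r * g1)).
  exists 0%N => //; have [h ih'] := hr.
  have nh : ~ I (h * g) by move=> ?; apply: nr; apply: id_sub ih'.
  have e x : I (x * (r * g1)) <-> I (x * (h * g)).
    have : I (x * (r * g1) - x * (h * g)) by rewrite -mulrBr; apply: idMl.
    move=> k; split=> k'; last exact: id_sub k.
    by apply: id_sub k' _ => //; rewrite -opprB; apply: idN.
  apply/seteqP; split=> x.
    move=> Px; apply: (@prime_cancel _ _ h) => //.
    rewrite /colon /= mulrAC mulrC.
    by apply/e; rewrite mulrCA; apply: idMl => //; move: Px; rewrite eP.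
  move=> xg; apply: (@prime_cancel _ _ r) => //; first by rewrite eP.
  rewrite eP /colon /= mulrAC mulrC.
  by apply/e; rewrite mulrCA; apply: idMl.
case: (hF P) => [|i hi eF]; last by exists i.+1.
split=> //; exists g1; apply/seteqP; split=> x.
  by rewrite eP => h; apply: gen_base.
move=> h; rewrite eP; apply: contrapT => nx.
by apply: H; exists x.
Qed.

Lemma assoc_finite I : is_ideal I ->
  exists n (F : nat -> set A), forall P, assoc I P <-> exists2 i, (i < n)%N & P = F i.
Proof.
move=> /assoc_finite_aux[n [F [_ hF]]].
suff [j [G hG]] : exists j (G : nat -> set A), forall P,
    (assoc I P /\ exists2 i, (i < n)%N & P = F i) <-> exists2 i, (i < j)%N & P = G i.
  by exists j, G => P; apply: iff_trans (hG P); split=> [aP|[]//]; split=> //; apply: hF.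
elim: n {hF} => [|n [j [G hG]]]; first by exists 0%N, F => P; split=> [[_ []]|[]].
have [aF|nF] := pselect (assoc I (F n)).
  exists j.+1, (fun i => if (i < j)%N then G i else F n) => P; split=> [[aP [i]]|[i]].
    rewrite ltnS leq_eqVlt => /orP[/eqP->|hi] eP; first by exists j; rewrite ?ltnn.
    have [k hk ek] : exists2 i, (i < j)%N & P = G i by apply/hG; split=> //; exists i.
    by exists k; [exact: leqW | rewrite hk].
  case: (ltnP i j) => [hi _ eP|hi _ ->]; last by split=> //; exists n.
  have [aP [k hk ek]] : assoc I P /\ exists2 i, (i < n)%N & P = F i by apply/hG; exists i.
  by split=> //; exists k => //; exact: leqW.
exists j, G => P; apply: iff_trans (hG P); split=> [[aP [i]]|[aP [i hi eP]]].
  rewrite ltnS leq_eqVlt => /orP[/eqP->|hi] eP; first by case: nF; rewrite -eP.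
  by split=> //; exists i.
by split=> //; exists i => //; exact: leqW.
Qed.

(** Let K be the kernel of A -> (A/I)_P. A maximal member among the (I : h) with h outside K is
    prime, and it stays inside P since an element outside P killing h modulo I would put h into
    K. *)
Lemma assoc_below I P : is_ideal I -> is_prime P -> I `<=` P ->
  exists2 P', assoc I P' & P' `<=` P.
Proof.
move=> hI pP IP.
pose K : set A := [set x | exists2 s, ~ P s & I (s * x)].
have [|_ [h nh ->]|J [[x nx ->] _ mx]] :=
  @max_ideal [set K' | exists2 h, ~ K h & K' = colon I h] (colon I 1).
- by exists 1 => // -[s ns]; rewrite mulr1 => /IP.
- exact: colon_ideal.
exists (colon I x).
  split; last by exists x.
  split; first exact: colon_ideal.
    rewrite /colon /= mul1r => Ix; apply: nx; exists 1; last by rewrite mul1r.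
    by case: pP.
  move=> a b; rewrite /colon /= => hab; apply: contrapT => /not_orP[na nb].
  have [[s ns hs]|nK] := pselect (K (b * x)).
    apply: nb; apply: (mx (colon I (s * x))) => [|y|].
    - exists (s * x) => // -[t nt ht]; apply: nx; exists (t * s).
        exact: prime_nM.
      by rewrite -mulrA.
    - by rewrite /colon /= mulrCA; apply: idMl.
    - by rewrite /colon /= mulrCA.
  apply: na; apply: (mx (colon I (b * x))) => [|y|].
  - by exists (b * x).
  - by rewrite /colon /= mulrCA; apply: idMl.
  - by rewrite /colon /= mulrA.
move=> t; rewrite /colon /= => ht; apply: contrapT => nt.
by apply: nx; exists t.
Qed.

End Noetherian.

Section PrimeAvoidance.
Variable A : comNzRingType.
Implicit Types (B P : set A) (y : A).

Lemma prime_inter n (F : nat -> set A) B P : is_prime P -> is_ideal B ->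
  (forall i, (i < n)%N -> is_ideal (F i)) ->
  (forall i, (i < n)%N -> ~ F i `<=` P) -> ~ B `<=` P ->
  exists b, [/\ B b, ~ P b & forall i, (i < n)%N -> F i b].
Proof.
move=> pP hB; elim: n => [|n ih] idF hF nB.
  by have /existsNP[b /not_implyP[Bb nb]] := nB; exists b.
have [|||b [Bb nb hb]] := ih => //; try by move=> i hi; [apply: idF|apply: hF]; lia.
  by move=> i hi; apply: idF; lia.
  by move=> i hi; apply: hF; lia.
have /existsNP[c /not_implyP[Fc nc]] := hF n (leqnn _).
exists (b * c); split; [exact: idMr|exact: prime_nM|] => i.
rewrite ltnS leq_eqVlt => /orP[/eqP->|hi]; first by apply: idMl => //; apply: idF.
by apply: idMr; [apply: idF; lia | exact: hb].
Qed.

(** Induction on the number of primes. Once no earlier prime lies inside F n, some element of B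
    belongs to all the earlier ones but not to F n, and adding it corrects a first choice of b at F
    n without spoiling the others. *)
Lemma coset_avoid n (F : nat -> set A) y B : is_ideal B ->
  (forall i, (i < n)%N -> is_prime (F i)) ->
  (forall i, (i < n)%N -> ~ (F i y /\ B `<=` F i)) ->
  exists2 b, B b & forall i, (i < n)%N -> ~ F i (y + b).
Proof.
move=> hB; elim: n {-2}n (leqnn n) F => [|N ih] n hn F pF hF.
  by exists 0 => [|i]; [exact: id0 | lia].
case: n hn pF hF => [|n] hn pF hF; first by exists 0 => [|i]; [exact: id0|].
have [[j hj jn]|H] := pselect (exists2 j, (j < n)%N & F j `<=` F n).
  have [||b Bb hb] := ih n hn (fun i => if i == j then F n else F i).
  - by move=> i hi; case: ifP => _; apply: pF; lia.
  - by move=> i hi; case: ifP => _; apply: hF; lia.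
  exists b => // i hi.
  have [e|ne] := eqVneq i j.
    by rewrite e => /jn; have := hb j hj; rewrite eqxx.
  have [e|ne'] := eqVneq i n; first by rewrite e; have := hb j hj; rewrite eqxx.
  by have := hb i; rewrite (negPf ne); apply; lia.
have [||b Bb hb] := ih n hn F.
- by move=> i hi; apply: pF; lia.
- by move=> i hi; apply: hF; lia.
have pn : is_prime (F n) by apply: pF.
have [Fn|nFn] := pselect (F n (y + b)); last first.
  exists b => // i; rewrite ltnS leq_eqVlt => /orP[/eqP->//|]; exact: hb.
have nB : ~ B `<=` F n.
  move=> BF; apply: (hF n) => //; split=> //.
  rewrite -(addrK b y); apply: idB => //; [exact: prime_ideal|exact: BF].
have [|||c [Bc nc hc]] := @prime_inter n F B (F n) pn hB => //.
- by move=> i hi; apply/prime_ideal/pF; lia.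
- by move=> i hi h; apply: H; exists i.
exists (b + c) => [|i]; first exact: idD.
rewrite addrA ltnS leq_eqVlt => /orP[/eqP->|hi] h.
  apply: nc; rewrite -(addKr (y + b) c) addrC; apply: idB => //; exact: prime_ideal.
apply: (hb i hi); rewrite -(addrK c (y + b)); apply: idB => //; last exact: hc.
by apply/prime_ideal/pF; lia.
Qed.

End PrimeAvoidance.

(** * Local rings and localization at a prime *)

Section Local.
Variable A : comNzRingType.
Implicit Types (I J K P Q M : set A) (x y z a c : A).

(** Elementwise form of locality, directly usable for inverting elements; in a noetherian ring it
    follows from [is_local]. *)
Definition loc_max M := [/\ is_ideal M, ~ M 1 & forall x, ~ M x -> exists y, x * y = 1].

Lemma loc_max_prime M : loc_max M -> is_prime M.
Proof.
case=> hM n1 hu; split=> // x y Mxy; apply: contrapT => /not_orP[nx ny].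
have [x' ex] := hu _ nx; apply: ny.
by rewrite -(mul1r y) -ex mulrAC; apply: idMr.
Qed.

Lemma loc_max_sub M I : loc_max M -> is_ideal I -> ~ I 1 -> I `<=` M.
Proof.
case=> hM n1 hu hI nI x Ix; apply: contrapT => /hu[y e].
by apply: nI; rewrite -e; apply: idMr.
Qed.

Lemma loc_max_is_local M : loc_max M -> is_local M.
Proof.
move=> hM; case: (hM) => hI n1 hu.
have mM : is_maximal M.
  split=> // J hJ MJ; have [J1|nJ] := pselect (J 1).
    by right; apply/seteqP; split=> // x _; apply: ideal1.
  by left; apply/seteqP; split=> //; apply: loc_max_sub.
split=> // N [hN nN mN]; have NM : N `<=` M by apply: loc_max_sub.
by case: (mN M hI NM) => // e; case: n1; rewrite e.
Qed.

Lemma is_local_uniq M N : is_local M -> is_local N -> M = N.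
Proof. by move=> [_ h] [hN _]; rewrite (h _ hN). Qed.

Lemma maximal_above I : noetherian A -> is_ideal I -> ~ I 1 ->
  exists2 N, is_maximal N & I `<=` N.
Proof.
move=> noeA hI n1.
have [|J []//|N [[hN nN] IN mN]] :=
  @max_ideal A noeA [set J | is_ideal J /\ ~ J 1] I; first by [].
exists N => //; split=> // J hJ NJ; have [J1|nJ] := pselect (J 1).
  by right; apply/seteqP; split=> // x _; apply: ideal1.
by left; apply/seteqP; split=> //; apply: mN.
Qed.

Lemma is_local_loc_max M : noetherian A -> is_local M -> loc_max M.
Proof.
move=> noeA [[hM n1 mM] uM]; split=> // x nx; apply: contrapT => nu.
have [||N hN xN] := @maximal_above (lin [:: x]) noeA; first exact: lin_ideal.
  by move=> /gen1P[a /subr0_eq e]; apply: nu; exists a; rewrite mulrC.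
by apply: nx; rewrite -(uM _ hN); apply: xN; apply: lin_mem; rewrite inE.
Qed.

Lemma maximal_prime M : is_maximal M -> is_prime M.
Proof.
case=> hM n1 mM; split=> // x y Mxy; apply: contrapT => /not_orP[nx ny].
have [||e|e] := mM (gen M [:: x]).
- exact: gen_ideal.
- by move=> z; apply: gen_base.
- by apply: nx; rewrite -e; apply: gen_mem; rewrite ?inE.
- have : [set: A] 1 by []; rewrite -e => /gen1P[a ha].
  apply: ny; rewrite (_ : y = (1 - a * x) * y + a * (x * y)); last by ring.
  by apply: idD => //; [apply: idMr | apply: idMl].
Qed.

Lemma maximal_inv M x : is_maximal M -> ~ M x -> exists y, M (1 - y * x).
Proof.
case=> hM n1 mM nx.
have [||e|e] := mM (gen M [:: x]).
- exact: gen_ideal.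
- by move=> z; apply: gen_base.
- by case: nx; rewrite -e; apply: gen_mem; rewrite ?inE.
- by have : [set: A] 1 by []; rewrite -e => /gen1P.
Qed.

Definition rad_sub M I := forall x, M x -> exists k, I (x ^+ k).

Lemma rad_subS M I J : I `<=` J -> rad_sub M I -> rad_sub M J.
Proof. by move=> IJ h x /h[k hk]; exists k; apply: IJ. Qed.

Lemma rad_sub_prime M I P : is_prime P -> I `<=` P -> rad_sub M I -> M `<=` P.
Proof. by move=> pP IP h x /h[k /IP/(primeX pP)]. Qed.

Lemma radD I x y j k : is_ideal I -> I (x ^+ j) -> I (y ^+ k) ->
  I ((x + y) ^+ (j + k)).
Proof.
move=> hI hx hy; rewrite exprDn; apply: id_sum => // i _.
rewrite -mulr_natr; apply: idMr => //; have := ltn_ord i => hi.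
have [le|lt] := leqP k i; first by apply: idMl => //; apply: id_exp hy.
by apply: idMr => //; apply: id_exp hx => //; lia.
Qed.

Lemma radical_ideal I : is_ideal I -> is_ideal (radical I).
Proof.
move=> hI; split=> [|x y [j hx] [k hy]|a x [k hx]].
- by exists 1%N; rewrite expr1; apply: id0.
- by exists (j + k)%N; apply: radD.
- by exists k; rewrite exprMn; apply: idMl.
Qed.

(** Modulo I the element 1 - y x is nilpotent, so x is a unit there. This is what makes denominators
    harmless at a maximal ideal. *)
Lemma rad_cancel M I x v : is_ideal I -> rad_sub M I ->
  (exists y, M (1 - y * x)) -> I (x * v) -> I v.
Proof.
move=> hI MI [y /MI[k hk]] hxv.
have [b eb] : exists b, (1 - y * x) ^+ k = 1 - b * x.
  elim: k {hk} => [|k [b eb]]; first by exists 0; rewrite expr0 mul0r subr0.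
  by exists (b + y - b * y * x); rewrite exprSr eb; ring.
rewrite eb in hk; rewrite (_ : v = (1 - b * x) * v + b * (x * v)); last by ring.
by apply: idD => //; [apply: idMr | apply: idMl].
Qed.

Lemma radical_primary M I : is_maximal M -> is_ideal I -> I `<=` M ->
  rad_sub M I -> primary_to M I.
Proof.
move=> mM hI IM MI; case: (mM) => hM n1 _.
split; last first.
  apply/seteqP; split=> [x [k /IM]|x /MI//].
  exact: primeX (maximal_prime mM).
split=> // [/IM//|x y Ixy]; have [/MI My|nMy] := pselect (M y); [by right|left].
apply: (@rad_cancel M I y) => //; last by rewrite mulrC.
exact: maximal_inv.
Qed.

(** Avoid the multiplicative set of all s x^k with s outside P. Primes strictly below a given one
    are produced in this way in the dimension arguments. *)
Lemma prime_below I P x : noetherian A -> is_ideal I -> is_prime P ->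
  (forall s k, ~ P s -> ~ I (s * x ^+ k)) ->
  exists P', [/\ is_prime P', I `<=` P', P' `<=` P & ~ P' x].
Proof.
move=> noeA hI pP h; case: (pP) => hP n1 hM.
have [|y z [s [k [ns ->]]] [t [l [nt ->]]]|y [s [k [ns ->]]]|P' [pP' IP' hP']] :=
  @prime_avoid_mult A noeA I [set y | exists s k, ~ P s /\ y = s * x ^+ k] hI.
- by exists 1, 0%N; rewrite expr0 mulr1.
- exists (s * t), (k + l)%N; split; first exact: prime_nM.
  by rewrite exprD; ring.
- exact: h.
exists P'; split=> // [y P'y|P'x].
  apply: contrapT => ny; apply: (hP' y) => //.
  by exists y, 0%N; rewrite expr0 mulr1.
by apply: (hP' x) => //; exists 1, 1%N; rewrite expr1 mul1r.
Qed.

End Local.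

(** * Localization at a prime, characterized by its fractions *)

Section Fractions.
Variables (A L : comNzRingType) (lam : {rmorphism A -> L}).
Implicit Types (I J K P Q : set A) (a b s t : A) (y z : L).

(* [lam] exhibits [L] as the localization of [A] at the prime [P] *)
Definition is_frac P := [/\ forall s, ~ P s -> exists y, lam s * y = 1,
  forall y, exists a s, ~ P s /\ y * lam s = lam a &
  forall a, lam a = 0 -> exists s, ~ P s /\ s * a = 0].

Variable P : set A.
Hypotheses (pP : is_prime P) (hf : is_frac P).

Lemma frac_eq a b : lam a = lam b -> exists s, ~ P s /\ s * a = s * b.
Proof.
move=> e; case: hf => _ _ /(_ (a - b)); rewrite rmorphB e subrr => /(_ erefl)[s [ns es]].
by exists s; split=> //; apply/eqP; rewrite -subr_eq0 -mulrBr es.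
Qed.

Lemma frac_cancel s y z : ~ P s -> y * lam s = z * lam s -> y = z.
Proof.
case: hf => hu _ _ /hu[v ev] e.
by rewrite -(mulr1 y) -(mulr1 z) -ev !mulrA e.
Qed.

Definition ext K : set L := [set y | exists a s, [/\ K a, ~ P s & y * lam s = lam a]].

Lemma ext_ideal K : is_ideal K -> is_ideal (ext K).
Proof.
move=> hK; split=> [|y z [a [s [Ka ns ea]]] [b [t [Kb nt eb]]]|z y [a [s [Ka ns ea]]]].
- exists 0, 1; split; [exact: id0|by case: pP|by rewrite rmorph0 mul0r].
- exists (a * t + b * s), (s * t); split; last first.
  + by rewrite rmorphM rmorphD !rmorphM -ea -eb; ring.
  + exact: prime_nM.
  by apply: idD => //; apply: idMr.
- case: hf => _ /(_ z)[b [t [nt eb]]] _; exists (b * a), (t * s); split.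
  + exact: idMl.
  + exact: prime_nM.
  by rewrite !rmorphM -ea -eb; ring.
Qed.

Lemma ext_lamP K a : is_ideal K -> ext K (lam a) <-> exists s, ~ P s /\ K (s * a).
Proof.
move=> hK; split=> [[b [s [Kb ns]]]|[s [ns Ks]]]; last first.
  by exists (s * a), s; split=> //; rewrite -rmorphM mulrC.
rewrite -rmorphM => /frac_eq[t [nt et]]; exists (t * s); split.
  exact: prime_nM.
by rewrite -mulrA (mulrC s) et; apply: idMl.
Qed.

Lemma ext_mem K a : K a -> ext K (lam a).
Proof. by move=> Ka; exists a, 1; rewrite rmorph1 mulr1; case: pP. Qed.

Lemma ext_prime_lam Q a : is_prime Q -> Q `<=` P -> ext Q (lam a) <-> Q a.
Proof.
move=> pQ QP; split=> [/(ext_lamP _ (prime_ideal pQ))[s [ns]]|]; last by move=> Qa; exact: ext_mem.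
by apply: (prime_cancel pQ) => Qs; apply: ns; apply: QP.
Qed.

Lemma ext_frac Q y a s : is_prime Q -> Q `<=` P -> ~ P s -> y * lam s = lam a ->
  ext Q y <-> Q a.
Proof.
move=> pQ QP ns e; have hQ := ext_ideal (prime_ideal pQ).
split=> [hy|Qa]; last by exists a, s.
by apply/(ext_prime_lam _ pQ QP); rewrite -e; apply: idMr.
Qed.

Lemma ext_prime Q : is_prime Q -> Q `<=` P -> is_prime (ext Q).
Proof.
move=> pQ QP; split; first exact: (ext_ideal (prime_ideal pQ)).
  by rewrite -(rmorph1 lam) => /(ext_prime_lam _ pQ QP); case: pQ.
move=> y z; case: hf => _ hs _; have [a [s [ns ea]]] := hs y.
have [b [t [nt eb]]] := hs z.
have e : y * z * lam (s * t) = lam (a * b) by rewrite !rmorphM -ea -eb; ring.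
move=> /(ext_frac pQ QP (prime_nM pP ns nt) e); case: pQ => hQ _ hM /hM[Qa|Qb].
  by left; exists a, s.
by right; exists b, t.
Qed.

Lemma ext_loc_max : loc_max (ext P).
Proof.
have pE : is_prime (ext P) by apply: ext_prime.
case: (pE) => hE n1 _; split=> // y ny.
case: hf => hu /(_ y)[a [s [ns ea]]] _.
have [|b eb] := hu a; first by move=> Pa; apply: ny; exists a, s.
by exists (lam s * b); rewrite mulrA ea.
Qed.

Lemma frac_noetherian : noetherian A -> noetherian L.
Proof.
move=> noeA I hI.
have [|s es] := @noeth_fg A noeA [set a | I (lam a)].
  split=> [|a b ha hb|a b hb] /=; first by rewrite rmorph0; apply: id0.
    by rewrite rmorphD; apply: idD.
  by rewrite rmorphM; apply: idMl.
exists (map lam s); rewrite ideal_genE; apply/seteqP; split=> y.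
  move=> Iy; case: hf => hu /(_ y)[a [t [nt et]]] _.
  have [v ev] := hu _ nt; rewrite -(mulr1 y) -ev mulrA et.
  apply: idMr => //; have : lin s a by apply/(set_eqP es); rewrite /= -et; apply: idMr.
  case/linP=> f ->; apply/linP; exists (fun i => lam (f i)).
  rewrite rmorph_sum size_map; apply: eq_bigr => i _.
  by rewrite rmorphM (nth_map 0).
apply: lin_min => // z /mapP[a sa ->].
by have : lin s a by [exact: lin_mem]; move=> /(set_eqP es).
Qed.

Lemma gen_lam K (s : seq A) a : gen K s a -> gen (ext K) (map lam s) (lam a).
Proof.
case/gen_sumP=> f hf'; apply/gen_sumP; exists (fun i => lam (f i)).
rewrite size_map (_ : _ - _ = lam (a - \sum_(i < size s) f i * s`_i)); last first.
  rewrite rmorphB rmorph_sum; congr (_ - _); apply: eq_bigr => i _.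
  by rewrite rmorphM (nth_map 0).
exact: ext_mem.
Qed.

Lemma gen_frac K (s : seq A) y : is_ideal K ->
  gen (ext K) (map lam s) y <-> ext (gen K s) y.
Proof.
move=> hK; have hKs := gen_ideal s hK.
split; last first.
  move=> [a [t [ha nt e]]]; case: hf => hu _ _; have [v ev] := hu _ nt.
  rewrite -(mulr1 y) -ev mulrA e; apply: idMr; first exact: (gen_ideal _ (ext_ideal hK)).
  exact: gen_lam.
move: y; apply: gen_min; first exact: ext_ideal.
  by move=> y [a [t [Ka nt e]]]; exists a, t; split=> //; apply: gen_base.
by move=> y /mapP[a sa ->]; apply: ext_mem; apply: gen_mem.
Qed.

Lemma gen_lamP K (s : seq A) a : is_ideal K ->
  gen (ext K) (map lam s) (lam a) <-> exists t, ~ P t /\ gen K s (t * a).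
Proof.
by move=> hK; rewrite gen_frac //; apply: ext_lamP; apply: gen_ideal.
Qed.

Lemma ext0 : ext [set 0] = [set 0].
Proof.
apply/seteqP; split=> y; last first.
  by move=> ->; apply: id0; apply: ext_ideal.
by move=> [a [s [-> ns e]]]; apply: (frac_cancel ns); rewrite e rmorph0 mul0r.
Qed.

Lemma lin_lamP (s : seq A) a :
  lin (map lam s) (lam a) <-> exists t, ~ P t /\ lin s (t * a).
Proof. by rewrite /lin -gen_lamP // ext0. Qed.

Lemma frac_chain n c : prime_chain n c -> c n `<=` P ->
  prime_chain n (fun i => ext (c i)).
Proof.
move=> [pc cc] cnP; have ccm i : (i <= n)%N -> c i `<=` P.
  move=> hi; apply: subset_trans cnP.
  have : forall k, (i + k <= n)%N -> c i `<=` c (i + k)%N.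
    elim=> [|k ih] hk; first by rewrite addn0.
    have [|cck _] := cc (i + k)%N; first by lia.
    by rewrite addnS; apply: subset_trans cck; apply: ih; lia.
  by move=> /(_ (n - i)%N); rewrite subnKC //; apply.
split=> [i hi|i hi]; first by apply: ext_prime; [apply: pc | apply: ccm].
have [cci /existsNP[a /not_implyP[ha na]]] := cc i hi.
split; first by move=> y [b [s [cb ns e]]]; exists b, s; split=> //; apply: cci.
move=> /(_ (lam a) (ext_mem ha)) h; apply: na.
apply/(@ext_prime_lam (c i)) => //; first by apply: pc; lia.
by apply: ccm; lia.
Qed.

End Fractions.

Section LocAt.
Variables (A : comNzRingType) (P : set A) (hP : is_prime P).

Definition loc_map (a : A) : loc_at hP :=
  @locfrac A (prime_compl hP) a 1 (prime_compl1 hP).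

Lemma loc_map_zmod : zmod_morphism loc_map.
Proof.
move=> a b; rewrite /loc_map /locfrac.
rewrite [- Localization.frac _ _]Localization.opp_frac [RHS]Localization.add_frac.
by apply: Localization.frac_eq => /=; ring.
Qed.
Lemma loc_map_monoid : monoid_morphism loc_map.
Proof.
split=> [|a b]; first exact: Localization.frac_eq.
by rewrite [RHS]Localization.mul_frac; apply: Localization.frac_eq => /=; ring.
Qed.

HB.instance Definition _ := GRing.isZmodMorphism.Build A (loc_at hP) loc_map loc_map_zmod.
HB.instance Definition _ := GRing.isMonoidMorphism.Build A (loc_at hP) loc_map loc_map_monoid.

Lemma loc_at_frac : is_frac loc_map P.
Proof.
split=> [s ns|y|a].
- exists (Localization.frac 1 (@Localization.mkden _ (prime_compl hP) s ns)).
  by rewrite [LHS]Localization.mul_frac; apply: Localization.frac_eq => /=; ring.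
- have [a [s ->]] := Localization.frac_surj y; exists a, (val s); split.
    exact: (Localization.denP s).
  by rewrite [LHS]Localization.mul_frac; apply: Localization.frac_eq => /=; ring.
- move=> /Localization.fracP[u nu] /=; rewrite mulr1 mul0r mulr0 => e.
  by exists u.
Qed.

End LocAt.

(** * Krull's principal ideal and height theorems *)

Section Nakayama.
Variable A : comNzRingType.
Implicit Types (I J K P Q M : set A) (x y z a c : A).

(** The ideal I + P (gs), as it occurs in the hypothesis of Nakayama's lemma. *)
Fixpoint pgen P I (gs : seq A) : set A :=
  if gs is g :: gs' then [set z | exists2 a, P a & pgen P I gs' (z - a * g)] else I.

Lemma pgen_ideal P I gs : is_ideal P -> is_ideal I -> is_ideal (pgen P I gs).
Proof.
move=> hP hI; elim: gs => [//|x s ih] /=.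
split=> [|y z [a Pa ha] [b Pb hb]|c y [a Pa ha]].
- by exists 0; rewrite ?mul0r ?subr0; apply: id0.
- exists (a + b); first exact: idD.
  rewrite (_ : _ - _ = (y - a * x) + (z - b * x)); last by ring.
  exact: idD.
- by exists (c * a); [exact: idMl | rewrite -mulrA -mulrBr; apply: idMl].
Qed.

Lemma pgen_base P I gs z : is_ideal P -> I z -> pgen P I gs z.
Proof.
move=> hP hI; elim: gs => [//|x s ih] /=.
by exists 0; [exact: id0 | rewrite mul0r subr0].
Qed.

Lemma pgen_mulr P I gs x z : is_ideal P -> is_ideal I -> P x -> gen I gs z ->
  pgen P I gs (x * z).
Proof.
move=> hP hI Px; elim: gs z => [|g gs ih] z /=; first exact: idMl.
move=> [a /ih h]; exists (x * a); first exact: idMr.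
by rewrite -mulrA -mulrBr.
Qed.

(** Nakayama's lemma over the localization at P, with the denominators written out: a relation for g
    has the coefficient s - a, which is outside P, so g can be eliminated from the list. *)
Lemma nakayama P I gs : is_prime P -> is_ideal I ->
  (forall g, g \in gs -> exists s, ~ P s /\ pgen P I gs (s * g)) ->
  forall g, g \in gs -> exists s, ~ P s /\ I (s * g).
Proof.
move=> pP hI; have hP := prime_ideal pP; elim: gs => [//|g gs ih] H.
have [|s [ns [a Pa hg]]] := H g; first by rewrite inE eqxx.
have hGs := pgen_ideal gs hP hI.
have nsa : ~ P (s - a) by move=> h; apply: ns; apply: id_sub h => //; rewrite opprB addrC subrK.
have hg' : pgen P I gs ((s - a) * g) by rewrite mulrBl.
have H' h : h \in gs -> exists s, ~ P s /\ I (s * h).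
  apply: ih => {}h hh; have [|t [nt [b Pb e]]] := H h; first by rewrite inE hh orbT.
  exists ((s - a) * t); split; first exact: prime_nM.
  rewrite (_ : _ * h = (s - a) * (t * h - b * g) + b * ((s - a) * g)); last by ring.
  by apply: idD => //; apply: idMl.
have [S [nS hS]] : exists S, ~ P S /\ forall h, h \in gs -> I (S * h).
  elim: gs {ih H hg hg' hGs} H' => [|h gs ih] H'; first by exists 1; case: pP.
  have [k kgs|S [nS hS]] := ih; first by apply: H'; rewrite inE kgs orbT.
  have [|t [nt ht]] := H' h; first by rewrite inE eqxx.
  exists (S * t); split; first exact: prime_nM.
  move=> k; rewrite inE => /orP[/eqP->|/hS]; first by rewrite -mulrA; apply: idMl.
  by rewrite mulrAC; apply: idMr.
have key z : pgen P I gs z -> I (S * z).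
  elim: gs hS z {ih H hg hg' hGs H'} => [|h gs ih] hS z /=; first exact: idMl.
  move=> [b Pb hz]; rewrite (_ : S * z = S * (z - b * h) + b * (S * h)); last by ring.
  apply: idD => //; last by apply: idMl => //; apply: hS; rewrite inE eqxx.
  by apply: ih hz => k kgs; apply: hS; rewrite inE kgs orbT.
move=> k; rewrite inE => /orP[/eqP->|/H' //].
by exists (S * (s - a)); split; [exact: prime_nM | rewrite -mulrA; apply: key].
Qed.

Hypothesis noeA : noetherian A.

Lemma local_nakayama M I K x : loc_max M -> is_ideal I -> is_ideal K -> M x ->
  (forall k, K k -> exists2 k', K k' & I (k - x * k')) -> K `<=` I.
Proof.
move=> lM hI hK Mx h; have pM := loc_max_prime lM; have hM := prime_ideal pM.
have [gs eK] := noeth_fg noeA hK; rewrite eK.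
apply: lin_min => // g gs_g.
have [|s [ns Isg]] := @nakayama M I gs pM hI _ g gs_g.
  move=> k kgs; exists 1; split; first by case: pM.
  have [|k' Kk' hk'] := h k; first by apply/(set_eqP eK); apply: lin_mem.
  rewrite mul1r -(subrK (x * k') k); apply: idD; first exact: pgen_ideal.
    exact: pgen_base.
  by apply: pgen_mulr => //; apply: lin_sub_gen => //; apply/(set_eqP eK).
case: lM => _ _ /(_ _ ns)[v ev].
by rewrite -(mul1r g) -ev mulrAC; apply: idMr.
Qed.

(* Since [M] is in the radical of [I0], enlarging an ideal [K] by one element [g] with
   [M g] in [K] at a time reaches the unit ideal. *)
Lemma local_dcc M I0 (F : nat -> set A) : loc_max M -> is_ideal I0 -> rad_sub M I0 ->
  (forall n, is_ideal (F n)) -> (forall n, I0 `<=` F n) ->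
  (forall n, F n.+1 `<=` F n) -> exists n, F n `<=` F n.+1.
Proof.
move=> lM hI0 rM hF IF dF.
have dFm m n : (m <= n)%N -> F n `<=` F m.
  move=> /subnK <-; elim: (n - m)%N => [|k ih]; first by rewrite add0n.
  by apply: subset_trans (dF _) ih.
pose st (K : set A) := exists n, forall m, (n <= m)%N -> F n `&` K `<=` F m.
suff [n hn] : st setT.
  by exists n => x Fx; apply: (hn n.+1) => //; split.
have [||K [[hK IK stK] _ mK]] := @max_ideal A noeA
    [set K | [/\ is_ideal K, I0 `<=` K & st K]] I0.
- split=> //; exists 0%N => m _ x [_ Ix]; exact: IF.
- by move=> K [].
have [K1|nK1] := pselect (K 1).
  by have <- : K = setT by apply/seteqP; split=> // x _; apply: ideal1.
have [g [ng [pg _]]] := assoc_over noeA hK nK1.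
have Mg : M `<=` colon K g.
  apply: rad_sub_prime pg _ rM => x Ix; apply: idMr => //; exact: IK.
case: ng; apply: (mK (gen K [:: g])); last by apply: gen_mem; rewrite ?inE.
  split; [exact: gen_ideal | by move=> x /IK; apply: gen_base|].
  have [[n hn]|/forallNP H] := pselect (exists n, F n `&` gen K [:: g] `<=` K).
    case: stK => k hk; exists (maxn n k) => m hm x [Fx Gx].
    have Kx : K x by apply: hn; split=> //; apply: dFm Fx; exact: leq_maxl.
    have hkm : (k <= m)%N by apply: leq_trans hm; exact: leq_maxr.
    by apply: (hk m hkm); split=> //; apply: dFm Fx; exact: leq_maxr.
  case: stK => k hk; exists k => m hm x [Fx Gx].
  have /existsNP[e /not_implyP[[Fe Ge] nKe]] := H m.
  have /gen1P[a ha] := Ge.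
  have na : ~ M a.
    by move=> /Mg Ka; apply: nKe; apply: id_sub ha.
  case: (lM) => _ _ /(_ _ na)[v ev].
  have /gen1P[b hb] := Gx.
  have Kd : K (x - b * v * e).
    rewrite (_ : x - _ = (x - b * g) - b * v * (e - a * g)  + b * (1 - a * v) * g); last by ring.
    rewrite ev subrr mulr0 mul0r addr0; apply: idB => //; exact: idMl.
  have Fbe : F m (b * v * e) by apply: idMl.
  apply: (id_sub (hF m) Fbe); apply: (hk m hm); split=> //; apply: idB => //.
  exact: dFm Fbe.
by move=> x; apply: gen_base.
Qed.

End Nakayama.

Section Krull.

Lemma ideal_pow_prime (A : comNzRingType) (P : set A) n x : P x -> ideal_pow P n (x ^+ n).
Proof.
move=> Px; elim: n => [//|n ih] /=.
by apply: ideal_gen_mem; exists x, (x ^+ n); split=> //; rewrite exprS.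
Qed.

(** Krull's argument with the symbolic powers S n of P' modulo P. They stabilize modulo u by
    [local_dcc]; as u is outside P', Nakayama's lemma makes S n = S (n+1), and a second use of it at
    P' puts P'^n inside P. *)
Lemma local_pit (A : comNzRingType) (M P P' : set A) (u : A) : noetherian A ->
  loc_max M -> is_prime P -> is_prime P' -> P `<=` P' -> ~ P' `<=` P ->
  ~ P' u -> M u -> rad_sub M (gen P [:: u]) -> False.
Proof.
move=> noeA lM pP pP' PP' nP'P nu Mu rM.
have hP := prime_ideal pP; have hP' := prime_ideal pP'.
pose S n := [set x | exists2 s, ~ P' s & exists2 v, ideal_pow P' n v & P (s * x - v)].
have hS n : is_ideal (S n).
  split=> [|x y [s ns [v hv ev]] [t nt [w hw ew]]|a x [s ns [v hv ev]]].
  - exists 1; first by case: pP'.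
    exists 0; first by apply: id0; apply: ideal_pow_ideal.
    by rewrite mulr0 subr0; apply: id0.
  - exists (s * t); first exact: prime_nM.
    exists (t * v + s * w).
      by apply: idD; [exact: ideal_pow_ideal| |]; apply: idMl => //; exact: ideal_pow_ideal.
    rewrite (_ : _ - _ = t * (s * x - v) + s * (t * y - w)); last by ring.
    by apply: idD => //; apply: idMl.
  - exists s => //; exists (a * v); first by apply: idMl => //; exact: ideal_pow_ideal.
    by rewrite mulrCA -mulrBr; apply: idMl.
have SS n : S n.+1 `<=` S n.
  move=> x [s ns [v hv ev]]; exists s => //; exists v => //.
  by apply: ideal_powS hv.
have PS n : P `<=` S n.
  move=> x Px; exists 1; first by case: pP'.
  exists 0; first by apply: id0; apply: ideal_pow_ideal.
  by rewrite mul1r subr0.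
have [|||||n hn] := @local_dcc A noeA M (gen P [:: u]) (fun n => gen (S n) [:: u]) lM.
- exact: gen_ideal.
- exact: rM.
- by move=> n; apply: gen_ideal.
- by move=> n; apply: gen_mono.
- by move=> n; apply: gen_mono.
have Sn : S n `<=` S n.+1.
  apply: (local_nakayama noeA lM (hS _) (hS _) Mu) => x Sx.
  have /gen1P[a ha] : gen (S n.+1) [:: u] x by apply: hn; apply: gen_base.
  exists a; last by rewrite mulrC.
  have [s ns [v hv ev]] : S n (a * u).
    by rewrite -(subKr x (a * u)); apply: idB => //; apply: SS.
  exists (s * u); first exact: prime_nM.
  by exists v => //; rewrite -mulrA (mulrC u).
have [gs egs] := noeth_fg noeA (ideal_pow_ideal P' n).
have gsP g : g \in gs -> P g.
  move=> gsg.
  have [|s [ns]] := @nakayama A P' P gs pP' hP _ g gsg; last by apply: (prime_cancel pP) => /PP'.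
  move=> k kgs; have [s ns [v hv ev]] : S n.+1 k.
    apply: Sn; exists 1; first by case: pP'.
    exists k; first by apply/(set_eqP egs); apply: lin_mem.
    by rewrite mul1r subrr; apply: id0.
  exists s; split=> //; apply: (id_sub (pgen_ideal gs hP' hP) (pgen_base gs hP' ev)).
  rewrite opprB addrC subrK.
  move: v hv {ev}; apply: ideal_gen_min; first exact: pgen_ideal.
  move=> _ [x [y [P'x Py ->]]]; apply: pgen_mulr => //.
  by apply: lin_sub_gen => //; apply/(set_eqP egs).
have powP : ideal_pow P' n `<=` P by rewrite egs; apply: lin_min.
by apply: nP'P => x P'x; apply: (primeX (n := n)) => //; apply: powP; apply: ideal_pow_prime.
Qed.

(** If no such prime exists, every element of Q is nilpotent modulo P + (u) after localizing at Q,
    which contradicts the principal ideal theorem in that local ring. *)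
Lemma prime_between (A : comNzRingType) (P P' Q : set A) (u : A) : noetherian A ->
  is_prime P -> is_prime P' -> is_prime Q -> P `<` P' -> P' `<` Q -> Q u ->
  exists P1, [/\ is_prime P1, P `<` P1, P1 `<` Q & P1 u].
Proof.
move=> noeA pP pP' pQ lt1 lt2 Qu.
have [P'u|nu] := pselect (P' u); first by exists P'.
have [PP' nP'P] := lt1; have [P'Q nQP'] := lt2.
have nPu : ~ P u by move=> /PP'.
have hP := prime_ideal pP.
have [[x [Qx hx]]|H] := pselect (exists x, Q x /\
    forall s k, ~ Q s -> ~ gen P [:: u] (s * x ^+ k)).
  have [|P1 [pP1 IP1 P1Q nx]] := @prime_below A (gen P [:: u]) Q x noeA _ pQ hx.
    exact: gen_ideal.
  have P1u : P1 u by apply: IP1; apply: gen_mem; rewrite ?inE.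
  exists P1; split=> //; split=> //.
  - by move=> y Py; apply: IP1; apply: gen_base.
  - by move=> /(_ _ P1u).
  - by move=> /(_ _ Qx).
exfalso; have hf := loc_at_frac pQ; set lam := loc_map pQ in hf.
have PQ : P `<=` Q by apply: subset_trans P'Q.
apply: (@local_pit _ (ext lam Q Q) (ext lam Q P) (ext lam Q P') (lam u)).
- exact: frac_noetherian hf _.
- exact: ext_loc_max.
- exact: ext_prime.
- exact: ext_prime.
- by move=> y [a [s [Pa ns e]]]; exists a, s; split=> //; apply: PP'.
- move=> h; apply: nP'P => a P'a; apply/(ext_prime_lam pQ hf _ pP PQ).
  by apply: h; apply: ext_mem.
- by move=> /(ext_prime_lam pQ hf _ pP' P'Q).
- exact: ext_mem.
- move=> y [a [s [Qa ns e]]].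
  have [t [k [nt ht]]] : exists t k, ~ Q t /\ gen P [:: u] (t * a ^+ k).
    apply: contrapT => H'; apply: H; exists a; split=> // t k nt ht.
    by apply: H'; exists t, k.
  exists k; apply/(@gen_frac _ _ _ _ pQ hf P [:: u]) => //.
  exists (t * a ^+ k), (t * s ^+ k); split=> //.
    by apply: prime_nM => //; apply: prime_nX.
  by rewrite !rmorphM !rmorphXn -e exprMn; ring.
Qed.

Section Chains.
Variable A : comNzRingType.
Implicit Types (P Q M I : set A) (c : nat -> set A).

Definition chain_cons P c i := if i is i'.+1 then c i' else P.

Lemma prime_chain_cons P c n : is_prime P -> P `<` c 0%N -> prime_chain n c ->
  prime_chain n.+1 (chain_cons P c).
Proof. by move=> pP lt [pc cc]; split=> [[|i]|[|i]] //= hi; [apply: pc | apply: cc]. Qed.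

Lemma prime_chain_behead c n : prime_chain n.+1 c -> prime_chain n (fun i => c i.+1).
Proof. by move=> [pc cc]; split=> i hi; [apply: pc | apply: cc]. Qed.

Lemma prime_chain_rcons P c n : is_prime P -> c n `<` P -> prime_chain n c ->
  prime_chain n.+1 (fun i => if (i <= n)%N then c i else P).
Proof.
move=> pP lt [pc cc]; split=> i hi.
  by case: ifP => // h; apply: pc.
case: (leqP i.+1 n) => h; first by rewrite (ltnW h) ; apply: cc.
by have -> : i = n by [lia]; rewrite leqnn.
Qed.

Lemma prime_chain_take c n k : (k <= n)%N -> prime_chain n c -> prime_chain k c.
Proof.
by move=> hk [pc cc]; split=> i hi; [apply: pc | apply: cc]; apply: leq_trans hk.
Qed.

Lemma prime_chain_sub c n i j : prime_chain n c -> (i <= j)%N -> (j <= n)%N ->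
  c i `<=` c j.
Proof.
move=> [pc cc] /subnK <-; elim: (j - i)%N => [|k ih] hk; first by rewrite add0n.
have [|cck _] := cc (k + i)%N; first by lia.
by rewrite addSn; apply: subset_trans cck; apply: ih; lia.
Qed.

Lemma krull_dim_uniq n k : krull_dim A n -> krull_dim A k -> n = k.
Proof.
have le j l : krull_dim_ge A j -> ~ krull_dim_ge A l.+1 -> (j <= l)%N.
  move=> [c hc] nl; rewrite leqNgt; apply/negP => lt; apply: nl.
  by exists c; apply: prime_chain_take hc.
by move=> [h1 h2] [h3 h4]; apply/eqP; rewrite eqn_leq !le.
Qed.

Hypothesis noeA : noetherian A.

(** [prime_between] replaces the members of the chain from the top downwards, so that membership of
    u descends while both ends stay fixed. *)
Lemma prime_chain_through c n (u : A) : prime_chain n.+1 c -> c n.+1 u ->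
  exists c', [/\ prime_chain n.+1 c', c' 0%N = c 0%N, c' n.+1 = c n.+1 & c' 1%N u].
Proof.
elim: n c => [|n ih] c hc cu; first by exists c.
have [pc cc] := hc.
have [||||||P1 [pP1 lt1 lt2 P1u]] := @prime_between A (c n) (c n.+1) (c n.+2) u noeA => //.
- by apply: pc; lia.
- by apply: pc; lia.
- by apply: pc; lia.
- by apply: cc; lia.
- by apply: cc; lia.
have hc1 := prime_chain_rcons pP1 lt1 (prime_chain_take (leq_trans (leqnSn n) (leqnSn _)) hc).
have [|c' [hc' e0 e1 c'u]] := ih _ hc1; first by rewrite ltnn.
have lt : c' n.+1 `<` c n.+2 by rewrite e1 ltnn.
exists (fun i => if (i <= n.+1)%N then c' i else c n.+2); split.
- by apply: prime_chain_rcons => //; apply: pc.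
- exact: e0.
- by rewrite ltnn.
- exact: c'u.
Qed.

(** Replace the top of the chain by M, let the chain pass through the first generator u, and drop
    its bottom: the remaining chain starts above I + (u), and one generator has been used for one
    step. *)
Lemma krull_height M I s c n : loc_max M -> is_ideal I -> (forall x, x \in s -> M x) ->
  rad_sub M (gen I s) -> prime_chain n c -> I `<=` c 0%N -> (n <= size s)%N.
Proof.
move=> lM; elim: s I c n => [|u s ih] I c n hI hs rM hc Ic.
  case: n hc => [//|n] hc; have [pc cc] := hc.
  have M0 : M `<=` c 0%N by apply: rad_sub_prime rM => //; apply: pc.
  have [_ n10] := cc 0%N isT; exfalso; apply: n10.
  apply: subset_trans M0; apply: loc_max_sub lM _ _; have := pc 1%N isT.
    exact: prime_ideal.
  by case.
case: n hc => [//|n] hc; have [pc cc] := hc.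
have pM := loc_max_prime lM.
have subM i : (i <= n.+1)%N -> c i `<=` M.
  move=> /pc pi; apply: loc_max_sub lM _ _; first exact: prime_ideal.
  by case: pi.
have ltM : c n `<` M.
  have [s1 n1] := cc n (leqnn _); split; first by apply: subM.
  by move=> h; apply: n1; apply: subset_trans h; apply: subM.
have hcM := prime_chain_rcons pM ltM (prime_chain_take (leqnSn n) hc).
have Mu : M u by apply: hs; rewrite inE eqxx.
have [|c' [hc' e0 e1 c'u]] := prime_chain_through (u := u) hcM; first by rewrite ltnn.
rewrite /= ltnS; apply: (ih (c' 1%N)) (prime_chain_behead hc') _ => //.
- by apply: prime_ideal; have [h _] := hc'; apply: h.
- by move=> x xs; apply: hs; rewrite inE xs orbT.
have hc1 : is_ideal (c' 1%N) by apply: prime_ideal; have [h _] := hc'; apply: h.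
apply: rad_subS rM; apply: gen_sub => //.
  move=> x Ix; apply: gen_base => //.
  by apply: (prime_chain_sub (i := 0%N) hc') => //; apply/(set_eqP e0); apply: Ic.
move=> x; rewrite inE => /orP[/eqP->|xs]; first exact: gen_base.
exact: gen_mem.
Qed.

End Chains.
End Krull.

(** * Regular sequences and Cohen-Macaulay local rings *)

Section Regular.
Variable A : comNzRingType.
Implicit Types (I J K P Q M : set A) (x y a u : A) (s t v : seq A).

Fixpoint reg I s : Prop :=
  if s is x :: s' then nzd I x /\ reg (gen I [:: x]) s' else True.

Lemma reg_cat I s t : is_ideal I -> reg I (s ++ t) <-> reg I s /\ reg (gen I s) t.
Proof.
move=> hI; elim: s I hI => [|x s ih] I hI /=; first by split=> [|[]].
have hx := gen_ideal [:: x] hI; rewrite (gen_cons x s hI).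
split=> [[nx /(ih _ hx)[]]|[[nx h1] h2]] //.
by split=> //; apply/(ih _ hx).
Qed.

Lemma reg_rcons I s x : is_ideal I -> reg I (rcons s x) <-> reg I s /\ nzd (gen I s) x.
Proof.
by move=> hI; rewrite -cats1 reg_cat //=; split=> [[? []]|[]].
Qed.

Definition all_in s M := forall x, x \in s -> M x.

Lemma all_in_cons x s M : all_in (x :: s) M <-> M x /\ all_in s M.
Proof.
split=> [h|[Mx h] y]; last by rewrite inE => /orP[/eqP->|/h].
by split=> [|y ys]; apply: h; rewrite inE ?eqxx // ys orbT.
Qed.
Lemma all_in_cat s t M : all_in (s ++ t) M <-> all_in s M /\ all_in t M.
Proof.
split=> [h|[h1 h2] y]; last by rewrite mem_cat => /orP[/h1|/h2].
by split=> y ys; apply: h; rewrite mem_cat ys ?orbT.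
Qed.
Lemma all_in_rcons x s M : all_in (rcons s x) M <-> M x /\ all_in s M.
Proof. by rewrite -cats1 all_in_cat all_in_cons; split=> [[? []]|[]]. Qed.

Hypothesis noeA : noetherian A.

Lemma nzd_assoc I x : is_ideal I -> (forall P, assoc I P -> ~ P x) -> nzd I x.
Proof.
by move=> hI h y hxy; apply: contrapT => /(assoc_zd noeA hI hxy)[P /h].
Qed.

(** The last element x is regular modulo the earlier ones, so below P there is a prime over these
    that omits x; each regular element thus contributes one step. *)
Lemma reg_chain_below I s P : is_ideal I -> reg I s -> is_prime P -> gen I s `<=` P ->
  exists c, [/\ prime_chain (size s) c, c (size s) = P & I `<=` c 0%N].
Proof.
move=> hI; elim/last_ind: s P => [|s x ih] P.
  by move=> _ pP IP; exists (fun=> P); split.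
move=> /reg_rcons[] // rs nx pP sP.
have hs := gen_ideal s hI.
have [|P' [pP' sP' P'P nP'x]] := @prime_below A (gen I s) P x noeA hs pP.
  move=> t k nt; rewrite mulrC => /(nzdX (n := k) nx) ht; apply: nt; apply: sP.
  by rewrite gen_rcons //; apply: gen_base.
have [c [hc ec Ic]] := ih _ rs pP' sP'.
have lt : c (size s) `<` P.
  rewrite ec; split=> // /(_ x); apply: contra_not nP'x; apply.
  by apply: sP; apply: gen_mem; rewrite ?mem_rcons ?inE ?eqxx.
rewrite size_rcons; exists (fun i => if (i <= size s)%N then c i else P); split.
- exact: prime_chain_rcons.
- by rewrite ltnn.
- exact: Ic.
Qed.

(** The elements u with P u inside I are not all in I + (x): otherwise Nakayama's lemma would put
    them in I. For u outside I + (x), the ideal (I + (x) : u) contains P and x, so an associated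
    prime of I + (x) lies strictly above P, and the induction continues from there. *)
Lemma reg_chain_above M I v P : loc_max M -> is_ideal I -> reg I v -> all_in v M ->
  assoc I P -> exists c, prime_chain (size v) c /\ c 0%N = P.
Proof.
move=> lM; elim: v I P => [|x v ih] I P hI.
  by move=> _ _ [pP _]; exists (fun=> P); split=> //; split.
move=> [nx rv] /all_in_cons[Mx Mv] [pP [g eP]].
have ng := assoc_notin hI pP eP.
pose U : set A := [set u | forall p, P p -> I (p * u)].
have hU : is_ideal U.
  split=> [p _|y z hy hz p Pp|a y hy p Pp].
  - by rewrite mulr0; apply: id0.
  - by rewrite mulrDr; apply: idD => //; [apply: hy|apply: hz].
  - by rewrite mulrCA; apply: idMl => //; apply: hy.
have Ug : U g by move=> p; rewrite eP.
have [u [Uu nu]] : exists u, U u /\ ~ gen I [:: x] u.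
  apply: contrapT => H; apply: ng.
  apply: (local_nakayama noeA lM hI hU Mx) Ug => k Uk.
  have /gen1P[a ha] : gen I [:: x] k.
    by apply: contrapT => nk; apply: H; exists k.
  exists a; last by rewrite mulrC.
  move=> p Pp; apply: nx; rewrite (_ : x * _ = p * k - p * (k - a * x)); last by ring.
  by apply: idB => //; [apply: Uk | apply: idMl].
have hIx := gen_ideal [:: x] hI.
have [h [nh [ph uh]]] := assoc_over noeA hIx nu.
have P'x : colon (gen I [:: x]) h x.
  by apply: idMr => //; apply: gen_mem; rewrite ?inE.
have [|c [hc ec]] := ih _ (colon (gen I [:: x]) h) hIx rv Mv.
  by split=> //; exists h.
have lt : P `<` c 0%N.
  rewrite ec; split=> [p Pp|/(_ x P'x)].
    by apply: uh; apply: gen_base => //; apply: Uu.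
  by rewrite eP => /nx.
by exists (chain_cons P c); split=> //; apply: prime_chain_cons.
Qed.

(* Two nonzerodivisors of a local ring have the same depth behind them: a socle
   element modulo [u] yields one modulo [w]. *)
Lemma socle_transfer M I u w : is_ideal I -> nzd I u -> nzd I w -> M w ->
  (exists2 g, ~ gen I [:: u] g & forall y, M y -> gen I [:: u] (y * g)) ->
  exists2 g, ~ gen I [:: w] g & forall y, M y -> gen I [:: w] (y * g).
Proof.
move=> hI nu nw Mw [s ns hs].
have /gen1P[s' hs'] := hs _ Mw.
exists s' => [/gen1P[r hr]|y My].
  apply: ns; apply/gen1P; exists r; apply: nw.
  rewrite (_ : _ * _ = (w * s - s' * u) + (s' - r * w) * u); last by ring.
  by apply: idD => //; apply: idMr.
have /gen1P[m' hm'] := hs _ My.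
apply/gen1P; exists m'; apply: nu.
rewrite (_ : _ * _ = w * (y * s - m' * u) - y * (w * s - s' * u)); last by ring.
by apply: idB => //; apply: idMl.
Qed.

Lemma nzd_swap M I x y : loc_max M -> is_ideal I -> M x -> nzd I x ->
  nzd (gen I [:: x]) y -> nzd I y /\ nzd (gen I [:: y]) x.
Proof.
move=> lM hI Mx nx ny.
have nyI : nzd I y.
  have hK : is_ideal (colon I y) by apply: colon_ideal.
  suff H : colon I y `<=` I by move=> z hz; apply: H; rewrite /colon /= mulrC.
  apply: (local_nakayama noeA lM hI hK Mx) => k; rewrite /colon /= => hk.
  have /gen1P[b hb] : gen I [:: x] k.
    by apply: ny; apply: gen_base => //; rewrite mulrC.
  exists b; last by rewrite mulrC.
  apply: nx; rewrite (_ : x * _ = k * y - (k - b * x) * y); last by ring.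
  by apply: idB => //; apply: idMr.
split=> // z /gen1P[b hb].
have /gen1P[c hc] : gen I [:: x] b.
  apply: ny; apply/gen1P; exists z.
  by rewrite -opprB; apply: idN => //; rewrite (mulrC y) (mulrC z).
apply/gen1P; exists c; apply: nx.
rewrite (_ : _ * _ = (x * z - b * y) + (b - c * x) * y); last by ring.
by apply: idD => //; apply: idMr.
Qed.

Lemma nzd_coset Q y (Is : seq (set A)) : is_ideal Q ->
  (forall I, List.In I Is -> is_ideal I /\ forall P, assoc I P -> ~ (P y /\ Q `<=` P)) ->
  exists2 b, Q b & forall I, List.In I Is -> nzd I (y + b).
Proof.
move=> hQ H.
have [n [F [pF hF]]] : exists n (F : nat -> set A),
    (forall i, (i < n)%N -> is_prime (F i) /\ ~ (F i y /\ Q `<=` F i)) /\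
    (forall I, List.In I Is -> forall P, assoc I P -> exists2 i, (i < n)%N & P = F i).
  elim: Is H => [|I Is ih] H; first by exists 0%N, (fun=> set0); split.
  have [|n [F [pF hF]]] := ih; first by move=> J hJ; apply: H; right.
  have [hI nI] := H I (or_introl erefl).
  have [k [G hG]] := assoc_finite noeA hI.
  exists (n + k)%N, (fun i => if (i < n)%N then F i else G (i - n)%N); split.
    move=> i hi; case: ltnP => h; first exact: pF.
    have aG : assoc I (G (i - n)%N) by apply/hG; exists (i - n)%N => //; lia.
    by split; [case: aG | apply: nI].
  move=> J [<-|hJ] P aP.
    have /hG[i hi ->] := aP; exists (n + i)%N; first by lia.
    by rewrite ltnNge leq_addr /= addnC addnK.
  by have [i hi ->] := hF J hJ P aP; exists i; [lia | rewrite hi].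
have [||b Qb hb] := @coset_avoid A n F y Q hQ.
- by move=> i /pF[].
- by move=> i /pF[].
exists b => // I hI; apply: nzd_assoc; first by have [] := H I hI.
by move=> P aP; have [i hi ->] := hF I hI P aP; apply: hb.
Qed.

Lemma nzd_common M (Is : seq (set A)) : is_ideal M ->
  (forall I, List.In I Is -> is_ideal I /\
     ~ exists2 g, ~ I g & forall y, M y -> I (y * g)) ->
  exists2 u, M u & forall I, List.In I Is -> nzd I u.
Proof.
move=> hM H; have [|b Mb hb] := @nzd_coset M 0 Is hM; last first.
  by exists b => // I /hb; rewrite add0r.
move=> I /H[hI nI]; split=> // P [pP [g eP]] [_ MP]; apply: nI.
by exists g; [exact: assoc_notin eP | move=> y /MP; rewrite eP].
Qed.

Lemma nzd_no_socle M I x : is_ideal I -> M x -> nzd I x ->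
  ~ exists2 g, ~ I g & forall y, M y -> I (y * g).
Proof. by move=> hI Mx nx [g ng h]; apply: ng; apply: nx; apply: h. Qed.

(** Choose w regular both modulo the first element v1 and modulo u. By induction modulo v1 the rest
    may start with w; after swapping w to the front, induction modulo w replaces v1 by u. *)
Lemma reg_exchange M I v u : loc_max M -> is_ideal I -> reg I v -> all_in v M ->
  M u -> nzd I u -> (0 < size v)%N ->
  exists v', [/\ (size v').+1 = size v, all_in v' M & reg I (u :: v')].
Proof.
move=> lM.
have [n] := ubnP (size v); elim: n v I u => [//|n ih] v I u /ltnSE sv hI rv Mv Mu nu v0.
case: v sv rv Mv v0 => [//|v1 [|v2 v]] sv; first by exists [::].
move=> [n1 [n2 rv]] /all_in_cons[M1 /all_in_cons[M2 Mv]] _.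
have h1 := gen_ideal [:: v1] hI; have hu := gen_ideal [:: u] hI.
have s1 := nzd_no_socle h1 M2 n2.
have su : ~ exists2 g, ~ gen I [:: u] g & forall y, M y -> gen I [:: u] (y * g).
  by move=> h; apply: s1; apply: socle_transfer h.
have [||w Mw hw] := @nzd_common M [:: gen I [:: v1]; gen I [:: u]].
- by case: lM.
- by move=> J [<-|[<-|[]]].
have nw1 : nzd (gen I [:: v1]) w by apply: hw; left.
have nwu : nzd (gen I [:: u]) w by apply: hw; right; left.
have Mv2 : all_in (v2 :: v) M by apply/all_in_cons.
have [v' [sv' Mv' [_ rv']]] := ih (v2 :: v) _ w sv h1 (conj n2 rv) Mv2 Mw nw1 isT.
have [nw nw1'] := nzd_swap lM hI M1 n1 nw1.
have [_ nwu'] := nzd_swap lM hI Mu nu nwu.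
have hw' := gen_ideal [:: w] hI.
have e x y : gen (gen I [:: x]) [:: y] = gen (gen I [:: y]) [:: x] by rewrite -gen_catC // gen_cat.
have Mv1 : all_in (v1 :: v') M by apply/all_in_cons.
have sv1 : (size (v1 :: v') < n)%N by move: sv' sv => /=; lia.
have rv1 : reg (gen I [:: w]) (v1 :: v') by split=> //; rewrite e.
have [v'' [sv'' Mv'' [_ rv'']]] := ih _ _ u sv1 hw' rv1 Mv1 Mu nwu' isT.
exists (w :: v''); split.
- by move: sv' sv'' sv => /=; lia.
- by apply/all_in_cons.
- by split=> //; split=> //; rewrite e.
Qed.

(** An associated prime P of I has a chain of length [size v] above it, by [reg_chain_above]. If the
    first parameter were in P, the remaining ones would bound such chains by a smaller number. *)
Lemma sop_reg M I v s : loc_max M -> is_ideal I -> reg I v -> all_in v M ->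
  size v = size s -> all_in s M -> rad_sub M (gen I s) -> reg I s.
Proof.
move=> lM; elim: s I v => [//|x s ih] I v hI rv Mv sv /all_in_cons[Mx Ms] rM.
have nx : nzd I x.
  apply: nzd_assoc => // P aP Px; have [pP _] := aP.
  have [c [hc ec]] := reg_chain_above lM hI rv Mv aP.
  have hP := prime_ideal pP.
  have : (size v <= size s)%N.
    apply: (krull_height noeA lM hP Ms _ hc); last by rewrite ec.
    apply: rad_subS rM; apply: gen_sub => //.
      by move=> y /(assoc_sub hI aP); apply: gen_base.
    move=> y; rewrite inE => /orP[/eqP->|]; first exact: gen_base.
    exact: gen_mem.
  by rewrite sv ltnn.
have [|v' [sv' Mv' [_ rv']]] := reg_exchange lM hI rv Mv Mx nx; first by rewrite sv.
split=> //; apply: (ih _ v') => //; first exact: gen_ideal.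
  by move: sv sv' => /=; lia.
by rewrite -gen_cons.
Qed.

(** Otherwise some prime over (s) is strictly smaller than M, and the chain that the regular
    sequence provides below it becomes too long once M is added. *)
Lemma reg_primary_dim M n s : loc_max M ->
  (forall k (c : nat -> set A), prime_chain k c -> (k <= n)%N) ->
  size s = n -> all_in s M -> reg [set 0] s -> rad_sub M (lin s).
Proof.
move=> lM dim ss Ms rs x Mx; apply: contrapT => /forallNP H.
have pM := loc_max_prime lM.
have sM : lin s `<=` M by apply: lin_min => //; exact: prime_ideal.
have [|P [pP sP PM nx]] := @prime_below A (lin s) M x noeA (lin_ideal _) pM.
  move=> t k nt ht; apply: (H k).
  have [_ _ /(_ _ nt)[y ey]] := lM.
  by rewrite -(mul1r (x ^+ k)) -ey mulrAC; apply: idMr.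
have [c [hc ec _]] := reg_chain_below (is_ideal0 _) rs pP sP.
have lt : c (size s) `<` M by rewrite ec; split=> // /(_ x Mx).
by have := dim _ _ (prime_chain_rcons pM lt hc); rewrite ss ltnn.
Qed.

(** The Cohen-Macaulay property of a local ring of dimension n, witnessed by a single sequence that
    is both regular and a system of parameters. *)
Definition cm_loc M n := exists v, [/\ size v = n, all_in v M, reg [set 0] v
  & rad_sub M (lin v)].

Lemma reg_extend M I v z : loc_max M -> is_ideal I -> reg I v -> all_in v M ->
  reg I z -> all_in z M -> (size z <= size v)%N ->
  exists v', [/\ (size z + size v')%N = size v, all_in v' M & reg (gen I z) v'].
Proof.
move=> lM; elim: z I v => [|x z ih] I v hI rv Mv; first by exists v.
move=> [nx rz] /all_in_cons[Mx Mz] hz.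
have [|v' [sv' Mv' [_ rv']]] := reg_exchange lM hI rv Mv Mx nx; first by case: v hz {rv Mv}.
have [|v'' [sv'' Mv'' rv'']] := ih _ v' (gen_ideal [:: x] hI) rv' Mv' rz Mz.
  by move: hz sv' => /=; lia.
exists v''; rewrite gen_cons //; split=> //.
by move: sv' sv'' => /=; lia.
Qed.

(** * Unmixedness and grade in a Cohen-Macaulay local ring *)

Section CohenMacaulay.
Variables (M : set A) (n : nat).
Hypotheses (lM : loc_max M) (cm : cm_loc M n).

Lemma cm_chain (c : nat -> set A) k : prime_chain k c -> (k <= n)%N.
Proof.
have [v [sv Mv rv rM]] := cm => hc.
rewrite -sv; apply: (krull_height noeA lM _ Mv rM hc) => //.
by move=> _ ->; apply: id0; apply: prime_ideal; have [h _] := hc; apply: h.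
Qed.

Lemma cm_sop_reg s : size s = n -> all_in s M -> rad_sub M (lin s) -> reg [set 0] s.
Proof. by have [v [sv Mv rv rM]] := cm => ss; apply: (sop_reg lM _ rv) => //; rewrite sv. Qed.

Lemma reg_primary s : size s = n -> all_in s M -> reg [set 0] s -> rad_sub M (lin s).
Proof. by apply: reg_primary_dim => // k c; apply: cm_chain. Qed.

Lemma cm_reg_size z : all_in z M -> reg [set 0] z -> (size z <= n)%N.
Proof.
move=> Mz rz; have pM := loc_max_prime lM.
have zM : gen [set 0] z `<=` M by apply: lin_min => //; exact: prime_ideal.
by have [c [hc _ _]] := reg_chain_below (is_ideal0 _) rz pM zM; apply: cm_chain hc.
Qed.

Lemma cm_reg_extend z : all_in z M -> reg [set 0] z ->
  exists v, [/\ (size z + size v)%N = n, all_in v M & reg (lin z) v].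
Proof.
move=> Mz rz; have hz := cm_reg_size Mz rz; have [v [sv Mv rv _]] := cm.
have [|v' [sv' Mv' rv']] := reg_extend lM (is_ideal0 _) rv Mv rz Mz; first by rewrite sv.
by exists v'; rewrite sv' sv.
Qed.

Lemma cm_regseq_primary z v : (size z + size v)%N = n -> all_in z M -> all_in v M ->
  reg [set 0] z -> reg (lin z) v -> rad_sub M (gen (lin z) v).
Proof.
move=> sz Mz Mv rz rv; rewrite -lin_cat; apply: reg_primary.
- by rewrite size_cat.
- by apply/all_in_cat.
- by apply/reg_cat.
Qed.

(** Unmixedness. The complementary regular sequence already yields a chain of maximal length above
    P; a smaller prime P' over (z) would lengthen it beyond Krull's bound. *)
Lemma cm_assoc_minimal z P P' : all_in z M -> reg [set 0] z -> assoc (lin z) P ->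
  is_prime P' -> lin z `<=` P' -> P' `<=` P -> P' = P.
Proof.
move=> Mz rz aP pP' zP' P'P; apply/seteqP; split=> //; apply: contrapT => nPP'.
have [v [sv Mv rv]] := cm_reg_extend Mz rz.
have [c [hc ec]] := reg_chain_above lM (lin_ideal _) rv Mv aP.
have lt : P' `<` c 0%N by rewrite ec.
have := krull_height noeA lM (lin_ideal z) Mv _ (prime_chain_cons pP' lt hc).
by move=> /(_ _ zP'); rewrite ltnn => H; have := H (cm_regseq_primary sv Mz Mv rz rv).
Qed.

(** Take a longest regular sequence in Q. Prime avoidance shows that Q is contained in an associated
    prime of it, and unmixedness turns this into equality. *)
Lemma cm_max_reg Q : is_prime Q -> exists z, [/\ all_in z Q, reg [set 0] z
  & assoc (lin z) Q].
Proof.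
move=> pQ; have hQ := prime_ideal pQ.
have QM : Q `<=` M by apply: loc_max_sub lM hQ _; case: pQ.
pose ok k := `[< exists z, [/\ size z = k, all_in z Q & reg [set 0] z] >].
have ok0 : exists k, ok k by exists 0%N; apply/asboolP; exists [::].
have okn k : ok k -> (k <= n)%N.
  by move=> /asboolP[z [<- Qz rz]]; apply: cm_reg_size rz => x /Qz/QM.
have [k /asboolP[z [sz Qz rz]] mk] := ex_maxnP ok0 okn.
exists z; split=> //.
have [[P [aP QP]]|H] := pselect (exists P, assoc (lin z) P /\ Q `<=` P).
  rewrite (@cm_assoc_minimal z P Q) //; first by move=> x /Qz/QM.
  exact: lin_min.
have [|u Qu hu] := @nzd_coset Q 0 [:: lin z] hQ.
  by move=> I [<-|[]]; split=> // P aP [_ QP]; apply: H; exists P.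
have := mk k.+1; rewrite ltnn => h; suff /h : ok k.+1 by [].
apply/asboolP; exists (rcons z u); split; first by rewrite size_rcons sz.
  exact/all_in_rcons.
by apply/reg_rcons => //; split=> //; rewrite -(add0r u); apply: hu; left.
Qed.

End CohenMacaulay.
End Regular.

(** * Colon capturing *)

Section AlmostRegular.
Variable A : comNzRingType.
Implicit Types (I J K P Q M : set A) (x y a c g : A) (s t v : seq A).

(** Regularity up to the multiplier c. Colon capturing amounts to [areg] for all powers of a
    sequence with one common c. *)
Fixpoint areg c I s : Prop :=
  if s is x :: s' then (forall y, I (x * y) -> I (c * y)) /\ areg c (gen I [:: x]) s'
  else True.

Lemma areg_weak d c I s : is_ideal I -> areg c I s -> areg (d * c) I s.
Proof.
elim: s I => [//|x s ih] I hI /= [h /ih h']; split; last exact/h'/gen_ideal.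
by move=> y /h; rewrite -mulrA; apply: idMl.
Qed.

Lemma areg_rcons c I s x : is_ideal I -> areg c I (rcons s x) <->
  areg c I s /\ (forall y, gen I s (x * y) -> gen I s (c * y)).
Proof.
elim: s I => [|z s ih] I hI /=; first by split=> [[h _]|[_ h]].
have hz := gen_ideal [:: z] hI; rewrite (gen_cons z s hI).
split=> [[h /(ih _ hz)[]]|[[h h1] h2]] //.
by split=> //; apply/(ih _ hz).
Qed.

(* [0 -> A/I' -> A/I -> A/(I + g) -> 0], with first map [g], is exact up to [c] *)
Definition almost_exact c I I' g :=
  (forall r, I' r -> I (r * g)) /\ (forall r, I (r * g) -> I' (c * r)).

Lemma almost_exact_step c I I' g x : is_ideal I -> is_ideal I' ->
  almost_exact c I I' g -> (forall y, gen I [:: g] (x * y) -> gen I [:: g] (c * y)) ->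
  almost_exact (c * c) (gen I [:: x]) (gen I' [:: x]) g.
Proof.
move=> hI hI' [h1 h2] hx; split=> r.
  move=> /gen1P[a /h1 ha]; apply/gen1P; exists (a * g).
  by rewrite (_ : _ - _ = (r - a * x) * g) //; ring.
move=> /gen1P[a ha].
have /hx/gen1P[b hb] : gen I [:: g] (x * a).
  apply/gen1P; exists r; by rewrite -opprB (mulrC x); apply: idN.
have /h2 hc : I ((c * r - x * b) * g).
  rewrite (_ : _ * g = c * (r * g - a * x) + x * (c * a - b * g)); last by ring.
  by apply: idD => //; apply: idMl.
apply/gen1P; exists (c * b).
by rewrite (_ : _ - _ = c * (c * r - x * b)) //; ring.
Qed.

(** The middle term of an almost exact sequence inherits almost regularity. The exponent depends on
    the length alone, hence serves all powers q: the first element costs c^3, and dividing by it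
    turns c into c^2 for the rest. *)
Lemma areg_extension k : exists e, forall c I I' g s, size s = k ->
  is_ideal I -> is_ideal I' -> almost_exact c I I' g ->
  areg c (gen I [:: g]) s -> areg c I' s -> areg (c ^+ e) I s.
Proof.
elim: k => [|k [e ih]]; first by exists 0%N => c I I' g [].
exists (2 * e + 3)%N => c I I' g [//|x s] [ss] hI hI' ex [hx hs] [hx' hs'].
have hg := gen_ideal [:: g] hI; have h1 := gen_ideal [:: x] hI.
have h1' := gen_ideal [:: x] hI'.
have genC : gen (gen I [:: x]) [:: g] = gen (gen I [:: g]) [:: x].
  by rewrite -gen_catC // gen_cat.
split; last first.
  have -> : c ^+ (2 * e + 3) = c ^+ 3 * (c * c) ^+ e.
    by rewrite addnC exprD exprM expr2.
  apply: areg_weak => //; apply: (ih _ _ (gen I' [:: x]) g) => //.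
  - exact: almost_exact_step.
  - by rewrite genC; apply: areg_weak => //; exact: gen_ideal.
  - exact: areg_weak.
move=> y Ixy; have [ex1 ex2] := ex.
have /hx/gen1P[b hb] : gen I [:: g] (x * y) by apply: gen_base.
have /ex2 hxb : I ((x * b) * g).
  rewrite (_ : _ * g = c * (x * y) - x * (c * y - b * g)); last by ring.
  by apply: idB => //; apply: idMl.
have /hx'/ex1 hcb : I' (x * (c * b)) by rewrite mulrCA.
rewrite exprD -mulrA; apply: idMl => //.
rewrite (_ : _ * y = c * c * (c * y - b * g) + c * (c * b) * g); last by ring.
by apply: idD => //; apply: idMl.
Qed.

(** For the submodule one element fewer is required of the quotient A/(I + g). This gain of one
    drives the induction on the length in [colon_capturing]. *)
Lemma areg_kernel k : exists e, forall c I I' g s, size s = k ->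
  is_ideal I -> is_ideal I' -> almost_exact c I I' g ->
  reg I s -> areg c (gen I [:: g]) (take k.-1 s) -> areg (c ^+ e) I' s.
Proof.
elim: k => [|k [e ih]]; first by exists 0%N => c I I' g [].
exists (2 * e + 1)%N => c I I' g [//|x s] [ss] hI hI' ex [nx rs] /= hs.
have h1 := gen_ideal [:: x] hI; have h1' := gen_ideal [:: x] hI'.
have genC : gen (gen I [:: x]) [:: g] = gen (gen I [:: g]) [:: x].
  by rewrite -gen_catC // gen_cat.
split.
  have [ex1 ex2] := ex => y /ex1; rewrite -mulrA => /nx/ex2.
  by rewrite exprD -mulrA expr1; apply: idMl.
case: k s ss e ih hs rs => [|k] s ss e ih hs rs; first by case: s ss {hs rs}.
have [hx hs'] := hs.
have -> : c ^+ (2 * e + 1) = c * (c * c) ^+ e.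
  by rewrite addn1 exprS exprM expr2.
apply: areg_weak => //; apply: (ih _ (gen I [:: x]) _ g) => //.
- exact: almost_exact_step.
- by rewrite genC; apply: areg_weak => //; do 2!apply: gen_ideal.
Qed.

Fixpoint congr_seq Q s t : Prop :=
  match s, t with
  | [::], [::] => True
  | x :: s', y :: t' => Q (x - y) /\ congr_seq Q s' t'
  | _, _ => False
  end.

Lemma gen_congr1 I x y : is_ideal I -> I (x - y) -> gen I [:: x] = gen I [:: y].
Proof.
move=> hI hxy; have hyx : I (y - x) by rewrite -opprB; apply: idN.
have sub (u w : A) : I (u - w) -> gen I [:: u] `<=` gen I [:: w].
  move=> huv; apply: gen_sub => //; first by move=> z; apply: gen_base.
  by move=> z; rewrite inE => /eqP->; apply/gen1P; exists 1; rewrite mul1r.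
by apply/seteqP; split; apply: sub.
Qed.

Lemma areg_congr c Q I s t : is_ideal I -> Q `<=` I -> congr_seq Q s t ->
  areg c I s -> areg c I t.
Proof.
elim: s t I => [|x s ih] [|y t] I hI QI //= [hxy hst] [hx hs].
have Ixy := QI _ hxy; split=> [z Iz|].
  by apply: hx; rewrite -(subrK (y * z) (x * z)) -mulrBl; apply: idD => //; apply: idMr.
apply: ih hst _; first exact: gen_ideal.
  by move=> z /QI; apply: gen_base.
by rewrite -(gen_congr1 hI Ixy).
Qed.

Lemma congr_sym Q s t : is_ideal Q -> congr_seq Q s t -> congr_seq Q t s.
Proof.
move=> hQ; elim: s t => [|x s ih] [|y t] //= [hxy /ih]; split=> //.
by rewrite -opprB; apply: idN.
Qed.

Definition pows s q := [seq x ^+ q | x <- s].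

Lemma congr_pows Q s t q : is_ideal Q -> congr_seq Q s t -> congr_seq Q (pows s q) (pows t q).
Proof.
move=> hQ; elim: s t => [|x s ih] [|y t] //= [hxy /ih]; split=> //.
by rewrite subrXX; apply: idMr.
Qed.

Lemma all_in_pows s M q : is_ideal M -> (0 < q)%N -> all_in s M -> all_in (pows s q) M.
Proof.
move=> hM q0 h _ /mapP[x /h Mx ->].
by rewrite -(prednK q0) exprS; apply: idMr.
Qed.

Lemma rad_trans M I s : is_ideal I -> rad_sub M (lin s) ->
  (forall x, x \in s -> exists k, I (x ^+ k)) -> rad_sub M I.
Proof.
move=> hI rM h x /rM[k hk].
have sub : lin s `<=` radical I by apply: lin_min => //; exact: radical_ideal.
by have [j hj] := sub _ hk; exists (k * j)%N; rewrite exprM.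
Qed.

Lemma rad_pows M s q : rad_sub M (lin s) -> rad_sub M (lin (pows s q)).
Proof.
move=> rM; apply: rad_trans rM _ => // x xs; exists q.
by apply: lin_mem; apply/mapP; exists x.
Qed.

End AlmostRegular.

Section ColonCapturing.
Variables (C : comNzRingType) (M Q : set C) (n : nat).
Hypotheses (noeC : noetherian C) (lM : loc_max M) (cm : cm_loc M n) (pQ : is_prime Q).
Implicit Types (I J : set C) (s v Y : seq C).

Let hM : is_ideal M. Proof. by case: lM. Qed.
Let hQ : is_ideal Q. Proof. exact: prime_ideal. Qed.

(* The associated primes of [I] have dimension at least [size s], while [s]
   lowers the dimension of [C/(I + Q)] to [0]; so a lift of the first element of
   [s] modulo [Q] avoids them. *)
Lemma lift_regular s I J v : is_ideal I -> is_ideal J -> I `<=` J -> Q `<=` J ->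
  (forall K, is_ideal K -> I `<=` K -> Q `<=` K -> J `<=` K) ->
  reg I v -> all_in v M -> size v = size s -> all_in s M -> rad_sub M (gen J s) ->
  exists Y, [/\ congr_seq Q s Y, all_in Y M & reg I Y].
Proof.
elim: s I J v => [|x s ih] I J v hI hJ IJ QJ minJ rv Mv sv; first by exists [::].
move=> /all_in_cons[Mx Ms] rM.
have [|b Qb hb] := @nzd_coset C noeC Q x [:: I] hQ.
  move=> _ [<-|[]]; split=> // P aP [Px QP]; have [pP _] := aP.
  have [c [hc ec]] := reg_chain_above noeC lM hI rv Mv aP.
  have hP := prime_ideal pP.
  have : (size v <= size s)%N.
    apply: (krull_height noeC lM hP Ms _ hc); last by rewrite ec.
    apply: rad_subS rM; rewrite gen_cons //; apply: gen_mono => //.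
    apply: gen_min => //; last by move=> z; rewrite inE => /eqP->.
    by apply: minJ => //; apply: assoc_sub.
  by rewrite sv ltnn.
have nxb := hb I (or_introl erefl).
have QM : Q `<=` M by apply: loc_max_sub lM hQ _; case: pQ.
have Mxb : M (x + b) by apply: idD => //; exact: QM.
have [|v' [sv' Mv' [_ rv']]] := reg_exchange noeC lM hI rv Mv Mxb nxb.
  by rewrite sv.
have hx := gen_ideal [:: x + b] hI.
have Jxb : gen J [:: x] (x + b).
  apply: idD; first exact: gen_ideal.
    by apply: gen_mem; rewrite ?inE.
  by apply: gen_base => //; apply: QJ.
have [||||||Y [cY MY rY]] := ih (gen I [:: x + b]) (gen J [:: x]) v' hx _ _ _ _ rv' Mv' _ Ms.
- exact: gen_ideal.
- apply: gen_sub => // z; first by move=> /IJ; apply: gen_base.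
  by rewrite inE => /eqP->.
- by move=> z /QJ; apply: gen_base.
- move=> K hK IK QK; apply: gen_min => //.
    by apply: minJ => // z Iz; apply: IK; apply: gen_base.
  move=> z; rewrite inE => /eqP->; rewrite -(addrK b x); apply: idB => //; last exact: QK.
  by apply: IK; apply: gen_mem; rewrite ?inE.
- by move: sv sv' => /=; lia.
- by rewrite -gen_cons.
exists (x + b :: Y); split=> //=; last exact/all_in_cons.
by split=> //; rewrite opprD addNKr; apply: idN.
Qed.

(** A prime filtration of C/I, by noetherian induction. Factors C/Q are covered by the hypothesis on
    c; any other prime over (z) contains an element outside Q, by unmixedness, and this element
    kills its factor. The index type T makes d independent of q. *)
Lemma areg_prime_filtration (T : Type) (s : T -> seq C) k z c : all_in z M ->
  reg [set 0] z -> assoc (lin z) Q -> ~ Q c -> (forall q, size (s q) = k) ->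
  (forall q, areg c Q (s q)) -> forall I, is_ideal I -> lin z `<=` I ->
  exists2 d, ~ Q d & forall q, areg d I (s q).
Proof.
move=> Mz rz aQ nc sk hc; apply: (noeth_ind noeC) => I hI ih zI.
have [I1|nI1] := pselect (I 1).
  exists 1; first by case: pQ.
  have areg_unit J t : is_ideal J -> J 1 -> areg 1 J t.
    elim: t J => [//|x t ih'] J hJ J1 /=; split; first by move=> *; apply: ideal1.
    by apply: ih'; [exact: gen_ideal | exact: gen_base].
  by move=> q; apply: areg_unit.
have [g [ng [pg _]]] := assoc_over noeC hI nI1.
have hg := gen_ideal [:: g] hI; have hcg := colon_ideal g hI.
have [|||d1 nd1 hd1] := ih (gen I [:: g]) hg.
- by move=> x; apply: gen_base.
- by move=> h; apply: ng; apply: h; apply: gen_mem; rewrite ?inE.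
- by move=> x /zI; apply: gen_base.
have [d2 nd2 hd2] : exists2 d, ~ Q d & forall q, areg d (colon I g) (s q).
  have [e|ne] := pselect (colon I g = Q); first by exists c => // q; rewrite e.
  have [d [cd nd]] : exists d, colon I g d /\ ~ Q d.
    apply: contrapT => H; apply: ne.
    apply: (cm_assoc_minimal noeC lM cm Mz rz aQ pg).
      by move=> x /zI Ix; apply: idMr.
    by move=> x cx; apply: contrapT => nx; apply: H; exists x.
  have areg_zero J t : is_ideal J -> J d -> areg d J t.
    elim: t J => [//|x t ih'] J hJ Jd /=; split; first by move=> *; apply: idMr.
    by apply: ih'; [exact: gen_ideal | exact: gen_base].
  by exists d => // q; apply: areg_zero.
have [e he] := areg_extension C k.
exists ((d1 * d2) ^+ e); first by apply: prime_nX => //; apply: prime_nM.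
move=> q; apply: (he _ _ (colon I g) g) => //.
- by split=> r //; rewrite /colon /= -mulrA; apply: idMl.
- by rewrite mulrC; apply: areg_weak.
- exact: areg_weak.
Qed.

(** Write Q = (z : g) for a maximal regular sequence z in Q and lift s modulo Q to a sequence Y
    regular modulo z. In 0 -> C/Q -> C/(z) -> C/(z, g) -> 0 the middle term has no colon defects.
    The filtration handles the right term for k elements, and [areg_kernel] then handles C/Q for k +
    1. *)
Lemma colon_capturing s (ch : nat -> set C) : all_in s M -> rad_sub M (gen Q s) ->
  prime_chain (size s) ch -> Q `<=` ch 0%N ->
  exists2 c, ~ Q c & forall q, (0 < q)%N -> areg c Q (pows s q).
Proof.
move=> Ms rM hch Qch.
have QM : Q `<=` M by apply: loc_max_sub lM hQ _; case: pQ.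
have [z [Qz rz aQ]] := cm_max_reg noeC lM cm pQ.
have Mz : all_in z M by move=> x /Qz/QM.
have [v [sv Mv rv]] := cm_reg_extend noeC lM cm Mz rz.
have rMv := cm_regseq_primary noeC lM cm sv Mz Mv rz rv.
have zQ := assoc_sub (lin_ideal z) aQ.
have esv : size v = size s.
  apply/eqP; rewrite eqn_leq; apply/andP; split.
    have [c [hc ec]] := reg_chain_above noeC lM (lin_ideal z) rv Mv aQ.
    by apply: (krull_height noeC lM hQ Ms rM hc); rewrite ec.
  apply: (krull_height noeC lM (lin_ideal z) Mv rMv hch).
  exact: subset_trans Qch.
have [Y [cY MY rY]] := lift_regular (lin_ideal z) hQ zQ (@subset_refl _ Q)
  (fun K _ _ h => h) rv Mv esv Ms rM.
have sY : size Y = size s by elim: (s) (Y) cY => [|a s' ih] [|b Y'] //= [_ /ih->].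
(* The powers of Y stay regular modulo z because z and Y^q together are again a system of parameters
   of the Cohen-Macaulay ring C. *)
have rYq q : (0 < q)%N -> reg (lin z) (pows Y q).
  move=> q0; have : reg [set 0] (z ++ pows Y q).
    apply: (cm_sop_reg noeC lM cm).
    - by rewrite size_cat size_map sY -esv.
    - by apply/all_in_cat; split=> //; apply: all_in_pows.
    rewrite lin_cat.
    have rMY : rad_sub M (lin (z ++ Y)).
      apply: (reg_primary noeC lM cm).
      - by rewrite size_cat sY -esv.
      - exact/all_in_cat.
      - exact/reg_cat.
    apply: rad_trans rMY _; first exact: gen_ideal.
    move=> x; rewrite mem_cat => /orP[xz|xY].
      by exists 1%N; apply: gen_base => //; apply: lin_mem.
    by exists q; apply: gen_mem => //; apply/mapP; exists x.
  by move=> /reg_cat[].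
have [g eQ] : exists g, Q = colon (lin z) g by case: aQ.
have claim k : (k <= size s)%N -> exists2 c, ~ Q c &
    forall q : {q | (0 < q)%N}, areg c Q (take k (pows Y (val q))).
  elim: k => [|k ih] hk.
    exists 1; first by case: pQ.
    by move=> q; rewrite take0.
  have [c nc hc] := ih (ltnW hk); have {}hk : (k < size Y)%N by rewrite sY.
  have sk j q : (j <= size Y)%N -> size (take j (pows Y q)) = j.
    by move=> hj; rewrite size_takel // size_map.
  have [q|||d nd hd] := @areg_prime_filtration {q | (0 < q)%N}
    (fun q => take k (pows Y (val q))) k z c Mz rz aQ nc _ hc (gen (lin z) [:: g]).
  - by apply: sk; apply: ltnW.
  - exact: gen_ideal.
  - by move=> x; apply: gen_base.
  have [e he] := areg_kernel C k.+1.
  exists (d ^+ e); first exact: prime_nX.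
  move=> q; apply: (he _ (lin z) _ g) => //.
  - exact: sk.
  - by split=> r; rewrite eQ //; rewrite /colon /= -mulrA; apply: idMl.
  - have := rYq _ (valP q); rewrite -{1}(cat_take_drop k.+1 (pows Y _)).
    by move=> /reg_cat[].
  - by rewrite /= take_takel //; apply: (hd q).
have [c nc hc] := claim _ (leqnn _); exists c => // q q0.
apply: (@areg_congr _ _ Q _ (pows Y q)) => //.
  by apply: congr_pows => //; apply: congr_sym.
have := hc (exist _ q q0); rewrite take_oversize //.
by rewrite size_map sY.
Qed.

End ColonCapturing.

(** * Tight closure of ideals generated by parameters *)

Definition domain (A : comNzRingType) := forall x y : A, x * y = 0 -> x = 0 \/ y = 0.

Section TightClosure.
Variables (p : nat) (A : comNzRingType).
Hypotheses (pA : p \in [pchar A]) (domA : domain A).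
Implicit Types (I J K P Q M : set A) (x y z a c : A) (s t v w : seq A).

Lemma domain_prime0 : is_prime [set (0 : A)].
Proof. by split=> // /eqP; rewrite oner_eq0. Qed.

Lemma domain_neq0M x y : x <> 0 -> y <> 0 -> x * y <> 0.
Proof. by move=> nx ny /domA[]. Qed.

Lemma domain_neq0X x n : x <> 0 -> x ^+ n <> 0.
Proof. exact: (prime_nX domain_prime0). Qed.

Lemma off_minimal_primesE c : off_minimal_primes c <-> c <> 0.
Proof.
split=> [h e|nc P [pP mP] Pc].
  apply: (h [set 0]) => //; split=> [|Q pQ Q0]; first exact: domain_prime0.
  by apply/seteqP; split=> // x ->; apply: id0; apply: prime_ideal.
have e : [set 0] = P.
  by apply: mP; [exact: domain_prime0 | move=> x ->; apply: id0; apply: prime_ideal].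
by apply: nc; move: Pc; rewrite -e.
Qed.

Lemma frobD e x y : (x + y) ^+ (p ^ e) = x ^+ (p ^ e) + y ^+ (p ^ e).
Proof.
have pp := pcharf_prime pA; apply: exprDn_pchar.
by rewrite pnatX pnatE // pA.
Qed.

Lemma frobB e x y : (x - y) ^+ (p ^ e) = x ^+ (p ^ e) - y ^+ (p ^ e).
Proof. by apply/eqP; rewrite -subr_eq opprK -frobD subrK. Qed.

Lemma p_gt0 e : (0 < p ^ e)%N.
Proof. by rewrite expn_gt0 prime_gt0 ?(pcharf_prime pA). Qed.

Lemma lin_frob s z e : lin s z -> lin (pows s (p ^ e)) (z ^+ (p ^ e)).
Proof.
elim: s z => [|x s ih] z.
  by move=> ->; rewrite expr0n -[_ == _]negbK -lt0n p_gt0.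
move=> [a /ih h]; exists (a ^+ (p ^ e)).
by rewrite frobB exprMn in h.
Qed.

Lemma frobenius_powerE s e : frobenius_power (lin s) (p ^ e) = lin (pows s (p ^ e)).
Proof.
apply/seteqP; split.
  by apply: ideal_gen_min => // _ [x sx <-]; apply: lin_frob.
apply: lin_min; first exact: ideal_gen_ideal.
move=> _ /mapP[x xs ->]; apply: ideal_gen_mem; exists x => //; exact: lin_mem.
Qed.

Definition tcl s z := exists2 c, c <> 0 & exists e0, forall e, (e0 <= e)%N ->
  lin (pows s (p ^ e)) (c * z ^+ (p ^ e)).

Lemma tight_closureE s : tight_closure p (lin s) = tcl s.
Proof.
apply/seteqP; split=> z [c hc [e0 h]]; exists c.
- exact/off_minimal_primesE.
- by exists e0 => e /h; rewrite frobenius_powerE.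
- exact/off_minimal_primesE.
- by exists e0 => e /h; rewrite frobenius_powerE.
Qed.

Definition TC s := tcl s `<=` lin s.

Lemma tcl_lin s : lin s `<=` tcl s.
Proof.
move=> z sz; exists 1; first by apply/eqP; rewrite oner_eq0.
by exists 0%N => e _; rewrite mul1r; apply: lin_frob.
Qed.

Lemma tightly_closedE s : tightly_closed p (ideal_gen [set` s]) <-> TC s.
Proof.
rewrite ideal_genE /tightly_closed tight_closureE; split=> [e z /(set_eqP e)//|h].
by apply/seteqP; split=> //; exact: tcl_lin.
Qed.

Lemma tcl_ideal s : is_ideal (tcl s).
Proof.
split=> [|x y [c nc [e0 h0]] [d nd [e1 h1]]|a x [c nc [e0 h0]]].
- by apply: tcl_lin; apply: id0.
- exists (c * d); first exact: domain_neq0M.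
  exists (maxn e0 e1) => e; rewrite geq_max => /andP[/h0 hx /h1 hy].
  rewrite frobD mulrDr; apply: idD => //; last by rewrite -mulrA; apply: idMl.
  by rewrite mulrAC; apply: idMr.
- by exists c => //; exists e0 => e /h0 h; rewrite exprMn mulrCA; apply: idMl.
Qed.

Lemma tcl_weak s z c d e0 : c <> 0 -> d <> 0 ->
  (forall e, (e0 <= e)%N -> lin (pows s (p ^ e)) (d * (c * z ^+ (p ^ e)))) -> tcl s z.
Proof.
move=> nc nd h; exists (d * c); first exact: domain_neq0M.
by exists e0 => e /h; rewrite mulrA.
Qed.

Lemma tcl_sub s t : (forall x, x \in s -> lin t x) -> tcl s `<=` tcl t.
Proof.
move=> st z [c nc [e0 h]]; exists c => //; exists e0 => e /h.
by apply: lin_min => // _ /mapP[x /st xt ->]; apply: lin_frob.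
Qed.

Lemma eq_TC s t : s =i t -> TC s -> TC t.
Proof.
move=> st hs z hz; rewrite -(eq_lin st); apply: hs.
by apply: tcl_sub hz => x; rewrite -st; apply: lin_mem.
Qed.

Lemma pows_rcons s x q : pows (rcons s x) q = rcons (pows s q) (x ^+ q).
Proof. exact: map_rcons. Qed.

Hypothesis noeA : noetherian A.
Variable M : set A.
Hypothesis lM : loc_max M.
Let hM : is_ideal M. Proof. by case: lM. Qed.

(** For z in the tight closure of (s), tight closedness of (s, y) gives z = r y modulo (s), and the
    colon hypothesis puts r into the tight closure of (s) again; Nakayama's lemma concludes. *)
Lemma TC_drop_last s y c : M y -> c <> 0 ->
  (forall e z, lin (pows s (p ^ e)) (y ^+ (p ^ e) * z) -> lin (pows s (p ^ e)) (c * z)) ->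
  TC (rcons s y) -> TC s.
Proof.
move=> My nc hc hs.
apply: (local_nakayama noeA lM (lin_ideal s) (tcl_ideal s) My) => z tz.
have : lin (rcons s y) z.
  by apply: hs; apply: tcl_sub tz => x xs; apply: lin_mem; rewrite mem_rcons inE xs orbT.
rewrite lin_rcons => /gen1P[r hr]; exists r; last by rewrite mulrC.
have [d nd [e0 h]] : tcl s (y * r).
  rewrite -(subKr z (y * r)); apply: idB => //; first exact: tcl_ideal.
  by apply: tcl_lin; rewrite mulrC.
apply: (tcl_weak (c := d) (d := c) (e0 := e0)) => // e /h; rewrite exprMn mulrCA.
exact: hc.
Qed.

(** Almost regularity places the colon ideal (s) : y in the tight closure of (s), which is (s)
    itself; the multiplier c thereby disappears. *)
Lemma TC_reg s c : all_in s M -> c <> 0 ->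
  (forall e, areg c [set 0] (pows s (p ^ e))) -> TC s -> reg [set 0] s.
Proof.
move=> + nc; elim/last_ind: s => [//|s y ih] /all_in_rcons[My Ms] hc hs.
have hcs e : areg c [set 0] (pows s (p ^ e)) /\
    (forall z, lin (pows s (p ^ e)) (y ^+ (p ^ e) * z) -> lin (pows s (p ^ e)) (c * z)).
  by have := hc e; rewrite pows_rcons => /areg_rcons[].
have Ts : TC s by apply: (TC_drop_last My nc _ hs) => e; case: (hcs e).
apply/reg_rcons => //; split; first by apply: ih => // e; case: (hcs e).
move=> z hz; apply: Ts; exists c => //; exists 0%N => e _.
by have [_] := hcs e; apply; rewrite -exprMn; apply: lin_frob.
Qed.

Section Exchange.
Variable n : nat.
Definition sop s := [/\ size s = n, all_in s M & rad_sub M (lin s)].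
Hypothesis regA : forall s, sop s -> reg [set 0] s.

Lemma sop_rcons_nzd s y : sop (rcons s y) -> nzd (lin s) y.
Proof. by move=> /regA /reg_rcons[]. Qed.

Lemma sop_eq_mem s t : size s = size t -> s =i t -> sop s -> sop t.
Proof.
move=> st e [ss Ms rM]; split; first by rewrite -st.
  by move=> x; rewrite -e; apply: Ms.
by rewrite -(eq_lin e).
Qed.

Lemma sop_pows s q : (0 < q)%N -> sop s -> sop (pows s q).
Proof.
move=> q0 [ss Ms rM]; split; [by rewrite size_map|exact: all_in_pows|exact: rad_pows].
Qed.

Lemma sop_rconsX s y (a : nat) : sop (rcons s y) -> (0 < a)%N -> sop (rcons s (y ^+ a)).
Proof.
move=> [ss /all_in_rcons[My Ms] rM] a0; split.
- by rewrite -ss !size_rcons.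
- by apply/all_in_rcons; split=> //; rewrite -(prednK a0) exprS; apply: idMr.
apply: rad_trans rM _ => // x; rewrite mem_rcons inE => /orP[/eqP->|xs].
  by exists a; apply: lin_mem; rewrite mem_rcons inE eqxx.
by exists 1%N; apply: lin_mem; rewrite mem_rcons inE expr1 xs orbT.
Qed.

Lemma sop_colon s y (a b : nat) (v : A) : sop (rcons s y) ->
  lin (rcons s (y ^+ (a + b))) (y ^+ a * v) -> lin (rcons s (y ^+ b)) v.
Proof.
move=> hs; rewrite !lin_rcons => /gen1P[r hr]; apply/gen1P; exists r.
apply: (nzdX (n := a) (sop_rcons_nzd hs)).
by rewrite mulrBr mulrCA -exprD.
Qed.

(** By induction z = r y^(a+1) modulo (s), and cancelling the power of y in the Frobenius relations
    puts r into the tight closure of (s, y). *)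
Lemma TC_rconsX s y (a : nat) : sop (rcons s y) -> TC (rcons s y) -> TC (rcons s (y ^+ a.+1)).
Proof.
move=> hs Ts; elim: a => [|a ih z hz]; first by rewrite expr1.
have : lin (rcons s (y ^+ a.+1)) z.
  apply: ih; apply: tcl_sub hz => x; rewrite mem_rcons inE => /orP[/eqP->|xs].
    by rewrite (exprS y a.+1); apply: idMl => //; apply: lin_mem; rewrite mem_rcons inE eqxx.
  by apply: lin_mem; rewrite mem_rcons inE xs orbT.
rewrite lin_rcons => /gen1P[r hr].
have hsub : lin s `<=` lin (rcons s (y ^+ a.+2)).
  by rewrite lin_rcons => x; apply: gen_base.
have [c nc [e0 h]] : tcl (rcons s (y ^+ a.+2)) (r * y ^+ a.+1).
  rewrite -(subKr z (r * _)); apply: idB => //; first exact: tcl_ideal.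
  by apply: tcl_lin; apply: hsub.
have : lin (rcons s y) r.
  apply: Ts; exists c => //; exists e0 => e /h; rewrite !pows_rcons.
  have hse := sop_pows (p_gt0 e) hs; rewrite pows_rcons in hse.
  rewrite (exprMn _ r) => hh.
  have := @sop_colon _ (y ^+ (p ^ e)) a.+1 1 (c * r ^+ (p ^ e)) hse.
  rewrite expr1 addn1; apply.
  rewrite !(exprAC y (p ^ e)) mulrCA (mulrC _ (r ^+ _)); exact: hh.
rewrite !lin_rcons => /gen1P[b hb]; apply/gen1P; exists b.
rewrite (_ : _ - _ = (z - r * y ^+ a.+1) + y ^+ a.+1 * (r - b * y)); last first.
  by rewrite [in LHS]exprS; ring.
by apply: idD => //; apply: idMl.
Qed.

(** Write y^(N+1) = b v modulo (s). Multiplication by b embeds A/(s, v) into A/(s, y^(N+1)) and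
    preserves tight closure relations. *)
Lemma TC_swap_last s y (v : A) : sop (rcons s y) -> sop (rcons s v) -> TC (rcons s y) ->
  TC (rcons s v).
Proof.
move=> hy hv Ty z [c nc [e0 h]].
have [N hN] : exists N, lin (rcons s v) (y ^+ N.+1).
  have [_ /all_in_rcons[My _] _] := hy; have [_ _ /(_ _ My)[k hk]] := hv.
  by exists k; rewrite exprS; apply: idMl.
rewrite lin_rcons in hN; have /gen1P[b hb] := hN.
have hyN : lin s (y ^+ N.+1 - b * v) by [].
have nb : nzd (lin s) b.
  move=> w hw; apply: (nzdX (n := N.+1) (sop_rcons_nzd hy)).
  rewrite (_ : _ * w = (y ^+ N.+1 - b * v) * w + v * (b * w)); last by ring.
  by apply: idD => //; [apply: idMr | apply: idMl].
have : lin (rcons s (y ^+ N.+1)) (b * z).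
  apply: TC_rconsX => //; exists c => //; exists e0 => e /h.
  rewrite !pows_rcons !lin_rcons => /gen1P[d hd]; apply/gen1P; exists d.
  have := lin_frob e hyN; rewrite frobB exprMn => hq.
  rewrite (_ : _ - _ = b ^+ (p ^ e) * (c * z ^+ (p ^ e) - d * v ^+ (p ^ e))
     - d * ((y ^+ N.+1) ^+ (p ^ e) - b ^+ (p ^ e) * v ^+ (p ^ e))); last first.
    by rewrite exprMn; ring.
  by apply: idB => //; apply: idMl.
rewrite !lin_rcons => /gen1P[f hf]; apply/gen1P; exists f; apply: nb.
rewrite (_ : b * _ = (b * z - f * y ^+ N.+1) + f * (y ^+ N.+1 - b * v)); last by ring.
by apply: idD => //; apply: idMl.
Qed.

Hypothesis reg_sop : forall s, size s = n -> all_in s M -> reg [set 0] s -> sop s.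

(* Both sequences are connected through a common new element [v]. *)
Lemma TC_sop_cat (s y w : seq A) : sop (s ++ y) -> sop (s ++ w) -> TC (s ++ y) -> TC (s ++ w).
Proof.
elim/last_ind: y s w => [|y y1 ih] s w.
  move=> [e1 _ _] [e2 _ _]; have : size w = 0%N by move: e1 e2; rewrite !size_cat /=; lia.
  by move=> /size0nil->.
case/lastP: w => [|w w1].
  by move=> [e1 _ _] [e2 _ _]; move: e1 e2; rewrite !size_cat size_rcons /=; lia.
rewrite -!rcons_cat => hy hw Ty.
have [ny nw] := (sop_rcons_nzd hy, sop_rcons_nzd hw).
have [sy /all_in_rcons[My1 My] _] := hy; have [sw /all_in_rcons[Mw1 Mw] _] := hw.
have [|v Mv hv] := @nzd_common A noeA M [:: lin (s ++ y); lin (s ++ w)] hM.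
  by move=> I [<-|[<-|[]]]; split=> //; [apply: nzd_no_socle ny|apply: nzd_no_socle nw].
have /reg_rcons[//|ry _] := regA hy; have /reg_rcons[//|rw _] := regA hw.
have hyv : sop (rcons (s ++ y) v).
  apply: reg_sop; first by rewrite -sy !size_rcons.
    exact/all_in_rcons.
  by apply/reg_rcons => //; split=> //; apply: hv; left.
have hwv : sop (rcons (s ++ w) v).
  apply: reg_sop; first by rewrite -sw !size_rcons.
    exact/all_in_rcons.
  by apply/reg_rcons => //; split=> //; apply: hv; right; left.
have mv t : rcons (s ++ t) v =i rcons s v ++ t.
  by move=> x; rewrite cat_rcons mem_rcons !(inE, mem_cat); do ! case: (_ \in _); case: eqP.
have szv t : size (rcons (s ++ t) v) = size (rcons s v ++ t).
  by rewrite cat_rcons size_rcons !size_cat /= addnS.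
apply: (TC_swap_last hwv hw).
apply: (@eq_TC (rcons s v ++ w)); first by move=> x; rewrite mv.
apply: (ih (rcons s v)).
- exact: sop_eq_mem (szv y) (mv y) hyv.
- exact: sop_eq_mem (szv w) (mv w) hwv.
exact: (eq_TC (mv y) (TC_swap_last hy hyv Ty)).
Qed.

Lemma TC_sop (y w : seq A) : sop y -> sop w -> TC y -> TC w.
Proof. exact: (@TC_sop_cat [::]). Qed.

End Exchange.
End TightClosure.

(** * Polynomial extensions of Cohen-Macaulay local rings *)

Section Hilbert.
Variable A : comNzRingType.
Hypothesis noeA : noetherian A.

Lemma lin_coef_lift (s : seq {poly A}) n a :
  (forall g, g \in s -> (size g <= n.+1)%N) -> lin [seq g`_n | g : {poly A} <- s] a ->
  exists h, [/\ lin s h, (size h <= n.+1)%N & h`_n = a].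
Proof.
move=> hs /linP[f ->]; exists (\sum_(i < size s) (f i)%:P * s`_i); split.
- by apply/linP; exists (fun i => (f i)%:P).
- apply: leq_trans (size_sum _ _ _) _; apply/bigmax_leqP => i _; rewrite mul_polyC.
  by apply: leq_trans (size_scale_leq _ _) _; apply: hs; apply: mem_nth.
- rewrite coef_sum size_map; apply: eq_bigr => i _.
  by rewrite coefCM (nth_map 0).
Qed.

Theorem hilbert_basis : noetherian {poly A}.
Proof.
move=> J hJ.
pose Ln n := [set a : A | exists g, [/\ J g, (size g <= n.+1)%N & g`_n = a]].
have hL n : is_ideal (Ln n).
  split=> [|a b [g [Jg sg <-]] [h [Jh sh <-]]|a b [g [Jg sg <-]]].
  - by exists 0; split; [exact: id0 | rewrite size_poly0 | rewrite coef0].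
  - exists (g + h); split; [exact: idD| |by rewrite coefD].
    by apply: leq_trans (size_polyD _ _) _; rewrite geq_max sg.
  - exists (a%:P * g); split; [exact: idMl| |by rewrite coefCM].
    by rewrite mul_polyC; apply: leq_trans (size_scale_leq _ _) _.
have LS n k : (n <= k)%N -> Ln n `<=` Ln k.
  move=> /subnK <-; elim: (k - n)%N => [|j ih]; first by rewrite add0n.
  apply: subset_trans ih _ => a [g [Jg sg <-]]; exists (g * 'X); split.
  - exact: idMr.
  - by rewrite addSn; apply: leq_trans (size_polyMleq _ _) _; rewrite size_polyX addn2.
  - by rewrite addSn coefMX.
pose U : set A := [set a | exists n, Ln n a].
have hU : is_ideal U.
  split=> [|a b [n hn] [k hk]|a b [n hn]].
  - by exists 0%N; apply: id0.
  - exists (maxn n k); apply: idD => //; [apply: LS hn|apply: LS hk].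
      exact: leq_maxl.
    exact: leq_maxr.
  - by exists n; apply: idMl.
have [N hN] : exists N, U `<=` Ln N.
  have [s eU] := noeth_fg noeA hU.
  have [N hN] : exists N, forall x, x \in s -> Ln N x.
    have : forall x, x \in s -> U x by move=> x xs; rewrite eU; apply: lin_mem.
    elim: s {eU} => [|x s ih] h; first by exists 0%N.
    have [|N hN] := ih; first by move=> y ys; apply: h; rewrite inE ys orbT.
    have [|k hk] := h x; first by rewrite inE eqxx.
    exists (maxn N k) => y; rewrite inE => /orP[/eqP->|/hN].
      by apply: LS hk; exact: leq_maxr.
    by apply: LS; exact: leq_maxl.
  by exists N; rewrite eU; apply: lin_min.
have gens n : exists s : seq {poly A}, (forall g, g \in s -> J g /\ (size g <= n.+1)%N) /\
    forall a, Ln n a -> lin [seq g`_n | g : {poly A} <- s] a.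
  have [t eL] := noeth_fg noeA (hL n).
  have : forall x, x \in t -> Ln n x by move=> x xt; rewrite eL; apply: lin_mem.
  move=> ht; suff [s [hs es]] : exists s : seq {poly A},
      (forall g, g \in s -> J g /\ (size g <= n.+1)%N) /\ [seq g`_n | g : {poly A} <- s] = t.
    by exists s; split=> // a; rewrite es eL.
  elim: t ht {eL} => [|x t ih] ht; first by exists [::].
  have [|s [hs <-]] := ih; first by move=> y yt; apply: ht; rewrite inE yt orbT.
  have [|g [Jg sg <-]] := ht x; first by rewrite inE eqxx.
  by exists (g :: s); split=> // h; rewrite inE => /orP[/eqP->//|/hs].
have [s hs] : exists s : seq {poly A}, (forall g, g \in s -> J g) /\
    forall n a, (n <= N)%N -> Ln n a -> exists h, [/\ lin s h, (size h <= n.+1)%N & h`_n = a].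
  elim: N {hN} => [|k [s [Js hs]]].
    have [s [h1 h2]] := gens 0%N; exists s; split=> [g /h1[]//|n a].
    by rewrite leqn0 => /eqP-> /h2; apply: lin_coef_lift => g /h1[].
  have [t [h1 h2]] := gens k.+1; exists (s ++ t); split.
    by move=> g; rewrite mem_cat => /orP[/Js|/h1[]].
  move=> n a; rewrite leq_eqVlt => /orP[/eqP->|hn] La.
    have [|h [th sh eh]] := lin_coef_lift _ (h2 _ La); first by move=> g /h1[].
    exists h; split=> //; apply: gen_subseq th => // x xt.
    by rewrite mem_cat xt orbT.
  have [h [th sh eh]] := hs n a hn La.
  exists h; split=> //; apply: gen_subseq th => // x xt.
  by rewrite mem_cat xt.
case: hs => Js hs; exists s; rewrite ideal_genE; apply/seteqP; split; last exact: lin_min.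
move=> f; have [n] := ubnP (size f); elim: n f => [//|n ih] f /ltnSE sf Jf.
have [k ek] : exists k, size f = k by exists (size f).
case: k ek => [|k] ek.
  by move/eqP: ek; rewrite size_poly_eq0 => /eqP->; apply: id0.
have Lk : Ln k f`_k by exists f; rewrite ek.
have [h [sh szh eh]] : exists h, [/\ lin s h, (size h <= k.+1)%N & h`_k = f`_k].
  have [le|lt] := leqP k N; first exact: hs.
  have LN : Ln N f`_k by apply: hN; exists k.
  have [h [th szh eh]] := hs N _ (leqnn _) LN.
  exists (h * 'X^(k - N)); split.
  - exact: idMr.
  - apply: leq_trans (size_polyMleq _ _) _; rewrite size_polyXn.
    by move: szh lt; lia.
  - by rewrite coefMXn ltnNge leq_subr /= subKn // ltnW.
have Jh : J h by apply: (lin_min hJ Js).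
rewrite -(subrK h f); apply: idD => //; apply: ih; last exact: idB.
apply: leq_trans sf; rewrite ek ltnS.
apply/leq_sizeP => j; rewrite leq_eqVlt => /orP[/eqP<-|hj].
  by rewrite coefB eh subrr.
rewrite coefB !nth_default ?subr0 //; first by apply: leq_trans szh _.
by rewrite ek.
Qed.

End Hilbert.

Lemma prime_compl_nM (A : comNzRingType) (P : set A) : is_prime P ->
  forall s t, ~ P s -> ~ P t -> ~ P (s * t).
Proof. by move=> pP s t; apply: prime_nM. Qed.

Section FracLift.
Variables (A L Z : comNzRingType) (lam : {rmorphism A -> L}) (P : set A).
Variable f : {rmorphism A -> Z}.
Hypotheses (nP1 : ~ P 1) (nPM : forall s t, ~ P s -> ~ P t -> ~ P (s * t)).
Hypothesis hl : is_frac lam P.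
Hypothesis hf : forall s, ~ P s -> exists y, f s * y = 1.

(** The value is f a / f s for any presentation of y as a fraction. The complement of [P] is only
    assumed multiplicative here, so that the Laurent ring is covered as well. *)
Lemma frac_lift_ex y : exists z, forall a s, ~ P s -> y * lam s = lam a -> f s * z = f a.
Proof.
case: (hl) => _ /(_ y)[a [s [ns e]]] _; have [v ev] := hf ns.
exists (f a * v) => b t nt e'.
have /(frac_eq hl)[r [nr er]] : lam (t * a) = lam (s * b).
  by rewrite !rmorphM -e -e'; ring.
have [w ew] := hf nr.
have key : f t * f a = f s * f b.
  rewrite -(mul1r (_ * _)) -(mul1r (f s * _)) -ew !(mulrC (f r)) -!mulrA.
  by rewrite -!rmorphM er.
by rewrite mulrA key mulrAC ev mul1r.
Qed.

Definition frac_lift y := sval (cid (frac_lift_ex y)).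
Lemma frac_liftP y a s : ~ P s -> y * lam s = lam a -> f s * frac_lift y = f a.
Proof. exact: (svalP (cid (frac_lift_ex y))). Qed.

Lemma unit_cancel s (y z : Z) : ~ P s -> f s * y = f s * z -> y = z.
Proof.
move=> /hf[v ev] e; rewrite -(mul1r y) -(mul1r z) -ev.
by rewrite (mulrC (f s)) -!mulrA e.
Qed.

Lemma frac_lift_lam a : frac_lift (lam a) = f a.
Proof.
have := @frac_liftP (lam a) a 1; rewrite !rmorph1 mulr1 mul1r; exact.
Qed.

Lemma frac_lift_zmod : zmod_morphism frac_lift.
Proof.
move=> y z; case: (hl) => _ hs _; have [a [s [ns ea]]] := hs y.
have [b [t [nt eb]]] := hs z; apply: (unit_cancel (nPM ns nt)).
rewrite (@frac_liftP _ (a * t - b * s)); last 2 first.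
- exact: nPM.
- by rewrite rmorphB !rmorphM -ea -eb; ring.
by rewrite rmorphB !rmorphM -(frac_liftP ns ea) -(frac_liftP nt eb); ring.
Qed.

Lemma frac_lift_monoid : monoid_morphism frac_lift.
Proof.
split; first by rewrite -(rmorph1 lam) frac_lift_lam rmorph1.
move=> y z; case: (hl) => _ hs _; have [a [s [ns ea]]] := hs y.
have [b [t [nt eb]]] := hs z; apply: (unit_cancel (nPM ns nt)).
rewrite (@frac_liftP _ (a * b)); last 2 first.
- exact: nPM.
- by rewrite !rmorphM -ea -eb; ring.
by rewrite !rmorphM -(frac_liftP ns ea) -(frac_liftP nt eb); ring.
Qed.

HB.instance Definition _ := GRing.isZmodMorphism.Build L Z frac_lift frac_lift_zmod.
HB.instance Definition _ := GRing.isMonoidMorphism.Build L Z frac_lift frac_lift_monoid.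

Lemma frac_lift_rmorph : exists g : {rmorphism L -> Z}, forall a, g (lam a) = f a.
Proof. by exists frac_lift; exact: frac_lift_lam. Qed.

End FracLift.

Section PolyRegular.
Variable A : comNzRingType.
Implicit Types (I J M : set A) (s v : seq A).

Definition poly_ext I : set {poly A} := [set f | forall i, I f`_i].

Lemma poly_ext_ideal I : is_ideal I -> is_ideal (poly_ext I).
Proof.
move=> hI; split=> [i|f g hf hg i|f g hg i].
- by rewrite coef0; apply: id0.
- by rewrite coefD; apply: idD.
- by rewrite coefM; apply: id_sum => // j _; apply: idMl.
Qed.

Lemma poly_ext_gen I s : is_ideal I ->
  poly_ext (gen I s) = gen (poly_ext I) (map polyC s).
Proof.
move=> hI; elim: s => [//|x s ih]; have hs := gen_ideal s hI.
apply/seteqP; split=> f; last first.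
  move: f; apply: gen_min; first exact/poly_ext_ideal/gen_ideal.
    by move=> f hf i; apply: gen_base.
  move=> _ /mapP[y ys ->] i; rewrite coefC; case: eqP => _; first exact: gen_mem.
  by apply: id0; apply: gen_ideal.
move=> hf; have /choice[a ha] : forall i, exists a, gen I s (f`_i - a * x) by move=> i; apply: hf.
exists (\poly_(i < size f) a i); rewrite -ih => i.
rewrite coefB coefMC coef_poly; case: ltnP => hi; first exact: ha.
by rewrite mul0r subr0 nth_default //; apply: id0.
Qed.

Lemma reg_poly_ext I s : is_ideal I -> reg I s -> reg (poly_ext I) (map polyC s).
Proof.
elim: s I => [//|x s ih] I hI [nx rs] /=; split.
  by move=> f hf i; apply: nx; have := hf i; rewrite coefCM.
by have := @poly_ext_gen I [:: x] hI => /= <-; apply: ih => //; exact: gen_ideal.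
Qed.

Lemma nzd_poly_extX I : nzd (poly_ext I) 'X.
Proof. by move=> f hf i; have := hf i.+1; rewrite coefXM. Qed.

(** If i and j are the lowest degrees where f and g have coefficients outside P, the coefficient of
    degree i + j of f g is outside P. *)
Lemma poly_ext_prime P : is_prime P -> is_prime (poly_ext P).
Proof.
move=> pP; have hP := prime_ideal pP; split; first exact: poly_ext_ideal.
  by move=> /(_ 0%N); rewrite coef1; case: pP.
move=> f g hfg; apply: contrapT => /not_orP[nf ng].
have low (h : {poly A}) : ~ poly_ext P h -> exists i, ~ P h`_i /\ forall j, (j < i)%N -> P h`_j.
  move=> /existsNP nh; have ex : exists i, `[< ~ P h`_i >].
    by case: nh => i hi; exists i; apply/asboolP.
  have [i /asboolP ni mi] := ex_minnP ex; exists i; split=> // j hj.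
  by apply: contrapT => nj; have := mi j; move/asboolP: nj => -> /(_ isT); lia.
have [i [ni hi]] := low _ nf; have [j [nj hj]] := low _ ng.
apply: (prime_nM pP ni nj).
have := hfg (i + j)%N; rewrite coefM.
have hi' : (i < (i + j).+1)%N by lia.
rewrite (bigD1 (Ordinal hi')) //= addKn => h.
apply: (id_sub (y := - (\sum_(k < (i + j).+1 | k != Ordinal hi') f`_k * g`_(i + j - k)))) => //; last by rewrite opprK.
apply: idN => //; apply: id_sum => // k nk.
have {}nk : (k : nat) <> i by move=> e; move/eqP: nk; apply; apply: val_inj.
have [lt|le] := ltnP k i; first by apply: idMr => //; apply: hi.
by apply: idMl => //; apply: hj; have := ltn_ord k; lia.
Qed.

Lemma poly_split0 (f : {poly A}) : exists q, f = q * 'X + (f`_0)%:P.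
Proof.
elim/poly_ind: f => [|q c _]; first by exists 0; rewrite mul0r add0r coef0.
by exists q; rewrite coefD coefMX coefC add0r.
Qed.

Definition poly_max M : set {poly A} := [set f | M f`_0].

Lemma poly_max_prime M : is_prime M -> is_prime (poly_max M).
Proof.
move=> pM; have hM := prime_ideal pM; case: (pM) => _ n1 hMM.
split; [split=> [|f g|f g]| |move=> f g]; rewrite /poly_max /=.
- by rewrite coef0; apply: id0.
- by rewrite coefD; apply: idD.
- by rewrite coef0M; apply: idMl.
- by rewrite coef1.
- by rewrite coef0M => /hMM.
Qed.

End PolyRegular.

Lemma reg_ext (A L : comNzRingType) (lam : {rmorphism A -> L}) (P I : set A) s :
  is_prime P -> is_frac lam P -> is_ideal I -> reg I s -> reg (ext lam P I) (map lam s).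
Proof.
move=> pP hf; elim: s I => [//|x s ih] I hI [nx rs] /=; have hE := ext_ideal pP hf hI.
have hx := gen_ideal [:: x] hI; split; last first.
  rewrite (_ : gen _ _ = ext lam P (gen I [:: x])); first exact: ih.
  by apply/seteqP; split=> y; rewrite -(gen_frac pP hf [:: x] y hI).
move=> y hy; case: (hf) => hu /(_ y)[a [t [nt e]]] _.
have : ext lam P I (lam (x * a)).
  by rewrite rmorphM -e mulrA; apply: idMr.
move=> /(ext_lamP pP hf _ hI)[r [nr hr]].
exists (r * a), (r * t); split.
- by apply: nx; rewrite mulrCA.
- exact: prime_nM.
- by rewrite !rmorphM -e; ring.
Qed.

Definition local_map (A L : comNzRingType) (MA : set A) (ML : set L)
  (psi : {rmorphism A -> L}) := forall x, MA x -> ML (psi x).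

Section Adjoin.
Variables (C L : comNzRingType) (M : set C) (ML : set L) (n : nat).
Variable psi : {rmorphism C -> L}.
Hypotheses (noeC : noetherian C) (lM : loc_max M) (cm : cm_loc M n).
Hypotheses (lML : loc_max ML) (hpsi : local_map M ML psi).

Lemma local_map_unit x : ~ M x -> ~ ML (psi x).
Proof.
case: lM => _ _ hu /hu[y e] h; case: lML => hML n1 _; apply: n1.
by rewrite -(rmorph1 psi) -e rmorphM; apply: idMr.
Qed.

(* [C'] is the localization of [C[X]] at [(M, X)]. *)
Lemma adjoin_element y : ML y -> exists (C' : comNzRingType) (M' : set C')
  (psi' : {rmorphism C' -> L}), [/\ noetherian C', loc_max M', cm_loc M' n.+1,
    local_map M' ML psi' & (exists c, psi' c = y) /\ forall c, exists c', psi' c' = psi c].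
Proof.
move=> My; have pM := loc_max_prime lM; have hM := prime_ideal pM.
have hML : is_ideal ML by case: lML.
have pP := poly_max_prime pM; have hf := loc_at_frac pP.
set P := poly_max M in pP hf; pose lam : {rmorphism {poly C} -> loc_at pP} := loc_map pP.
have cfu : commr_rmorph psi y by move=> x; apply: mulrC.
pose f : {rmorphism {poly C} -> L} := horner_morph cfu.
have fP g : P g -> ML (f g).
  move=> Pg; have [q ->] := poly_split0 g.
  rewrite rmorphD rmorphM /= /f horner_morphX horner_morphC.
  by apply: idD => //; [apply: idMl | apply: hpsi].
have fu s : ~ P s -> exists z, f s * z = 1.
  move=> ns; case: (lML) => _ _; apply=> Ms; apply: (local_map_unit ns).
  have [q e] := poly_split0 s; move: Ms.
  rewrite {1}e rmorphD rmorphM /= /f horner_morphX horner_morphC => h.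
  by rewrite -[psi _](addKr (f q * y)); apply: idD => //; apply: idN => //; apply: idMl.
have [g hg] := frac_lift_rmorph (prime_compl1 pP) (@prime_compl_nM _ _ pP) hf fu.
exists (loc_at pP), (ext lam P P), g; split.
- exact: (frac_noetherian hf (hilbert_basis noeC)).
- exact: ext_loc_max.
- have [v [sv Mv rv rM]] := cm.
  exists (map lam (rcons (map polyC v) 'X)); split.
  + by rewrite size_map size_rcons size_map sv.
  + move=> _ /mapP[z zs ->]; apply: ext_mem => //; move: zs.
    rewrite mem_rcons inE => /orP[/eqP->|/mapP[c cv ->]]; rewrite /P /poly_max /=.
      by rewrite coefX; apply: id0.
    by rewrite coefC; apply: Mv.
  + rewrite -(ext0 pP hf); apply: reg_ext => //; apply/reg_rcons => //.
    have e0 : poly_ext [set 0] = [set (0 : {poly C})].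
      apply/seteqP; split=> [h hh|_ -> i]; last by rewrite coef0.
      by apply/polyP => i; rewrite coef0; apply: hh.
    split; first by rewrite -e0; apply: reg_poly_ext.
    by rewrite -e0 -poly_ext_gen //; apply: nzd_poly_extX.
  + move=> z [a [s [Pa ns e]]].
    have [k hk] : radical (lin (rcons (map polyC v) 'X)) a.
      have hr := radical_ideal (lin_ideal (rcons (map polyC v) 'X)).
      have [q ->] := poly_split0 a; apply: idD => //.
        apply: idMl => //; exists 1%N; apply: lin_mem.
        by rewrite mem_rcons inE expr1 eqxx.
      have [k hk] := rM _ Pa; exists k; rewrite -rmorphXn.
      rewrite lin_rcons; apply: gen_base => //.
      move/linP: hk => [h eh]; apply/linP; exists (fun i => (h i)%:P).
      rewrite eh rmorph_sum size_map; apply: eq_bigr => i _.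
      by rewrite rmorphM (nth_map 0).
    exists k; rewrite /lin -(ext0 pP hf); apply/(gen_frac pP hf) => //.
    exists (a ^+ k), (s ^+ k); split=> //; first exact: prime_nX.
    by rewrite !rmorphXn -e exprMn.
- move=> z [a [s [Pa ns e]]]; have [v ev] := fu _ ns.
  rewrite -(mulr1 (g z)) -ev mulrA -(hg s) -rmorphM e hg.
  by apply: idMr => //; apply: fP.
- split; first by exists (lam 'X); rewrite hg /f /= horner_morphX.
  by move=> c; exists (lam c%:P); rewrite hg /f /= horner_morphC.
Qed.

End Adjoin.

(** * F-rational local rings *)

Section Preimage.
Variables (A B : comNzRingType) (f : {rmorphism A -> B}).
Implicit Types (I : set B).

Definition pre I : set A := [set a | I (f a)].

Lemma pre_ideal I : is_ideal I -> is_ideal (pre I).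
Proof.
move=> hI; split=> [|x y hx hy|a x hx]; rewrite /pre /=.
- by rewrite rmorph0; apply: id0.
- by rewrite rmorphD; apply: idD.
- by rewrite rmorphM; apply: idMl.
Qed.

Lemma pre_prime I : is_prime I -> is_prime (pre I).
Proof.
move=> [hI n1 hM]; split; first exact: pre_ideal.
  by rewrite /pre /= rmorph1.
by move=> x y; rewrite /pre /= rmorphM => /hM.
Qed.

Lemma lin_map s z : lin s z -> lin (map f s) (f z).
Proof.
move=> /linP[h ->]; apply/linP; exists (fun i => f (h i)).
rewrite rmorph_sum size_map; apply: eq_bigr => i _.
by rewrite rmorphM (nth_map 0).
Qed.

Lemma pows_map s q : pows (map f s) q = map f (pows s q).
Proof. by rewrite /pows -!map_comp; apply: eq_map => x /=; rewrite rmorphXn. Qed.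

Hypothesis surj : forall b, exists a, f a = b.

Lemma pre_gen I s : pre (gen I (map f s)) = gen (pre I) s.
Proof.
elim: s => [//|x s ih]; apply/seteqP; split=> z.
  move=> [b hb]; have [a ea] := surj b; exists a; apply/(set_eqP ih).
  by rewrite /pre /= rmorphB rmorphM ea.
by move=> [a /(set_eqP ih)]; rewrite /pre /= rmorphB rmorphM => ha; exists (f a).
Qed.

Lemma pre_areg c I s : areg c (pre I) s -> areg (f c) I (map f s).
Proof.
elim: s I => [//|x s ih] I [hx hs] /=; split.
  move=> b; have [a <-] := surj b; rewrite -!rmorphM; exact: hx.
by apply: ih; rewrite (pre_gen I [:: x]).
Qed.

Lemma pre_chain n (c : nat -> set B) : prime_chain n c ->
  prime_chain n (fun i => pre (c i)).
Proof.
move=> [pc cc]; split=> i hi; first exact/pre_prime/pc.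
have [s1 n1] := cc i hi; split; first by move=> x; apply: s1.
by move=> h; apply: n1 => b; have [a <-] := surj b; apply: h.
Qed.

Lemma image_noetherian : noetherian A -> noetherian B.
Proof.
move=> noeA I hI; have [s es] := noeth_fg noeA (pre_ideal hI).
exists (map f s); rewrite ideal_genE; apply/seteqP; split=> b.
  have [a <-] := surj b => Ia; apply: lin_map.
  by apply/(set_eqP es).
apply: lin_min => // _ /mapP[a sa ->].
by have : lin s a by [exact: lin_mem]; move=> /(set_eqP es).
Qed.

End Preimage.

Section Packaging.
Variables (p : nat) (L : comNzRingType).
Hypotheses (pL : p \in [pchar L]) (domL : domain L).
Implicit Types (M : set L) (s : seq L).

Definition image_of_cm := exists (C : comNzRingType) (M : set C) (n : nat)
  (psi : {rmorphism C -> L}), [/\ noetherian C, loc_max M, cm_loc M n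
    & forall y, exists c, psi c = y].

Definition frat M n := [/\ noetherian L, loc_max M, krull_dim L n, cm_loc M n
  & forall s, sop M n s -> TC p s].

Lemma cm_regA M n s : noetherian L -> loc_max M -> cm_loc M n -> sop M n s ->
  reg [set 0] s.
Proof. by move=> noeL lM cm [ss Ms rM]; apply: (cm_sop_reg noeL lM cm). Qed.

Lemma local_of_TC M s : noetherian L -> loc_max M -> krull_dim L (size s) ->
  all_in s M -> rad_sub M (lin s) -> TC p s -> F_rational_local p L.
Proof.
move=> noeL lM dimL Ms rM Ts.
have hloc := loc_max_is_local lM.
exists M => //; exists s; last by apply/(tightly_closedE pL domL).
split=> //; rewrite ideal_genE; apply: radical_primary => //; first by case: hloc.
by apply: lin_min => //; case: lM.
Qed.

Lemma krull_dim_sop M s (c : nat -> set L) : noetherian L -> loc_max M -> all_in s M ->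
  rad_sub M (lin s) -> prime_chain (size s) c -> krull_dim L (size s).
Proof.
move=> noeL lM Ms rM hc; split; first by exists c.
move=> [c' hc']; have := krull_height noeL lM (is_ideal0 _) Ms rM hc'.
rewrite ltnn => h; suff : false by []; apply: h.
by move=> _ ->; apply: id0; apply: prime_ideal; have [h _] := hc'; apply: h.
Qed.

(** Lift the parameters to C and apply colon capturing to the kernel of psi. The resulting uniform
    multiplier is removed by tight closedness, so L is Cohen-Macaulay; then regular sequences can be
    exchanged and every system of parameters is tightly closed. *)
Theorem frat_of_local : image_of_cm -> F_rational_local p L -> exists M n, frat M n.
Proof.
move=> [C [MC [n [psi [noeC lMC cmC surj]]]]] [M hloc [xs [dimL xsM prim] tc]].
have noeL := image_noetherian surj noeC.
have lM := is_local_loc_max noeL hloc.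
rewrite ideal_genE in prim; have [_ radM] := prim.
have rM : rad_sub M (lin xs) by move=> x; rewrite -radM.
have Txs : TC p xs by apply/(tightly_closedE pL domL).
have Mxs : all_in xs M by move=> x /xsM.
pose Q := pre psi [set 0].
have pQ : is_prime Q by apply: pre_prime; exact: domain_prime0.
have QM : Q `<=` MC by apply: loc_max_sub lMC (prime_ideal pQ) _; case: pQ.
have preM x : M (psi x) -> MC x.
  case: lMC => _ _ hu Mx; apply: contrapT => /hu[y e].
  case: lM => hM n1 _; apply: n1; rewrite -(rmorph1 psi) -e rmorphM.
  exact: idMr.
have Mpre x : MC x -> M (psi x).
  case: lM => _ _ hu Mx; apply: contrapT => /hu[y e].
  have [z ez] := surj y; case: lMC => hMC n1 _; apply: n1.
  rewrite -(subrK (x * z) 1); apply: idD => //; last exact: idMr.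
  by apply: QM; rewrite /Q /pre /= rmorphB rmorphM rmorph1 ez e subrr.
have [s es] : exists s : seq C, map psi s = xs.
  elim: (xs) => [|x s [t <-]]; first by exists [::].
  by have [y <-] := surj x; exists (y :: t).
have [[c hc] _] := dimL.
have Ms : all_in s MC by move=> x xs'; apply: preM; apply: Mxs; rewrite -es map_f.
have rMC : rad_sub MC (gen Q s).
  move=> x /Mpre/rM[k hk]; exists k.
  have h := set_eqP (pre_gen surj [set 0] s) (x ^+ k).
  by apply/h; rewrite /pre /= es rmorphXn.
have hcC := pre_chain surj hc.
have [||c0 nc0 hc0] := colon_capturing noeC lMC cmC pQ Ms rMC (ch := fun i => pre psi (c i)).
- by rewrite -(size_map psi) es.
- move=> x; rewrite /pre /= => ->; apply: id0; apply: prime_ideal.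
  by have [h _] := hc; apply: h.
have npc0 : psi c0 <> 0 by move=> e; apply: nc0.
have rxs : reg [set 0] xs.
  apply: (TC_reg pL domL noeL lM Mxs npc0) => // e.
  by rewrite -es pows_map; apply: (pre_areg surj); apply: hc0; apply: p_gt0 pL e.
have cm : cm_loc M (size xs) by exists xs.
exists M, (size xs); split=> // w hw.
apply: (TC_sop pL domL noeL lM (n := size xs) _ _ _ hw Txs).
- by move=> t; apply: cm_regA.
- by move=> t st Mt rt; split=> //; apply: (reg_primary noeL lM cm).
- by split.
Qed.

Lemma frat_reg M n s : frat M n -> sop M n s -> reg [set 0] s.
Proof. by move=> [noeL lM _ cm _]; apply: cm_regA. Qed.

Lemma frat_reg_sop M n s : frat M n -> size s = n -> all_in s M -> reg [set 0] s ->
  sop M n s.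
Proof. by move=> [noeL lM _ cm _] ss Ms rs; split=> //; apply: (reg_primary noeL lM cm). Qed.

Lemma frat_prefix M n s t : frat M n -> sop M n (s ++ t) -> TC p s.
Proof.
move=> hF hs; have [noeL lM _ cm Tall] := hF.
have hM : is_ideal M by case: lM.
suff H w : sop M n (s ++ t ++ w) -> TC p (s ++ t) -> TC p s.
  by apply: (H [::]); rewrite ?cats0 //; apply: Tall.
elim/last_ind: t w {hs} => [|t y ih] w; first by rewrite cats0.
rewrite -rcons_cat cat_rcons => hs Ts; apply: (ih (y :: w)) => //.
have [_ /all_in_cat[_ /all_in_cat[_ /all_in_cons[My _]]] _] := hs.
apply: (TC_drop_last pL domL noeL lM My (c := 1)) Ts; first by apply/eqP; rewrite oner_eq0.
move=> e z; rewrite mul1r; move: z.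
have := frat_reg hF (sop_pows lM (p_gt0 pL e) hs).
by rewrite catA /pows map_cat => /reg_cat[//|_ []].
Qed.

End Packaging.

(** * Localization of F-rationality *)

Section Isomorphism.

Lemma frac_iso (A L L' : comNzRingType) (lam : {rmorphism A -> L})
  (lam' : {rmorphism A -> L'}) (P : set A) : is_prime P -> is_frac lam P ->
  is_frac lam' P -> exists (g : {rmorphism L -> L'}) (h : {rmorphism L' -> L}),
    cancel g h /\ cancel h g.
Proof.
move=> pP hf hf'.
have [n1 nM] := (prime_compl1 pP, @prime_compl_nM _ _ pP).
have [g hg] := frac_lift_rmorph (f := lam') n1 nM hf (let: And3 hu _ _ := hf' in hu).
have [h hh] := frac_lift_rmorph (f := lam) n1 nM hf' (let: And3 hu _ _ := hf in hu).
exists g, h; split=> y.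
  case: (hf) => _ /(_ y)[a [s [ns e]]] _; apply: (frac_cancel hf ns).
  by rewrite -{1}(hh s) -(hg s) -!rmorphM e hg hh.
case: (hf') => _ /(_ y)[a [s [ns e]]] _; apply: (frac_cancel hf' ns).
by rewrite -{1}(hg s) -(hh s) -!rmorphM e hh hg.
Qed.

Lemma F_rational_local_iso (p : nat) (L L' : comNzRingType) (g : {rmorphism L -> L'})
  (h : {rmorphism L' -> L}) (N : set L) : p \in [pchar L] -> domain L -> loc_max N ->
  cancel g h -> cancel h g -> F_rational_local p L -> F_rational_local p L'.
Proof.
move=> pL domL lN gK hK [M hloc [xs [dimL xsM prim] tc]].
have lM : loc_max M by rewrite (is_local_uniq hloc (loc_max_is_local lN)).
have domL' : domain L'.
  move=> x y e; have /domL[] : h x * h y = 0 by rewrite -rmorphM e rmorph0.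
    by move=> e'; left; rewrite -(hK x) e' rmorph0.
  by move=> e'; right; rewrite -(hK y) e' rmorph0.
have pL' := rmorph_pchar g pL.
have surjg y : exists x, g x = y by exists (h y).
have surjh x : exists y, h y = x by exists (g x).
rewrite ideal_genE in prim; have [_ radM] := prim.
have lM' : loc_max (pre h M).
  have pM := pre_prime h (loc_max_prime lM); have [hI n1 _] := pM.
  split=> // y; case: lM => _ _ hu /hu[z ez]; exists (g z).
  by rewrite -(hK y) -rmorphM ez rmorph1.
have lin_h s z : lin (map g s) z <-> lin s (h z).
  split=> [/(lin_map h)|/(lin_map g)]; last by rewrite hK.
  by rewrite -map_comp (eq_map (g := id)) ?map_id // => x /=; rewrite gK.
have hloc' := loc_max_is_local lM'.
exists (pre h M) => //; exists (map g xs).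
  split.
  - rewrite size_map; have [[c hc] nc] := dimL; split.
      exists (fun i => pre h (c i)); exact: (pre_chain surjh hc).
    move=> [c' hc']; apply: nc; exists (fun i => pre g (c' i)).
    exact: (pre_chain surjg hc').
  - by move=> _ /mapP[x xs_x ->]; rewrite /pre /= gK; apply: xsM.
  - rewrite ideal_genE; apply: radical_primary => //; first by case: hloc'.
      apply: lin_min; first by case: lM'.
      by move=> _ /mapP[x xs_x ->]; rewrite /pre /= gK; apply: xsM.
    move=> x; rewrite /pre /= -radM => -[k hk]; exists k.
    by apply/lin_h; rewrite rmorphXn.
apply/(tightly_closedE pL' domL') => z [c nc [e0 hz]].
have /(tightly_closedE pL domL) Txs := tc.
apply/lin_h; apply: Txs; exists (h c).
  by move=> e; apply: nc; rewrite -(hK c) e rmorph0.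
exists e0 => e /hz; rewrite pows_map => /lin_h.
by rewrite rmorphM rmorphXn.
Qed.

Lemma F_rational_local_frac (p : nat) (A L L' : comNzRingType) (lam : {rmorphism A -> L})
  (lam' : {rmorphism A -> L'}) (P : set A) : is_prime P -> p \in [pchar L] -> domain L ->
  is_frac lam P -> is_frac lam' P -> F_rational_local p L -> F_rational_local p L'.
Proof.
move=> pP pL domL hf hf'; have [g [h [gK hK]]] := frac_iso pP hf hf'.
exact: (F_rational_local_iso pL domL (ext_loc_max pP hf) gK hK).
Qed.

Lemma frac_domain (A L : comNzRingType) (lam : {rmorphism A -> L}) (P : set A) :
  is_prime P -> is_frac lam P -> domain A -> domain L.
Proof.
move=> pP hf domA x y e.
have p0 : is_prime [set (0 : A)].
  exact: domain_prime0.
have : is_prime (ext lam P [set 0]).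
  by apply: ext_prime => // _ ->; apply: id0; apply: prime_ideal.
by rewrite ext0 // => -[_ _]; apply.
Qed.

End Isomorphism.

Section ImageOfCM.

Lemma cm_start (R : comNzRingType) (m : set R) : noetherian R -> loc_max m ->
  image_of_excellent_CM R -> exists (C : comNzRingType) (M : set C) (n : nat)
  (psi : {rmorphism C -> R}), [/\ noetherian C, loc_max M, cm_loc M n,
    local_map M m psi & forall y, exists c, psi c = y].
Proof.
move=> noeR lm [B [f [_ [_ hB] surj]]].
have pm := loc_max_prime lm; have pn := pre_prime f pm.
have mn : is_maximal (pre f m).
  have [hn n1 _] := pn; split=> // J hJ nJ.
  have [e|/existsNP[x /not_implyP[Jx nx]]] := pselect (J `<=` pre f m).
    by left; apply/seteqP; split.
  right; apply/seteqP; split=> // y _; apply: ideal1 => //.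
  case: lm => _ _ /(_ _ nx)[z ez]; have [w ew] := surj z.
  rewrite -(subrK (x * w) 1); apply: idD => //; last exact: idMr.
  apply: nJ; rewrite /pre /= rmorphB rmorphM rmorph1 ew ez subrr.
  by apply: id0; apply: prime_ideal.
have [noeC [M [n [hloc dimC [[v [vM rv]] _]]]]] := hB _ pn mn.
have lM := is_local_loc_max noeC hloc.
have hf := loc_at_frac pn.
have fu s : ~ pre f m s -> exists y, f s * y = 1 by case: lm => _ _ hu /hu.
have [psi hpsi] := frac_lift_rmorph (prime_compl1 pn) (@prime_compl_nM _ _ pn) hf fu.
exists (loc_at pn), M, n, psi; split=> //.
- exists v; have Mv : all_in v M by move=> x xv; apply: vM.
  have rv' : reg [set 0] v.
    suff H k : (k <= size v)%N -> reg [set 0] (take k v).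
      by rewrite -(take_size v); apply: H.
    elim: k => [|k ih] hk; first by rewrite take0.
    rewrite (take_nth 0) //; apply/reg_rcons => //; split; first exact/ih/ltnW.
    by move=> y; have := rv k hk y; rewrite ideal_genE.
  split=> //; first by rewrite size_tuple.
  apply: (@reg_primary_dim _ noeC M n v lM _ (size_tuple v) Mv rv').
  move=> k c hc; rewrite leqNgt; apply/negP => lt; have [_] := dimC; apply.
  by exists c; apply: prime_chain_take hc.
- move=> x; rewrite (is_local_uniq hloc (loc_max_is_local (ext_loc_max pn hf))).
  move=> [a [s [na ns e]]]; have [y ey] := fu _ ns.
  have [hm _ _] := lm; rewrite -(mulr1 (psi x)) -ey mulrA -hpsi -rmorphM e hpsi.
  exact: idMr.
- by move=> y; have [b <-] := surj y; exists (loc_map pn b); rewrite hpsi.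
Qed.

Lemma adjoin_elements (C L : comNzRingType) (M : set C) (ML : set L) n
  (psi : {rmorphism C -> L}) ys : noetherian C -> loc_max M -> cm_loc M n ->
  loc_max ML -> local_map M ML psi -> all_in ys ML ->
  exists (C' : comNzRingType) (M' : set C') (n' : nat) (psi' : {rmorphism C' -> L}),
  [/\ noetherian C', loc_max M', cm_loc M' n', local_map M' ML psi' &
   (forall y, y \in ys -> exists c, psi' c = y) /\
    forall c, exists c', psi' c' = psi c].
Proof.
move=> noeC lM cm lML; elim: ys C M n psi noeC lM cm => [|y ys ih] C M n psi noeC lM cm hpsi.
  by exists C, M, n, psi; split=> //; split=> // c; exists c.
move=> /all_in_cons[My Mys].
have [C1 [M1 [psi1 [noe1 lM1 cm1 loc1 [[c1 e1] sur1]]]]] :=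
  adjoin_element noeC lM cm lML hpsi My.
have [C2 [M2 [n2 [psi2 [noe2 lM2 cm2 loc2 [ysur sur2]]]]]] :=
  ih _ _ _ _ noe1 lM1 cm1 loc1 Mys.
exists C2, M2, n2, psi2; split=> //; split=> [z|c].
  rewrite inE => /orP[/eqP->|/ysur//].
  by have [c2 e2] := sur2 c1; exists c2; rewrite e2.
by have [c' <-] := sur1 c.
Qed.

(** One variable is adjoined to C for each member of ys. The image is a subring that contains R and
    ys, and it is closed under inverses because C' is local and maps locally to L; [gen_L] then says
    that it is all of L. *)
Lemma image_of_cm_ext (R L : comNzRingType) (m : set R) (ML : set L)
  (iota : {rmorphism R -> L}) ys : noetherian R -> loc_max m -> image_of_excellent_CM R ->
  loc_max ML -> local_map m ML iota -> all_in ys ML ->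
  (forall T : set L, T 1 -> (forall x y, T x -> T y -> T (x - y)) ->
    (forall x y, T x -> T y -> T (x * y)) -> (forall x y, T x -> x * y = 1 -> T y) ->
    (forall r, T (iota r)) -> (forall y, y \in ys -> T y) -> forall y, T y) ->
  image_of_cm L.
Proof.
move=> noeR lm hR lML hi Mys gen_L.
have [C [M [n [psi [noeC lM cm lpsi surj]]]]] := cm_start noeR lm hR.
pose psi0 : {rmorphism C -> L} := iota \o psi.
have lpsi0 : local_map M ML psi0 by move=> x /lpsi/hi.
have [C' [M' [n' [psi' [noeC' lM' cm' lpsi' [ysur sur]]]]]] :=
  adjoin_elements noeC lM cm lML lpsi0 Mys.
exists C', M', n', psi'; split=> //.
apply: gen_L => //.
- by exists 1; rewrite rmorph1.
- by move=> x y [c <-] [d <-]; exists (c - d); rewrite rmorphB.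
- by move=> x y [c <-] [d <-]; exists (c * d); rewrite rmorphM.
- move=> x y [c <-] e; case: (lM') => _ _ hu.
  have [|d ed] := hu c.
    move=> /lpsi' Mc; case: lML => hML n1 _; apply: n1.
    by rewrite -e; apply: idMr.
  exists d; rewrite -(mulr1 (psi' d)) -e mulrA -rmorphM mulrC (mulrC d).
  by rewrite ed rmorph1 mulr1.
- by move=> r; have [c <-] := surj r; apply: sur.
Qed.

End ImageOfCM.

Section LocalizeFRational.
Variables (p : nat) (A : comNzRingType) (M Q : set A) (n : nat).
Hypotheses (pA : p \in [pchar A]) (domA : domain A) (hF : frat p M n) (pQ : is_prime Q).

Let noeA : noetherian A. Proof. by case: hF. Qed.
Let lM : loc_max M. Proof. by case: hF. Qed.
Let cmA : cm_loc M n. Proof. by case: hF. Qed.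

(* [sigma] lies in the minimal primes of [z] other than [Q], with a power that
   is locally in [lin z] there; then [sigma ^ q] kills the components of
   [lin (pows z q)] away from [Q]. *)
Lemma uniform_denominator z : all_in z M -> reg [set 0] z -> assoc (lin z) Q ->
  exists2 sigma, ~ Q sigma & forall e v s, ~ Q s -> lin (pows z (p ^ e)) (s * v) ->
    lin (pows z (p ^ e)) (sigma ^+ (p ^ e) * v).
Proof.
move=> Mz rz aQ; have hM : is_ideal M by case: lM.
have [v [sv Mv rv]] := cm_reg_extend noeA lM cmA Mz rz.
have szv : sop M n (z ++ v).
  apply: (frat_reg_sop hF); rewrite ?size_cat //; first exact/all_in_cat.
  exact/reg_cat.
have [N [F hFz]] := assoc_finite noeA (lin_ideal z).
have [s0 [s0Q hs0]] : exists s0, ~ Q s0 /\ forall P, assoc (lin z) P -> P <> Q -> P s0.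
  pose G i := if `[< F i = Q >] then setT else F i.
  have [|||b [_ nb hb]] := @prime_inter A N G setT Q pQ (is_idealT _).
  - move=> i hi; rewrite /G; case: asboolP => _; first exact: is_idealT.
    by have [pF _] : assoc (lin z) (F i) by [apply/hFz; exists i]; apply: prime_ideal.
  - move=> i hi; rewrite /G; case: asboolP => [_ h|nF h].
      by case: pQ => _ n1 _; apply: n1; apply: h.
    apply: nF; apply: (cm_assoc_minimal noeA lM cmA Mz rz aQ) => //.
      by have [] : assoc (lin z) (F i) by apply/hFz; exists i.
    by apply: assoc_sub => //; apply/hFz; exists i.
  - by move=> h; case: pQ => _ n1 _; apply: n1; apply: h.
  exists b; split=> // P /hFz[i hi eP] nP.
  by have := hb i hi; rewrite /G; case: asboolP => [e|_]; [case: nP; rewrite eP | rewrite eP].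
have pw P : assoc (lin z) P -> P <> Q -> exists k, exists2 t, ~ P t & lin z (t * s0 ^+ k).
  move=> aP nP; have Ps0 := hs0 P aP nP; have [pP _] := aP.
  apply: contrapT => H.
  have [|P' [pP' zP' P'P ns0]] := @prime_below A (lin z) P s0 noeA (lin_ideal z) pP.
    by move=> s k ns h; apply: H; exists k, s.
  by apply: ns0; rewrite (cm_assoc_minimal noeA lM cmA Mz rz aP pP' zP' P'P).
have [K hK] : exists K, forall P, assoc (lin z) P -> P <> Q ->
    exists2 t, ~ P t & lin z (t * s0 ^+ K).
  have [K hK] : exists K, forall i, (i < N)%N -> F i <> Q ->
      exists2 t, ~ F i t & lin z (t * s0 ^+ K).
    have : forall i, (i < N)%N -> assoc (lin z) (F i).
      by move=> i hi; apply/hFz; exists i.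
    elim: N {hFz} => [|N ih] aF; first by exists 0%N.
    have [|K hK] := ih; first by move=> i hi; apply: aF; apply: leqW.
    have [e|ne] := pselect (F N = Q).
      exists K => i; rewrite ltnS leq_eqVlt => /orP[/eqP->//|]; exact: hK.
    have [k [t nt ht]] := pw _ (aF N (leqnn _)) ne.
    exists (K + k)%N => i; rewrite ltnS leq_eqVlt => /orP[/eqP-> _|hi nQ].
      by exists t => //; rewrite addnC exprD mulrA; apply: idMr.
    have [t' nt' ht'] := hK i hi nQ.
    by exists t' => //; rewrite exprD mulrA; apply: idMr.
  by exists K => P /hFz[i hi ->]; apply: hK.
exists (s0 ^+ K); first exact: prime_nX.
move=> e w s ns hsw; apply: contrapT => nw.
have hq := p_gt0 pA e; set q := (p ^ e)%N in hq hsw nw.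
(* Otherwise an associated prime P' of the q-th powers contains s and all elements killing sigma^q
   w. By unmixedness P' is associated to z and differs from Q, so some t outside P' has t sigma in
   (z); then t^q kills sigma^q w and lies in P', a contradiction. *)
have [g [ng [pg wg]]] := assoc_over noeA (lin_ideal _) nw.
set P' := colon (lin (pows z q)) g in pg wg.
have aP' : assoc (lin (pows z q)) P' by split=> //; exists g.
have P's : P' s by apply: wg; rewrite /colon /= mulrCA; apply: idMl.
have zP' : lin z `<=` P'.
  apply: lin_min; first exact: prime_ideal.
  move=> x xz; apply: (primeX (n := q)) => //; apply: (assoc_sub (lin_ideal _) aP').
  by apply: lin_mem; apply/mapP; exists x.
have [P aP PP'] := assoc_below noeA (lin_ideal z) pg zP'.
have rzq : reg [set 0] (pows z q ++ v).
  apply: (frat_reg hF); have [s1 s2 s3] := szv; split.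
  - by rewrite size_cat size_map -size_cat.
  - by apply/all_in_cat; split=> //; apply: all_in_pows.
  apply: rad_trans s3 _ => // x; rewrite mem_cat => /orP[xz|xv].
    exists q; apply: lin_mem; rewrite mem_cat; apply/orP; left.
    by apply/mapP; exists x.
  by exists 1%N; apply: lin_mem; rewrite mem_cat xv orbT.
have [rq rqv] := proj1 (reg_cat _ _ (is_ideal0 A)) rzq.
have [pP _] := aP.
have eP : P = P'.
  apply: (cm_assoc_minimal noeA lM cmA _ rq aP' pP) => //; first exact: all_in_pows.
  apply: lin_min; first exact: prime_ideal.
  move=> _ /mapP[x xz ->]; rewrite -(prednK hq) exprS; apply: idMr; first exact: prime_ideal.
  by apply: (assoc_sub (lin_ideal z) aP); apply: lin_mem.
have nPQ : P <> Q by move=> e'; apply: ns; rewrite -e' eP.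
have [t nt ht] := hK P aP nPQ.
have := lin_frob pA e ht; rewrite exprMn -/q => htq.
apply: (prime_nX (n := q) pP nt); rewrite eP; apply: wg.
by rewrite /colon /= mulrA; apply: idMr.
Qed.

(** A maximal regular sequence z in Q is part of a system of parameters, hence tightly closed. A
    relation over the localization has a denominator that varies with e; [uniform_denominator]
    trades it for sigma^q, so sigma a rather than a is in the tight closure of (z), and sigma is a
    unit at Q. *)
Lemma localize_frat (L : comNzRingType) (lam : {rmorphism A -> L}) : is_frac lam Q ->
  exists (s : seq L) (c : nat -> set L), [/\ all_in s (ext lam Q Q),
    rad_sub (ext lam Q Q) (lin s), prime_chain (size s) c & TC p s].
Proof.
move=> hf; have hQ := prime_ideal pQ.
have QM : Q `<=` M by apply: loc_max_sub lM hQ _; case: pQ.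
have [z [Qz rz aQ]] := cm_max_reg noeA lM cmA pQ.
have Mz : all_in z M by move=> x /Qz/QM.
have [sigma nsig hsig] := uniform_denominator Mz rz aQ.
have zQ : lin z `<=` Q by exact: lin_min.
have [c [hc ec _]] := reg_chain_below noeA (is_ideal0 _) rz pQ zQ.
have [v [sv Mv rv]] := cm_reg_extend noeA lM cmA Mz rz.
have Tz : TC p z.
  apply: (frat_prefix pA domA hF (t := v)); apply: (frat_reg_sop hF).
  - by rewrite size_cat.
  - exact/all_in_cat.
  - exact/reg_cat.
exists (map lam z), (fun i => ext lam Q (c i)); split.
- by move=> _ /mapP[x xz ->]; apply: ext_mem => //; apply: Qz.
- move=> y [a [s [Qa ns e]]].
  have [k [t [nt ht]]] : exists k t, ~ Q t /\ lin z (t * a ^+ k).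
    apply: contrapT => H.
    have [|P' [pP' zP' P'Q na]] := @prime_below A (lin z) Q a noeA (lin_ideal z) pQ.
      by move=> t k nt h; apply: H; exists k, t.
    by apply: na; rewrite (cm_assoc_minimal noeA lM cmA Mz rz aQ pP' zP' P'Q).
  exists k; rewrite /lin -(ext0 pQ hf); apply/(gen_frac pQ hf) => //.
  exists (t * a ^+ k), (t * s ^+ k); split=> //.
    by apply: prime_nM => //; apply: prime_nX.
  by rewrite !rmorphM !rmorphXn -e exprMn; ring.
- by rewrite size_map; apply: frac_chain => //; rewrite ec.
move=> y [d nd [e0 hd]]; case: (hf) => hu hs hk.
have [a [s [ns ea]]] := hs y; have [b [t [nt eb]]] := hs d.
have nb : b <> 0.
  move=> e; apply: nd; apply: (frac_cancel hf nt); rewrite eb e rmorph0 mul0r.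
  by [].
have : tcl p z (sigma * a).
  exists b => //; exists e0 => e /hd; rewrite pows_map => hy.
  have : lin (map lam (pows z (p ^ e))) (lam (b * a ^+ (p ^ e))).
    rewrite rmorphM rmorphXn -eb -ea exprMn.
    rewrite (_ : _ * _ = lam t * lam s ^+ (p ^ e) * (d * y ^+ (p ^ e))); last by ring.
    exact: idMl.
  move=> /(lin_lamP pQ hf)[r [nr hr]].
  have := hsig _ _ _ nr hr; rewrite exprMn; congr (lin _ _); ring.
move=> /Tz hlin; have : lin (map lam z) (lam a).
  by apply/(lin_lamP pQ hf); exists sigma.
rewrite -ea => h; have [v' ev'] := hu _ ns.
by rewrite -(mulr1 y) -ev' mulrA; apply: idMr.
Qed.

End LocalizeFRational.

(** * The affine line over an F-rational local ring *)

Section PolyLemmas.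
Variable A : comNzRingType.
Implicit Types (f g h q r : {poly A}).

Lemma monic_div f g : f \is monic -> exists q r, g = q * f + r /\ (size r < size f)%N.
Proof.
move=> mf; exists (Pdiv.Ring.rdivp g f), (Pdiv.Ring.rmodp g f).
split; first exact: Pdiv.RingMonic.rdivp_eq.
by rewrite Pdiv.Ring.ltn_rmodp monic_neq0.
Qed.

Lemma size_monicX f n : f \is monic -> size (f ^+ n) = ((size f).-1 * n).+1.
Proof.
move=> mf; elim: n => [|n ih]; first by rewrite expr0 size_poly1 muln0.
have nf : f ^+ n != 0 by apply: monic_neq0; exact: monic_exp.
rewrite exprSr size_Mmonic // ih mulnS.
have : (0 < size f)%N by rewrite size_poly_gt0 monic_neq0.
lia.
Qed.

(** A multiple b g congruent modulo I to something of smaller degree than the monic g has leading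
    coefficient of b in I; strip it and repeat. *)
Lemma monic_small_mod (I : set A) f g b : is_ideal I -> g \is monic ->
  (size f < size g)%N -> poly_ext I (f - b * g) -> poly_ext I f.
Proof.
move=> hI mg sf; have [n] := ubnP (size b); elim: n b => [//|n ih] b /ltnSE sb hb.
have [e|nb] := eqVneq b 0; first by move: hb; rewrite e mul0r subr0.
pose k := (size b).-1; have sk : size b = k.+1 by rewrite prednK // size_poly_gt0.
have Ik : I (b`_k).
  have := hb (k + (size g).-1)%N; rewrite coefB.
  have hsf : (size f <= k + (size g).-1)%N.
    by clear -sf; move: (size f) (size g) k sf => a b' k; lia.
  rewrite (nth_default _ hsf).
  have sg : (0 < size g)%N by rewrite size_poly_gt0 monic_neq0.
  have := lead_coef_Mmonic b mg; rewrite !lead_coefE size_Mmonic // sk.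
  have -> : ((k.+1 + size g).-1.-1 = k + (size g).-1)%N by lia.
  by move=> -> h; rewrite -(opprK b`_k); apply: idN => //; rewrite -sub0r.
refine (ih (b - (b`_k)%:P * 'X^k) _ _).
  apply: leq_trans sb; rewrite sk ltnS; apply/leq_sizeP => j hj.
  rewrite coefB coefCM coefXn; have [->|ne] := eqVneq j k; first by rewrite mulr1 subrr.
  by rewrite mulr0 subr0 nth_default // sk; lia.
rewrite (_ : _ - _ = (f - b * g) + (b`_k)%:P * ('X^k * g)); last by ring.
apply: (idD (poly_ext_ideal hI)) => //.
by move=> i; rewrite coefCM; apply: idMr.
Qed.

Lemma poly_coefs_ideal (N : set {poly A}) f : is_ideal N ->
  (forall i, N (f`_i)%:P) -> N f.
Proof.
move=> hN h; rewrite -[f]coefK poly_def; apply: id_sum => // i _.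
by rewrite -mul_polyC; apply: idMr.
Qed.

Lemma lin_polyC (s : seq A) f : poly_ext (lin s) f <-> lin (map polyC s) f.
Proof.
have := set_eqP (poly_ext_gen s (is_ideal0 A)) f.
have -> : poly_ext [set 0] = [set (0 : {poly A})] => //.
apply/seteqP; split=> [h hh|_ -> i]; last by rewrite coef0.
by apply/polyP => i; rewrite coef0; apply: hh.
Qed.

Lemma poly_domain : domain A -> domain {poly A}.
Proof.
move=> domA f g e; have := poly_ext_prime (domain_prime0 domA).
have -> : poly_ext [set 0] = [set (0 : {poly A})].
  apply/seteqP; split=> [h hh|_ -> i]; last by rewrite coef0.
  by apply/polyP => i; rewrite coef0; apply: hh.
by move=> [_ _]; apply.
Qed.

Lemma poly_pchar p : p \in [pchar A] -> p \in [pchar {poly A}].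
Proof. exact: (rmorph_pchar (polyC : {rmorphism A -> {poly A}})). Qed.

(** The polynomial g^q lives in degrees divisible by q and f has degree below q, so the
    contributions to f g^q of different coefficients do not overlap. *)
Lemma coef_mul_frob p e f g i j : p \in [pchar A] -> (size f <= p ^ e)%N ->
  (j < p ^ e)%N -> (f * g ^+ (p ^ e))`_(i * p ^ e + j) = f`_j * g`_i ^+ (p ^ e).
Proof.
move=> pA sf hj; have pP := poly_pchar pA; have q0 := p_gt0 pA e.
elim/poly_ind: g i => [|h c ih] i.
  by rewrite expr0n coef0 expr0n -[(p ^ e == 0)%N]negbK -lt0n q0 /= !mulr0 coef0.
rewrite (frobD pP) exprMn mulrDr -rmorphXn coefD coefMC mulrA coefMXn.
rewrite coefD coefMX coefC; case: i => [|i].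
  by rewrite mul0n add0n hj !add0r.
have -> : (i.+1 * p ^ e + j < p ^ e)%N = false by apply/negbTE; rewrite mulSn; lia.
have -> : (i.+1 * p ^ e + j - p ^ e = i * p ^ e + j)%N by rewrite mulSn; lia.
rewrite ih (nth_default _ (n := (i.+1 * p ^ e + j)%N)) ?mul0r ?addr0 //.
by apply: leq_trans sf _; rewrite mulSn; lia.
Qed.

End PolyLemmas.

Section AffineLine.
Variables (p : nat) (A L : comNzRingType) (M : set A) (N : set {poly A}).
Variables (s : seq A) (ch : nat -> set A) (lam : {rmorphism {poly A} -> L}).
Hypotheses (pA : p \in [pchar A]) (domA : domain A) (noeA : noetherian A).
Hypotheses (lM : loc_max M) (Ms : all_in s M) (rM : rad_sub M (lin s)).
Hypotheses (hch : prime_chain (size s) ch) (Ts : TC p s).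
Hypotheses (pN : is_prime N) (hf : is_frac lam N).
Hypotheses (MN : forall a, M a -> N a%:P) (nN : ~ N `<=` poly_ext M).

Let hM : is_ideal M. Proof. by case: lM. Qed.
Let hN : is_ideal N. Proof. exact: prime_ideal. Qed.
Let hE : is_ideal (poly_ext M). Proof. exact: poly_ext_ideal. Qed.

Lemma poly_ext_sub : poly_ext M `<=` N.
Proof. by move=> f hf'; apply: poly_coefs_ideal => // i; apply: MN. Qed.

(** Take the least degree among the elements of J outside M A[X]: the leading coefficient cannot be
    in M, since its term could be removed, so it is a unit. *)
Lemma exists_monic (J : set {poly A}) : is_ideal J -> poly_ext M `<=` J ->
  ~ J `<=` poly_ext M -> exists f, [/\ J f, f \is monic
    & forall g, J g -> (size g < size f)%N -> poly_ext M g].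
Proof.
move=> hJ EJ nJ.
have ex : exists k, `[< exists f, [/\ J f, ~ poly_ext M f & size f = k] >].
  have /existsNP[f /not_implyP[Jf nf]] := nJ.
  by exists (size f); apply/asboolP; exists f.
have [k /asboolP[f [Jf nf sf]] mk] := ex_minnP ex.
have small g : J g -> (size g < k)%N -> poly_ext M g.
  move=> Jg sg; apply: contrapT => ng; have := mk (size g).
  by rewrite leqNgt sg => h; suff /h : `[< exists f, [/\ J f, ~ poly_ext M f & size f = size g] >]
    by []; apply/asboolP; exists g.
have k0 : (0 < k)%N.
  rewrite -sf size_poly_gt0; apply/eqP => e; apply: nf; rewrite e.
  exact: id0.
have nlead : ~ M f`_k.-1.
  move=> Ml; apply: nf; rewrite -(subrK ((f`_k.-1)%:P * 'X^(k.-1)) f).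
  have El : poly_ext M ((f`_k.-1)%:P * 'X^(k.-1)) by move=> i; rewrite coefCM; apply: idMr.
  apply: (idD hE) => //; apply: small; first by apply: idB => //; apply: EJ.
  rewrite -[X in (_ < X)%N](prednK k0) ltnS; apply/leq_sizeP => j hj.
  rewrite coefB coefCM coefXn; have [->|ne] := eqVneq j k.-1; first by rewrite mulr1 subrr.
  by rewrite mulr0 subr0 nth_default // sf; lia.
case: (lM) => _ _ /(_ _ nlead)[v ev].
have sv : size (v%:P * f) = k.
  apply/eqP; rewrite eqn_leq; apply/andP; split.
    by rewrite mul_polyC -sf; apply: size_scale_leq.
  rewrite leqNgt; apply/negP => lt.
  have : (v%:P * f)`_k.-1 = 0 by rewrite nth_default // -ltnS prednK.
  by rewrite coefCM mulrC ev => /eqP; rewrite oner_eq0.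
exists (v%:P * f); split.
- exact: idMl.
- by apply/monicP; rewrite lead_coefE sv coefCM mulrC.
- by move=> g Jg; rewrite sv; apply: small.
Qed.

Lemma monic_notin f : f \is monic -> ~ poly_ext M f.
Proof.
move=> /monicP mf /(_ (size f).-1); rewrite -lead_coefE mf.
by case: lM.
Qed.

(** The principal ideal argument over the field A/M: h generates N + (sg) and divides f, the
    generator of N. If h were in N, so would be sg; hence the cofactor is in N, has degree at least
    that of f, and h = 1. *)
Lemma N_maximal sg : ~ N sg -> exists t, N (1 - t * sg).
Proof.
move=> nsg; have [f [Nf mf smallf]] := exists_monic hN poly_ext_sub nN.
pose J := gen N [:: sg]; have hJ : is_ideal J by exact: gen_ideal.
have NJ : N `<=` J by move=> g; apply: gen_base.
have [|h [Jh mh smallh]] := exists_monic hJ (subset_trans poly_ext_sub NJ).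
  by move=> h; apply: (monic_notin mf); apply: h; apply: NJ.
have [q [r [ef sr]]] := monic_div f mh.
have Nr : N r.
  apply: poly_ext_sub; apply: smallh => //.
  rewrite (_ : r = f - q * h); last by rewrite ef; ring.
  by apply: idB => //; [exact: NJ | exact: idMl].
have : N (q * h).
  by rewrite (_ : q * h = f - r); [apply: idB | rewrite ef; ring].
have [_ _ hNM] := pN => /hNM[Nq|Nh]; last first.
  have [q' [r' [es sr']]] := monic_div sg mh.
  case: nsg; rewrite es; apply: idD => //; first exact: idMl.
  apply: poly_ext_sub; apply: smallh => //.
  rewrite (_ : r' = sg - q' * h); last by rewrite es; ring.
  by apply: idB => //; [apply: gen_mem; rewrite ?inE | exact: idMl].
have nq : ~ poly_ext M q.
  move=> Eq; apply: (monic_notin mf); rewrite ef; apply: (idD hE).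
    exact: (idMr _ hE).
  apply: smallh => //; exact: NJ.
have q0 : q != 0 by apply/eqP => e; apply: nq; rewrite e; exact: id0.
have sqf : (size f <= size q)%N by rewrite leqNgt; apply/negP => /(smallf _ Nq).
have sh : (size h <= 1)%N.
  have sqh : size (q * h) = (size q + size h).-1 by rewrite size_Mmonic.
  rewrite -size_poly_gt0 in q0.
  have sfq : size f = size (q * h) by rewrite ef size_polyDl // sqh; move: sr q0; lia.
  have := monic_neq0 mh; rewrite -size_poly_gt0; move: sqf q0; rewrite sfq sqh; lia.
have : J 1.
  have h1 : h = 1.
    rewrite (size1_polyC sh); have := monicP mh; rewrite lead_coefE.
    have -> : (size h).-1 = 0%N by move: sh; lia.
    by move=> ->.
  by rewrite -h1.
by move=> /gen1P[t ht]; exists t.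
Qed.

(** The parameters are s and the monic f. After reduction modulo f, the element gam g1^q has smaller
    degree than f^q for large q, so f^q drops out of the relation by [monic_small_mod], and
    comparing coefficients leaves tight closure relations for the coefficients of g1 over A. *)
Theorem affine_line_F_rational : F_rational_local p L.
Proof.
have domP := poly_domain domA; have domL := frac_domain pN hf domP.
have pP := poly_pchar pA; have pL := rmorph_pchar lam pP.
have noeL := frac_noetherian hf (hilbert_basis noeA).
have lL := ext_loc_max pN hf.
have [f [Nf mf smallf]] := exists_monic hN poly_ext_sub nN.
pose S := rcons (map polyC s) f.
have NS x : x \in S -> N x.
  rewrite mem_rcons inE => /orP[/eqP->//|/mapP[a sa ->]]; exact/MN/Ms.
have rN : rad_sub N (lin S).
  move=> g Ng; have hr := radical_ideal (lin_ideal S).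
  suff : radical (lin S) g by [].
  have [q [r [eg sr]]] := monic_div g mf.
  have Er : poly_ext M r.
    apply: smallf => //; rewrite (_ : r = g - q * f); last by rewrite eg; ring.
    by apply: idB => //; exact: idMl.
  rewrite eg; apply: idD => //.
    apply: idMl => //; exists 1%N; rewrite expr1; apply: lin_mem.
    by rewrite mem_rcons inE eqxx.
  apply: poly_coefs_ideal => // i; have [k hk] := rM (Er i).
  exists k; rewrite -rmorphXn /S lin_rcons; apply: gen_base => //.
  exact: (lin_map (polyC : {rmorphism A -> {poly A}}) hk).
have NSa : all_in (map lam S) (ext lam N N).
  by move=> _ /mapP[x xS ->]; apply: ext_mem => //; apply: NS.
have rNS : rad_sub (ext lam N N) (lin (map lam S)).
  move=> y [a [t [Na nt e]]]; have [k hk] := rN _ Na.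
  exists k; rewrite /lin -(ext0 pN hf); apply/(gen_frac pN hf) => //.
  exists (a ^+ k), (t ^+ k); split=> //; first exact: prime_nX.
  by rewrite !rmorphXn -e exprMn.
have dimL : krull_dim L (size (map lam S)).
  have [pc cc] := hch.
  have chM i : (i <= size s)%N -> ch i `<=` M.
    move=> /pc pi; apply: loc_max_sub lM (prime_ideal pi) _; by case: pi.
  have hc1 : prime_chain (size s) (fun i => poly_ext (ch i)).
    split=> i hi; first exact/poly_ext_prime/pc.
    have [s1 /existsNP[a /not_implyP[ha na]]] := cc i hi; split.
      by move=> g hg j; apply: s1.
    move=> /(_ a%:P) h; apply: na; have := h _ 0%N; rewrite coefC; apply.
    move=> j; rewrite coefC; case: eqP => // _; apply: id0.
    exact/prime_ideal/pc.
  have lt : poly_ext (ch (size s)) `<` N.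
    split; first by move=> g hg; apply: poly_ext_sub => i; apply: (chM _ (leqnn _)).
    by move=> h; apply: nN => g /h hg i; apply: (chM _ (leqnn _)).
  have hc2 := prime_chain_rcons pN lt hc1.
  apply: (krull_dim_sop noeL lL NSa rNS); rewrite size_map size_rcons size_map.
  by apply: (frac_chain pN hf hc2); rewrite ltnn.
apply: (local_of_TC pL domL noeL lL dimL NSa rNS).
move=> z [c nc [e0 hz]]; case: (hf) => hu hs _.
have [g [t [nt et]]] := hs z; have [gam [u [nu eu]]] := hs c.
have ngam : gam <> 0.
  by move=> e; apply: nc; apply: (frac_cancel hf nu); rewrite eu e rmorph0 mul0r.
have [q [g1 [eg sg1]]] := monic_div g mf.
suff hg1 : lin (map polyC s) g1.
  have [v ev] := hu _ nt; rewrite -(mulr1 z) -ev mulrA et; apply: idMr => //.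
  apply: lin_map; rewrite eg; apply: idD => //.
    by apply: idMl => //; apply: lin_mem; rewrite mem_rcons inE eqxx.
  by rewrite /S lin_rcons; apply: gen_base.
apply/lin_polyC => i.
have [j nj] : exists j, gam`_j <> 0.
  apply: contrapT => H; apply: ngam; apply/polyP => j; rewrite coef0.
  by apply: contrapT => nj; apply: H; exists j.
apply: Ts; exists gam`_j => //; exists (maxn e0 (size gam)) => e.
rewrite geq_max => /andP[he hsg].
have sq : (size gam <= p ^ e)%N.
  apply: leq_trans hsg (ltnW _); apply: ltn_expl; apply: prime_gt1.
  exact: (pcharf_prime pA).
have hgam : lin (pows S (p ^ e)) (gam * g1 ^+ (p ^ e)).
  have hg : lin (pows S (p ^ e)) (gam * g ^+ (p ^ e)).
    have : lin (map lam (pows S (p ^ e))) (lam (gam * g ^+ (p ^ e))).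
      rewrite rmorphM rmorphXn -eu -et exprMn -pows_map.
      rewrite (_ : _ * _ = lam u * lam t ^+ (p ^ e) * (c * z ^+ (p ^ e))); last by ring.
      by apply: idMl => //; apply: hz.
    move=> /(lin_lamP pN hf)[r [nr hr]].
    (* The denominator r depends on e, but it is a unit modulo the N-primary ideal generated by the
       q-th powers. *)
    apply: (rad_cancel (M := N)) hr => //; first exact: rad_pows.
    exact: N_maximal.
  rewrite (_ : g1 = g - q * f); last by rewrite eg; ring.
  rewrite (frobB pP) mulrBr; apply: idB => //; apply: idMl => //.
  rewrite exprMn; apply: idMl => //; apply: lin_mem.
  by apply/mapP; exists f => //; rewrite mem_rcons inE eqxx.
rewrite -(coef_mul_frob g1 i pA sq); last first.
  apply: leq_trans sq; rewrite ltnNge; apply/negP => /(nth_default 0) e'.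
  by apply: nj.
move: hgam; rewrite /S pows_rcons lin_rcons => /gen1P[b].
rewrite (pows_map (polyC : {rmorphism A -> {poly A}})) => /lin_polyC hb.
have := monic_small_mod (lin_ideal _) (monic_exp (p ^ e) mf) _ hb; apply.
rewrite size_monicX // ltnS.
have q0 := p_gt0 pA e.
have [->|g1n] := eqVneq g1 0; first by rewrite expr0n -[(p ^ e == 0)%N]negbK -lt0n q0 mulr0 size_poly0.
apply: leq_trans (size_polyMleq _ _) _.
have := size_poly_exp_leq g1 (p ^ e); rewrite -size_poly_gt0 in g1n.
have : ((size g1).-1 * p ^ e + p ^ e <= (size f).-1 * p ^ e)%N.
  by rewrite -mulSnr leq_mul2r; apply/orP; right; move: sg1 g1n; lia.
by move: sq; lia.
Qed.

End AffineLine.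

(** * Elements of the Rees algebras *)

Section ReesElements.
Variables (A : comNzRingType) (I : set A).
Implicit Types (a b c r : A) (i j k n : nat).
Local Notation S := (rees_algebra I).
Local Notation Ip := (ideal_pow I).
Implicit Types (f g : S).

Lemma Ip_ideal n : is_ideal (Ip n). Proof. exact: ideal_pow_ideal. Qed.
Hint Resolve Ip_ideal : core.

Lemma Ip0 n : Ip n 0. Proof. exact: (id0 (Ip_ideal n)). Qed.
Lemma IpD n a b : Ip n a -> Ip n b -> Ip n (a + b). Proof. exact: (idD (Ip_ideal n)). Qed.
Lemma IpMl n a b : Ip n b -> Ip n (a * b). Proof. exact: (idMl a (Ip_ideal n)). Qed.
Lemma IpMr n a b : Ip n b -> Ip n (b * a). Proof. exact: (idMr a (Ip_ideal n)). Qed.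
Lemma IpX k n a : Ip n a -> Ip (n * k) (a ^+ k).
Proof.
move=> h; elim: k => [|k ih]; first by rewrite muln0.
by rewrite exprS mulnS; apply: ideal_powM.
Qed.
Lemma Ip_leq i j a : (i <= j)%N -> Ip j a -> Ip i a. Proof. by move=> h; apply: ideal_powS. Qed.
Lemma Ip1 a : Ip 1 a <-> ideal_gen I a.
Proof.
split; move: a.
  apply: ideal_gen_min; first exact: ideal_gen_ideal.
  by move=> _ [x [y [Ix _ ->]]]; apply: (idMr y (ideal_gen_ideal I)); apply: ideal_gen_mem.
apply: ideal_gen_min => // x Ix; apply: ideal_gen_mem.
by exists x, 1; rewrite mulr1.
Qed.

Definition rcoef (f : S) i : A := (rees_val f)`_i.

Lemma rcoefP f i : Ip i (rcoef f i).
Proof. by case: f => f h; have /asboolP := h. Qed.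

Lemma rcoef_inj f g : (forall i, rcoef f i = rcoef g i) -> f = g.
Proof. by move=> h; apply/val_inj/polyP. Qed.

Definition mkrees (f : {poly A}) (h : forall i, Ip i f`_i) : S :=
  @ReesElement _ _ f (asboolT h).

Lemma rcoefD f g i : rcoef (f + g) i = rcoef f i + rcoef g i.
Proof. by rewrite /rcoef -[rees_val _]/(val (f + g)) rmorphD coefD. Qed.
Lemma rcoefN f i : rcoef (- f) i = - rcoef f i.
Proof. by rewrite /rcoef -[rees_val _]/(val (- f)) rmorphN coefN. Qed.
Lemma rcoefB f g i : rcoef (f - g) i = rcoef f i - rcoef g i.
Proof. by rewrite rcoefD rcoefN. Qed.
Lemma rcoef0 i : rcoef 0 i = 0.
Proof. by rewrite /rcoef -[rees_val _]/(val (0 : S)) rmorph0 coef0. Qed.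
Lemma rcoef1 i : rcoef 1 i = (i == 0)%:R.
Proof. by rewrite /rcoef -[rees_val _]/(val (1 : S)) rmorph1 coef1. Qed.
Lemma rcoef_sum (T : Type) (r : seq T) (P : pred T) (F : T -> S) i :
  rcoef (\sum_(j <- r | P j) F j) i = \sum_(j <- r | P j) rcoef (F j) i.
Proof.
elim/big_rec2: _ => [|j x y _ <-]; first exact: rcoef0.
exact: rcoefD.
Qed.
Lemma rees_val_inj f g : rees_val f = rees_val g -> f = g.
Proof. exact: val_inj. Qed.
Lemma val_reesM f g : rees_val (f * g) = rees_val f * rees_val g.
Proof. exact: (rmorphM (val : S -> {poly A})). Qed.
Lemma val_reesX f n : rees_val (f ^+ n) = rees_val f ^+ n.
Proof. exact: (rmorphXn (val : S -> {poly A})). Qed.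
Lemma rcoefM f g i : rcoef (f * g) i = \sum_(j < i.+1) rcoef f j * rcoef g (i - j).
Proof. by rewrite /rcoef val_reesM coefM. Qed.
Lemma rcoef0M f g : rcoef (f * g) 0 = rcoef f 0 * rcoef g 0.
Proof. by rewrite rcoefM big_ord1. Qed.

(* [c t^i], for [c] in [I^i] (and [0] otherwise) *)
Definition st c i : S := insubd (0 : S) (c%:P * 'X^i).

Lemma mon_rees c i : Ip i c -> c%:P * 'X^i \in rees_pred I.
Proof.
move=> h; apply/asboolP => j; rewrite coefCM coefXn.
by case: eqP => [->|_]; rewrite ?mulr1 ?mulr0 //; exact: Ip0.
Qed.

Lemma val_st c i : Ip i c -> rees_val (st c i) = c%:P * 'X^i.
Proof. by move=> h; apply: (@insubdK _ _ S); apply: mon_rees. Qed.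

Lemma rcoef_st c i j : Ip i c -> rcoef (st c i) j = if j == i then c else 0.
Proof.
move=> h; rewrite /rcoef val_st // coefCM coefXn.
by case: eqP; rewrite ?mulr1 ?mulr0.
Qed.

Lemma rcoef_stM c i f j : Ip i c ->
  rcoef (st c i * f) j = if (j < i)%N then 0 else c * rcoef f (j - i).
Proof.
move=> h; rewrite /rcoef val_reesM val_st // -mulrA coefCM coefXnM.
by case: ifP; rewrite ?mulr0.
Qed.

Lemma stM c i b j : Ip i c -> Ip j b -> st c i * st b j = st (c * b) (i + j).
Proof.
move=> hc hb; apply: rees_val_inj; rewrite val_reesM !val_st //; last exact: ideal_powM.
by rewrite rmorphM exprD; ring.
Qed.

Lemma stX c i k : Ip i c -> st c i ^+ k = st (c ^+ k) (i * k).
Proof.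
move=> hc; apply: rees_val_inj; rewrite val_reesX !val_st //; last exact: IpX.
by rewrite exprMn -rmorphXn exprM.
Qed.

Lemma stD c b i : Ip i c -> Ip i b -> st (c + b) i = st c i + st b i.
Proof.
move=> hc hb; apply: rcoef_inj => j; rewrite rcoefD !rcoef_st //; last exact: IpD.
by case: ifP; rewrite ?addr0.
Qed.

Lemma stN c i : Ip i c -> st (- c) i = - st c i.
Proof.
move=> hc; apply: rcoef_inj => j; rewrite rcoefN !rcoef_st //; last exact: ideal_powN.
by case: ifP; rewrite ?oppr0.
Qed.

Definition sconst c : S := st c 0.

Lemma sconst_zmod : zmod_morphism sconst.
Proof. by move=> a b; rewrite /sconst stD // stN. Qed.
Lemma sconst_monoid : monoid_morphism sconst.
Proof.
split=> [|a b]; last by rewrite /sconst stM.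
by apply: rcoef_inj => i; rewrite rcoef_st // rcoef1; case: i.
Qed.
HB.instance Definition _ := GRing.isZmodMorphism.Build A S sconst sconst_zmod.
HB.instance Definition _ := GRing.isMonoidMorphism.Build A S sconst sconst_monoid.

Lemma rcoef_sconst c i : rcoef (sconst c) i = if i == 0%N then c else 0.
Proof. by rewrite rcoef_st. Qed.
Lemma rcoef_sconstM c f i : rcoef (sconst c * f) i = c * rcoef f i.
Proof. by rewrite rcoef_stM // subn0. Qed.

Lemma rees_sum f : f = \sum_(i < size (rees_val f)) st (rcoef f i) i.
Proof.
apply: rcoef_inj => j; rewrite rcoef_sum.
under eq_bigr => i _ do rewrite (rcoef_st _ (rcoefP f i)).
have [lt|le] := ltnP j (size (rees_val f)).
  rewrite (bigD1 (Ordinal lt)) //= eqxx big1 ?addr0 // => i /eqP ne.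
  by case: eqP => // e; case: ne; apply: val_inj.
rewrite big1 => [|i _]; first exact: nth_default.
by case: eqP => // e; have := ltn_ord i; rewrite -e ltnNge le.
Qed.

Lemma rees_ind (T : set S) : T 0 -> (forall x y, T x -> T y -> T (x + y)) ->
  (forall c i, Ip i c -> T (st c i)) -> forall f, T f.
Proof.
move=> T0 TD Tm f; rewrite (rees_sum f); elim/big_ind: _ => // i _.
by apply: Tm; apply: rcoefP.
Qed.

End ReesElements.

#[global] Hint Resolve Ip_ideal Ip0 : core.

Section LaurentElements.
Variables (A : comNzRingType).
Local Notation L := (laurent A).
Implicit Types (x y : L) (f g : {poly A}).

Lemma laurent_rep x : exists f n, x = laurent_frac f n.
Proof.
have [f [s ->]] := Localization.frac_surj x.
have [n _ en] := Localization.denP s; exists f, n.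
by apply: Localization.frac_eq; rewrite /= en.
Qed.

Definition laurent_num x := projT1 (cid (laurent_rep x)).
Definition laurent_den x := projT1 (cid (projT2 (cid (laurent_rep x)))).
Lemma laurent_numK x : x = laurent_frac (laurent_num x) (laurent_den x).
Proof. exact: (projT2 (cid (projT2 (cid (laurent_rep x))))). Qed.

(* the coefficient of [t^i], for [i >= 0] *)
Definition lcoef x i := (laurent_num x)`_(i + laurent_den x).

Lemma lcoef_frac f n i : lcoef (laurent_frac f n) i = f`_(i + n).
Proof.
set x := laurent_frac f n; have /laurent_frac_inj := laurent_numK x.
move=> /(congr1 (fun h : {poly A} => h`_(i + n + laurent_den x))).
by rewrite !coefMXn !ltnNge leq_addl addnAC leq_addl /= !addnK addnAC addnK => ->.
Qed.

Lemma lcoefB x y i : lcoef (x - y) i = lcoef x i - lcoef y i.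
Proof.
rewrite {1}(laurent_numK x) {1}(laurent_numK y) laurent_fracB lcoef_frac coefB.
rewrite !coefMXn !ltnNge.
have -> : (laurent_den y <= i + (laurent_den x + laurent_den y))%N by lia.
have -> : (laurent_den x <= i + (laurent_den x + laurent_den y))%N by lia.
by rewrite /lcoef /= addnA addnK addnAC addnK.
Qed.

Lemma lcoef0 i : lcoef 0 i = 0.
Proof. by rewrite -(subrr 0) lcoefB subrr. Qed.
Lemma lcoefN x i : lcoef (- x) i = - lcoef x i.
Proof. by rewrite -sub0r lcoefB lcoef0 sub0r. Qed.
Lemma lcoefD x y i : lcoef (x + y) i = lcoef x i + lcoef y i.
Proof. by rewrite -{1}(opprK y) lcoefB lcoefN opprK. Qed.

Definition lpoly f : L := laurent_frac f 0.
Lemma lpoly_zmod : zmod_morphism lpoly.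
Proof. by move=> f g; rewrite /lpoly laurent_fracB expr0 !mulr1. Qed.
Lemma lpoly_monoid : monoid_morphism lpoly.
Proof. by split=> [|f g]; rewrite /lpoly ?laurent_fracM // laurent_frac1. Qed.
HB.instance Definition _ := GRing.isZmodMorphism.Build {poly A} L lpoly lpoly_zmod.
HB.instance Definition _ := GRing.isMonoidMorphism.Build {poly A} L lpoly lpoly_monoid.

Definition lu : L := laurent_frac 1 1.
Lemma lu_X : lu * lpoly 'X = 1.
Proof.
rewrite /lu /lpoly laurent_fracM mul1r laurent_frac1.
by apply: Localization.frac_eq; rewrite /= expr0 expr1 mulr1 mul1r.
Qed.
Lemma lpolyXn_lu n : lpoly 'X^n * lu ^+ n = 1.
Proof. by rewrite rmorphXn -exprMn mulrC lu_X expr1n. Qed.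
Lemma luX k : lu ^+ k = laurent_frac 1 k.
Proof.
elim: k => [|k ih]; first by rewrite expr0 laurent_frac1.
by rewrite exprS ih laurent_fracM mulr1.
Qed.
Lemma laurent_fracE f n : laurent_frac f n = lpoly f * lu ^+ n.
Proof. by rewrite luX /lpoly laurent_fracM mulr1 add0n. Qed.

Lemma lpoly_inj : injective lpoly.
Proof. by move=> f g /laurent_frac_inj; rewrite expr0 !mulr1. Qed.

End LaurentElements.

Section ExtReesElements.
Variables (A : comNzRingType) (I : set A).
Implicit Types (c r : A) (i j k n : nat).
Local Notation S := (rees_algebra I).
Local Notation E := (ext_rees_algebra I).
Local Notation Ip := (ideal_pow I).
Implicit Types (x y : E) (f g : S).

Lemma incl_subproof (f : S) : lpoly (rees_val f) \in ext_rees_pred I.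
Proof. by apply/ext_rees_predE => i; rewrite subn0; apply: rcoefP. Qed.
Definition incl (f : S) : E := ExtReesElement (incl_subproof f).

Lemma val_ext_inj x y : ext_rees_val x = ext_rees_val y -> x = y.
Proof. exact: val_inj. Qed.
Lemma val_extM x y : ext_rees_val (x * y) = ext_rees_val x * ext_rees_val y.
Proof. exact: (rmorphM (val : E -> laurent A)). Qed.
Lemma val_extD x y : ext_rees_val (x + y) = ext_rees_val x + ext_rees_val y.
Proof. exact: (rmorphD (val : E -> laurent A)). Qed.
Lemma val_extB x y : ext_rees_val (x - y) = ext_rees_val x - ext_rees_val y.
Proof. exact: (rmorphB (val : E -> laurent A)). Qed.
Lemma val_ext1 : ext_rees_val (1 : E) = 1.
Proof. exact: (rmorph1 (val : E -> laurent A)). Qed.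
Lemma val_ext0 : ext_rees_val (0 : E) = 0.
Proof. exact: (rmorph0 (val : E -> laurent A)). Qed.
Lemma val_extX x n : ext_rees_val (x ^+ n) = ext_rees_val x ^+ n.
Proof. exact: (rmorphXn (val : E -> laurent A)). Qed.

Lemma incl_zmod : zmod_morphism incl.
Proof.
move=> f g; apply: val_ext_inj; by rewrite val_extB /= -rmorphB.
Qed.
Lemma incl_monoid : monoid_morphism incl.
Proof.
split=> [|f g]; apply: val_ext_inj.
  by rewrite val_ext1 /= -[RHS](rmorph1 (@lpoly A)).
by rewrite val_extM -[LHS]/(lpoly (rees_val (f * g))) val_reesM rmorphM.
Qed.
HB.instance Definition _ := GRing.isZmodMorphism.Build S E incl incl_zmod.
HB.instance Definition _ := GRing.isMonoidMorphism.Build S E incl incl_monoid.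

Lemma incl_inj : injective incl.
Proof. by move=> f g /(congr1 (@ext_rees_val A I))/lpoly_inj/val_inj. Qed.

Lemma eu_subproof : lu A \in ext_rees_pred I.
Proof.
apply/ext_rees_predE => i; rewrite coef1; case: eqP => [->|_]; last exact: Ip0.
by rewrite sub0n.
Qed.
Definition eu : E := ExtReesElement eu_subproof.

Definition econst : {rmorphism A -> E} := incl \o @sconst A I.

Definition ecoef x i := lcoef (ext_rees_val x) i.

Lemma ecoefD x y i : ecoef (x + y) i = ecoef x i + ecoef y i.
Proof. by rewrite /ecoef val_extD lcoefD. Qed.
Lemma ecoefB x y i : ecoef (x - y) i = ecoef x i - ecoef y i.
Proof. by rewrite /ecoef val_extB lcoefB. Qed.
Lemma ecoef0 i : ecoef 0 i = 0.
Proof. by rewrite /ecoef val_ext0 lcoef0. Qed.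
Lemma ecoef_sum (T : Type) (r : seq T) (P : pred T) (F : T -> E) i :
  ecoef (\sum_(j <- r | P j) F j) i = \sum_(j <- r | P j) ecoef (F j) i.
Proof.
elim/big_rec2: _ => [|j x y _ <-]; first exact: ecoef0.
exact: ecoefD.
Qed.
Lemma ecoef_incl f i : ecoef (incl f) i = rcoef f i.
Proof. by rewrite /ecoef /= /lpoly lcoef_frac addn0. Qed.

Lemma ext_rep x : exists (f : {poly A}) n, ext_rees_val x = laurent_frac f n /\
  forall i, Ip (i - n) f`_i.
Proof.
have [f [n e]] := laurent_rep (ext_rees_val x); exists f, n; split=> //.
by apply/ext_rees_predE; rewrite -e; case: x {e}.
Qed.

Lemma ecoefP x i : Ip i (ecoef x i).
Proof.
have [f [n [e h]]] := ext_rep x; rewrite /ecoef e lcoef_frac.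
by have := h (i + n)%N; rewrite addnK.
Qed.

Lemma ecoef_euM k x i : ecoef (eu ^+ k * x) i = ecoef x (i + k).
Proof.
have [f [n [e h]]] := ext_rep x; rewrite /ecoef val_extM val_extX e /= luX.
by rewrite laurent_fracM mul1r !lcoef_frac addnA.
Qed.

Lemma ecoef_stM c k x i : Ip k c ->
  ecoef (incl (st I c k) * x) (i + k) = c * ecoef x i.
Proof.
move=> hc; have [f [n [e h]]] := ext_rep x.
rewrite /ecoef val_extM e /= val_st // /lpoly laurent_fracM !lcoef_frac.
rewrite -mulrA coefCM coefXnM ltnNge add0n addnAC leq_addl /=.
by rewrite addnK.
Qed.

Lemma ecoef_stM_ex c k x i : Ip k c ->
  exists2 b, Ip (i - k) b & ecoef (incl (st I c k) * x) i = c * b.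
Proof.
move=> hc; have [f [n [e h]]] := ext_rep x.
have eq : ecoef (incl (st I c k) * x) i = c * ('X^k * f)`_(i + n).
  by rewrite /ecoef val_extM e /= val_st // /lpoly laurent_fracM lcoef_frac -mulrA coefCM.
rewrite {}eq; exists ('X^k * f)`_(i + n) => //.
rewrite coefXnM; case: ltnP => [_|le]; first exact: Ip0.
by apply: Ip_leq (h _); lia.
Qed.

Lemma ecoef_constM c x i : ecoef (econst c * x) i = c * ecoef x i.
Proof. by have := @ecoef_stM c 0 x i; rewrite addn0; apply. Qed.

Lemma eu_st c k : Ip k.+1 c -> eu * incl (st I c k.+1) = incl (st I c k).
Proof.
move=> hc; have hc' : Ip k c by apply: Ip_leq hc.
apply: val_ext_inj; rewrite val_extM /= !val_st // exprS mulrCA rmorphM mulrA.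
by rewrite lu_X mul1r.
Qed.

Lemma euX_st c k i : Ip (k + i) c -> eu ^+ k * incl (st I c (k + i)) = incl (st I c i).
Proof.
elim: k => [|k ih] hc; first by rewrite expr0 mul1r.
rewrite exprSr -mulrA eu_st // ih //; by apply: Ip_leq hc; rewrite addSn.
Qed.

Lemma ext_rees_sum x : exists n, exists2 f : {poly A}, (forall i, Ip (i - n) f`_i) &
  x = \sum_(i < size f) (if (i < n)%N then econst f`_i * eu ^+ (n - i)
                         else incl (st I f`_i (i - n))).
Proof.
have [f [n [e h]]] := ext_rep x; exists n, f => //; apply: val_ext_inj.
rewrite -[ext_rees_val (\sum__ _)]/(val _) rmorph_sum /= e laurent_fracE.
rewrite -[f in LHS]coefK poly_def rmorph_sum mulr_suml; apply: eq_bigr => i _.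
rewrite -mul_polyC; have hi := h i; case: ltnP => hin.
  rewrite val_extM val_extX /= val_st // expr0 mulr1 rmorphM -mulrA; congr (_ * _).
  by rewrite -{1}(subnKC (ltnW hin)) exprD mulrA lpolyXn_lu mul1r.
rewrite /= val_st // rmorphM rmorphM -mulrA; congr (_ * _).
by rewrite -{1}(subnK hin) exprD rmorphM -mulrA lpolyXn_lu mulr1.
Qed.

Lemma ext_rees_ind (T : set E) : T 0 -> (forall x y, T x -> T y -> T (x + y)) ->
  (forall c i, Ip i c -> T (incl (st I c i))) ->
  (forall c i, T (econst c * eu ^+ i.+1)) -> forall x, T x.
Proof.
move=> T0 TD Tm Tu x; have [n [f hf ->]] := ext_rees_sum x.
elim/big_ind: _ => // i _; case: ltnP => h; last exact: Tm.
by rewrite -(prednK (n := (n - i)%N)) // subn_gt0.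
Qed.

Lemma ext_rees_split x : exists y f, x = eu * y + incl f.
Proof.
move: x; apply: ext_rees_ind => [|x y [x1 [f ->]] [y1 [g ->]]|c i hc|c i].
- by exists 0, 0; rewrite mulr0 rmorph0 addr0.
- by exists (x1 + y1), (f + g); rewrite rmorphD; ring.
- by exists 0, (st I c i); rewrite mulr0 add0r.
- by exists (econst c * eu ^+ i), 0; rewrite rmorph0 addr0 exprS; ring.
Qed.

Lemma laurent_compl1 : ~ (~` @powers_of_X A) 1. Proof. by apply; exact: powers_of_X1. Qed.
Lemma laurent_complM s t : ~ (~` @powers_of_X A) s -> ~ (~` @powers_of_X A) t ->
  ~ (~` @powers_of_X A) (s * t).
Proof.
move=> /contrapT hs /contrapT ht; apply; exact: powers_of_XM.
Qed.
Lemma laurent_is_frac : is_frac (@lpoly A) (~` @powers_of_X A).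
Proof.
split=> [s /contrapT[n _ <-]|y|f e].
- by exists (lu A ^+ n); rewrite rmorphXn -exprMn mulrC lu_X expr1n.
- have [f [n ->]] := laurent_rep y; exists f, 'X^n; split; first by apply; exists n.
  by rewrite laurent_fracE -mulrA rmorphXn -exprMn lu_X expr1n mulr1.
- exists 1; split; first exact: laurent_compl1.
  by rewrite mul1r; apply: lpoly_inj; rewrite e rmorph0.
Qed.

Lemma ext_rees_lift (Z : comNzRingType) (h : {rmorphism {poly A} -> Z}) (v : Z) :
  h 'X * v = 1 -> exists g : {rmorphism E -> Z}, [/\ forall f, g (incl f) = h (rees_val f),
    g eu = v & forall x (f : {poly A}) n, ext_rees_val x = laurent_frac f n ->
      g x = h f * v ^+ n].
Proof.
move=> hv; have hu s : ~ (~` @powers_of_X A) s -> exists w, h s * w = 1.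
  by move=> /contrapT[n _ <-]; exists (v ^+ n); rewrite rmorphXn -exprMn hv expr1n.
have [g hg] := frac_lift_rmorph laurent_compl1 laurent_complM laurent_is_frac hu.
have gu : g (lu A) = v.
  by rewrite -(mulr1 (g _)) -hv mulrA -hg -rmorphM lu_X rmorph1 mul1r.
exists (g \o (val : {rmorphism E -> laurent A})); split=> [f|//|x f n e] /=; first exact: hg.
by rewrite -[val x]/(ext_rees_val x) e laurent_fracE rmorphM rmorphXn gu hg.
Qed.

End ExtReesElements.

(** * Syzygies, generators and primes of the Rees algebras *)

Lemma pre_maximal (A B : comNzRingType) (f : {rmorphism A -> B}) (m : set B) :
  (forall b, exists a, f a = b) -> loc_max m -> is_maximal (pre f m).
Proof.
move=> surj lm; have pm := loc_max_prime lm; have [hn n1 _] := pre_prime f pm.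
split=> // J hJ nJ.
have [e|/existsNP[x /not_implyP[Jx nx]]] := pselect (J `<=` pre f m).
  by left; apply/seteqP; split.
right; apply/seteqP; split=> // y _; apply: ideal1 => //.
case: lm => _ _ /(_ _ nx)[z ez]; have [w ew] := surj z.
rewrite -(subrK (x * w) 1); apply: idD => //; last exact: idMr.
apply: nJ; rewrite /pre /= rmorphB rmorphM rmorph1 ew ez subrr.
by apply: id0; apply: prime_ideal.
Qed.

Lemma domain_rmorph_inj (A B : comNzRingType) (f : {rmorphism A -> B}) :
  injective f -> domain B -> domain A.
Proof.
move=> f_inj domB x y e; have /domB[h|h] : f x * f y = 0 by rewrite -rmorphM e rmorph0.
  by left; apply: f_inj; rewrite rmorph0.
by right; apply: f_inj; rewrite rmorph0.
Qed.

Lemma frac_inj (A L : comNzRingType) (lam : {rmorphism A -> L}) (P : set A) :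
  is_prime P -> is_frac lam P -> domain A -> injective lam.
Proof.
move=> pP [_ _ hk] domA a b e.
have /hk[s [ns es]] : lam (a - b) = 0 by rewrite rmorphB e subrr.
case/domA: es => [e0|/eqP]; last by rewrite subr_eq0 => /eqP.
by case: ns; rewrite e0; apply: id0; apply: prime_ideal.
Qed.

Lemma lin_cat0 (A : comNzRingType) (s : seq A) z : lin (rcons s 0) z -> lin s z.
Proof.
apply: lin_min => // x; rewrite mem_rcons inE => /orP[/eqP->|]; first exact: id0.
exact: lin_mem.
Qed.

Section Syzygies.
Variables (A : comNzRingType) (M : set A) (n : nat).
Hypothesis regA : forall s, sop M n s -> reg [set 0] s.

(** Reorder the parameters so that the j-th comes last; its coefficient is then in the ideal of the
    others by regularity. *)
Lemma sop_syz s (f : nat -> A) j : sop M n s -> (j < size s)%N ->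
  \sum_(i < size s) f i * s`_i = 0 -> lin s (f j).
Proof.
move=> hs hj e; pose s' := take j s ++ drop j.+1 s.
have es : s = take j s ++ s`_j :: drop j.+1 s by rewrite -drop_nth // cat_take_drop.
have mem : s =i rcons s' s`_j.
  by move=> y; rewrite {1}es mem_rcons /s' !(inE, mem_cat) orbCA.
have sz : size s = size (rcons s' s`_j).
  by rewrite {1}es size_rcons /s' !size_cat /= addnS.
have h : nzd (lin s') s`_j := sop_rcons_nzd regA (sop_eq_mem sz mem hs).
have : lin s' (f j).
  apply: h; rewrite mulrC; move: e; rewrite (bigD1 (Ordinal hj)) //= => /eqP.
  rewrite addr_eq0 => /eqP->; apply: idN => //; apply: id_sum => // i ni.
  apply: idMl => //; apply: lin_mem; rewrite /s' mem_cat.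
  have {}ni : (i : nat) <> j by move=> e; move/eqP: ni; apply; apply: val_inj.
  have [lt|le] := ltnP i j; apply/orP; [left|right].
    by rewrite -(nth_take 0 lt); apply: mem_nth; rewrite size_take; case: ifP => //; have := ltn_ord i; lia.
  have lt : (j < i)%N by rewrite ltn_neqAle le andbT; apply/eqP => e; exact: ni.
  have -> : s`_i = (drop j.+1 s)`_(i - j.+1) by rewrite nth_drop subnKC.
  by apply: mem_nth; rewrite size_drop; apply: ltn_sub2r (ltn_ord i); apply: leq_ltn_trans lt (ltn_ord i).
by apply: gen_subseq => // y; rewrite mem => ys; rewrite mem_rcons inE ys orbT.
Qed.

Hypothesis lM : loc_max M.

Lemma sop_colon_all s t a b v : sop M n (s ++ t) ->
  lin (pows s (a + b) ++ t) (\prod_(y <- s) y ^+ a * v) -> (0 < b)%N ->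
  lin (pows s b ++ t) v.
Proof.
move=> hs + b0; have hM : is_ideal M by case: lM.
elim: s t v hs => [|y s ih] t v hs; first by rewrite big_nil mul1r.
rewrite big_cons /=; set w := \prod_(y <- s) _ => hv.
have mem c u : y ^+ c :: u ++ t =i rcons (u ++ t) (y ^+ c) by move=> z; rewrite mem_rcons.
have hs' : sop M n (rcons (pows s (a + b) ++ t) y).
  have [ss Ms rs] := hs; split.
  - by rewrite -ss size_rcons !size_cat size_map.
  - move: Ms => /= /all_in_cons[My /all_in_cat[Ms Mt]]; apply/all_in_rcons; split=> //.
    by apply/all_in_cat; split=> //; apply: all_in_pows => //; rewrite addn_gt0 b0 orbT.
  - apply: rad_trans rs _ => // z /=; rewrite inE mem_cat => /or3P[/eqP->|zs|zt].
    + by exists 1%N; apply: lin_mem; rewrite mem_rcons inE expr1 eqxx.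
    + exists (a + b)%N; apply: lin_mem; rewrite mem_rcons inE mem_cat.
      by apply/orP; right; apply/orP; left; apply/mapP; exists z.
    + by exists 1%N; apply: lin_mem; rewrite mem_rcons inE expr1 mem_cat zt !orbT.
have h1 : lin (rcons (pows s (a + b) ++ t) (y ^+ b)) (w * v).
  by apply: (sop_colon regA (a := a) hs'); rewrite -(eq_lin (mem _ _)) mulrA.
have hsb : sop M n (s ++ y ^+ b :: t).
  have e1 : size (rcons (s ++ t) (y ^+ b)) = size (s ++ y ^+ b :: t).
    by rewrite size_rcons !size_cat /= addnS.
  apply: (sop_eq_mem e1).
    by move=> z; rewrite mem_rcons !(inE, mem_cat) orbCA.
  have e2 : size (y :: s ++ t) = size (rcons (s ++ t) y) by rewrite size_rcons.
  have e3 : y :: s ++ t =i rcons (s ++ t) y by move=> z; rewrite mem_rcons.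
  have hy : sop M n (rcons (s ++ t) y) := sop_eq_mem e2 e3 hs.
  exact: (sop_rconsX lM).
have := ih (y ^+ b :: t) v hsb; rewrite (@eq_lin _ (pows s b ++ y ^+ b :: t) (y ^+ b :: pows s b ++ t)).
  apply; rewrite (@eq_lin _ _ (rcons (pows s (a + b) ++ t) (y ^+ b))) //.
  by move=> z; rewrite mem_rcons !(inE, mem_cat) orbCA.
by move=> z; rewrite !(inE, mem_cat) orbCA.
Qed.

End Syzygies.

Section Domains.
Variables (R : idomainType) (I : set R).
Local Notation S := (rees_algebra I).
Local Notation E := (ext_rees_algebra I).

Lemma idom_domain : domain R.
Proof. by move=> x y /eqP; rewrite mulf_eq0 => /orP[]/eqP; [left|right]. Qed.

Lemma laurent_domain : domain (laurent R).
Proof.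
move=> x y; have [f [n ->]] := laurent_rep x; have [g [k ->]] := laurent_rep y.
rewrite laurent_fracM => e.
have e0 : laurent_frac (0 : {poly R}) 0 = 0 := rmorph0 (@lpoly R).
rewrite -e0 in e; have := laurent_frac_inj e; rewrite mul0r expr0 mulr1 => e1.
case: (poly_domain idom_domain e1) => ->; [left|right];
  by rewrite laurent_fracE rmorph0 mul0r.
Qed.

Lemma ext_rees_domain : domain E.
Proof.
apply: (@domain_rmorph_inj _ _ (val : {rmorphism E -> laurent R})) laurent_domain.
exact: val_inj.
Qed.

Lemma rees_domain : domain S.
Proof. exact: (domain_rmorph_inj (@incl_inj R I)) ext_rees_domain. Qed.

End Domains.

Section Generation.
Variables (A L : comNzRingType) (I : set A) (gs : seq A) (T : set L).
Local Notation S := (rees_algebra I).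
Local Notation E := (ext_rees_algebra I).
Hypothesis eI : I = lin gs.
Hypotheses (T1 : T 1) (TB : forall x y, T x -> T y -> T (x - y))
  (TM : forall x y, T x -> T y -> T (x * y)).

Lemma sub_T0 : T 0. Proof. by rewrite -(subrr 1); apply: TB. Qed.
Lemma sub_TD x y : T x -> T y -> T (x + y).
Proof. by move=> hx hy; rewrite -(opprK y); apply: TB => //; rewrite -sub0r; apply: TB => //; exact: sub_T0. Qed.

Lemma rees_generated (lam : {rmorphism S -> L}) : (forall c, T (lam (sconst I c))) ->
  (forall g, g \in gs -> T (lam (st I g 1))) -> forall f, T (lam f).
Proof.
move=> Tc Tg; have hI : is_ideal I by rewrite eI.
have I1 b : I b -> ideal_pow I 1 b by move=> Ib; apply/Ip1; apply: ideal_gen_mem.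
have Tb b : I b -> T (lam (st I b 1)).
  move=> /(set_eqP eI b) hb; suff [] : ideal_pow I 1 b /\ T (lam (st I b 1)) by [].
  move: b hb; apply: lin_min => [|g hg]; last first.
    by split; [apply: I1; apply/(set_eqP eI); apply: lin_mem | apply: Tg].
  split=> [|x y [hx Tx] [hy Ty]|a x [hx Tx]].
  - split=> //; rewrite (_ : st I 0 1 = 0) ?rmorph0; first exact: sub_T0.
    by apply: rcoef_inj => i; rewrite rcoef_st // rcoef0 if_same.
  - by split; [exact: IpD | rewrite stD // rmorphD; apply: sub_TD].
  - split; first exact: IpMl.
    rewrite -(add0n 1%N) -stM // rmorphM; apply: TM => //; exact: Tc.
have Ti i c : ideal_pow I i c -> T (lam (st I c i)).
  elim: i c => [|i ih] c hc; first exact: Tc.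
  suff [] : ideal_pow I i.+1 c /\ T (lam (st I c i.+1)) by [].
  move: c hc; apply: ideal_gen_min => [|_ [b [c [Ib hc ->]]]]; last first.
    split; first by apply: ideal_gen_mem; exists b, c.
    by rewrite -add1n -stM ?rmorphM //; [apply: TM; [exact: Tb|exact: ih] | exact: I1].
  split=> [|x y [hx Tx] [hy Ty]|a x [hx Tx]].
  - split=> //; rewrite (_ : st I 0 i.+1 = 0) ?rmorph0; first exact: sub_T0.
    by apply: rcoef_inj => j; rewrite rcoef_st // rcoef0 if_same.
  - by split; [exact: IpD | rewrite stD // rmorphD; apply: sub_TD].
  - split; first exact: IpMl.
    rewrite -(add0n i.+1) -stM // rmorphM; apply: TM => //; exact: Tc.
apply: rees_ind => [|x y|c i /Ti//]; first by rewrite rmorph0; exact: sub_T0.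
by rewrite rmorphD; apply: sub_TD.
Qed.

Lemma ext_rees_generated (lam : {rmorphism E -> L}) : (forall c, T (lam (econst I c))) ->
  T (lam (eu I)) -> (forall g, g \in gs -> T (lam (incl (st I g 1)))) ->
  forall e, T (lam e).
Proof.
move=> Tc Tu Tg.
have Ti f : T (lam (incl f)).
  by apply: (@rees_generated (lam \o @incl A I)).
apply: ext_rees_ind => [|x y|c i _|c i].
- by rewrite rmorph0; exact: sub_T0.
- by rewrite rmorphD; apply: sub_TD.
- exact: Ti.
- rewrite rmorphM rmorphXn; apply: TM => //.
  by elim: i.+1 => [|k ih]; [rewrite expr0 | rewrite exprS; apply: TM].
Qed.

End Generation.

Lemma frac_subring (A L : comNzRingType) (lam : {rmorphism A -> L}) (P : set A) (T : set L) :
  is_frac lam P -> (forall x y, T x -> T y -> T (x * y)) ->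
  (forall x y, T x -> x * y = 1 -> T y) -> (forall a, T (lam a)) -> forall y, T y.
Proof.
move=> [hu hs _] TM Tinv Ta y; have [a [s [ns e]]] := hs y; have [v ev] := hu _ ns.
by rewrite -(mulr1 y) -ev mulrA e; apply: TM => //; apply: Tinv ev.
Qed.

(* The prime [P R[t, 1/t]] contracted to the extended Rees algebra. *)
Section PrimeExtension.
Variables (A : comNzRingType) (I : set A).
Local Notation E := (ext_rees_algebra I).
Implicit Types (P : set A).

Definition pe P : set E := [set e | exists n (f : {poly A}),
  ext_rees_val e = laurent_frac f n /\ poly_ext P f].

Lemma pe_frac P e f n : is_prime P -> ext_rees_val e = laurent_frac f n ->
  pe P e <-> poly_ext P f.
Proof.
move=> pP e1; split=> [[k [g [e2 hg]]]|]; last by exists n, f.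
rewrite e1 in e2; have e3 := laurent_frac_inj e2.
move=> i; have := congr1 (fun h : {poly A} => h`_(i + k)) e3.
rewrite coefMXn ltnNge leq_addl addnK /= => ->.
have hE := poly_ext_ideal (prime_ideal pP).
by apply: (idMr 'X^n hE hg).
Qed.

Lemma pe_prime P : is_prime P -> is_prime (pe P).
Proof.
move=> pP; have hE := poly_ext_ideal (prime_ideal pP).
have [_ _ hEM] := poly_ext_prime pP.
split; [split=> [|x y|a x]| |move=> x y].
- exists 0%N, 0; split; last exact: id0.
  by rewrite val_ext0 -(rmorph0 (@lpoly A)).
- have [f [n [ex _]]] := ext_rep x; have [g [k [ey _]]] := ext_rep y.
  move=> /(pe_frac pP ex) hf /(pe_frac pP ey) hg.
  exists (n + k)%N, (f * 'X^k + g * 'X^n); split.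
    rewrite val_extD ex ey !laurent_fracE rmorphD !rmorphM mulrDl exprD; congr (_ + _).
      by rewrite -!mulrA (mulrCA (lpoly 'X^k)) lpolyXn_lu mulr1.
    by rewrite -!mulrA (mulrA (lpoly 'X^n)) lpolyXn_lu mul1r.
  by apply: (idD hE); apply: (idMr _ hE).
- have [f [n [ex _]]] := ext_rep x; have [g [k [ea _]]] := ext_rep a.
  move=> /(pe_frac pP ex) hf; exists (k + n)%N, (g * f); split.
    by rewrite val_extM ex ea laurent_fracM.
  exact: (idMl _ hE).
- rewrite (@pe_frac P 1 1 0) //; last by rewrite val_ext1 laurent_frac1.
  by move=> /(_ 0%N); rewrite coef1; case: pP.
- have [f [n [ex _]]] := ext_rep x; have [g [k [ey _]]] := ext_rep y.
  have exy : ext_rees_val (x * y) = laurent_frac (f * g) (n + k).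
    by rewrite val_extM ex ey laurent_fracM.
  by move=> /(pe_frac pP exy)/hEM[hf|hg]; [left; apply/(pe_frac pP ex)|right; apply/(pe_frac pP ey)].
Qed.

Lemma pe_incl P f : is_prime P -> pe P (incl f) <-> forall i, P (rcoef f i).
Proof. by move=> pP; rewrite (@pe_frac P _ (rees_val f) 0). Qed.

Lemma pe_econst P c : is_prime P -> pe P (econst I c) <-> P c.
Proof.
move=> pP; have -> : pe P (econst I c) = pe P (incl (sconst I c)) by [].
rewrite pe_incl //; split=> [/(_ 0%N)|Pc i]; rewrite rcoef_sconst //.
by case: ifP => // _; apply: id0; apply: prime_ideal.
Qed.

Lemma pe_eu P : is_prime P -> ~ pe P (eu I).
Proof.
move=> pP; rewrite (@pe_frac P _ 1 1) // => /(_ 0%N).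
by rewrite coef1; case: pP.
Qed.

Lemma pe_sub P Q : P `<=` Q -> pe P `<=` pe Q.
Proof. by move=> PQ e [n [f [ef hf]]]; exists n, f; split=> // i; apply: PQ. Qed.

Lemma pe_chain n c : prime_chain n c -> prime_chain n (fun i => pe (c i)).
Proof.
move=> [pc cc]; split=> i hi; first exact/pe_prime/pc.
have [s1 /existsNP[a /not_implyP[ha na]]] := cc i hi.
split; first exact: pe_sub.
move=> /(_ (econst I a)) h; apply: na; apply/pe_econst; first by apply: pc; lia.
by apply: h; apply/pe_econst => //; apply: pc.
Qed.

End PrimeExtension.

(** * Reductions *)

Section TightClosureFractions.
Variables (p : nat) (A L : comNzRingType) (lam : {rmorphism A -> L}) (P : set A).
Hypotheses (domA : domain A) (mP : is_maximal P).
Hypothesis hf : is_frac lam P.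

Lemma lin_frac_rad s z : rad_sub P (lin s) -> lin (map lam s) (lam z) -> lin s z.
Proof.
move=> rs /(lin_lamP (maximal_prime mP) hf)[t [nt ht]].
by apply: (rad_cancel (lin_ideal s) rs _ ht); apply: maximal_inv.
Qed.

(** At a maximal P the ideals generated by powers of s are P-primary, so each denominator can be
    cancelled separately and no uniformity in e is at stake. *)
Lemma TC_frac s : rad_sub P (lin s) -> TC p (map lam s) <-> TC p s.
Proof.
move=> rs; have pP := maximal_prime mP.
have linj := frac_inj pP hf domA.
have rq q : rad_sub P (lin (pows s q)) by apply: rad_pows.
split=> hT z [c nc [e0 h]].
  apply: lin_frac_rad => //; apply: hT; exists (lam c).
    by rewrite -(rmorph0 lam) => /linj.
  by exists e0 => e /h hq; rewrite -rmorphXn -rmorphM pows_map; apply: lin_map.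
case: (hf) => hu hs _; have [a [t [nt et]]] := hs z; have [g [t' [nt' et']]] := hs c.
have [v ev] := hu _ nt; rewrite -(mulr1 z) -ev mulrA et; apply: (idMr v) => //.
apply: lin_map; apply: hT; exists g.
  move=> g0; apply: nc; rewrite g0 rmorph0 in et'; have [v' ev'] := hu _ nt'.
  by rewrite -(mulr1 c) -ev' mulrA et' mul0r.
exists e0 => e he; apply: lin_frac_rad => //.
rewrite -pows_map rmorphM rmorphXn -et -et' exprMn mulrACA.
by apply: (idMr _ (lin_ideal _)); apply: h.
Qed.

End TightClosureFractions.

(* Antisymmetric form of the exactness of the Koszul complex in degree one,
   for a sequence that is regular after localization at [P]. *)
Section Koszul.
Variables (A : comNzRingType) (P : set A).
Hypothesis pP : is_prime P.

Definition weak_nzd (s : seq A) x :=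
  forall y, lin s (x * y) -> exists2 t, ~ P t & lin s (t * y).

Lemma koszul (n : nat) (s f : nat -> A) :
  (forall k, (k < n)%N -> weak_nzd (mkseq s k) (s k)) ->
  \sum_(i < n) f i * s i = 0 ->
  exists t (K : nat -> nat -> A), [/\ ~ P t, forall i j, K i j = - K j i, forall i, K i i = 0
    & forall i, (i < n)%N -> t * f i = \sum_(j < n) K i j * s j].
Proof.
elim: n f => [|n ih] f hs e.
  by exists 1, (fun _ _ => 0); split=> // [|i j]; [case: pP|rewrite oppr0].
rewrite big_ord_recr /= in e.
have [|t1 nt1 /linP[g eg]] := hs n (leqnn _) (f n).
  apply/linP; exists (fun i => - f i); rewrite size_mkseq.
  have /eqP := e; rewrite addrC addr_eq0 mulrC => /eqP->.
  by rewrite -sumrN; apply: eq_bigr => i _; rewrite nth_mkseq // mulNr.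
rewrite size_mkseq in eg.
have {}eg : t1 * f n = \sum_(i < n) g i * s i.
  by rewrite eg; apply: eq_bigr => i _; rewrite nth_mkseq.
have [k hk||t2 [K [nt2 Ka K0 hK]]] := ih (fun i => t1 * f i + g i * s n).
- by apply: hs; apply: ltnW.
- transitivity (t1 * (\sum_(i < n) f i * s i) + (\sum_(i < n) g i * s i) * s n).
    by rewrite mulr_sumr mulr_suml -big_split; apply: eq_bigr => i _ /=; ring.
  by rewrite -eg -mulrA -mulrDr e mulr0.
(* The old matrix bordered by a last row and column made of the coefficients g of t1 f_n, with
   opposite signs. *)
pose K' i j := if (i < n)%N then (if (j < n)%N then K i j else - (t2 * g i) *+ (j == n))
               else if (j < n)%N then (t2 * g j) *+ (i == n) else 0.
exists (t2 * t1), K'; split.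
- exact: prime_compl_nM.
- move=> i j; rewrite /K'; case: ltnP => hi; case: ltnP => hj; rewrite ?mulNrn ?opprK ?oppr0 //.
- by move=> i; rewrite /K'; case: ltnP.
move=> i; rewrite ltnS leq_eqVlt => /predU1P[->|lt].
  rewrite big_ord_recr /= {2}/K' ltnn mul0r addr0 -mulrA eg mulr_sumr.
  by apply: eq_bigr => j _; rewrite /K' ltnn ltn_ord eqxx mulr1n mulrA.
rewrite big_ord_recr /= {2}/K' lt ltnn eqxx mulr1n -mulrA.
rewrite -[t1 * f i](addrK (g i * s n)) mulrDr hK // mulrN mulNr mulrA.
by congr (_ - _); apply: eq_bigr => j _; rewrite /K' lt ltn_ord.
Qed.

End Koszul.

Record red_data (p d : nat) (R : idomainType) (m I : set R) (x : seq R) : Prop := RedData {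
  rd_p : p \in [pchar R]; rd_noeth : noetherian R; rd_loc : loc_max m;
  rd_dim : krull_dim R d; rd_d : (2 <= d)%N; rd_primary : primary_to m I;
  rd_size : size x = d; rd_red : is_reduction (lin x) I;
  rd_cm : image_of_excellent_CM R }.

Section Reduction.
Variables (p d : nat) (R : idomainType) (m I : set R) (x : seq R).
Hypothesis D : red_data p d m I x.
Local Notation Ip := (ideal_pow I).

Let sx := rd_size D.
Let lm := rd_loc D.

Lemma rd_I : is_ideal I. Proof. by case: (rd_primary D) => -[]. Qed.
Lemma rd_rad : rad_sub m I.
Proof. by case: (rd_primary D) => _ <- z. Qed.
Lemma rd_Im : I `<=` m.
Proof. by case: (rd_primary D) => _ <- z Iz; exists 1%N; rewrite expr1. Qed.
Lemma rd_I1 z : Ip 1 z <-> I z.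
Proof.
rewrite Ip1; split=> [|Iz]; last exact: ideal_gen_mem.
by apply: ideal_gen_min => //; apply: rd_I.
Qed.
Lemma rd_xI i : I x`_i.
Proof.
have [lt|le] := ltnP i (size x); last by rewrite nth_default //; apply: id0 rd_I.
by case: (rd_red D) => _ JI _; apply: JI; apply: lin_mem; apply: mem_nth.
Qed.
Lemma rd_IpS n b : Ip n b -> forall i, Ip n.+1 (x`_i * b).
Proof. by move=> hb i; rewrite -add1n; apply: ideal_powM => //; apply/rd_I1; apply: rd_xI. Qed.
Lemma rd_Ipm n b : Ip n.+1 b -> m b.
Proof. by move=> h; apply: rd_Im; apply/rd_I1; apply: Ip_leq h. Qed.

(* [J I^n] *)
Definition jip n : set R := [set z | exists b : nat -> R, (forall i, Ip n (b i)) /\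
  z = \sum_(i < d) x`_i * b i].

Lemma jip_ideal n : is_ideal (jip n).
Proof.
split=> [|y z [a [ha ->]] [b [hb ->]]|c y [a [ha ->]]].
- by exists (fun=> 0); split=> //; rewrite big1 // => i _; rewrite mulr0.
- exists (fun i => a i + b i); split=> [i|]; first exact: IpD.
  by rewrite -big_split; apply: eq_bigr => i _; rewrite mulrDr.
- exists (fun i => c * a i); split=> [i|]; first exact: IpMl.
  by rewrite mulr_sumr; apply: eq_bigr => i _; rewrite mulrCA.
Qed.

Lemma jip_mem n i b : (i < d)%N -> Ip n b -> jip n (x`_i * b).
Proof.
move=> hi hb; exists (fun j => b *+ (j == i)); split=> [j|].
  by case: eqP; rewrite ?mulr0n.
rewrite (bigD1 (Ordinal hi)) //= eqxx big1 ?addr0 // => j ne.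
by rewrite -val_eqE /= in ne; rewrite (negPf ne) mulr0.
Qed.

Lemma jip_lin n z : jip n z -> lin x z.
Proof.
move=> [b [hb ->]]; apply: id_sum => // i _; apply: idMr => //.
by apply: lin_mem; apply: mem_nth; rewrite sx.
Qed.

Lemma jip0 z : lin x z <-> jip 0 z.
Proof.
split=> [|/jip_lin//]; move: z; apply: lin_min => [|y /(nthP 0)[i hi <-]]; first exact: jip_ideal.
by rewrite -(mulr1 x`_i); apply: jip_mem; rewrite -?sx.
Qed.

Lemma reduction_number : exists r, forall n z, (r <= n)%N -> Ip n.+1 z -> jip n z.
Proof.
have [_ _ [r er]] := rd_red D; exists r => n z /subnKC <-; move: z; elim: (n - r)%N => [|k ih] z.
  rewrite addn0 -er; move: z; apply: ideal_gen_min; first exact: jip_ideal.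
  move=> _ [a [b [/jip0[c [_ ->]] hb ->]]]; rewrite mulr_suml.
  apply: id_sum => [|i _]; first exact: jip_ideal.
  by rewrite -mulrA; apply: jip_mem => //; apply: IpMl.
rewrite addnS; move: z; apply: ideal_gen_min; first exact: jip_ideal.
move=> _ [a [b [Ia /ih[c [hc ->]] ->]]]; rewrite mulr_sumr.
apply: id_sum => [|i _]; first exact: jip_ideal.
rewrite mulrCA; apply: jip_mem => //; rewrite -add1n.
by apply: ideal_powM => //; apply/rd_I1.
Qed.

Lemma rad_lin : rad_sub m (lin x).
Proof.
move=> z /rd_rad[k hk]; have [r hr] := reduction_number.
exists (k * r.+1)%N; rewrite exprM; apply: (@jip_lin r); apply: hr => //.
by have := @IpX _ I r.+1 1 (z ^+ k); rewrite mul1n; apply; apply/rd_I1.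
Qed.

Lemma x_sop : sop m d x.
Proof.
split=> //; last exact: rad_lin.
by move=> _ /(nthP 0)[i _ <-]; apply: rd_Im; apply: rd_xI.
Qed.

(** For n at least r one has I^n = J^(n-r) I^r, and a monomial of degree at least dq in d generators
    contains some q-th power. *)
Lemma frob_absorb : exists r, forall q n z, (0 < q)%N -> (d * q + r <= n)%N -> Ip n z ->
  lin (pows x q) z.
Proof.
have [r hr] := reduction_number; exists r => q n z q0 hn hz.
(* Here e is the exponent vector of the monomial extracted so far, and k counts the factors of J
   still available in y. *)
suff h k (e : nat -> nat) y : Ip (r + k) y -> (d * q <= \sum_(i < d) e i + k)%N ->
    lin (pows x q) ((\prod_(i < d) x`_i ^+ e i) * y).
  have := h (n - r)%N (fun=> 0%N) z.
  rewrite [\sum_(i < d) _]big1 // big1 // mul1r; apply; last by lia.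
  by rewrite subnKC //; lia.
elim: k e y => [|k ih] e y hy he.
all: have [[i hi]|/forallNP hno] := pselect (exists i : 'I_d, (q <= e i)%N).
1,3: rewrite (bigD1 i) //= -mulrA; apply: idMr => //;
  rewrite -(subnK hi) exprD; apply: idMl => //; apply: lin_mem; apply/mapP;
  by exists x`_i => //; apply: mem_nth; rewrite sx.
- exfalso; have : (\sum_(i < d) e i <= \sum_(i < d) q.-1)%N.
    by apply: leq_sum => i _; have := hno i; lia.
  by rewrite sum_nat_const card_ord; have := rd_d D; nia.
- move: hy; rewrite addnS => /(hr _ _ (leq_addr _ _))[b [hb ->]].
  rewrite mulr_sumr; apply: id_sum => // i _.
  have := ih (fun j => e j + (j == i))%N (b i) (hb i).
  have -> : \prod_(j < d) x`_j ^+ (e j + (j == i :> nat)) = (\prod_(j < d) x`_j ^+ e j) * x`_i.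
    rewrite (bigD1 i) //= [in RHS](bigD1 i) //= eqxx exprD expr1 mulrAC; congr (_ * _ * _).
    apply: eq_bigr => j ne; rewrite -val_eqE /= in ne; by rewrite (negPf ne) addn0.
  rewrite -mulrA; apply; rewrite big_split /= (_ : \sum_(j < d) (j == i :> nat) = 1)%N; last first.
    rewrite (bigD1 i) //= eqxx big1 // => j ne; rewrite -val_eqE /= in ne; by rewrite (negPf ne).
  by rewrite -addnA add1n.
Qed.

Lemma I_neq0 : exists b, I b /\ b <> 0.
Proof.
have [[c [pc cc]] _] := rd_dim D; have d2 := rd_d D.
have [h0 /existsNP[z /not_implyP[z1 z0]]] := cc 0%N (ltnW d2).
have p0 := pc _ (leq0n d); have p1 := pc _ (ltnW d2).
have [k hk] : exists k, I (z ^+ k).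
  apply: rd_rad; apply: loc_max_sub z1 => //; first exact: prime_ideal.
  by case: p1.
by exists (z ^+ k); split=> // e; apply: z0; apply: (@primeX _ _ _ k) => //; rewrite e; apply: id0; apply: prime_ideal.
Qed.

End Reduction.

(** * The homogeneous maximal ideals *)

Section MaximalIdeal.
Variables (p : nat) (A L : comNzRingType) (lam : {rmorphism A -> L}) (P : set A).
Hypotheses (pA : p \in [pchar A]) (domA : domain A) (mP : is_maximal P).
Hypotheses (hf : is_frac lam P) (cmL : image_of_cm L).
Variables (s0 : seq A) (c : nat -> set A) (n : nat).
Hypotheses (hs0 : sop P n s0) (hc : prime_chain n c) (cP : c n `<=` P).

Let pP := maximal_prime mP.
Let domL := frac_domain pP hf domA.
Let pL : p \in [pchar L] := rmorph_pchar lam pA.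
Let ML := ext lam P P.
Let lML : loc_max ML := ext_loc_max pP hf.

Let noeL : noetherian L.
Proof.
by have [C [M [k [psi [noeC _ _ surj]]]]] := cmL; apply: image_noetherian noeC.
Qed.

Lemma sop_ext t : sop P n t -> sop ML n (map lam t).
Proof.
move=> [st Pt rt]; split; first by rewrite size_map.
  by move=> _ /mapP[a ta ->]; apply: ext_mem => //; apply: Pt.
move=> y [a [b [Pa nb e]]]; have [k hk] := rt _ Pa; exists k.
have [hu _ _] := hf; have [v ev] := hu _ nb.
rewrite -(mulr1 y) -ev mulrA e exprMn; apply: (idMr _ (lin_ideal _)).
by rewrite -rmorphXn; apply: lin_map.
Qed.

Let dimL : krull_dim L n.
Proof.
have [st Pt rt] := sop_ext hs0; rewrite -st; apply: (krull_dim_sop noeL lML Pt rt).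
by rewrite st; apply: (frac_chain pP hf hc).
Qed.

Lemma frat_at : F_rational_local p L -> frat p ML n.
Proof.
move=> /(frat_of_local pL domL cmL)[M [k hF]].
have [_ lM dM _ _] := hF.
have -> : ML = M by apply: is_local_uniq; apply: loc_max_is_local.
by rewrite (krull_dim_uniq dimL dM).
Qed.

Lemma F_rational_at t : sop P n t -> TC p t -> F_rational_local p L.
Proof.
move=> ht Tt; have [st Pt rt] := sop_ext ht.
apply: (local_of_TC pL domL noeL lML _ Pt rt); first by rewrite st.
by have [_ _ rt'] := ht; apply/(TC_frac p domA mP hf rt').
Qed.

Hypothesis FL : F_rational_local p L.

Lemma TC_at t : sop P n t -> TC p t.
Proof.
move=> ht; have [_ _ _ _ Tall] := frat_at FL; have [_ _ rt] := ht.
by apply/(TC_frac p domA mP hf rt); apply: Tall; apply: sop_ext.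
Qed.

Lemma weak_nzd_at s y t : sop P n (rcons s y ++ t) -> weak_nzd P s y.
Proof.
move=> /sop_ext/(frat_reg (frat_at FL)); rewrite map_cat map_rcons.
move=> /reg_cat[]// /reg_rcons[]// _ h _ z hz; have : lin (map lam s) (lam z).
  by apply: h; rewrite -rmorphM; apply: lin_map.
by move=> /(lin_lamP pP hf)[u [nu hu]]; exists u.
Qed.

Lemma sop_colon_at s t a b v : sop P n (s ++ t) -> (0 < b)%N ->
  lin (pows s (a + b) ++ t) (\prod_(y <- s) y ^+ a * v) -> lin (pows s b ++ t) v.
Proof.
move=> hs b0 hv; apply: (lin_frac_rad mP hf).
  have [_ _ rs] := hs; apply: rad_trans rs _ => // z; rewrite mem_cat => /orP[zs|zt].
    by exists b; apply: lin_mem; rewrite mem_cat; apply/orP; left; apply/mapP; exists z.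
  by exists 1%N; apply: lin_mem; rewrite mem_cat zt orbT.
have /= hs' := sop_ext hs; rewrite map_cat in hs'.
rewrite map_cat -pows_map; apply: (sop_colon_all (a := a) _ lML hs' _ b0).
  by move=> u; apply: frat_reg (frat_at FL).
rewrite pows_map -map_cat big_map.
rewrite (_ : \prod_(y <- s) lam y ^+ a = lam (\prod_(y <- s) y ^+ a)).
  by rewrite -rmorphM; apply: lin_map.
by rewrite rmorph_prod; apply: eq_bigr => y _; rewrite rmorphXn.
Qed.

End MaximalIdeal.

Section Rees.
Variables (p d : nat) (R : idomainType) (m I : set R) (x : seq R).
Hypothesis D : red_data p d m I x.
Local Notation Ip := (ideal_pow I).
Local Notation S := (rees_algebra I).
Local Notation E := (ext_rees_algebra I).

Let sx := rd_size D.
Let lm := rd_loc D.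
Let pm := loc_max_prime lm.
Let hm := prime_ideal pm.
Let hI := rd_I D.
Let I1 b : I b -> Ip 1 b. Proof. by move/(rd_I1 D). Qed.

Definition ev0 (f : S) : R := rcoef f 0.
Lemma ev0_zmod : zmod_morphism ev0. Proof. by move=> f g; apply: rcoefB. Qed.
Lemma ev0_monoid : monoid_morphism ev0.
Proof. by split=> [|f g]; [apply: rcoef1 | apply: rcoef0M]. Qed.
HB.instance Definition _ := GRing.isZmodMorphism.Build S R ev0 ev0_zmod.
HB.instance Definition _ := GRing.isMonoidMorphism.Build S R ev0 ev0_monoid.

(* the homogeneous maximal ideals of the two Rees algebras *)
Definition MS : set S := pre ev0 m.
Definition ME : set E := [set e : E | m (ecoef e 0)].

Lemma MS_max : is_maximal MS.
Proof.
apply: pre_maximal => // b; exists (sconst I b).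
by rewrite /= /ev0 rcoef_sconst.
Qed.

Lemma ecoef_euX i : ecoef (eu I ^+ i.+1) 0 = 0.
Proof. by rewrite -[_ ^+ _]mulr1 ecoef_euM -(rmorph1 (@incl R I)) ecoef_incl rcoef1. Qed.

(** The degree 0 coefficient is not multiplicative, since t^i and t^(-i) multiply into degree 0;
    such products involve an element of I^i with i > 0, hence vanish modulo I. *)
Lemma ecoef0M (e1 e2 : E) : I (ecoef (e1 * e2) 0 - ecoef e1 0 * ecoef e2 0).
Proof.
move: e1; apply: ext_rees_ind => [|e f h h'|c i hc|c i].
- by rewrite mul0r ecoef0 mul0r subrr; apply: id0.
- rewrite mulrDl !ecoefD mulrDl opprD addrACA; exact: idD.
- case: i hc => [|i] hc.
    by have := @ecoef_stM _ _ c 0 e2 0 hc; rewrite addn0 => ->; rewrite ecoef_incl rcoef_st // subrr; apply: id0.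
  have [b _ ->] := @ecoef_stM_ex _ _ c i.+1 e2 0 hc.
  rewrite ecoef_incl rcoef_st //= mul0r subr0; apply: idMr => //.
  by apply/(rd_I1 D); apply: Ip_leq hc.
- rewrite -mulrA !ecoef_constM ecoef_euM add0n.
  rewrite ecoef_euX mulr0 mul0r subr0.
  by apply: idMl => //; apply/(rd_I1 D); apply: Ip_leq (ecoefP _ _).
Qed.

Lemma ecoef_econst c i : ecoef (econst I c) i = if i == 0%N then c else 0.
Proof. by rewrite ecoef_incl rcoef_sconst. Qed.

Lemma ecoef_eu i : ecoef (eu I) i = 0.
Proof.
have := @ecoef_euM _ I 1 1 i; rewrite expr1 mulr1 => ->.
by rewrite -(rmorph1 (@incl R I)) ecoef_incl rcoef1 addn1.
Qed.

Lemma ME_mul (e1 e2 : E) : ME (e1 * e2) <-> m (ecoef e1 0 * ecoef e2 0).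
Proof.
have h := rd_Im D (ecoef0M e1 e2); split=> hm'.
  by have := idB hm hm' h; rewrite opprB addrC subrK.
by have := idD hm h hm'; rewrite subrK.
Qed.

Lemma ME_ideal : is_ideal ME.
Proof.
split=> [|e e'|a e]; rewrite /ME /= ?ecoef0 ?ecoefD //; first exact: id0.
  exact: idD.
by move=> h; apply/ME_mul; apply: idMl.
Qed.

Lemma ME_max : is_maximal ME.
Proof.
have n1 : ~ ME 1.
  by rewrite /ME /= -(rmorph1 (econst I)) ecoef_econst; case: pm.
split=> [||J hJ MJ] //; first exact: ME_ideal.
have [e|/existsNP[e /not_implyP[Je ne]]] := pselect (J `<=` ME).
  by left; apply/seteqP; split.
right; apply/seteqP; split=> // y _; apply: ideal1 => //.
case: lm => _ _ /(_ _ ne)[b eb]; rewrite -(subrK (e * econst I b) 1).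
apply: idD => //; last exact: idMr; apply: MJ.
have h := rd_Im D (ecoef0M e (econst I b)).
rewrite ecoef_econst /= eb in h.
by have := idN hm h; rewrite opprB /ME /= ecoefB -(rmorph1 (econst I)) ecoef_econst.
Qed.

Lemma MS_min K : is_ideal K -> (forall c, m c -> K (sconst I c)) ->
  (forall b, I b -> K (st I b 1)) -> MS `<=` K.
Proof.
move=> hK Kc Kb f Mf; rewrite -(subrK (sconst I (ev0 f)) f); apply: idD => //; last exact: Kc.
move: f {Mf}; suff Ki i c : Ip i.+1 c -> K (st I c i.+1).
  apply: rees_ind => [|f g hf hg|c [|i] hc].
  - by rewrite !rmorph0 subrr; apply: id0.
  - by rewrite !rmorphD opprD addrACA; apply: idD.
  - by rewrite /ev0 rcoef_st //= subrr; apply: id0.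
  - by rewrite /ev0 rcoef_st //= rmorph0 subr0; apply: Ki.
move=> hc; suff [] : Ip i.+1 c /\ K (st I c i.+1) by [].
move: c hc; apply: ideal_gen_min => [|_ [b [c [Ib hc ->]]]]; last first.
  split; first by apply: ideal_gen_mem; exists b, c.
  by rewrite -add1n -stM //; [apply: idMr => //; exact: Kb | exact: I1].
split=> [|a b [ha Ka] [hb Kb']|a b [hb Kb']].
- split=> //; rewrite (_ : st I 0 i.+1 = 0) ; first exact: id0.
  by apply: rcoef_inj => j; rewrite rcoef_st // rcoef0 if_same.
- by split; [exact: IpD | rewrite stD //; apply: idD].
- split; first exact: IpMl.
  by rewrite -(add0n i.+1) -stM //; apply: idMl.
Qed.

Lemma ME_min K : is_ideal K -> (forall c, m c -> K (econst I c)) -> K (eu I) ->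
  (forall b, I b -> K (incl (st I b 1))) -> ME `<=` K.
Proof.
move=> hK Kc Ku Kb e Me; rewrite -(subrK (econst I (ecoef e 0)) e).
apply: idD => //; last exact: Kc.
have hMS : MS `<=` pre (@incl R I) K by apply: MS_min => //; apply: pre_ideal.
move: e {Me}; apply: ext_rees_ind => [|f g hf hg|c [|i] hc|c i].
- by rewrite ecoef0 rmorph0 subrr; apply: id0.
- by rewrite ecoefD rmorphD opprD addrACA; apply: idD.
- by rewrite ecoef_incl rcoef_st //= subrr; apply: id0.
- rewrite ecoef_incl rcoef_st //= !rmorph0 subr0; apply: hMS.
  by rewrite /MS /pre /= /ev0 rcoef_st //; apply: id0.
- rewrite ecoef_constM ecoef_euX mulr0 !rmorph0 subr0.
  by apply: idMl => //; apply: id_expS.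
Qed.

(* [xk] is the sequence [x] numbered from 1, with [xk 0 = xk d.+1 = 0] *)
Definition xk k := if k is k'.+1 then x`_k' else 0.
Lemma xkI k : Ip 1 (xk k). Proof. by case: k => [|k]; [exact: Ip0 | apply: I1; apply: rd_xI D k]. Qed.
Hint Resolve xkI : core.
Lemma xk_gt k : (d < k)%N -> xk k = 0.
Proof. by case: k => // k h; rewrite /= nth_default // sx. Qed.
Lemma x_mem i : (i < d)%N -> x`_i \in x.
Proof. by move=> h; apply: mem_nth; rewrite sx. Qed.

Definition w i : S := sconst I (xk i.+1) - st I (xk i) 1.
Definition ws := mkseq w d.+1.
Definition ys : seq S := [seq st I y 1 | y <- x].
Definition us : seq E := rcons (map (@incl R I) ys) (eu I).

Lemma w_lin i : lin ws (w i).
Proof.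
have [lt|le] := ltnP i d.+1; first by apply: lin_mem; apply: map_f; rewrite mem_iota.
rewrite /w !xk_gt ?rmorph0 ?sub0r; [|lia|lia].
apply: idN => //; rewrite (_ : st I 0 1 = 0); first exact: id0.
by apply: rcoef_inj => j; rewrite rcoef_st // rcoef0 if_same.
Qed.

Lemma x1_lin b j : Ip j b -> lin ws (st I (xk 1 * b) j).
Proof.
move=> hb; rewrite -(add0n j) -stM //; apply: idMr => //.
have := w_lin 0; rewrite /w (_ : st I 0 1 = 0) ?subr0 //.
by apply: rcoef_inj => i; rewrite rcoef_st // rcoef0 if_same.
Qed.

Lemma shift_lin k b j : Ip j b ->
  lin ws (st I (xk k.+1 * b) j - st I (xk k * b) j.+1).
Proof.
move=> hb; rewrite -[j in X in X - _]add0n -stM // -[j.+1]add1n -stM //.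
by rewrite -mulrBl; apply: idMr => //; apply: w_lin.
Qed.

(** Telescoping over [shift_lin]. The exponent j + n - 1 suffices because the factor from the
    reduction supplies the last power of I. *)
Lemma shiftn_lin n k b j : Ip (j + n.-1) b ->
  lin ws (st I (xk (k + n) * b) j - st I (xk k * b) (j + n)).
Proof.
elim: n j => [|n ih] j hb; first by rewrite !addn0 subrr; apply: id0.
have hb' : Ip j b by apply: Ip_leq hb; apply: leq_addr.
rewrite addnS -(subrK (st I (xk (k + n) * b) j.+1) (st I _ j)) -addrA; apply: idD => //.
  exact: shift_lin.
rewrite addnS -addSn; case: n ih hb => [|n] ih hb; first by rewrite !addn0 subrr; apply: id0.
by apply: ih; rewrite addSnnS.
Qed.

Lemma xr_lin r b : Ip r b -> lin ws (st I (xk r.+1 * b) 0).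
Proof.
move=> hb; have h : lin ws (st I (xk (1 + r) * b) 0 - st I (xk 1 * b) (0 + r)).
  by apply: shiftn_lin; apply: Ip_leq hb; rewrite leq_pred.
by apply: id_sub h => //; apply: x1_lin.
Qed.

(** The combination x_k w_i - x_i w_k equals x_(i+1) x_k - x_i x_(k+1), so a product can be pushed
    towards index 0, where it vanishes. *)
Lemma xx_lin i k b j : Ip j b -> lin ws (st I (xk i * xk k * b) j).
Proof.
move=> hb; rewrite -(add0n j) -stM //; apply: idMr => //.
elim: i k => [|i ih] k; first by rewrite mul0r -/(sconst I 0) rmorph0; apply: id0.
apply: id_sub (ih k.+1) _ => //; rewrite -!/(sconst I _).
rewrite (_ : _ - _ = sconst I (xk k) * w i - sconst I (xk i) * w k).
  by apply: idB => //; apply: idMl => //; apply: w_lin.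
rewrite /w !mulrBr -!rmorphM /sconst !stM // !add0n (mulrC (xk k) (xk i)).
by rewrite opprB addrA subrK mulrC.
Qed.

(** For b in I the power (b t)^(r+1) lies in J I^r t^(r+1), hence in the ideal of the x_i t;
    elements of m have powers in J. *)
Lemma MS_rad K : is_ideal K -> (forall f n, K (f ^+ n) -> K f) ->
  (forall i, (i < d)%N -> K (sconst I x`_i)) -> (forall i, (i < d)%N -> K (st I x`_i 1)) ->
  MS `<=` K.
Proof.
move=> hK rK Kx Ky; apply: MS_min => // [c mc|b Ib].
  have [k hk] := rad_lin D mc; apply: (rK _ k); rewrite -rmorphXn.
  have: lin x `<=` pre (sconst I) K; last exact.
  apply: lin_min => [|y /(nthP 0)[i hi <-]]; first exact: pre_ideal.
  by apply: Kx; rewrite -sx.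
have [r hr] := reduction_number D; apply: (rK _ r.+1); rewrite stX //; last exact: I1.
rewrite mul1n; have [|a [ha ->]] := hr r (b ^+ r.+1) (leqnn r).
  by have := @IpX _ I r.+1 1 b; rewrite mul1n; apply; apply: I1.
have hs i : Ip r.+1 (x`_i * a i) by exact: (rd_IpS D (ha i) i).
have -> : st I (\sum_(i < d) x`_i * a i) r.+1 = \sum_(i < d) st I (x`_i * a i) r.+1.
  apply: rcoef_inj => j; rewrite rcoef_sum rcoef_st; last by apply: id_sum.
  under [RHS]eq_bigr => i _ do rewrite rcoef_st //.
  by case: ifP => // _; rewrite big1.
apply: id_sum => // i _; rewrite -add1n -stM //; last exact: (xkI i.+1).
by apply: idMr => //; apply: Ky.
Qed.

(** Squares of the x_k are in the ideal by [xx_lin], and x_k t differs from x_(k+1) by w_k. *)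
Lemma ws_sop : sop MS d.+1 ws.
Proof.
split; first by rewrite size_mkseq.
  move=> _ /mapP[i _ ->]; rewrite /MS /pre /= /ev0 rcoefB rcoef_sconst rcoef_st; last exact: xkI.
  rewrite /= subr0.
  exact: (rd_Ipm D (n := 0) (xkI i.+1)).
have hr := radical_ideal (lin_ideal ws).
have xx k : radical (lin ws) (sconst I (xk k)).
  exists 2%N; rewrite -rmorphXn expr2 -(mulr1 (_ * _)); exact: xx_lin.
apply: MS_rad => // [f n [k hk]|i _|i _].
- by exists (n * k)%N; rewrite exprM.
- exact: (xx i.+1).
- have e : st I x`_i 1 = sconst I (xk i.+2) - w i.+1 by rewrite /w opprB addrC subrK.
  by rewrite e; apply: (idB hr) => //; exists 1%N; rewrite expr1; apply: w_lin.
Qed.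

Lemma us_sop : sop ME d.+1 us.
Proof.
split; first by rewrite size_rcons !size_map sx.
  apply/all_in_rcons; split; first by rewrite /ME /= ecoef_eu; apply: id0.
  move=> _ /mapP[_ /mapP[y yx ->] ->]; rewrite /ME /= ecoef_incl rcoef_st; first exact: id0.
  by case/(nthP 0): yx => i _ <-; exact: (xkI i.+1).
have hr := radical_ideal (lin_ideal us).
have Ku : radical (lin us) (eu I).
  by exists 1%N; rewrite expr1; apply: lin_mem; rewrite mem_rcons mem_head.
have Ky i : (i < d)%N -> radical (lin us) (incl (st I x`_i 1)).
  move=> hi; exists 1%N; rewrite expr1; apply: lin_mem; rewrite mem_rcons inE.
  apply/orP; right; apply/mapP; exists (st I x`_i 1) => //; apply/mapP.
  by exists x`_i => //; apply: x_mem.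
have sub : MS `<=` pre (@incl R I) (radical (lin us)).
  apply: MS_rad => [|f n [k hk]|i hi|i hi]; last exact: Ky.
  - exact: pre_ideal.
  - by exists (n * k)%N; rewrite exprM -rmorphXn.
  - rewrite /pre /= -eu_st; last exact: (xkI i.+1).
    by apply: (idMl _ hr); apply: Ky.
apply: ME_min => // [c mc|b Ib]; apply: sub; rewrite /MS /pre /=.
  by rewrite /ev0 rcoef_sconst.
by rewrite /ev0 rcoef_st /=; [apply: id0 | apply: I1].
Qed.

Lemma ME_chain : exists2 c, prime_chain d.+1 c & c d.+1 `<=` ME.
Proof.
have [[c hc] _] := rd_dim D; have [pc _] := hc.
have cm : c d `<=` m by apply: loc_max_sub lm _ _; [apply: prime_ideal|]; have [] := pc d (leqnn d).
have h := pe_chain I hc.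
have hE : pe (I := I) (c d) `<=` ME.
  move=> e [k [f [ef hf]]]; rewrite /ME /= /ecoef ef lcoef_frac; exact/cm/hf.
exists (fun i => if (i <= d)%N then pe (c i) else ME); last by rewrite ltnn.
apply: prime_chain_rcons h; first exact/maximal_prime/ME_max.
split=> // /(_ (eu I)) h'; have := @pe_eu _ I (c d) (pc d (leqnn d)); apply; apply: h'.
by rewrite /ME /= ecoef_eu; apply: id0.
Qed.

(** The contraction of m R[t] is [MS] itself, so contracting the chain of R would be one step too
    short. The chain instead stops at the prime below m, passes to that prime plus all positive
    degrees, and ends with [MS]; the detour is strict since some power of an element of m lies in I
    and outside the smaller prime. *)
Lemma MS_chain : exists2 c, prime_chain d.+1 c & c d.+1 `<=` MS.
Proof.
have [[c hc] _] := rd_dim D; have [pc cc] := hc.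
have [d' ed] : exists d', d = d'.+1 by case: (d) (rd_d D) => // k _; exists k.
have cm i : (i <= d)%N -> c i `<=` m.
  by move=> hi; apply: loc_max_sub lm _ _; [apply: prime_ideal|]; have [] := pc i hi.
have p' : is_prime (c d') by apply: pc; rewrite ed.
have [s1 /existsNP[z /not_implyP[z1 z0]]] : c d' `<` c d by rewrite ed; apply: cc; rewrite ed.
have mz := cm _ (leqnn d) _ z1.
have h1 : prime_chain d' (fun i => pre (@incl R I) (pe (c i))).
  have [pc' cc'] : prime_chain d' c by apply: prime_chain_take hc; rewrite ed.
  split=> i hi; first exact/pre_prime/pe_prime/pc'.
  have [q1 /existsNP[a /not_implyP[a1 a0]]] := cc' i hi.
  split=> [f|/(_ (sconst I a)) hs]; first exact: pe_sub.
  apply: a0; apply/(pe_econst I _ (pc' i (ltnW hi))).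
  by apply: hs; apply/(pe_econst I _ (pc' _ hi)).
have h2 : prime_chain d (fun i => if (i <= d')%N then pre (@incl R I) (pe (c i)) else pre ev0 (c d')).
  rewrite {1}ed; apply: prime_chain_rcons h1; first exact: pre_prime.
  split=> [f /(pe_incl _ p')/(_ 0%N)//|hs].
  have [k hk] := rd_rad D mz; apply: z0; apply: (@primeX _ _ _ k) => //.
  have : pre (@incl R I) (pe (c d')) (st I (z ^+ k) 1).
    by apply: hs; rewrite /pre /= /ev0 rcoef_st /=; [apply: id0; apply: prime_ideal | apply: I1].
  by move=> /(pe_incl _ p')/(_ 1%N); rewrite rcoef_st //; apply: I1.
exists (fun i => if (i <= d)%N then (if (i <= d')%N then pre (@incl R I) (pe (c i)) else pre ev0 (c d')) else MS); last by rewrite ltnn.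
apply: (prime_chain_rcons _ _ h2); first exact/maximal_prime/MS_max.
rewrite {1}ed ltnn; split=> [f|/(_ (sconst I z)) hs].
  by rewrite /MS /pre /=; apply: cm; rewrite ed.
by apply: z0; move: hs; rewrite /MS /pre /= /ev0 rcoef_sconst; apply.
Qed.

End Rees.

(** * From the extended Rees algebra to the base ring *)

Section AtMaximalIdeals.
Variables (p d : nat) (R : idomainType) (m I : set R) (x : seq R).
Hypothesis D : red_data p d m I x.
Local Notation Ip := (ideal_pow I).
Local Notation S := (rees_algebra I).
Local Notation E := (ext_rees_algebra I).

Let sx := rd_size D.
Let lm := rd_loc D.
Let hm : is_ideal m := prime_ideal (loc_max_prime lm).
Let hI := rd_I D.
Let I1 b : I b -> Ip 1 b. Proof. by move/(rd_I1 D). Qed.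

Lemma rees_pchar : p \in [pchar S].
Proof. exact: (rmorph_pchar (sconst I) (rd_p D)). Qed.
Lemma ext_rees_pchar : p \in [pchar E].
Proof. exact: (rmorph_pchar (econst I) (rd_p D)). Qed.

Lemma MS_cm (L : comNzRingType) (lam : {rmorphism S -> L}) :
  is_frac lam (MS m (I := I)) -> image_of_cm L.
Proof.
move=> hf; have pM := maximal_prime (MS_max D).
have [gs eI] := noeth_fg (rd_noeth D) hI.
have gI g : g \in gs -> I g by move=> h; apply/(set_eqP eI); apply: lin_mem.
pose iota : {rmorphism R -> L} := lam \o sconst I.
apply: (image_of_cm_ext (m := m) (iota := iota) (ys := [seq lam (st I g 1) | g <- gs])
  (rd_noeth D) lm (rd_cm D) (ext_loc_max pM hf)).
- by move=> c mc; apply: ext_mem => //; rewrite /MS /pre /= /ev0 rcoef_sconst.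
- move=> _ /mapP[g /gI Ig ->]; apply: ext_mem => //.
  by rewrite /MS /pre /= /ev0 rcoef_st /=; [apply: id0 | apply: I1].
move=> T T1 TB TM Tinv Tc Tg; apply: (frac_subring hf TM Tinv).
by apply: (rees_generated eI T1 TB TM Tc) => g gg; apply: Tg; apply: map_f.
Qed.

Lemma ME_cm (L : comNzRingType) (lam : {rmorphism E -> L}) :
  is_frac lam (ME m (I := I)) -> image_of_cm L.
Proof.
move=> hf; have pM := maximal_prime (ME_max D).
have [gs eI] := noeth_fg (rd_noeth D) hI.
have gI g : g \in gs -> I g by move=> h; apply/(set_eqP eI); apply: lin_mem.
pose iota : {rmorphism R -> L} := lam \o econst I.
apply: (image_of_cm_ext (m := m) (iota := iota)
  (ys := lam (eu I) :: [seq lam (incl (st I g 1)) | g <- gs])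
  (rd_noeth D) lm (rd_cm D) (ext_loc_max pM hf)).
- by move=> c mc; apply: ext_mem => //; rewrite /ME /= ecoef_econst.
- apply/all_in_cons; split; first by apply: ext_mem => //; rewrite /ME /= ecoef_eu; apply: id0.
  move=> _ /mapP[g /gI Ig ->]; apply: ext_mem => //.
  by rewrite /ME /= ecoef_incl rcoef_st /=; [apply: id0 | apply: I1].
move=> T T1 TB TM Tinv Tc Tg; apply: (frac_subring hf TM Tinv).
apply: (ext_rees_generated eI T1 TB TM Tc); first by apply: Tg; apply: mem_head.
by move=> g gg; apply: Tg; rewrite inE; apply/orP; right; apply/mapP; exists g.
Qed.

Section AtOne.
Variable ev : {rmorphism E -> R}.
Hypotheses (ev_incl : forall f, ev (incl f) = (rees_val f).[1]) (ev_u : ev (eu I) = 1).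
Hypothesis evE : forall e (f : {poly R}) n, ext_rees_val e = laurent_frac f n -> ev e = f.[1].
Let N := pre ev m.

Lemma ev_st c i : Ip i c -> ev (incl (st I c i)) = c.
Proof. by move=> hc; rewrite ev_incl val_st // hornerM hornerC hornerXn expr1n mulr1. Qed.
Lemma ev_econst c : ev (econst I c) = c.
Proof. exact: ev_st. Qed.

Lemma N_max : is_maximal N.
Proof. by apply: pre_maximal => // c; exists (econst I c); apply: ev_econst. Qed.

Lemma ker_ev e : lin [:: eu I - 1] (e - econst I (ev e)).
Proof.
have hu k : lin [:: eu I - 1] (eu I ^+ k - 1).
  by rewrite subrX1; apply: idMr => //; apply: lin_mem; apply: mem_head.
move: e; apply: ext_rees_ind => [|e f he hf|c i hc|c i].
- by rewrite !rmorph0 subrr; apply: id0.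
- by rewrite !rmorphD opprD addrACA; apply: idD.
- rewrite ev_st //; have := @euX_st _ I c i 0; rewrite addn0 => /(_ hc) e.
  have {1}-> : incl (st I c i) = - ((eu I ^+ i - 1) * incl (st I c i)) + econst I c.
    by rewrite mulrBl e mul1r opprB subrK.
  by rewrite addrK; apply: idN => //; apply: idMr.
- rewrite rmorphM rmorphXn ev_u expr1n ev_econst mulr1.
  by rewrite -[X in lin _ (_ - X)]mulr1 -mulrBr; apply: idMl.
Qed.

Let s := rcons (map (econst I) x) (eu I - 1).

Lemma N_sop : sop N d.+1 s.
Proof.
split; first by rewrite size_rcons size_map sx.
  apply/all_in_rcons; split; first by rewrite /N /pre /= rmorphB ev_u rmorph1 subrr; apply: id0.
  move=> _ /mapP[y yx ->]; rewrite /N /pre /= ev_econst.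
  by have [_ h _] := x_sop D; apply: h.
move=> e /(rad_lin D)[k hk]; exists k.
have h : lin s (e ^+ k - econst I (ev e ^+ k)).
  by rewrite -rmorphXn; apply: gen_subseq (ker_ev _) => // z; rewrite mem_rcons !inE => ->.
apply: (id_sub (lin_ideal _) _ h).
by apply: gen_subseq (lin_map (econst I) hk) => // z; rewrite mem_rcons inE orbC => ->.
Qed.

Lemma N_chain : exists2 c, prime_chain d.+1 c & c d.+1 `<=` N.
Proof.
have [[c hc] _] := rd_dim D; have [pc _] := hc.
have cm : c d `<=` m by apply: loc_max_sub lm _ _; [apply: prime_ideal|]; have [] := pc d (leqnn d).
have hE : pe (I := I) (c d) `<=` N.
  move=> e [k [f [ef hf]]]; rewrite /N /pre /= (evE ef) horner_coef.
  by apply: id_sum => // i _; apply: idMr => //; apply/cm/hf.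
exists (fun i => if (i <= d)%N then pe (c i) else N); last by rewrite ltnn.
apply: prime_chain_rcons (pe_chain I hc); first exact/maximal_prime/N_max.
split=> // /(_ (eu I - 1)) h'.
have : pe (c d) (eu I - 1) by apply: h'; rewrite /N /pre /= rmorphB ev_u rmorph1 subrr; apply: id0.
have ef : ext_rees_val (eu I - 1) = laurent_frac (1 - 'X) 1.
  by rewrite val_extB val_ext1 /= laurent_frac1 laurent_fracB expr0 expr1 !mulr1 mul1r.
have pd := pc d (leqnn d).
move=> /(pe_frac pd ef)/(_ 0%N); rewrite coefB coef1 coefX subr0.
by case: pd.
Qed.

(** The generators u and g t are shifted by their values at t = 1, because adjoined elements have to
    lie in the maximal ideal. *)
Lemma N_cm (L : comNzRingType) (lam : {rmorphism E -> L}) : is_frac lam N -> image_of_cm L.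
Proof.
move=> hf; have pM := maximal_prime N_max.
have [gs eI] := noeth_fg (rd_noeth D) hI.
have gI g : g \in gs -> I g by move=> h; apply/(set_eqP eI); apply: lin_mem.
pose iota : {rmorphism R -> L} := lam \o econst I.
apply: (image_of_cm_ext (m := m) (iota := iota)
  (ys := lam (eu I - 1) :: [seq lam (incl (st I g 1) - econst I g) | g <- gs])
  (rd_noeth D) lm (rd_cm D) (ext_loc_max pM hf)).
- by move=> c mc; apply: ext_mem => //; rewrite /N /pre /= ev_econst.
- apply/all_in_cons; split.
    by apply: ext_mem => //; rewrite /N /pre /= rmorphB ev_u rmorph1 subrr; apply: id0.
  move=> _ /mapP[g /gI Ig ->]; apply: ext_mem => //.
  by rewrite /N /pre /= rmorphB ev_st ?ev_econst ?subrr; [apply: id0 | apply: I1].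
move=> T T1 TB TM Tinv Tc Tg; apply: (frac_subring hf TM Tinv).
have TD := sub_TD T1 TB.
apply: (ext_rees_generated eI T1 TB TM Tc).
  rewrite -(subrK 1 (eu I)) rmorphD rmorph1; apply: TD => //.
  by apply: Tg; apply: mem_head.
move=> g gg; rewrite -(subrK (econst I g) (incl _)) rmorphD; apply: TD; last exact: Tc.
by apply: Tg; rewrite inE; apply/orP; right; apply/mapP; exists g.
Qed.

(** At the point t = 1 the generators of J and u - 1 form a system of parameters. A tight closure
    relation for x over R is one over E for constants; membership in the ideal, evaluated at t = 1,
    loses the term u - 1. *)
Lemma base_F_rational0 : F_rational p E -> F_rational_local p R.
Proof.
move=> FE; have pN := maximal_prime N_max; have hf := loc_at_frac pN.
have [c hc cN] := N_chain; have cmL := N_cm hf.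
have T : TC p s.
  exact: (TC_at ext_rees_pchar (@ext_rees_domain R I) N_max hf cmL N_sop hc cN (FE _ pN N_max) N_sop).
have [sz mx rx] := x_sop D.
apply: (local_of_TC (rd_p D) (@idom_domain R) (rd_noeth D) lm (s := x)) => //.
  by rewrite sx; exact: (rd_dim D).
move=> z [a na [e0 h]].
have : lin s (econst I z).
  apply: T; exists (econst I a).
    by move=> e; apply: na; rewrite -(ev_econst a) e rmorph0.
  exists e0 => e /h hq; rewrite -rmorphXn -rmorphM pows_rcons lin_rcons.
  by apply: gen_base => //; rewrite pows_map; apply: lin_map.
move=> /(lin_map ev); rewrite ev_econst map_rcons rmorphB ev_u rmorph1 subrr -map_comp.
by move=> /lin_cat0; rewrite (eq_map (g := id)) ?map_id // => c'; apply: ev_econst.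
Qed.

End AtOne.

Theorem base_F_rational : F_rational p E -> F_rational_local p R.
Proof.
have [|ev [h1 h2 h3]] := @ext_rees_lift _ I _ (horner_eval (1 : R)) 1.
  by rewrite /= /horner_eval hornerX mulr1.
apply: (@base_F_rational0 ev) => // e f n /h3 ->.
by rewrite expr1n mulr1.
Qed.

End AtMaximalIdeals.

(** * Coefficients and syzygies of the parameters [w_j] *)

Lemma alternating_sum0 (A : comNzRingType) n (K : nat -> nat -> A) (s : nat -> A) :
  (forall i j, K i j = - K j i) -> (forall i, K i i = 0) ->
  \sum_(i < n) (\sum_(j < n) K i j * s j) * s i = 0.
Proof.
move=> Ka K0; elim: n => [|n ih]; first by rewrite big_ord0.
rewrite big_ord_recr /= big_ord_recr /= K0 mul0r addr0.
under eq_bigr => i _ do rewrite big_ord_recr /= mulrDl.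
rewrite big_split /= ih add0r mulr_suml -big_split /= big1 // => i _.
by rewrite (Ka n i); ring.
Qed.

Lemma weak_nzd_mkseq (A : comNzRingType) (P : set A) N (s : nat -> A) n v :
  (forall t y u, sop P N (rcons t y ++ u) -> weak_nzd P t y) ->
  sop P N (mkseq s n ++ v) -> forall k, (k < n)%N -> weak_nzd P (mkseq s k) (s k).
Proof.
move=> h hs k hk; apply: (h _ _ (map s (iota k.+1 (n - k.+1)) ++ v)).
suff -> : rcons (mkseq s k) (s k) ++ map s (iota k.+1 (n - k.+1)) ++ v = mkseq s n ++ v by [].
rewrite catA; congr (_ ++ _); rewrite /mkseq -map_rcons -map_cat; congr map.
have -> : rcons (iota 0 k) k = iota 0 k.+1 by rewrite -addn1 iotaD cats1.
by rewrite -{1}(add0n k.+1) -iotaD subnKC.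
Qed.

Lemma lin_mkseq (A : comNzRingType) (s : nat -> A) n z :
  lin (mkseq s n) z <-> exists f : nat -> A, z = \sum_(i < n) f i * s i.
Proof.
split=> [/linP[f ->]|[f ->]]; last first.
  apply: id_sum => // i _; apply: idMl => //; apply: lin_mem; apply: map_f.
  by rewrite mem_iota /=.
exists f; rewrite size_mkseq; apply: eq_bigr => i _; by rewrite nth_mkseq.
Qed.

Section Coefficients.
Variables (p d : nat) (R : idomainType) (m I : set R) (x : seq R).
Hypothesis D : red_data p d m I x.
Local Notation Ip := (ideal_pow I).
Local Notation S := (rees_algebra I).
Local Notation xk := (xk x).
Local Notation w := (w I x).
Local Notation ws := (ws d I x).

Let sx := rd_size D.
Let lm := rd_loc D.
Let pm := loc_max_prime lm.
Let xkI1 k : Ip 1 (xk k) := xkI D k.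
Hint Resolve xkI1 : core.
Let x1 k : Ip 1 x`_k := xkI D k.+1.
Hint Resolve x1 : core.

Definition pcoef (f : S) i := if i is i'.+1 then rcoef f i' else 0.

Lemma rcoef_st1M c f i : Ip 1 c -> rcoef (st I c 1 * f) i = c * pcoef f i.
Proof.
by move=> hc; rewrite rcoef_stM //; case: i => [|i] /=; rewrite ?mulr0 // subn1.
Qed.

(** Each generator of J occurs in two consecutive w_j, once as a constant and once with -t; regroup
    the sum accordingly, the two boundary terms being zero. *)
Lemma coef_w (f : nat -> S) i : rcoef (\sum_(j < d.+1) f j * w j) i =
  \sum_(k < d) x`_k * (rcoef (f k) i - pcoef (f k.+1) i).
Proof.
rewrite rcoef_sum.
under eq_bigr => j _ do rewrite mulrC mulrBl rcoefB rcoef_sconstM rcoef_st1M //.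
rewrite sumrB [X in X - _]big_ord_recr [X in _ - X]big_ord_recl /=.
rewrite (@nth_default _ 0 x d) ?sx // !mul0r addr0 add0r -sumrB.
by apply: eq_bigr => k _ /=; rewrite mulrBr.
Qed.

Lemma base_sop_weak_nzd : frat p m d ->
  forall t y u, sop m d (rcons t y ++ u) -> weak_nzd m t y.
Proof.
move=> hF t y u /(frat_reg hF)/reg_cat[]// /reg_rcons[]// _ h _ z hz.
by exists 1; [case: pm | rewrite mul1r; apply: h].
Qed.

Hypothesis hF : frat p m d.

Lemma x_syz (e : nat -> R) : \sum_(k < d) x`_k * e k = 0 ->
  forall k, (k < d)%N -> lin x (e k).
Proof.
move=> h k hk; apply: (@sop_syz _ m d (fun s => frat_reg hF) x e k (x_sop D)); first by rewrite sx.
by rewrite sx -[RHS]h; apply: eq_bigr => i _; rewrite mulrC.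
Qed.

Lemma coef_w_lin (f : nat -> S) i t c : (t < d)%N ->
  rcoef (\sum_(j < d.+1) f j * w j) i = x`_t * c ->
  forall k, (k < d)%N -> lin x (rcoef (f k) i - pcoef (f k.+1) i - c *+ (k == t)).
Proof.
move=> ht h; apply: (@x_syz (fun k => rcoef (f k) i - pcoef (f k.+1) i - c *+ (k == t))).
under eq_bigr => k _ do rewrite mulrBr.
rewrite sumrB -coef_w h (bigD1 (Ordinal ht)) //= eqxx big1 ?addr0 ?subrr // => k ne.
by rewrite -val_eqE /= in ne; rewrite (negPf ne) mulr0.
Qed.

(** In the degrees where the combination vanishes, the coefficient of t^i in f k is congruent modulo
    J to that of t^(i-1) in f (k+1), because syzygies of x have entries in J; the descent ends in
    degree 0. *)
Lemma antidiagonal (f : nat -> S) (l : nat) :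
  (forall i, (i < l)%N -> rcoef (\sum_(j < d.+1) f j * w j) i = 0) ->
  forall k i, (i < l)%N -> (k + i < d)%N -> lin x (rcoef (f k) i).
Proof.
move=> h; have hs k i : (i < l)%N -> (k < d)%N ->
    lin x (rcoef (f k) i - pcoef (f k.+1) i).
  move=> hi hk; have := @coef_w_lin f i k 0 hk; rewrite mulr0 => /(_ (h i hi) k hk).
  by rewrite mul0rn subr0.
move=> k i; elim: i k => [|i ih] k hi hk.
  by have := hs k 0%N; rewrite /= subr0; apply; lia.
apply: (id_sub (lin_ideal x) (ih k.+1 _ _)); [lia|lia|].
by apply: (hs k i.+1); lia.
Qed.

End Coefficients.

(** * Intersections of powers of [I] with the reduction *)

Section Down.
Variables (A : comNzRingType) (I : set A).
Local Notation Ip := (ideal_pow I).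
Local Notation S := (rees_algebra I).
Implicit Types f g : S.

Lemma sdown_subproof f : forall i, Ip i (drop_poly 1 (rees_val f))`_i.
Proof. by move=> i; rewrite coef_drop_poly; apply: Ip_leq (rcoefP f (i + 1)); lia. Qed.
Definition sdown f := mkrees (sdown_subproof f).

Lemma rcoef_sdown f i : rcoef (sdown f) i = rcoef f i.+1.
Proof. by rewrite /rcoef /= coef_drop_poly addn1. Qed.

Lemma sdownP f i : Ip i.+1 (rcoef (sdown f) i).
Proof. by rewrite rcoef_sdown; apply: rcoefP. Qed.

Lemma sdown_mulX f : rcoef f 0 = 0 -> rees_val f = rees_val (sdown f) * 'X.
Proof.
move=> f0; apply/polyP => i; rewrite coefMX; case: i => [|i] //=.
by rewrite -[RHS]/(rcoef (sdown f) i) rcoef_sdown.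
Qed.

Lemma mulX_rcoef f g h i : rees_val f = rees_val g * 'X ->
  rcoef (f * h) i.+1 = rcoef (g * h) i.
Proof. by move=> e; rewrite /rcoef !val_reesM e mulrAC coefMX. Qed.

(** The ideal I S of the Rees algebra. *)
Definition IS : set S := [set f | forall i, Ip i.+1 (rcoef f i)].

Lemma IS_ideal : is_ideal IS.
Proof.
split=> [i|f g hf hg i|a f hf i]; rewrite ?rcoef0 ?rcoefD //; first exact: IpD.
rewrite rcoefM; apply: id_sum => // j _.
apply: (@Ip_leq _ _ _ (j + (i - j).+1)); first by have := ltn_ord j; lia.
by apply: ideal_powM; [apply: rcoefP | apply: hf].
Qed.

End Down.

Section ValabregaValla.
Variables (p d : nat) (R : idomainType) (m I : set R) (x : seq R).
Hypothesis D : red_data p d m I x.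
Local Notation Ip := (ideal_pow I).
Local Notation S := (rees_algebra I).
Local Notation xk := (xk x).
Local Notation w := (w I x).
Local Notation ws := (ws d I x).
Local Notation MS := (MS m (I := I)).
Hypothesis hF : frat p m d.
Hypothesis hN : forall t y u, sop MS d.+1 (rcons t y ++ u) -> weak_nzd MS t y.

Let sx := rd_size D.
Let lm := rd_loc D.
Let pm := loc_max_prime lm.
Let pMS : is_prime MS := maximal_prime (MS_max D).
Let xkI1 k : Ip 1 (xk k) := xkI D k.
Let x1 k : Ip 1 x`_k := xkI D k.+1.
Let xI k b i : Ip i b -> Ip i.+1 (x`_k * b) := fun h => rd_IpS D h k.
Hint Resolve xkI1 x1 xI : core.

Local Notation W := (fun j => w j.+1).
Let n := d.-1.
Let dn : d = n.+1. Proof. by rewrite /n; have := rd_d D; case: (d). Qed.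
Local Notation x' := (fun l => x`_l.+1).

Let sumd (V : nmodType) (F : nat -> V) : \sum_(j < d) F j = \sum_(j < n) F j + F n.
Proof. by rewrite dn big_ord_recr. Qed.

Lemma w0E : w 0 = sconst I x`_0.
Proof.
rewrite /w (_ : st I (xk 0) 1 = 0) ?subr0 //.
by apply: rcoef_inj => i; rewrite rcoef_st // rcoef0 if_same.
Qed.

Lemma W_sop : sop MS d.+1 (mkseq W d ++ [:: w 0]).
Proof.
have ew : ws = w 0 :: mkseq W d by rewrite /ws /mkseq /= [iota 1 d](iotaDl 1 0) -map_comp.
have e : ws =i mkseq W d ++ [:: w 0] by move=> y; rewrite ew mem_cat orbC !inE.
apply: (sop_eq_mem _ e (ws_sop D)).
by rewrite size_cat !size_mkseq addn1.
Qed.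

Lemma W_nzd k : (k < d)%N -> weak_nzd MS (mkseq W k) (W k).
Proof. exact: (weak_nzd_mkseq hN W_sop). Qed.

Lemma W_last : weak_nzd MS (mkseq W d) (sconst I x`_0).
Proof. by rewrite -w0E; apply: (@hN _ _ [::]); rewrite cats0 -cats1; exact: W_sop. Qed.

Lemma x'_nzd k : (k < n)%N -> weak_nzd m (mkseq x' k) x`_k.+1.
Proof.
apply: (weak_nzd_mkseq (s := x') (base_sop_weak_nzd D hF) (v := [:: x`_0])).
have e : x = x`_0 :: mkseq x' n.
  apply: (@eq_from_nth _ 0) => [|i]; first by rewrite /= size_mkseq sx.
  rewrite sx dn; case: i => [|i] //= hi.
  by rewrite nth_mkseq.
have e' : x =i mkseq x' n ++ [:: x`_0].
  by move=> y; rewrite {1}e mem_cat inE orbC inE.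
apply: (sop_eq_mem _ e' (x_sop D)).
by rewrite size_cat size_mkseq sx dn addn1.
Qed.

Lemma MS_unit s : ~ MS s -> exists v, rcoef s 0 * v = 1.
Proof. by case: lm => _ _ hu /hu. Qed.

Lemma x_lastE l : (l < n)%N ->
  sconst I (x`_l.+1 * x`_n) = sconst I x`_n * W l - sconst I x`_l * W n.
Proof.
move=> hl; rewrite /w /= (@nth_default _ 0 x n.+1) ?sx ?dn // rmorph0 sub0r.
rewrite mulrN opprK mulrBr -!rmorphM /sconst !stM // !add0n.
by rewrite (mulrC x`_l x`_n) subrK mulrC.
Qed.

(** Let K be the ideal of all h with h x_n locally in (W). It contains J' = (x_1, ..., x_n), and
    Nakayama's lemma applied with x_0 gives K = J': an element k of K lies in J, so k = x_0 b modulo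
    J', and b is in K since w_0 = x_0 is regular modulo W. *)
Lemma colon_last c : lin (mkseq W d) (sconst I (c * x`_n)) -> lin (mkseq x' n) c.
Proof.
pose K : set R := [set h | exists2 s, ~ MS s & lin (mkseq W d) (s * sconst I (h * x`_n))].
suff sub : K `<=` lin (mkseq x' n).
  by move=> hh; apply: sub; exists 1; [case: pMS | rewrite mul1r].
have Kmul a b : K a -> K (b * a).
  move=> [s ns hs]; exists s => //; rewrite -mulrA rmorphM mulrCA.
  by apply: idMl.
have KD a b : K a -> K b -> K (a + b).
  move=> [s ns hs] [t nt ht]; exists (s * t); first exact: prime_compl_nM.
  rewrite mulrDl rmorphD mulrDr; apply: idD => //; first by rewrite mulrAC; apply: idMr.
  by rewrite -mulrA; apply: idMl.
have K0 : K 0 by exists 1; [case: pMS | rewrite mul0r rmorph0 mulr0; apply: id0].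
have hK : is_ideal K by split=> // a b; apply: Kmul.
have KJ' z : lin (mkseq x' n) z -> K z.
  apply: lin_min => // y /mapP[l]; rewrite mem_iota /= add0n => hl ->.
  exists 1; first by case: pMS.
  rewrite mul1r x_lastE //; apply: idB => //; apply: idMl => //; apply: lin_mem.
    by apply: map_f; rewrite mem_iota /= add0n dn; lia.
  by apply: map_f; rewrite mem_iota /= add0n dn.
apply: (local_nakayama (x := x`_0) (rd_noeth D) lm _ hK) => //.
  by have [_ hx _] := x_sop D; apply: hx; apply: mem_nth; rewrite sx dn.
move=> k [s ns /lin_mkseq[f ef]].
pose F j := if j is j'.+1 then f j' else 0.
have eF : \sum_(j < d.+1) F j * w j = s * sconst I (k * x`_n).
  by rewrite big_ord_recl mul0r add0r ef.
have cF i : rcoef (\sum_(j < d.+1) F j * w j) i = x`_n * (k * rcoef s i).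
  by rewrite eF mulrC rcoef_sconstM; ring.
have hn : (n < d)%N by rewrite dn.
have hs i j : (j < d)%N -> lin x (rcoef (F j) i - pcoef (F j.+1) i - (k * rcoef s i) *+ (j == n)).
  exact: (coef_w_lin D hF hn (cF i)).
(* With no w_0 term present, F 0 = 0, and the coefficients on this antidiagonal lie in J one after
   the other. At j = n the relation then puts k s_0 into J, where s_0 is a unit. *)
have anti j i : (j + i = n)%N -> lin x (rcoef (F j) i).
  elim: j i => [|j ih] i ji; first by rewrite /F rcoef0; apply: id0.
  have := hs i.+1 j; rewrite (_ : (j == n) = false) ?subr0; last by lia.
  move=> /(_ _) h; have hj : lin x (rcoef (F j) i.+1) by apply: ih; lia.
  have := idB (lin_ideal x) hj (h _); rewrite opprB addrC subrK; apply; lia.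
have Jk : lin x k.
  have [v ev] := MS_unit ns.
  have := hs 0%N n hn; rewrite /= subr0 eqxx mulr1n => h.
  have := idB (lin_ideal x) (anti n 0%N (addn0 n)) h; rewrite opprB addrC subrK => h'.
  by have := idMr v (lin_ideal x) h'; rewrite -mulrA ev mulr1.
have [b [_ ek]] := (jip0 D k).1 Jk; exists (b 0%N).
  have : K (x`_0 * b 0%N).
    have -> : x`_0 * b 0%N = k - \sum_(l < n) x`_l.+1 * b l.+1.
      by rewrite ek [in RHS]dn big_ord_recl /= addrK.
    apply: idB => //; first by exists s => //; apply/lin_mkseq; exists f.
    apply: KJ'; apply/lin_mkseq; exists (fun l => b l.+1).
    by apply: eq_bigr => l _; rewrite mulrC.
  move=> [t nt]; rewrite -mulrA rmorphM mulrCA => /W_last[t' nt' ht'].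
  by exists (t' * t); [apply: prime_compl_nM | rewrite -mulrA].
rewrite ek dn big_ord_recl /= addrC addKr.
by apply/lin_mkseq; exists (fun l => b l.+1); apply: eq_bigr => l _; rewrite mulrC.
Qed.

(* Multiply by [t] and use that [w_0] is regular modulo the other [w_j]. *)
Lemma W_strict (v V : S) (f : nat -> S) : rees_val V = rees_val v * 'X ->
  v = \sum_(j < d) f j * W j ->
  exists s (g : nat -> S), [/\ ~ MS s, forall j, IS (g j) & s * v = \sum_(j < d) g j * W j].
Proof.
move=> eV ev.
have h1 : lin (mkseq W d) (sconst I x`_0 * V).
  have -> : sconst I x`_0 * V = st I x`_0 1 * v.
    by apply: rees_val_inj; rewrite !val_reesM eV !val_st // expr0 mulr1 expr1; ring.
  rewrite ev mulr_sumr; apply/lin_mkseq; exists (fun j => st I x`_0 1 * f j).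
  by apply: eq_bigr => j _; rewrite mulrA.
have [s1 ns1 /lin_mkseq[h eh]] := W_last h1.
have W0 j : rcoef (W j) 0 = x`_j.+1.
  by rewrite /w rcoefB rcoef_sconst rcoef_st // /= subr0.
have xd : x`_n.+1 = 0 by rewrite nth_default // sx dn.
have V0 : rcoef V 0 = 0 by rewrite /rcoef eV coefMX.
have e0 : \sum_(j < n) rcoef (h j) 0 * x`_j.+1 = 0.
  have := congr1 (fun f : S => rcoef f 0) eh; rewrite rcoef0M V0 mulr0 rcoef_sum dn.
  rewrite big_ord_recr /= rcoef0M W0 xd mulr0 addr0 => e; rewrite [RHS]e.
  by apply: eq_bigr => j _; rewrite rcoef0M W0.
have [t [K [nt Ka K0 eK]]] := koszul (s := x') (f := fun j => rcoef (h j) 0) pm x'_nzd e0.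
(* The constant terms of the h_j with j < n form a syzygy of x_1, ..., x_n. Subtracting the matching
   Koszul relation among the W_j removes them, so that these coefficients become divisible by t. *)
pose h2 j := sconst I t * h j - (\sum_(k < n) sconst I (K j k) * W k) *+ (j < n)%N.
have eh2 : sconst I t * s1 * V = \sum_(j < d) h2 j * W j.
  rewrite -mulrA eh mulr_sumr /h2.
  under [RHS]eq_bigr => j _ do rewrite mulrBl -mulrA.
  rewrite sumrB [X in _ - X](_ : _ = 0) ?subr0 //.
  rewrite (sumd (fun i => (\sum_(k < n) sconst I (K i k) * W k) *+ (i < n)%N * W i)).
  rewrite ltnn mulr0n mul0r addr0.
  rewrite -[RHS](@alternating_sum0 _ n (fun i j => sconst I (K i j)) W).
  - by apply: eq_bigr => j _; rewrite ltn_ord.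
  - by move=> i j; rewrite -rmorphN -Ka.
  - by move=> i; rewrite K0 rmorph0.
have h20 j : (j < n)%N -> rcoef (h2 j) 0 = 0.
  move=> hj; rewrite /h2 hj mulr1n rcoefB rcoef_sconstM eK // rcoef_sum; apply/eqP.
  rewrite subr_eq0; apply/eqP/eq_bigr => k _; by rewrite rcoef_sconstM W0.
(* The last W_n = - x_n t has no constant part, so the constant term c of its coefficient escapes.
   Dividing by t leaves the error c x_n, which [colon_last] controls. *)
clearbody h2; pose c := rcoef (h2 n) 0.
pose H j := h2 j - sconst I (rcoef (h2 j) 0).
have H0 j : rcoef (H j) 0 = 0 by rewrite /H rcoefB rcoef_sconst subrr.
pose g j := sdown (H j).
have hg j : rees_val (H j) = rees_val (g j) * 'X by apply: sdown_mulX.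
have eg : sconst I t * s1 * v = \sum_(j < d) g j * W j - sconst I (c * x`_n).
  apply: rcoef_inj => i; have := congr1 (fun f : S => rcoef f i.+1) eh2.
  rewrite /= mulrC (mulX_rcoef _ _ eV) mulrC => ->.
  have eg1 : rcoef (\sum_(j < d) g j * W j) i = \sum_(j < d) rcoef (H j * W j) i.+1.
    by rewrite rcoef_sum; apply: eq_bigr => j _; rewrite (mulX_rcoef _ _ (hg j)).
  rewrite rcoefB eg1 rcoef_sum.
  rewrite (sumd (fun j => rcoef (H j * W j) i.+1)) (sumd (fun j => rcoef (h2 j * W j) i.+1)).
  rewrite -addrA; congr (_ + _).
    by apply: eq_bigr => j _; rewrite /H h20 // rmorph0 subr0.
  have Wn : w n.+1 = - st I x`_n 1 by rewrite /w /= xd rmorph0 sub0r.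
  rewrite /H -/c mulrBl rcoefB rcoef_sconstM Wn rcoefN.
  rewrite rcoef_st // rcoef_sconst; case: i {eg1} => [|i] /=; ring.
have [e ec] : exists e : nat -> R, c = \sum_(l < n) e l * x`_l.+1.
  apply/(lin_mkseq x' n c); apply: colon_last.
  have -> : sconst I (c * x`_n) = \sum_(j < d) g j * W j - sconst I t * s1 * v.
    by rewrite eg opprB addrC subrK.
  apply: idB => //; first by apply/lin_mkseq; exists g.
  by apply: idMl => //; apply/lin_mkseq; exists f.
(* With c in (x_1, ..., x_n), [x_lastE] writes c x_n as a combination of the W_j with coefficients
   in J, so the error too is absorbed within I S. *)
pose g' j := g j - (if (j < n)%N then sconst I (e j * x`_n) else - \sum_(l < n) sconst I (e l * x`_l)).
have cI a k : IS (sconst I (a * x`_k)).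
  by move=> i; rewrite rcoef_sconst; case: eqP => [->|//]; rewrite mulrC; apply: xI.
exists (sconst I t * s1), g'; split.
- apply: prime_compl_nM => //; by rewrite /MS /pre /= /ev0 rcoef_sconst.
- move=> j; rewrite /g'; have hIS := IS_ideal I; apply: (idB hIS) => //; first exact: sdownP.
  case: ifP => // _; apply: (idN hIS); apply: id_sum => // l _; exact: cI.
rewrite eg /g'; under [RHS]eq_bigr => j _ do rewrite mulrBl.
rewrite sumrB; congr (_ - _).
rewrite (sumd (fun j => (if (j < n)%N then sconst I (e j * x`_n) else - \sum_(l < n) sconst I (e l * x`_l)) * W j)) ltnn ec mulr_suml rmorph_sum mulNr mulr_suml.
rewrite -sumrB; apply: eq_bigr => l _; rewrite ltn_ord -(mulrA (e l)) rmorphM -[X in _ * X]/(sconst I _) x_lastE //.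
by rewrite !rmorphM; ring.
Qed.

(** From z = sum_j x_j y_j one gets v = - sum_j (y_j t^s) W_j, and [W_strict] gives a second
    expression with coefficients in I S. Their difference is a syzygy, hence alternating: its part
    that is not in I^(s+1) is an alternating matrix applied to x and contributes nothing to sum_j
    x_j y_j. *)
Lemma vv_step s z : jip d I x s z -> Ip s.+2 z -> jip d I x s.+1 z.
Proof.
move=> [y [hy ez]] hz.
pose v : S := st I z s.+1 - \sum_(j < d) st I (x`_j.+1 * y j) s.
(* This is v multiplied by t; it belongs to the Rees algebra because z is in I^(s+2). *)
pose V : S := st I z s.+2 - \sum_(j < d) st I (x`_j.+1 * y j) s.+1.
have xyI j k : Ip s.+1 (x`_k * y j) by apply: xI.
have xyI' j k : Ip s (x`_k * y j) by apply: IpMl.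
have hz1 : Ip s.+1 z by apply: Ip_leq hz.
have eV : rees_val V = rees_val v * 'X.
  apply/polyP => i; rewrite coefMX -!/(rcoef _ _); case: i => [|i] /=.
    by rewrite /V rcoefB rcoef_st //= rcoef_sum big1 ?subrr // => j _; rewrite rcoef_st.
  rewrite -/(rcoef v i) /V /v !rcoefB !rcoef_st // !rcoef_sum; congr (_ - _).
  by apply: eq_bigr => j _; rewrite !rcoef_st.
have ev : v = \sum_(j < d) (- st I (y j) s) * W j.
  apply: rcoef_inj => i; rewrite /v rcoefB rcoef_st // !rcoef_sum.
  have -> : (if i == s.+1 then z else 0) = \sum_(j < d) (if i == s.+1 then x`_j * y j else 0).
    by case: eqP => _; rewrite ?ez // big1.
  rewrite -sumrB; apply: eq_bigr => j _; rewrite mulNr /w mulrBr opprB rcoefB.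
  rewrite ![st I (y j) s * _]mulrC /sconst !stM // add0n add1n.
  by rewrite !rcoef_st //; exact: xyI.
have [t [g [nt gI eg]]] := @W_strict v V (fun j => - st I (y j) s) eV ev.
have e0 : \sum_(j < d) (t * st I (y j) s + g j) * W j = 0.
  under eq_bigr => j _ do rewrite mulrDl.
  rewrite big_split /= -eg ev mulr_sumr -big_split /= big1 // => j _; ring.
have [r [K [nr Ka K0 eK]]] := koszul (s := W) (f := fun j => t * st I (y j) s + g j) pMS W_nzd e0.
have nrt : ~ MS (r * t) by apply: prime_compl_nM.
have [c ec] := MS_unit nrt.
have hc j : (j < d)%N -> rcoef (r * t) 0 * y j =
    (\sum_(k < d) rcoef (K j k) s * x`_k.+1 - rcoef (r * g j) s) - \sum_(k < d) pcoef (K j k) s * x`_k.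
  move=> hj; have := congr1 (fun f : S => rcoef f s) (eK j hj).
  rewrite mulrDr rcoefD mulrA [r * t * _]mulrC rcoef_stM // ltnn subnn rcoef_sum mulrC => /eqP.
  rewrite eq_sym -subr_eq => /eqP <-; rewrite addrAC; congr (_ - _).
  rewrite -sumrB; apply: eq_bigr => k _.
  rewrite [K j k * _]mulrC /w mulrBl rcoefB rcoef_sconstM rcoef_st1M //; rewrite /=; ring.
have Ka' i j : pcoef (K i j) s = - pcoef (K j i) s.
  by rewrite Ka; case: (s) => [|k]; rewrite /= ?oppr0 // rcoefN.
have K0' i : pcoef (K i i) s = 0 by rewrite K0; case: (s) => [|k] //=; rewrite rcoef0.
have : jip d I x s.+1 (rcoef (r * t) 0 * z).
  exists (fun j => if (j < d)%N then \sum_(k < d) rcoef (K j k) s * x`_k.+1 - rcoef (r * g j) s else 0).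
  split=> [j|].
    case: ifP => // _; apply: IpD; last first.
      by apply: ideal_powN; apply: (idMl r (IS_ideal I) (gI j)).
    by apply: id_sum => // k _; rewrite mulrC; apply: xI; apply: rcoefP.
  rewrite ez mulr_sumr.
  have a0 := @alternating_sum0 _ d (fun i j => pcoef (K i j) s) (fun k => x`_k) Ka' K0'.
  rewrite -[RHS]subr0 -[X in _ = _ - X]a0 -sumrB; apply: eq_bigr => j _.
  by rewrite ltn_ord mulrCA hc // mulrBr [(\sum_(k < d) _) * x`_j]mulrC.
move=> h; have := idMl c (jip_ideal d I x s.+1) h.
by rewrite mulrA (mulrC c) ec mul1r.
Qed.

Lemma valabrega_valla s z : lin x z -> Ip s.+1 z -> jip d I x s z.
Proof.
move=> hz; elim: s => [|s ih] hs; first by apply/(jip0 D).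
by apply: vv_step => //; apply: ih; apply: Ip_leq hs.
Qed.

End ValabregaValla.

(** * From the Rees algebra to the extended Rees algebra *)

Section ReesToExtended.
Variables (p d : nat) (R : idomainType) (m I : set R) (x : seq R).
Hypothesis D : red_data p d m I x.
Local Notation Ip := (ideal_pow I).
Local Notation S := (rees_algebra I).
Local Notation E := (ext_rees_algebra I).
Local Notation xk := (xk x).
Local Notation w := (w I x).
Local Notation ws := (ws d I x).
Local Notation us := (us I x).
Local Notation ys := (ys I x).
Local Notation jip := (jip d I x).
Local Notation MS := (MS m (I := I)).

Let sx := rd_size D.
Let hI := rd_I D.
Let xkI1 k : Ip 1 (xk k) := xkI D k.
Let x1 k : Ip 1 x`_k := xkI D k.+1.
Let xI k b i : Ip i b -> Ip i.+1 (x`_k * b) := fun h => rd_IpS D h k.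
Hint Resolve xkI1 x1 xI : core.
Let domR := @idom_domain R.
Let pR := rd_p D.
Let p0 e : (0 < p ^ e)%N := p_gt0 pR e.
Let d0 : (0 < d)%N := ltnW (rd_d D).

Let inclD f g : incl (f + g : S) = incl f + incl g := rmorphD _ f g.
Let inclM f g : incl (f * g : S) = incl f * incl g := rmorphM _ f g.

Lemma us_lin_eu e : lin us (eu I * e).
Proof. by apply: idMr => //; apply: lin_mem; rewrite mem_rcons mem_head. Qed.

Lemma us_lin_y l e : (l < d)%N -> lin us (incl (st I x`_l 1) * e).
Proof.
move=> hl; apply: idMr => //; apply: lin_mem; rewrite mem_rcons inE; apply/orP; right.
by apply: map_f; apply: map_f; apply: mem_nth; rewrite sx.
Qed.

(** I^(i+1) t^i is in u E and J I^(i-1) t^i is in the ideal of the x_l t. In degree 0 the inclusion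
    of J in I takes the place of the latter. *)
Lemma us_lin_st i z : Ip i z -> (exists2 a, Ip i.+1 a & lin x (z - a) /\ ((0 < i)%N -> jip i.-1 (z - a))) ->
  lin us (incl (st I z i)).
Proof.
move=> hz [a ha [h0 h1]]; have ha' : Ip i a by apply: Ip_leq ha.
have hza : Ip i (z - a) by apply: (idB _ hz ha').
rewrite -(subrK a z) stD // inclD; apply: idD => //; last first.
  by rewrite -eu_st //; apply: us_lin_eu.
case: i hz ha ha' hza h1 => [|i] hz ha ha' hza h1.
  have : Ip 1 (z - a).
    by apply/(rd_I1 D); move: h0; apply: lin_min => // y /(nthP 0)[l _ <-]; apply: rd_xI D l.
  by move=> /eu_st <-; apply: us_lin_eu.
have [b [hb e]] := h1 isT.
have hs l : Ip i.+1 (x`_l * b l) by apply: xI.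
have -> : st I (z - a) i.+1 = \sum_(l < d) st I (x`_l * b l) i.+1.
  apply: rcoef_inj => j; rewrite rcoef_sum rcoef_st // e.
  by case: (j =P i.+1) => [->|/eqP/negPf ne]; [|rewrite big1 //];
    [apply: eq_bigr|]; move=> l _; rewrite rcoef_st // ?eqxx ?ne.
rewrite rmorph_sum; apply: id_sum => // l _.
by rewrite -[X in lin us X]/(incl (st I (x`_l * b l) i.+1)) -add1n -stM // inclM; apply: us_lin_y.
Qed.

Lemma ys_coef q e : lin (pows (map (@incl R I) ys) q) e -> forall k, exists b : nat -> R,
  (forall l, Ip (k - q) (b l)) /\ ecoef e k = \sum_(l < d) x`_l ^+ q * b l.
Proof.
move=> /linP[f ->] k; rewrite !size_map sx.
have hb (l : 'I_d) : exists b, Ip (k - q) b /\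
    ecoef (f l * (pows (map (@incl R I) ys) q)`_l) k = x`_l ^+ q * b.
  rewrite (nth_map 0) ?size_map ?sx // (nth_map 0) ?size_map ?sx // (nth_map 0) ?sx //.
  rewrite -rmorphXn stX // mul1n mulrC; have h : Ip q (x`_l ^+ q).
    by have := @IpX _ I q 1 x`_l; rewrite mul1n; apply.
  by have [b hb ->] := ecoef_stM_ex (f l) k h; exists b.
have /choice[b hb'] := hb.
exists (fun l => oapp b 0 (insub l)); split.
  by move=> l; case: insubP => [u _ _|_] /=; [case: (hb' u) | exact: Ip0].
rewrite ecoef_sum; apply: eq_bigr => l _.
by have [_ ->] := hb' l; rewrite valK.
Qed.

Lemma us_coef q r e : lin (rcons (pows (map (@incl R I) ys) q) (eu I ^+ r)) e ->
  forall k, exists (a : R) (b : nat -> R), [/\ Ip (k + r) a, forall l, Ip (k - q) (b l)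
    & ecoef e k = a + \sum_(l < d) x`_l ^+ q * b l].
Proof.
rewrite lin_rcons => /gen1P[a ha] k; have [b [hb eb]] := ys_coef ha k.
exists (ecoef a (k + r)), b; split=> //; first exact: ecoefP.
by rewrite -eb ecoefB mulrC ecoef_euM addrC subrK.
Qed.

(** Multiplication by a high power of b t, with b nonzero in I, clears the negative powers of t.
    Multipliers can therefore be taken in the Rees algebra, where coefficients are compared. *)
Lemma into_rees (c : E) : c <> 0 -> exists (a : E) (g : S), g <> 0 /\ incl g = a * c.
Proof.
move=> nc; have [f [n [ef hf]]] := ext_rep c; have [b [Ib nb]] := I_neq0 D.
have hb : Ip n (b ^+ n).
  by have := @IpX _ I n 1 b; rewrite mul1n; apply; apply/(rd_I1 D).
have hg i : Ip i ((b ^+ n)%:P * f)`_i.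
  rewrite coefCM; apply: (@Ip_leq _ _ _ (n + (i - n))); first by lia.
  exact: ideal_powM.
have eg : incl (mkrees hg) = incl (st I (b ^+ n) n) * c.
  apply: val_ext_inj; rewrite val_extM /= val_st // ef laurent_fracE !rmorphM.
  by rewrite mulrACA lpolyXn_lu mulr1.
exists (incl (st I (b ^+ n) n)), (mkrees hg); split=> // g0; apply: nc.
rewrite g0 rmorph0 in eg; case: (@ext_rees_domain R I _ _ (esym eg)) => // e.
have : st I (b ^+ n) n = 0 by apply: incl_inj; rewrite e rmorph0.
move=> /(congr1 (fun f => rcoef f n)); rewrite rcoef_st // eqxx rcoef0 => /eqP.
by rewrite expf_eq0 => /andP[_ /eqP].
Qed.

(* The condition on a coefficient [z] of [t^i] expressing that [z t^i] lies in the
   tight closure of [(u, x_1 t, ..., x_d t)]. *)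
Definition tight_coef i z := exists2 c : R, c <> 0 & exists e0, forall e, (e0 <= e)%N ->
  exists (a : R) (b : nat -> R), [/\ Ip (i.+1 * p ^ e) a, forall l, Ip (i * p ^ e - p ^ e) (b l)
    & c * z ^+ (p ^ e) = a + \sum_(l < d) x`_l ^+ (p ^ e) * b l].

Lemma tight_coefP (f : S) i : tcl p us (incl f) -> tight_coef i (rcoef f i).
Proof.
move=> [c nc [e0 h]]; have [a [g [ng eg]]] := into_rees nc.
have [j nj] : exists j, rcoef g j <> 0.
  apply: contrapT => /forallNP h'; apply: ng; apply: rcoef_inj => j.
  by rewrite rcoef0; apply: contrapT; apply: h'.
exists (rcoef g j) => //; exists (maxn e0 (size (rees_val g))) => e.
rewrite geq_max => /andP[he hs].
have hq : (size (rees_val g) <= p ^ e)%N.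
  apply: leq_trans hs _; apply: ltnW; apply: ltn_expl.
  exact: prime_gt1 (pcharf_prime pR).
have hj : (j < p ^ e)%N.
  by apply: leq_trans hq; rewrite ltnNge; apply/negP => /(nth_default 0).
have : lin (pows us (p ^ e)) (incl (g * f ^+ (p ^ e))).
  by rewrite inclM rmorphXn eg -mulrA; apply: idMl => //; apply: h.
rewrite pows_rcons => /us_coef/(_ (i * p ^ e + j)%N)[b [b' [hb hb' eb]]].
exists b, b'; split.
- by apply: Ip_leq hb; rewrite mulSn; lia.
- by move=> l; apply: Ip_leq (hb' l); lia.
rewrite -eb ecoef_incl /rcoef val_reesM val_reesX.
by rewrite (coef_mul_frob _ _ pR hq hj).
Qed.

Hypothesis hF : frat p m d.
Hypothesis hN : forall t y u, sop MS d.+1 (rcons t y ++ u) -> weak_nzd MS t y.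
Hypothesis Tw : TC p ws.

(** Here i + 1 is at least d, so b^r carries I^((i+1)q) into (x^q), and what remains is a tight
    closure relation for x in R. *)
Lemma tight_coef_high i z : (d <= i.+1)%N -> tight_coef i z -> lin x z.
Proof.
move=> hi [c nc [e0 h]]; have [_ _ _ _ Tall] := hF.
have [r hr] := frob_absorb D; have [b [Ib nb]] := I_neq0 D.
apply: (Tall _ (x_sop D)); exists (b ^+ r * c).
  by apply: (domain_neq0M domR) => //; apply: (domain_neq0X domR).
exists e0 => e /h[a [a' [ha ha' eq]]]; rewrite -mulrA eq mulrDr; apply: idD => //.
  apply: (hr _ (r + i.+1 * p ^ e)%N) => //; first by rewrite addnC leq_add2l leq_mul2r hi orbT.
  apply: ideal_powM => //; have := @IpX _ I r 1 b; rewrite mul1n; apply.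
  exact/(rd_I1 D).
apply: idMl => //; apply: id_sum => // l _; apply: idMr => //; apply: lin_mem.
by apply/mapP; exists x`_l => //; apply: mem_nth; rewrite sx.
Qed.

Lemma tight_coef_low i z : Ip i z -> (i.+1 < d)%N -> tight_coef i z ->
  exists2 a, Ip i.+1 a & lin x (z - a).
Proof.
move=> hz hi [c nc [e0 h]].
have hxz : Ip i.+1 (x`_0 * z) by apply: xI.
have Xk q k : Ip q (xk k ^+ q) by have := @IpX _ I q 1 (xk k); rewrite mul1n; apply.
have X q k : Ip q (x`_k ^+ q) := Xk q k.+1.
(* In degree i + 1 the element a of I^((i+1)q) gives an admissible term, a multiple of w_0^q. The
   extra factor w_0 is what lifts z into that degree. *)
have : lin ws (st I (x`_0 * z) i.+1).
  apply: Tw; exists (sconst I c).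
    by move=> /(congr1 (fun f => rcoef f 0)); rewrite rcoef_sconst rcoef0.
  exists e0 => e /h[a [b [ha hb eq]]]; set q := (p ^ e)%N in ha hb eq *.
  have hK := lin_ideal (pows ws q).
  have w0q f : lin (pows ws q) (sconst I (x`_0 ^+ q) * f).
    apply: idMr => //; apply: lin_mem; apply/mapP; exists (w 0); last first.
      by rewrite (w0E D) -rmorphXn.
    by apply: map_f; rewrite mem_iota.
  have shift l f : lin (pows ws q) ((sconst I (xk l.+1 ^+ q) - st I (xk l ^+ q) q) * f).
    apply: idMr => //; have -> : sconst I (xk l.+1 ^+ q) - st I (xk l ^+ q) q = w l ^+ q.
      by rewrite /w (frobB (rees_pchar D)) -rmorphXn stX // mul1n.
    exact: (lin_frob (rees_pchar D)) (w_lin D l).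
  have hb' l : Ip (i.+1 * q) (x`_0 ^+ q * (x`_l ^+ q * b l)).
    apply: (@Ip_leq _ _ _ (q + (q + (i * q - q)))); first by rewrite mulSn; lia.
    by apply: ideal_powM => //; apply: ideal_powM.
  have ha' : Ip (i.+1 * q) (x`_0 ^+ q * a) by apply: IpMl.
  have -> : sconst I c * st I (x`_0 * z) i.+1 ^+ q = sconst I (x`_0 ^+ q) * st I a (i.+1 * q)
      + \sum_(l < d) st I (x`_0 ^+ q * (x`_l ^+ q * b l)) (i.+1 * q).
    apply: rcoef_inj => j; rewrite stX // rcoef_sconstM rcoefD rcoef_sconstM rcoef_sum.
    rewrite !rcoef_st //; last exact: IpX.
    under [X in _ = _ + X]eq_bigr => l _ do rewrite rcoef_st //.
    case: eqP => _; last by rewrite big1 // !mulr0 addr0.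
    by rewrite exprMn mulrCA eq mulrDr mulr_sumr.
  apply: idD => //; apply: id_sum => // l _.
  case: i {hz hi h hxz} ha hb hb' ha' => [|i] ha hb hb' ha'.
    have -> : st I (x`_0 ^+ q * (x`_l ^+ q * b l)) (1 * q) = sconst I (x`_0 ^+ q) * st I (x`_l ^+ q * b l) q.
      by rewrite /sconst stM ?add0n ?mul1n //; apply: IpMr.
    exact: w0q.
  have hbl : Ip (i * q) (b l) by have := hb l; rewrite mulSn addKn.
  have -> : st I (x`_0 ^+ q * (x`_l ^+ q * b l)) (i.+2 * q) =
      st I (xk l.+1 ^+ q) q * (st I (x`_0 ^+ q) q * st I (b l) (i * q)).
    rewrite !stM //; last exact: ideal_powM.
    by rewrite mulrCA; congr st; rewrite !mulSn.
  (* Modulo the q-th power of one of the w_j, (x_l t)^q becomes x_(l+1)^q. The power t^q then passes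
     from x_0 to x_(l+1), which leaves x_0^q = w_0^q as a factor. *)
  have := shift l.+1 (st I (x`_0 ^+ q) q * st I (b l) (i * q)).
  rewrite mulrBl => h'. rewrite -[X in lin _ X](subKr (sconst I (xk l.+2 ^+ q) * (st I (x`_0 ^+ q) q * st I (b l) (i * q)))).
  apply: idB => //.
  have -> : sconst I (xk l.+2 ^+ q) * (st I (x`_0 ^+ q) q * st I (b l) (i * q)) =
      sconst I (x`_0 ^+ q) * (st I (xk l.+2 ^+ q) q * st I (b l) (i * q)).
    have hx : Ip q (xk l.+2 ^+ q) := X q l.+1.
    have h1 : Ip (q + i * q) (x`_0 ^+ q * b l) by apply: ideal_powM.
    have h2 : Ip (q + i * q) (xk l.+2 ^+ q * b l) by apply: ideal_powM.
    rewrite (stM (X q 0%N) hbl) (stM hx hbl) /sconst (stM _ h1) // (stM _ h2) // add0n.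
    by congr st; ring.
  exact: w0q.
move=> /lin_mkseq[f ef].
have cf k : rcoef (\sum_(j < d.+1) f j * w j) k = if k == i.+1 then x`_0 * z else 0.
  by rewrite -ef rcoef_st.
(* In degree i + 1 the relation says that z is the coefficient of f 0 in degree i + 1 minus that of
   f 1 in degree i, modulo J. The latter is in J and the former in I^(i+1). *)
have h1 : lin x (rcoef (f 1%N) i).
  apply: (antidiagonal D hF (f := f) (l := i.+1)) => // k hk; rewrite cf.
  by case: eqP => // e; rewrite e ltnn in hk.
have := @coef_w_lin _ _ _ _ _ _ D hF f i.+1 0%N z d0; rewrite cf eqxx => /(_ erefl 0%N d0).
rewrite mulr1n /= => h0; exists (rcoef (f 0%N) i.+1); first by have := rcoefP (f 0%N) i.+1.
have := idN (lin_ideal x) (idD (lin_ideal x) h0 h1).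
by rewrite (_ : - _ = z - rcoef (f 0%N) i.+1) //; ring.
Qed.

Lemma TC_us : TC p us.
Proof.
move=> e he; have [y [f ef]] := ext_rees_split e.
rewrite ef; apply: idD => //; first exact: us_lin_eu.
have hf : tcl p us (incl f).
  have -> : incl f = e - eu I * y by rewrite ef addrC addKr.
  apply: (idB (tcl_ideal (ext_rees_pchar D) (@ext_rees_domain R I) us)) => //.
  by apply: (tcl_lin (ext_rees_pchar D)); apply: us_lin_eu.
rewrite (rees_sum f) rmorph_sum; apply: id_sum => // i _.
have hz := rcoefP f i; have ht := tight_coefP i hf.
suff [a ha hJ] : exists2 a, Ip i.+1 a & lin x (rcoef f i - a).
  apply: us_lin_st => //; exists a => //; split=> // i0.
  apply: (valabrega_valla D hF hN hJ); rewrite prednK //.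
  by apply: (idB _ hz) => //; apply: Ip_leq ha.
have [hi|hi] := ltnP i.+1 d; first exact: tight_coef_low.
by exists 0; rewrite ?subr0 //; apply: tight_coef_high ht.
Qed.

End ReesToExtended.

Section AtHomogeneous.
Variables (p d : nat) (R : idomainType) (m I : set R) (x : seq R).
Hypothesis D : red_data p d m I x.
Local Notation S := (rees_algebra I).
Local Notation E := (ext_rees_algebra I).

Lemma base_frat : F_rational_local p R -> frat p m d.
Proof.
move=> FR; have [C [M [n [psi [noeC lM cm _ surj]]]]] := cm_start (rd_noeth D) (rd_loc D) (rd_cm D).
have cmR : image_of_cm R by exists C, M, n, psi.
have [N [k hF]] := frat_of_local (rd_p D) (@idom_domain R) cmR FR.
have [_ lN dN _ _] := hF.
have -> : m = N by apply: is_local_uniq; apply: loc_max_is_local => //; exact: rd_loc D.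
by rewrite (krull_dim_uniq (rd_dim D) dN).
Qed.

Theorem ext_rees_F_rational_at (L : comNzRingType) (lam : {rmorphism E -> L}) :
  F_rational_local p R -> F_rational p S -> is_frac lam (ME m (I := I)) ->
  F_rational_local p L.
Proof.
move=> FR FS hf.
have [c hc cM] := ME_chain D.
apply: (F_rational_at (ext_rees_pchar D) (@ext_rees_domain R I) (ME_max D) hf (ME_cm D hf)
  (us_sop D) hc cM (us_sop D)).
have mS := MS_max D; have pS := maximal_prime mS; have hfS := loc_at_frac pS.
have [c' hc' cM'] := MS_chain D.
have cmS := MS_cm D hfS; have FSL := FS _ pS mS.
apply: (TC_us D (base_frat FR)).
  move=> t y u; exact: (weak_nzd_at (rees_pchar D) (@rees_domain R I) mS hfS cmS (ws_sop D) hc' cM' FSL).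
exact: (TC_at (rees_pchar D) (@rees_domain R I) mS hfS cmS (ws_sop D) hc' cM' FSL (ws_sop D)).
Qed.

End AtHomogeneous.

(** * From the extended Rees algebra to the Rees algebra *)

Section ExtendedToRees.
Variables (p d : nat) (R : idomainType) (m I : set R) (x : seq R).
Hypothesis D : red_data p d m I x.
Local Notation Ip := (ideal_pow I).
Local Notation S := (rees_algebra I).
Local Notation E := (ext_rees_algebra I).
Local Notation xk := (xk x).
Local Notation w := (w I x).
Local Notation ws := (ws d I x).
Local Notation Y := (map (@incl R I) (ys I x)).
Local Notation u := (eu I).
Local Notation jip := (jip d I x).
Local Notation ME := (ME m (I := I)).

Hypothesis hF : frat p m d.
Hypothesis TE : forall t, sop ME d.+1 t -> TC p t.
Hypothesis colE : forall s t a b v, sop ME d.+1 (s ++ t) -> (0 < b)%N ->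
  lin (pows s (a + b) ++ t) (\prod_(y <- s) y ^+ a * v) -> lin (pows s b ++ t) v.
Hypothesis nzdE : forall t y v, sop ME d.+1 (rcons t y ++ v) -> weak_nzd ME t y.

Let sx := rd_size D.
Let lm := rd_loc D.
Let xkI1 k : Ip 1 (xk k) := xkI D k.
Let x1 k : Ip 1 x`_k := xkI D k.+1.
Let xI k b i : Ip i b -> Ip i.+1 (x`_k * b) := fun h => rd_IpS D h k.
Hint Resolve xkI1 x1 xI : core.
Let domR := @idom_domain R.
Let pR := rd_p D.
Let p0 e : (0 < p ^ e)%N := p_gt0 pR e.
Let d0 : (0 < d)%N := ltnW (rd_d D).
Let xX q k : Ip q (x`_k ^+ q).
Proof. by have := @IpX _ I q 1 x`_k; rewrite mul1n; apply. Qed.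
Let hw : is_ideal (lin ws) := lin_ideal ws.

Lemma sop_mixed a b : (0 < a)%N -> (0 < b)%N -> sop ME d.+1 (rcons (pows Y a) (u ^+ b)).
Proof.
move=> a0 b0; have [su /all_in_rcons[Mu MY] ru] := us_sop D.
have hM := prime_ideal (maximal_prime (ME_max D)).
split; first by rewrite size_rcons !size_map sx.
  by apply/all_in_rcons; split; [case: b b0 => // b _; apply: id_expS | apply: all_in_pows].
apply: rad_trans ru _ => // y; rewrite mem_rcons inE => /orP[/eqP->|yY].
  by exists b; apply: lin_mem; rewrite mem_rcons mem_head.
by exists a; apply: lin_mem; rewrite mem_rcons inE; apply/orP; right; apply/mapP; exists y.
Qed.

(** In E an element c of I^b equals u^b (c t^b), and x_l^a equals u^a (x_l t)^a; this is how
    relations in R become relations among parameters of E. *)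
Lemma us_mem0 a b z : gen (Ip b) (pows x a) z ->
  lin (rcons (pows Y a) (u ^+ b)) (econst I z).
Proof.
have hK : is_ideal (pre (econst I) (lin (rcons (pows Y a) (u ^+ b)))) by apply: pre_ideal.
move: z; apply: gen_min => // [c hc|_ /mapP[y /(nthP 0)[l hl <-] ->]]; rewrite /pre.
  have := @euX_st _ I c b 0; rewrite addn0 => /(_ hc) e.
  rewrite -[econst I c]/(incl (st I c 0)) -e; apply: idMr => //; apply: lin_mem.
  by rewrite mem_rcons mem_head.
have := @euX_st _ I (x`_l ^+ a) a 0; rewrite addn0 => /(_ (xX a l)) e.
rewrite -[econst I _]/(incl (st I (x`_l ^+ a) 0)) -e; apply: idMl => //; apply: lin_mem.
rewrite mem_rcons inE; apply/orP; right; apply/mapP; exists (incl (st I x`_l 1)).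
  by apply: map_f; apply: map_f; apply: mem_nth.
by rewrite -rmorphXn stX // mul1n.
Qed.

Lemma gen_pows k q z : gen (Ip k) (pows x q) z <->
  exists (c : R) (b : nat -> R), Ip k c /\ z = c + \sum_(l < d) x`_l ^+ q * b l.
Proof.
rewrite gen_sumP size_map sx; split=> [[f hf]|[c [b [hc ->]]]].
  exists (z - \sum_(l < d) f l * (pows x q)`_l), f; split=> //.
  rewrite -addrA [X in z + X](_ : _ = 0) ?addr0 // addrC; apply/eqP.
  rewrite subr_eq0; apply/eqP; apply: eq_bigr => l _.
  by rewrite (nth_map 0) ?sx // mulrC.
exists b; rewrite (_ : _ - _ = c) //; rewrite -addrA -sumrB big1 ?addr0 // => l _.
by rewrite (nth_map 0) ?sx // mulrC subrr.
Qed.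

Local Notation G k := (gen (Ip k) (pows x 2)).
Let hG k : is_ideal (G k). Proof. exact: gen_ideal. Qed.
Let G_Ip k z : Ip k z -> G k z. Proof. exact: gen_base. Qed.
Let G_lin k z : lin (pows x 2) z -> G k z. Proof. exact: lin_sub_gen. Qed.
Let G_leq i j z : (i <= j)%N -> G j z -> G i z.
Proof. by move=> h; apply: gen_mono => // y; apply: Ip_leq. Qed.

Definition pi : R := \prod_(l < d) x`_l.
Definition mu i : R := \prod_(l < d | l != i :> nat) x`_l.

Lemma mu_pi i : (i < d)%N -> x`_i * mu i = pi.
Proof. by move=> hi; rewrite /pi (bigD1 (Ordinal hi)). Qed.

Lemma mu_lin i k : (k < d)%N -> i != k -> lin (pows x 2) (x`_k * mu i).
Proof.
move=> hk ik; rewrite /mu (bigD1 (Ordinal hk)) /=; last by rewrite eq_sym.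
rewrite mulrA; apply: idMr => //; apply: lin_mem; apply/mapP; exists x`_k => //.
by apply: mem_nth; rewrite sx.
Qed.

Lemma Ip_prod (P : pred 'I_d) : Ip #|P| (\prod_(l < d | P l) x`_l).
Proof.
rewrite -sum1_card; elim/big_rec2: _ => // l k y _ hy.
by apply: ideal_powM.
Qed.

Lemma pi_Ip : Ip d pi.
Proof. by have := Ip_prod predT; rewrite cardT size_enum_ord. Qed.

Lemma mu_Ip i : (i < d)%N -> Ip d.-1 (mu i).
Proof.
move=> hi; have := Ip_prod (fun l => l != Ordinal hi); apply: Ip_leq.
by have := cardC1 (Ordinal hi); rewrite card_ord => <-.
Qed.

(* The coefficients of [H f], with [H = sum_i mu_i t^i]; multiplication by [H] kills
   [w_1, ..., w_(d-1)] modulo [(x_0^2, ..., x_(d-1)^2)]. *)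
Definition Hp : {poly R} := \sum_(i < d) (mu i)%:P * 'X^i.
Definition hc (f : S) k := \sum_(i < d) mu i * (if (i <= k)%N then rcoef f (k - i) else 0).

Lemma coef_Hp f k : (Hp * rees_val f)`_k = hc f k.
Proof.
rewrite /Hp mulr_suml coef_sum; apply: eq_bigr => i _.
by rewrite -mulrA coefCM coefXnM ltnNge; case: leqP.
Qed.

Local Notation x2 := (map polyC (pows x 2)).

Lemma Hp_x k : (k < d)%N -> lin x2 (Hp * (x`_k)%:P - pi%:P * 'X^k).
Proof.
move=> hk; rewrite /Hp mulr_suml.
have e i : (mu i)%:P * 'X^i * (x`_k)%:P = (x`_k * mu i)%:P * 'X^i :> {poly R}.
  by rewrite rmorphM /=; ring.
under eq_bigr => i _ do rewrite e.
rewrite (bigD1 (Ordinal hk)) //= mu_pi // addrAC subrr add0r; apply: id_sum => // i ne.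
apply: idMr => //; apply/lin_polyC => j; rewrite coefC; case: eqP => _; last exact: id0.
by apply: mu_lin.
Qed.

(** H w_j modulo the squares: the two terms pi t^j cancel except at both ends of the range. *)
Definition Hw j : {poly R} :=
  if j == 0%N then pi%:P else if j == d then - (pi%:P * 'X^d) else 0.

Lemma Hp_w j : (j <= d)%N -> lin x2 (Hp * rees_val (w j) - Hw j).
Proof.
have -> : rees_val (w j) = (xk j.+1)%:P - (xk j)%:P * 'X.
  by rewrite -[LHS]/(val (w j)) rmorphB /= !val_st // expr0 mulr1 expr1.
have xd : xk d.+1 = 0 by rewrite (xk_gt D).
move=> hj; rewrite /Hw mulrBr mulrA; case: j hj => [|j] hj /=.
  rewrite rmorph0 mulr0 mul0r subr0; have := Hp_x d0; by rewrite expr0 mulr1.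
have h1 := idMr 'X (lin_ideal x2) (Hp_x hj); rewrite mulrBl -[pi%:P * 'X^j * 'X]mulrA -exprSr in h1.
move: hj; rewrite leq_eqVlt => /predU1P[ej|lt].
  rewrite ej eqxx -ej /= in h1 *; rewrite -[x`_j.+1]/(xk j.+2) ej xd rmorph0 mulr0 sub0r.
  by rewrite -opprD -mulrA; apply: idN => //; rewrite ej mulrA in h1 *.
have -> : (j.+1 == d) = false by lia.
have := idB (lin_ideal x2) (Hp_x lt) h1.
by rewrite opprB addrA subrK subr0.
Qed.

(** Multiply a Frobenius relation for f by H^q and compare coefficients in degree kq + j: only w_0
    survives, with a coefficient in I^(kq+j) pi^q. So (hc f k)^q, times a fixed multiplier, lies in
    I^((d+k)q) + (x_l^(2q)), and tight closedness of (u^(d+k), (x_l t)^2) in E applies. *)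
Lemma S1 f k : (k < d)%N -> tcl p ws f -> G (d + k) (hc f k).
Proof.
move=> hk [c nc [e0 h]].
have [j nj] : exists j, rcoef c j <> 0.
  apply: contrapT => /forallNP h'; apply: nc; apply: rcoef_inj => j.
  by rewrite rcoef0; apply: contrapT; apply: h'.
have dk : (0 < d + k)%N by lia.
suff hT : lin (rcons (pows Y 2) (u ^+ (d + k))) (econst I (hc f k)).
  have [a [b [ha hb]]] := us_coef D hT 0; rewrite ecoef_econst /= => e.
  by apply/gen_pows; exists a, b.
apply: TE; first exact: sop_mixed.
exists (econst I (rcoef c j)).
  by move=> /(congr1 (fun z : E => ecoef z 0)); rewrite ecoef_econst ecoef0.
exists (maxn e0 (size (rees_val c))) => e; rewrite geq_max => /andP[he hs].
set q := (p ^ e)%N; have q0 : (0 < q)%N := p0 e.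
have hq : (size (rees_val c) <= q)%N.
  apply: leq_trans hs _; apply: ltnW; apply: ltn_expl.
  exact: prime_gt1 (pcharf_prime pR).
have hj : (j < q)%N.
  by apply: leq_trans hq; rewrite ltnNge; apply/negP => /(nth_default 0).
rewrite -rmorphXn -rmorphM pows_rcons -exprM.
have -> : pows (pows Y 2) q = pows Y (2 * q).
  by rewrite /pows -map_comp; apply: eq_map => y /=; rewrite exprM.
apply: us_mem0.
have pP := poly_pchar pR.
have /lin_mkseq[g eg] : lin (mkseq (fun i => w i ^+ q) d.+1) (c * f ^+ q).
  by have := h e he; rewrite /ws /pows /mkseq -map_comp.
have hx : lin (pows x2 q) (rees_val c * (Hp * rees_val f) ^+ q
    - \sum_(i < d.+1) rees_val (g i) * Hw i ^+ q).
  have -> : rees_val c * (Hp * rees_val f) ^+ q =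
      \sum_(i < d.+1) rees_val (g i) * (Hp * rees_val (w i)) ^+ q.
    rewrite exprMn mulrCA -val_reesX -val_reesM eg.
    rewrite -[rees_val (\sum__ _)]/(val _) rmorph_sum /= mulr_sumr.
    by apply: eq_bigr => i _; rewrite -[X in _ * X = _]/(rees_val (g i * w i ^+ q)) val_reesM val_reesX mulrCA exprMn.
  rewrite -sumrB; apply: id_sum => // i _; rewrite -mulrBr; apply: idMl => //.
  by rewrite -(frobB pP); apply: (lin_frob pP); apply: Hp_w; rewrite -ltnS.
have ex2 : pows x2 q = map polyC (pows x (2 * q)).
  by rewrite /pows -!map_comp; apply: eq_map => y /=; rewrite exprM -rmorphXn.
rewrite ex2 in hx; move/lin_polyC/(_ (k * q + j)%N): hx.
rewrite coefB (coef_mul_frob _ _ pR hq hj) coef_Hp coef_sum => hx.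
have hGi : is_ideal (gen (Ip ((d + k) * q)) (pows x (2 * q))) by apply: gen_ideal.
apply: (id_sub hGi _ (lin_sub_gen (Ip_ideal _ _) hx)); apply: gen_base => //.
apply: id_sum => // i _; rewrite /Hw; case: eqP => _.
  rewrite -rmorphXn coefMC; apply: (@Ip_leq _ _ _ ((k * q + j) + d * q)); first by lia.
  by apply: ideal_powM; [apply: rcoefP | apply: IpX; apply: pi_Ip].
case: eqP => _; last by rewrite expr0n -[(q == 0)%N]negbK -lt0n q0 mulr0 coef0.
(* The term of w_d starts in degree dq, beyond kq + j because k < d and j < q. *)
rewrite exprNn exprMn -exprM !mulrA coefMXn.
have -> : (k * q + j < d * q)%N by nia.
exact: Ip0.
Qed.

Lemma prod_Y : \prod_(y <- Y) y = incl (st I pi d).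
Proof.
rewrite !big_map (big_nth 0) big_mkord sx.
have <- := rmorph_prod (@incl R I).
suff h n : \prod_(i < n) st I x`_i 1 = st I (\prod_(i < n) x`_i) n /\ Ip n (\prod_(i < n) x`_i).
  by have [-> _] := h d.
elim: n => [|n [ih1 ih2]]; first by rewrite !big_ord0; split=> //; rewrite -(rmorph1 (sconst I)).
rewrite !big_ord_recr /= ih1 stM // addn1; split=> //.
by rewrite mulrC; apply: (@xI n _ n).
Qed.

(** In E, pi e is the product of pi t^d, of u^(d+s) and of e t^s. Colon by the x_l t lowers their
    exponents from 2 to 1, then colon by u^(d+s) lowers the exponent of u to 1; the degree s part of
    the result is the claim. *)
Lemma S2 s e : Ip s e -> G (d + s.+1) (pi * e) ->
  exists (a : R) (b : nat -> R), [/\ Ip s.+1 a, forall l, Ip s.-1 (b l)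
    & e = a + \sum_(l < d) x`_l * b l].
Proof.
move=> he hG'; have ds : (0 < d + s.+1)%N by lia.
have sop1 B : (0 < B)%N -> sop ME d.+1 (Y ++ [:: u ^+ B]).
  move=> B0; have := sop_mixed (a := 1) isT B0; rewrite -cats1.
  by rewrite (_ : pows Y 1 = Y) // /pows (eq_map (g := id)) ?map_id.
have h1 : lin (pows Y 1 ++ [:: u ^+ (d + s.+1)]) (u ^+ (d + s) * incl (st I e s)).
  apply: (@colE Y [:: u ^+ (d + s.+1)] 1 1) => //; first exact: sop1.
  have -> : \prod_(y <- Y) y ^+ 1 * (u ^+ (d + s) * incl (st I e s)) = econst I (pi * e).
    rewrite [\prod_(y <- Y) _](_ : _ = incl (st I pi d)); last by rewrite -prod_Y; apply: eq_bigr.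
    rewrite mulrCA -rmorphM stM //; last exact: pi_Ip.
    have := @euX_st _ I (pi * e) (d + s) 0; rewrite addn0; apply.
    by apply: ideal_powM => //; apply: pi_Ip.
  by rewrite cats1; apply: us_mem0.
have h2 : lin (pows [:: u] 1 ++ Y) (incl (st I e s)).
  have sop2 : sop ME d.+1 ([:: u] ++ Y).
    have := sop1 1%N isT; rewrite expr1; apply: sop_eq_mem; first by rewrite size_cat addn1.
    by move=> y; rewrite mem_cat orbC mem_cat.
  apply: (@colE [:: u] Y (d + s) 1 _ sop2) => //.
  rewrite big_seq1; move: h1; rewrite (_ : pows Y 1 = Y); last by rewrite /pows (eq_map (g := id)) ?map_id.
  have eqm : Y ++ [:: u ^+ (d + s.+1)] =i pows [:: u] (d + s + 1) ++ Y.
    by move=> y; rewrite /pows /= addn1 addnS mem_cat orbC !inE.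
  by rewrite (eq_lin eqm).
have h3 : lin (rcons (pows Y 1) (u ^+ 1)) (incl (st I e s)).
  rewrite (eq_lin (t := pows [:: u] 1 ++ Y)) // => y.
  rewrite (_ : pows Y 1 = Y); last by rewrite /pows (eq_map (g := id)) ?map_id.
  by rewrite mem_rcons.
have [a [b [ha hb]]] := us_coef D h3 s; rewrite ecoef_incl rcoef_st // eqxx => ee.
exists a, b; split; [by rewrite -addn1 | by move=> l; rewrite -subn1 | by rewrite ee].
Qed.

(** Since x_l = u (x_l t), the product of u^(n+1) and z t^(n+1) lies in the ideal of the x_l t,
    modulo which u is regular. *)
Lemma S3 n z : lin x z -> Ip n.+1 z -> jip n z.
Proof.
move=> hx hz; have hs : sop ME d.+1 (rcons Y (u ^+ n.+1) ++ [::]).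
  rewrite cats0; have := sop_mixed (a := 1) isT (isT : (0 < n.+1)%N).
  by rewrite (_ : pows Y 1 = Y) // /pows (eq_map (g := id)) ?map_id.
have [|t nt] := @nzdE _ _ _ hs (incl (st I z n.+1)).
  have := @euX_st _ I z n.+1 0; rewrite addn0 => /(_ hz) ->.
  have hK : is_ideal (pre (econst I) (lin Y)) by apply: pre_ideal.
  suff sub : lin x `<=` pre (econst I) (lin Y) by apply: (sub z).
  apply: lin_min => // y /(nthP 0)[l hl <-]; rewrite /pre.
  change (lin Y (econst I x`_l)); rewrite -[econst I x`_l]/(incl (st I x`_l 0)) -eu_st //; apply: idMl => //; apply: lin_mem.
  by apply: map_f; apply: map_f; apply: mem_nth.
rewrite -[Y in lin Y _](_ : pows Y 1 = Y); last by rewrite /pows (eq_map (g := id)) ?map_id.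
move=> /(ys_coef D)/(_ n.+1)[b [hb]].
rewrite mulrC -[X in ecoef _ X]add0n ecoef_stM // => e.
have [v ev] : exists v, ecoef t 0 * v = 1 by case: lm => _ _ hu; apply: hu.
have hj : jip n (z * ecoef t 0).
  by exists b; split=> [l|]; [have := hb l; rewrite subn1 | rewrite e].
have := idMr v (jip_ideal d I x n) hj.
by rewrite -mulrA ev mulr1.
Qed.

(** A Briancon-Skoda argument: b^r carries I^((n+1)q) into (x^q), so z is in the tight closure of J,
    which is J; then [S3]. *)
Lemma K1 n z : (d <= n.+1)%N -> Ip n.+1 z -> jip n z.
Proof.
move=> hn hz; apply: S3 => //; have [_ _ _ _ Tall] := hF.
have [r hr] := frob_absorb D; have [b [Ib nb]] := I_neq0 D.
apply: (Tall _ (x_sop D)); exists (b ^+ r); first exact: (domain_neq0X domR).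
exists 0%N => e _; apply: (hr _ (r + n.+1 * p ^ e)%N) => //.
  by rewrite addnC leq_add2l leq_mul2r hn orbT.
apply: ideal_powM; last exact: IpX.
by have := @IpX _ I r 1 b; rewrite mul1n; apply; apply/(rd_I1 D).
Qed.

Lemma sconst_lin r b : Ip r b -> lin ws (sconst I (x`_r * b)).
Proof. exact: (xr_lin D). Qed.

Lemma shift0_lin n l b : Ip n.-1 b ->
  lin ws (st I (x`_l * b) n - sconst I (x`_(l + n) * b)).
Proof.
move=> hb; have := idN hw (shiftn_lin D l.+1 (j := 0) hb).
by rewrite opprB add0n.
Qed.

Lemma x_pick (k : nat) (b : R) : \sum_(r < d) x`_r * (b *+ (k == r)) = x`_k * b.
Proof.
have [hk|hk] := ltnP k d; last first.
  rewrite nth_default ?sx // mul0r big1 // => r _.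
  have -> : (k == r) = false by apply/negbTE; rewrite neq_ltn (leq_trans (ltn_ord r) hk) orbT.
  by rewrite mulr0.
rewrite (bigD1 (Ordinal hk)) //= eqxx big1 ?addr0 // => r ne.
by rewrite -val_eqE /= eq_sym in ne; rewrite (negPf ne) mulr0.
Qed.

Lemma mu_sum k (b : nat -> R) : (k < d)%N ->
  lin (pows x 2) (mu k * (\sum_(r < d) x`_r * b r) - pi * b k).
Proof.
move=> hk; rewrite (bigD1 (Ordinal hk)) //= mulrDr mulrA (mulrC (mu k)) mu_pi // addrAC subrr add0r.
rewrite mulr_sumr; apply: id_sum => // r ne; rewrite mulrA (mulrC (mu k)); apply: idMr => //.
by apply: mu_lin => //; rewrite eq_sym; exact: ne.
Qed.

Lemma hc_pick f k i : (i < d)%N ->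
  lin (pows x 2) (x`_i * hc f k - pi * (if (i <= k)%N then rcoef f (k - i) else 0)).
Proof.
move=> hi; rewrite /hc (bigD1 (Ordinal hi)) //= mulrDr mulrA mu_pi // addrAC subrr add0r.
rewrite mulr_sumr; apply: id_sum => // r ne; rewrite mulrA; apply: idMr => //.
exact: mu_lin.
Qed.

Lemma G_x k i z : G k z -> G k.+1 (x`_i * z).
Proof.
move=> /gen_pows[c [b [hc' ->]]]; apply/gen_pows.
exists (x`_i * c), (fun l => x`_i * b l); split; first exact: xI.
by rewrite mulrDr mulr_sumr; congr (_ + _); apply: eq_bigr => l _; rewrite mulrCA.
Qed.

(** [S1] in degree d - 1 gives order 2d - 1. Multiplication by the generator of index d - 1 - n
    isolates pi times the n-th coefficient modulo squares and raises the order to 2d. *)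
Lemma pi_coef f n : tcl p ws f -> (n < d)%N -> G (d + d) (pi * rcoef f n).
Proof.
move=> hf hn; have hi : (d.-1 - n < d)%N by lia.
have hG1 : G (d + d) (x`_(d.-1 - n) * hc f d.-1).
  have hd1 : (d.-1 < d)%N by rewrite prednK.
  by have := G_x (d.-1 - n) (S1 hd1 hf); rewrite -addnS prednK.
have hn' : (n <= d.-1)%N by rewrite -ltnS prednK.
have := hc_pick f d.-1 hi; rewrite leq_subr (subKn hn').
by move=> /(G_lin (d + d)) h; have := idB (hG _) hG1 h; rewrite opprB addrC subrK.
Qed.

(** Up to I^(s+2) and modulo the w_j, all coefficients are collected in degree 0 as sum_r x_r beta_r
    with beta_r in I^s. For this normal form [S1] in degree r isolates pi beta_r, and [S2] improves
    beta_r to I^(s+1) + J. *)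
Lemma lower_step s f : (s.+1 < d)%N -> tcl p ws f -> (forall i, Ip s.+1 (rcoef f i)) ->
  exists2 f', lin ws (f - f') & forall i, Ip s.+2 (rcoef f' i).
Proof.
move=> hs hf cf.
have hS : is_ideal (tcl p ws) := tcl_ideal (rees_pchar D) (@rees_domain R I) ws.
have dec n : exists b : nat -> R, [/\ forall l, Ip s (b l),
    Ip s.+2 (rcoef f n - \sum_(l < d) x`_l * b l) & (s.+1 < n)%N -> forall l, b l = 0].
  have [hn|hn] := ltnP s.+1 n.
    exists (fun=> 0); split=> //; rewrite big1 ?subr0 => [|l _]; last by rewrite mulr0.
    exact: Ip_leq (rcoefP f n).
  have [|a [b [ha hb e]]] := S2 (cf n).
    by apply: (G_leq (j := d + d)); [lia | apply: pi_coef => //; lia].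
  by exists b; split=> //; rewrite {1}e addrK.
have /choice[B hB] := dec; clear dec.
have BI n l : Ip s (B n l) by case: (hB n).
pose T n := \sum_(l < d) x`_l * B n l.
have TI n : Ip s.+1 (T n) by apply: id_sum => // l _; apply: xI.
have TIn n : (n < s.+2)%N -> Ip n (T n) by move=> hn; apply: Ip_leq (TI n).
pose fi := f - \sum_(n < s.+2) st I (T n) n.
have cfi n : Ip s.+2 (rcoef fi n).
  rewrite /fi rcoefB rcoef_sum; have [hn|hn] := ltnP n s.+2.
    rewrite (bigD1 (Ordinal hn)) //= rcoef_st ?eqxx; last exact: TIn.
    rewrite big1 ?addr0 => [|k ne]; first by case: (hB n).
    rewrite rcoef_st; last by apply: TIn.
    by rewrite -val_eqE /= eq_sym in ne; rewrite (negPf ne).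
  rewrite big1 ?subr0 => [|k _]; first exact: Ip_leq (rcoefP f n).
  rewrite rcoef_st; last by apply: TIn.
  by case: eqP => // e; have := ltn_ord k; rewrite -e ltnNge hn.
(* Terms with l + n <= s vanish modulo the w_j by [sconst_lin]. Dropping them makes beta_r zero for
   r <= s, the range where [S1] would give too low a power of I. *)
pose B' n l := if (s < l + n)%N then B n l else 0.
have B'I n l : Ip s (B' n l) by rewrite /B'; case: ifP.
pose beta r := \sum_(n < s.+2) \sum_(l < d) B' n l *+ (l + n == r)%N.
have betaI r : Ip s (beta r).
  by apply: id_sum => // n _; apply: id_sum => // l _; case: eqP => _; rewrite ?mulr0n ?mulr1n.
have ebeta : \sum_(n < s.+2) \sum_(l < d) x`_(l + n) * B' n l = \sum_(r < d) x`_r * beta r.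
  under [RHS]eq_bigr => r _ do rewrite mulr_sumr.
  rewrite [RHS]exchange_big; apply: eq_bigr => n _ /=.
  under [RHS]eq_bigr => r _ do rewrite mulr_sumr.
  by rewrite [RHS]exchange_big; apply: eq_bigr => l _; rewrite x_pick.
pose f2 := fi + sconst I (\sum_(r < d) x`_r * beta r).
have h2 : lin ws (f - f2).
  have -> : f - f2 = \sum_(n < s.+2) (st I (T n) n - \sum_(l < d) sconst I (x`_(l + n) * B' n l)).
    rewrite sumrB /f2 /fi -ebeta.
    have -> : sconst I (\sum_(n < s.+2) \sum_(l < d) x`_(l + n) * B' n l) =
        \sum_(n < s.+2) \sum_(l < d) sconst I (x`_(l + n) * B' n l).
      by rewrite rmorph_sum; apply: eq_bigr => n _; rewrite rmorph_sum.
    by ring.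
  apply: id_sum => // n _.
  have hn : (n <= s.+1)%N by rewrite -ltnS.
  have -> : st I (T n) n = \sum_(l < d) st I (x`_l * B n l) n.
    have hI' l : Ip n (x`_l * B n l) by apply: Ip_leq hn _; apply: xI.
    apply: rcoef_inj => j; rewrite rcoef_sum rcoef_st; last exact: TIn.
    under [RHS]eq_bigr => l _ do rewrite rcoef_st //.
    by case: ifP => // _; rewrite big1.
  rewrite -sumrB; apply: id_sum => // l _.
  have hB1 : Ip n.-1 (B n l) by apply: Ip_leq (BI n l); lia.
  have hB2 : lin ws (sconst I (x`_(l + n) * (B n l - B' n l))).
    rewrite /B'; case: ltnP => h; first by rewrite subrr mulr0 rmorph0; apply: id0.
    by apply: sconst_lin; rewrite subr0; apply: Ip_leq h _.
  have := idD hw (shift0_lin l hB1) hB2.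
  by rewrite mulrBr rmorphB addrA subrK.
have h2t : tcl p ws f2.
  rewrite -[f2](subKr f); apply: (idB hS) => //.
  by apply: (tcl_lin (rees_pchar D)).
have hr r : exists a, (r < d)%N -> Ip s.+1 a /\ lin x (beta r - a).
  have [hr|hr] := leqP d r; first by exists 0.
  have [hsr|hsr] := leqP r s.
    exists 0 => _; split=> //; rewrite subr0 /beta big1; first exact: id0.
    move=> n _; rewrite big1 // => l _; case: eqP => e; rewrite ?mulr0n //.
    by rewrite /B' e ltnNge hsr.
  suff hG2 : G (d + s.+1) (pi * beta r).
    have [a [b [ha hb e]]] := S2 (betaI r) hG2; exists a => _; split=> //.
    rewrite {1}e addrAC subrr add0r; apply: id_sum => // l _; apply: idMr => //.
    by apply: lin_mem; apply: mem_nth; rewrite sx.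
  (* All terms of [hc f2 r] other than mu_r times the collected sum have order at least (d - 1) + (s
     + 2); [mu_sum] then leaves pi beta_r alone. *)
  have hGr : G (d + s.+1) (hc f2 r) by apply: (G_leq (j := d + r)); [lia | exact: S1].
  have f20 : rcoef f2 0 = rcoef fi 0 + \sum_(k < d) x`_k * beta k.
    by rewrite /f2 rcoefD rcoef_sconst.
  have f2S k : rcoef f2 k.+1 = rcoef fi k.+1 by rewrite /f2 rcoefD rcoef_sconst addr0.
  have hlow k b : (k < d)%N -> Ip s.+2 b -> G (d + s.+1) (mu k * b).
    move=> hk hb; apply: G_Ip; have -> : (d + s.+1 = d.-1 + s.+2)%N by lia.
    by apply: ideal_powM => //; apply: mu_Ip.
  have hG3 : G (d + s.+1) (mu r * (\sum_(k < d) x`_k * beta k)).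
    have -> : mu r * (\sum_(k < d) x`_k * beta k) = hc f2 r - mu r * rcoef fi 0 -
        \sum_(i < d | i != Ordinal hr) mu i * (if (i <= r)%N then rcoef f2 (r - i) else 0).
      by rewrite [hc f2 r](bigD1 (Ordinal hr)) //= leqnn subnn f20; ring.
    apply: (idB (hG _)); first by apply: (idB (hG _)) => //; apply: hlow.
    apply: id_sum => // i ne; case: leqP => hi; last by rewrite mulr0; apply: id0.
    have : (0 < r - i)%N by rewrite subn_gt0 ltn_neqAle hi andbT; exact: ne.
    by case: (r - i)%N => // k _; rewrite f2S; apply: hlow.
  have := idB (hG _) hG3 (G_lin (d + s.+1) (mu_sum beta hr)).
  by rewrite opprB addrC subrK.
have /choice[a ha] := hr.
(* Passing from beta_r to a_r changes the element by members of x_r J, which lie in the ideal of the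
   w_j. *)
exists (fi + sconst I (\sum_(r < d) x`_r * a r)).
  rewrite (_ : f - _ = (f - f2) + (sconst I (\sum_(r < d) x`_r * beta r) -
    sconst I (\sum_(r < d) x`_r * a r))); last by rewrite /f2; ring.
  apply: idD => //.
  rewrite -rmorphB -sumrB rmorph_sum; apply: id_sum => // r _; rewrite -mulrBr.
  have [_ /(jip0 D)[b [_ ->]]] := ha r (ltn_ord r).
  rewrite mulr_sumr rmorph_sum; apply: id_sum => // l _; rewrite mulrA.
  exact: (xx_lin D r.+1 l.+1 (j := 0)).
move=> i; rewrite rcoefD rcoef_sconst; apply: IpD => //; case: eqP => [_|_]; last exact: Ip0.
by apply: id_sum => // r _; apply: xI; case: (ha r (ltn_ord r)).
Qed.

Lemma TC_ws : TC p ws.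
Proof.
move=> f hf; have hS : is_ideal (tcl p ws) := tcl_ideal (rees_pchar D) (@rees_domain R I) ws.
have H s : (s < d)%N -> exists2 f', lin ws (f - f') & forall i, Ip s.+1 (rcoef f' i).
  elim: s => [|s ih] hs.
    exists f => [|i]; first by rewrite subrr; apply: id0.
    case: i => [|i]; last by apply: Ip_leq (rcoefP f i.+1).
    have [//||a [b [ha hb ->]]] := @S2 0 (rcoef f 0).
      by apply: (G_leq (j := d + d)); [lia | exact: pi_coef].
    by apply: IpD => //; apply: id_sum => // l _; apply: IpMr.
  have [f' h1 h2] := ih (ltnW hs).
  have [|f2 h3 h4] := lower_step hs _ h2.
    rewrite -[f'](subKr f); apply: (idB hS) => //.
    by apply: (tcl_lin (rees_pchar D)).
  exists f2 => //; rewrite -(subrK f' f) -addrA; exact: idD.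
have hd1 : (d.-1 < d)%N by rewrite prednK.
have [f' h1 h2] := H _ hd1; rewrite prednK // in h2.
rewrite -(subrK f' f); apply: idD => //; rewrite (rees_sum f'); apply: id_sum => // n _.
(* The coefficient lies in I^k = J I^(k-1). Each x_l b_l t^n is shifted to the constant x_(l+n) b_l,
   which is zero for l + n >= d and otherwise in the ideal, since k - 1 is then large enough. *)
pose k := maxn n d; have hk : (d <= k)%N by apply: leq_maxr.
have k0 : (0 < k)%N by apply: leq_trans hk.
have h3 : Ip k (rcoef f' n).
  by rewrite /k; case: (leqP n d) => _; [exact: h2 | exact: rcoefP].
have [b [hb eb]] : jip k.-1 (rcoef f' n) by apply: K1; rewrite prednK.
rewrite eb.
have hn l : Ip n (x`_l * b l).
  by have := xI l (hb l); apply: Ip_leq; rewrite prednK // leq_maxl.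
have -> : st I (\sum_(l < d) x`_l * b l) n = \sum_(l < d) st I (x`_l * b l) n.
  apply: rcoef_inj => j; rewrite rcoef_sum rcoef_st; last by apply: id_sum.
  under [RHS]eq_bigr => l _ do rewrite rcoef_st //.
  by case: ifP => // _; rewrite big1.
apply: id_sum => // l _.
have hb1 : Ip n.-1 (b l) by apply: Ip_leq (hb l); have : (n <= k)%N := leq_maxl _ _; lia.
have h := shift0_lin l hb1; apply: (id_sub hw _ h).
have [hl|hl] := ltnP (l + n) d; last by rewrite nth_default ?sx // mul0r rmorph0; apply: id0.
by apply: sconst_lin; apply: Ip_leq (hb l); lia.
Qed.

End ExtendedToRees.

Theorem rees_F_rational_at (p d : nat) (R : idomainType) (m I : set R) (x : seq R)
    (D : red_data p d m I x) (L : comNzRingType) (lam : {rmorphism rees_algebra I -> L}) :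
  F_rational p (ext_rees_algebra I) -> is_frac lam (MS m (I := I)) -> F_rational_local p L.
Proof.
move=> FE hf; have [c hc cM] := MS_chain D.
apply: (F_rational_at (rees_pchar D) (@rees_domain R I) (MS_max D) hf (MS_cm D hf)
  (ws_sop D) hc cM (ws_sop D)).
have mE := ME_max D; have pE := maximal_prime mE; have hfE := loc_at_frac pE.
have [c' hc' cM'] := ME_chain D.
have cmE := ME_cm D hfE; have FEL := FE _ pE mE.
have pE' := ext_rees_pchar D; have dE := @ext_rees_domain R I.
apply: (TC_ws D (base_frat D (base_F_rational D FE))).
- move=> t; exact: (TC_at pE' dE mE hfE cmE (us_sop D) hc' cM' FEL).
- move=> s t a b v; exact: (sop_colon_at pE' dE mE hfE cmE (us_sop D) hc' cM' FEL).
- move=> t y u; exact: (weak_nzd_at pE' dE mE hfE cmE (us_sop D) hc' cM' FEL).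
Qed.

(** * The other maximal ideals *)

Lemma poly_lift (A Z : comNzRingType) (f : {rmorphism A -> Z}) (v : Z) :
  exists h : {rmorphism {poly A} -> Z}, (forall c, h c%:P = f c) /\ h 'X = v.
Proof.
have cfv : commr_rmorph f v by move=> a; apply: mulrC.
exists (horner_morph cfv : {rmorphism {poly A} -> Z}); split=> [c|].
  exact: horner_morphC.
exact: horner_morphX.
Qed.

Lemma poly_rmorph_ext (A Z : comNzRingType) (f g : {rmorphism {poly A} -> Z}) :
  (forall c, f c%:P = g c%:P) -> f 'X = g 'X -> f =1 g.
Proof.
move=> hC hX; elim/poly_ind => [|q c ih]; first by rewrite !rmorph0.
by rewrite !rmorphD !rmorphM /= ih hX hC.
Qed.

(* A point [N] of [Spec T] lying in an affine line over [Spec R]: locally at [N]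
   the ring [T] is a localization of [R[X]]. *)
Section Chart.
Variables (p d : nat) (R T L : comNzRingType) (m : set R) (N : set T).
Variables (const : {rmorphism R -> T}) (lam : {rmorphism T -> L}) (hR : {rmorphism {poly R} -> L}).
Hypotheses (pR : p \in [pchar R]) (domR : domain R) (hF : frat p m d).
Hypotheses (pN : is_prime N) (hf : is_frac lam N).
Hypothesis hRC : forall c, hR c%:P = lam (const c).
Hypothesis hRE : forall e, exists f k w, hR k * w = 1 /\ lam e * hR k = hR f.
Hypothesis hR0 : forall f, hR f = 0 -> f = 0.
Let q := pre const N.
Hypothesis hN : exists f, ext lam N N (hR f) /\ exists i, ~ q f`_i.

(** Localizing R at q = N ∩ R keeps a tightly closed system of parameters, by [localize_frat]. Then
    L is a localization of R_q[X] at a prime over the maximal ideal of R_q that is not extended from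
    it, and the affine line theorem applies. *)
Lemma chart_F_rational_loc (A : comNzRingType) (loc : {rmorphism R -> A}) :
  is_frac loc q -> F_rational_local p L.
Proof.
move=> hl; have pq : is_prime q by apply: pre_prime.
have [noeR _ _ _ _] := hF.
have domA := frac_domain pq hl domR.
have [s [c [Ms rs hc Ts]]] := localize_frat pR domR hF pq hl.
have [hu hs hk] := hf.
have [q1 qM] : ~ q 1 /\ (forall s t, ~ q s -> ~ q t -> ~ q (s * t)).
  by split; [by have [] := pq | move=> ? ?; apply: prime_compl_nM].
have [|alpha ha] := @frac_lift_rmorph _ _ _ loc q (lam \o const) q1 qM hl.
  by move=> r nr; apply: hu.
have [hA [hAC hAX]] := poly_lift alpha (hR 'X).
have hAR f : hA (map_poly loc f) = hR f.
  apply: (poly_rmorph_ext (f := hA \o map_poly loc) (g := hR)) => [r|] /=.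
    by rewrite map_polyC hAC ha /= hRC.
  by rewrite map_polyX hAX.
pose ML := ext lam N N; have lML : loc_max ML by apply: ext_loc_max.
have pML := loc_max_prime lML.
have unit_nM y z : y * z = 1 -> ~ ML y.
  by case: lML => hM n1 _ e My; apply: n1; rewrite -e; apply: idMr.
have aq r : ~ q r -> exists z, alpha (loc r) * z = 1.
  by move=> nr; rewrite ha /=; apply: hu.
have hfA : is_frac hA (pre hA ML).
  split=> [F nF|y|F e].
  - by case: lML => _ _; apply.
  - have [a [b [nb e]]] := hs y; have [f1 [k1 [w1 [u1 e1]]]] := hRE a.
    have [f2 [k2 [w2 [u2 e2]]]] := hRE b; have [v ev] := hu _ nb.
    exists (map_poly loc (f1 * k2)), (map_poly loc (f2 * k1)); split.
      rewrite /pre /= hAR; apply: (unit_nM _ (v * w2 * w1)).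
      rewrite rmorphM -e2; transitivity ((lam b * v) * (hR k2 * w2) * (hR k1 * w1)); first by ring.
      by rewrite ev u1 u2 !mulr1.
    rewrite !hAR !rmorphM -e1 -e2 -e; ring.
  have [t [f [nt et]]] : exists t f, ~ q t /\ F * (loc t)%:P = map_poly loc f.
    elim/poly_ind: (F) => [|G b [t [f [nt et]]]].
      by exists 1, 0; split=> //; rewrite mul0r rmorph0.
    have [_ hs' _] := hl; have [r [t' [nt' et']]] := hs' b.
    exists (t * t'), (f * 'X * t'%:P + (r * t)%:P); split; first exact: qM.
    rewrite rmorphD !(rmorphM (map_poly loc)) /= map_polyX !map_polyC /=.
    by rewrite -et !rmorphM /= -et' rmorphM; ring.
  have f0 : f = 0 by apply: hR0; rewrite -hAR -et rmorphM e mul0r.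
  have [z ez] := aq _ nt.
  exists (loc t)%:P; split; last by rewrite mulrC et f0 rmorph0.
  by rewrite /pre /= hAC; apply: unit_nM ez.
apply: (affine_line_F_rational (rmorph_pchar loc pR) domA (frac_noetherian hl noeR)
  (ext_loc_max pq hl) Ms rs hc Ts (pre_prime hA pML) hfA).
  move=> a [r [t [qr nt e]]]; rewrite /pre /= hAC.
  have [z ez] := aq _ nt; apply: (prime_cancel (s := alpha (loc t)) pML); first exact: unit_nM ez.
  by rewrite mulrC -rmorphM e ha; apply: ext_mem.
have [f [Mf [i nqi]]] := hN => /(_ (map_poly loc f)).
rewrite {1}/pre /= hAR => /(_ Mf)/(_ i); rewrite coef_map.
by move=> /(ext_prime_lam pq hl _ pq (@subset_refl _ q)).
Qed.

Lemma chart_F_rational : F_rational_local p L.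
Proof. exact: (chart_F_rational_loc (loc_at_frac (pre_prime const pN))). Qed.

End Chart.

Section Cases.
Variables (p d : nat) (R : idomainType) (m I : set R) (x : seq R).
Hypothesis D : red_data p d m I x.
Local Notation Ip := (ideal_pow I).
Local Notation S := (rees_algebra I).
Local Notation E := (ext_rees_algebra I).

Let lm := rd_loc D.
Let x1 k : Ip 1 x`_k := xkI D k.+1.
Hint Resolve x1 : core.
Let domE := @ext_rees_domain R I.
Let domS := @rees_domain R I.
Let incM f g : incl (f * g : S) = incl f * incl g := rmorphM _ f g.
Let incD f g : incl (f + g : S) = incl f + incl g := rmorphD _ f g.
Let incX f k : incl (f ^+ k : S) = incl f ^+ k := rmorphXn _ k f.

Hypothesis FR : F_rational_local p R.
Let hF := base_frat D FR.

(* [u] not in [N]: the chart [R[t, 1/t]] *)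
Lemma ext_chart (L : comNzRingType) (N : set E) (lam : {rmorphism E -> L}) :
  is_maximal N -> is_frac lam N -> ~ N (eu I) -> F_rational_local p L.
Proof.
move=> mN hf nu; have pN := maximal_prime mN; have linj := frac_inj pN hf domE.
have [hu _ _] := hf; have [v ev] := hu _ nu.
have [h [hC hX]] := poly_lift (lam \o econst I) v.
have hXv : h 'X * lam (eu I) = 1 by rewrite hX mulrC.
have [g [g1 g2 g3]] := @ext_rees_lift _ I _ h (lam (eu I)) hXv.
have hg e : lam e = g e.
  move: e; apply: ext_rees_ind => [|e f he hf'|c i hc|c i]; first by rewrite !rmorph0.
  - by rewrite !rmorphD he hf'.
  - have := @euX_st _ I c i 0; rewrite addn0 => /(_ hc) e.
    have e1 : lam (eu I) ^+ i * lam (incl (st I c i)) = lam (eu I) ^+ i * g (incl (st I c i)).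
      rewrite -{2}g2 -!rmorphXn -!rmorphM e g1 val_st // expr0 mulr1 hC //.
    have vi : v ^+ i * lam (eu I) ^+ i = 1 by rewrite -exprMn mulrC ev expr1n.
    by rewrite -[LHS]mul1r -vi -mulrA e1 mulrA vi mul1r.
  - rewrite !rmorphM !rmorphXn g2; congr (_ * _).
    by rewrite /= g1 val_st // expr0 mulr1 hC.
apply: (chart_F_rational (const := econst I) (rd_p D) (@idom_domain R) hF pN hf hC).
- move=> e; have [f [n [ef _]]] := ext_rep e; exists f, 'X^n, (lam (eu I) ^+ n).
  have e1 : h 'X^n * lam (eu I) ^+ n = 1 by rewrite rmorphXn -exprMn hXv expr1n.
  by split=> //; rewrite hg (g3 _ _ _ ef) -mulrA (mulrC (lam _ ^+ n)) e1 mulr1.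
(* Dividing by t^(size f) puts f into nonpositive degrees, where every coefficient is allowed. *)
- move=> f f0; have hsub : laurent_frac f (size f) \in ext_rees_pred I.
    apply/ext_rees_predE => i; have [hi|hi] := ltnP i (size f).
      by rewrite (_ : (i - size f)%N = 0%N) //; apply/eqP; rewrite subn_eq0 ltnW.
    by rewrite nth_default.
  pose e : E := ExtReesElement hsub.
  have : lam e = 0 by rewrite hg (g3 _ f (size f)) // f0 mul0r.
  rewrite -(rmorph0 lam) => /linj /(congr1 (@ext_rees_val _ I)).
  rewrite val_ext0 -(rmorph0 (@lpoly R)) => /laurent_frac_inj.
  by rewrite mul0r expr0 mulr1.
(* The element 1 - y u lies in N, and its degree 0 coefficient is 1 minus an element of I, a unit of
   R; so N is not extended from R. *)
- have [y Ny] := maximal_inv mN nu; set z := 1 - y * eu I in Ny.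
  have [f [n [ef _]]] := ext_rep z; exists f; split.
    have -> : h f = lam z * h 'X^n.
      by rewrite hg (g3 _ _ _ ef) rmorphXn -mulrA -exprMn (mulrC (lam _)) hXv expr1n mulr1.
    by apply: idMr; [apply: (ext_ideal pN hf); apply: prime_ideal | apply: ext_mem].
  exists n; have -> : f`_n = 1 - ecoef y 1.
    have : ecoef z 0 = f`_n by rewrite /ecoef ef lcoef_frac.
    move=> <-; rewrite /z ecoefB -(rmorph1 (econst I)) (ecoef_econst I) mulrC -[eu I]expr1.
    by rewrite ecoef_euM.
  have my : m (ecoef y 1) by apply: (rd_Im D); apply/(rd_I1 D); apply: ecoefP.
  rewrite /pre /= => Nc; have [_ n1 hu1] := lm.
  have [b eb] : exists b, (1 - ecoef y 1) * b = 1.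
    apply: hu1 => m1; apply: n1; rewrite -(subrK (ecoef y 1) 1).
    by apply: idD => //; apply: prime_ideal; apply: loc_max_prime.
  have [hN N1 _] := pN; apply: N1; rewrite -(rmorph1 (econst I)) -eb rmorphM.
  exact: idMr.
Qed.

(* some [x_i] not in [N]: the chart [R[X]] with [X = x_i t / x_i] *)
Lemma rees_chart (L : comNzRingType) (N : set S) (lam : {rmorphism S -> L}) i :
  is_maximal N -> is_frac lam N -> ~ N (sconst I x`_i) -> F_rational_local p L.
Proof.
move=> mN hf nx; have pN := maximal_prime mN; have linj := frac_inj pN hf domS.
have [hu _ _] := hf; have [v ev] := hu _ nx.
have [h [hC hX]] := poly_lift (lam \o sconst I) (lam (st I x`_i 1) * v).
have xj j : Ip j (x`_i ^+ j) by have := @IpX _ I j 1 x`_i; rewrite mul1n; apply.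
have hst c j : Ip j c -> lam (st I c j) = h (c%:P * 'X^j).
  move=> hc; have e1 : sconst I c * st I x`_i 1 ^+ j = sconst I x`_i ^+ j * st I c j.
    by rewrite stX // mul1n -rmorphXn /sconst !stM // !add0n mulrC.
  rewrite rmorphM rmorphXn hX hC exprMn mulrA -rmorphXn -[X in X * _]/(lam (sconst I c) * _).
  by rewrite -rmorphM e1 rmorphM rmorphXn mulrAC -exprMn ev expr1n mul1r.
have hE f : lam f = h (rees_val f).
  rewrite {1}(rees_sum f) rmorph_sum -[in RHS](coefK (rees_val f)) poly_def rmorph_sum.
  apply: eq_bigr => j _; rewrite hst; last exact: rcoefP.
  by rewrite mul_polyC.
apply: (chart_F_rational (const := sconst I) (rd_p D) (@idom_domain R) hF pN hf hC).
- by move=> f; exists (rees_val f), 1, 1; rewrite !rmorph1 mulr1 hE mulr1.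
- move=> f f0.
  have hg j : Ip j ((x`_i ^+ size f)%:P * f)`_j.
    rewrite coefCM; have [hj|hj] := ltnP j (size f); last by rewrite [f`_j]nth_default // mulr0; exact: Ip0.
    by apply: IpMr; apply: Ip_leq (xj (size f)); apply: ltnW.
  have : lam (mkrees hg) = 0 by rewrite hE /= rmorphM f0 mulr0.
  rewrite -(rmorph0 lam) => /linj /(congr1 (@rees_val _ I)) /= e.
  have nx0 : x`_i != 0.
    by apply/eqP => e0; apply: nx; rewrite e0 rmorph0; apply: id0; apply: prime_ideal.
  have /eqP : (x`_i ^+ size f)%:P * f = 0 by [].
  by rewrite mulf_eq0 polyC_eq0 expf_eq0 (negPf nx0) andbF /= => /eqP.
- have [Nx|nNx] := pselect (N (st I x`_i 1)).
    exists (rees_val (st I x`_i 1)); split; first by rewrite -hE; apply: ext_mem.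
    by exists 1%N; rewrite -/(rcoef _ _) rcoef_st.
  have [y Ny] := maximal_inv mN nNx; exists (rees_val (1 - y * st I x`_i 1)).
  split; first by rewrite -hE; apply: ext_mem.
  exists 0%N; rewrite -/(rcoef _ _) rcoefB rcoef1 rcoef0M rcoef_st // mulr0 subr0 /pre /=.
  by rewrite rmorph1; case: pN.
Qed.

(* Inverting some [x_i t] identifies the two Rees algebras. *)
Lemma ext_into_rees i e : exists k (f : S), incl (st I x`_i 1) ^+ k * e = incl f.
Proof.
move: e; apply: ext_rees_ind => [|e e' [k [f ef]] [k' [f' ef']]|c j hc|c j].
- by exists 0%N, 0; rewrite mulr0 rmorph0.
- exists (k + k')%N, (st I x`_i 1 ^+ k' * f + st I x`_i 1 ^+ k * f').
  rewrite incD !incM !incX -ef -ef' exprD; ring.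
- by exists 0%N, (st I c j); rewrite expr0 mul1r.
- exists j.+1, (sconst I c * sconst I (x`_i ^+ j.+1)).
  by rewrite incM mulrCA -exprMn (mulrC _ (eu I)) eu_st // rmorphXn incX.
Qed.

Lemma incl_frac (L : comNzRingType) (N : set E) (lam : {rmorphism E -> L}) i :
  is_prime N -> is_frac lam N -> ~ N (incl (st I x`_i 1)) ->
  is_frac (lam \o @incl R I) (pre (@incl R I) N).
Proof.
move=> pN hf nx; have [hu hs _] := hf; split=> [s ns|y|a /= e].
- exact: hu.
- have [a [s [ns e]]] := hs y.
  have [k [f ef]] := ext_into_rees i a; have [k' [g eg]] := ext_into_rees i s.
  exists (st I x`_i 1 ^+ k' * f), (st I x`_i 1 ^+ k * g); split.
    rewrite /pre /= incM -eg incX mulrA -exprD.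
    by apply: prime_nM => //; apply: prime_nX.
  by rewrite /= !incM -ef -eg !incX !rmorphM -e; ring.
- exists 1; split; first by rewrite /pre /= rmorph1; case: pN.
  rewrite mul1r; apply: (@incl_inj _ I); rewrite rmorph0.
  by apply: (frac_inj pN hf domE); rewrite e rmorph0.
Qed.

(** As u is in N and E = u E + S, an inverse modulo N can be chosen in the Rees algebra. *)
Lemma pre_incl_max (N : set E) : is_maximal N -> N (eu I) -> is_maximal (pre (@incl R I) N).
Proof.
move=> mN Nu; have pN := maximal_prime mN; have hN := prime_ideal pN.
have pp := pre_prime (@incl R I) pN; have [hp p1 _] := pp.
split=> // J hJ nJ; have [e|/existsNP[f /not_implyP[Jf nf]]] := pselect (J `<=` pre (@incl R I) N).
  by left; apply/seteqP; split.
right; apply/seteqP; split=> // y _; apply: ideal1 => //.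
have [e Ne] := maximal_inv mN nf; have [e' [g eg]] := ext_rees_split e.
rewrite -(subrK (g * f) 1); apply: idD => //; last exact: idMl.
apply: nJ; rewrite /pre /=.
have -> : incl (1 - g * f) = (1 - e * incl f) + eu I * (e' * incl f).
  by rewrite rmorphB rmorph1 rmorphM eg; ring.
by apply: idD => //; apply: idMr.
Qed.

(** N' consists of the elements that some power of x_i t carries into N; [ext_into_rees] transfers
    maximality from N to it. *)
Lemma rees_lift_max (N : set S) i : is_maximal N -> ~ N (st I x`_i 1) ->
  exists N' : set E, [/\ is_maximal N', pre (@incl R I) N' = N & ~ N' (incl (st I x`_i 1))].
Proof.
move=> mN nx; have pN := maximal_prime mN; have hN := prime_ideal pN.
pose y := incl (st I x`_i 1).
pose N' : set E := [set e | exists k f, y ^+ k * e = incl f /\ N f].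
have ey : pre (@incl R I) N' = N.
  apply/seteqP; split=> [g [k [f [e Nf]]]|g Ng]; last by exists 0%N, g; rewrite expr0 mul1r.
  apply: (prime_cancel (s := st I x`_i 1 ^+ k) pN); first exact: prime_nX.
  suff -> : st I x`_i 1 ^+ k * g = f by [].
  by apply: (@incl_inj _ I); rewrite incM incX.
have N'incl g : N' (incl g) -> N g by move=> h; apply/(set_eqP ey).
have hN' : is_ideal N'.
  split=> [|a b [k [f [ef Nf]]] [k' [f' [ef' Nf']]]|a b [k [f [ef Nf]]]].
  - by exists 0%N, 0; rewrite mulr0 rmorph0; split=> //; apply: id0.
  - exists (k + k')%N, (st I x`_i 1 ^+ k' * f + st I x`_i 1 ^+ k * f'); split.
      rewrite incD !incM !incX -ef -ef' exprD -/y; ring.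
    by apply: idD => //; apply: idMl.
  - have [l [b' eb]] := ext_into_rees i a; exists (l + k)%N, (b' * f); split.
      by rewrite incM -eb -ef exprD -/y; ring.
    exact: idMl.
have n1 : ~ N' 1 by rewrite -(rmorph1 (@incl R I)) => /N'incl; case: pN.
exists N'; split=> //; last by move=> /N'incl.
split=> // J hJ NJ; have [e|/existsNP[e /not_implyP[Je ne]]] := pselect (J `<=` N').
  by left; apply/seteqP; split.
right; apply/seteqP; split=> // z _; apply: ideal1 => //.
have [k [f ef]] := ext_into_rees i e.
have nf : ~ N f by move=> Nf; apply: ne; exists k, f.
have [b Nb] := maximal_inv mN nf.
rewrite -(subrK (incl (b * f)) 1); apply: idD => //.
  by apply: NJ; rewrite -(rmorph1 (@incl R I)) -rmorphB; exists 0%N, (1 - b * f); rewrite expr0 mul1r.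
by rewrite incM -ef; apply: idMl => //; apply: idMl.
Qed.

Theorem ext_rees_F_rational : F_rational p S -> F_rational p E.
Proof.
move=> FS N pN mN; have hf := loc_at_frac pN; have hN := prime_ideal pN.
have [Nu|nu] := pselect (N (eu I)); last exact: (ext_chart mN hf).
have [[i ni]|/forallNP hx] := pselect (exists i, ~ N (incl (st I x`_i 1))).
  have mS := pre_incl_max mN Nu; have pS := maximal_prime mS; have hfS := loc_at_frac pS.
  have pL := rmorph_pchar (loc_map pS) (rees_pchar D).
  apply: (F_rational_local_frac pS pL (frac_domain pS hfS domS) hfS (incl_frac pN hf ni)).
  exact: FS.
have Nx i : N (incl (st I x`_i 1)) by apply: contrapT; apply: hx.
have sub : MS m (I := I) `<=` pre (@incl R I) N.
  apply: (MS_rad D) => [|f n|i _|i _]; last exact: Nx.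
  - exact: pre_ideal.
  - by rewrite /pre /= rmorphXn; apply: primeX.
  - by rewrite /pre /= -[sconst I _]/(st I x`_i 0) -eu_st //; apply: idMr.
have ME_N : ME m (I := I) `<=` N.
  apply: (ME_min D) => // [c mc|b Ib]; apply: sub; rewrite /MS /pre /= /ev0.
    by rewrite rcoef_sconst.
  rewrite rcoef_st /=; last exact/(rd_I1 D).
  by apply: id0; apply: prime_ideal; apply: loc_max_prime.
have eN : ME m (I := I) = N.
  have [_ _ hmax] := ME_max D; have [_ n1 _] := pN.
  by have [//|e] := hmax N hN ME_N; case: n1; rewrite e.
by subst N; apply: (ext_rees_F_rational_at D FR FS hf).
Qed.

Theorem rees_F_rational : F_rational p E -> F_rational p S.
Proof.
move=> FE N pN mN; have hf := loc_at_frac pN; have hN := prime_ideal pN.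
have [[i ni]|/forallNP hx] := pselect (exists i, ~ N (sconst I x`_i)).
  exact: (rees_chart mN hf ni).
have [[i ni]|/forallNP hy] := pselect (exists i, ~ N (st I x`_i 1)).
  have [N' [mN' eN nN']] := rees_lift_max mN ni.
  have pN' := maximal_prime mN'; have hf' := loc_at_frac pN'.
  have hfi := incl_frac pN' hf' nN'; rewrite eN in hfi.
  have pL := rmorph_pchar (loc_map pN') (ext_rees_pchar D).
  apply: (F_rational_local_frac pN pL (frac_domain pN' hf' domE) hfi hf).
  exact: FE.
have sub : MS m (I := I) `<=` N.
  apply: (MS_rad D) => // [f n|i _|i _]; first exact: primeX.
    by apply: contrapT; apply: hx.
  by apply: contrapT; apply: hy.
have eN : MS m (I := I) = N.
  have [_ _ hmax] := MS_max D; have [_ n1 _] := pN.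
  by have [//|e] := hmax N hN sub; case: n1; rewrite e.
by subst N; apply: (rees_F_rational_at D FE hf).
Qed.

End Cases.

Theorem theorem1p1 (p d : nat) (R : idomainType) (m I : set R)
    (hchar : p \in [pchar R]) (hlocal : is_local m)
    (hexc : excellent R) (heqd : equidimensional R)
    (hCM : image_of_excellent_CM R)
    (hdim : krull_dim R d) (hd : (2 <= d)%N)
    (hI : primary_to m I)
    (hred : exists x : d.-tuple R, is_reduction (ideal_gen [set` x]) I) :
  F_rational p (ext_rees_algebra I) <->
  F_rational_local p R /\ F_rational p (rees_algebra I).
Proof.
have [x redx] := hred; rewrite ideal_genE in redx.
have [noeR _ _ _] := hexc.
have D : red_data p d m I x.
  by split=> //; [exact: is_local_loc_max | rewrite size_tuple].
split=> [FE|[FR FS]]; last exact: (ext_rees_F_rational D FR FS).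
have FR := base_F_rational D FE; split=> //.
exact: (rees_F_rational D FR FE).
Qed.
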